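(* Let $n\ge 2$ and $m\ge 1$ be integers, $p\in(1,n)$, $Q\in\mathcal{K}_o^{1,m}$, and let $K\subset M_{n,1}(\mathbb{R})=\mathbb{R}^n$ be compact. Then $$C_{p,Q}(K)\ge n\,\omega_n^{\frac pn}\,d_{n,p}(Q)\Big(\frac{p-1}{n-p}\Big)^{1-p}V_n(K)^{\frac{n-p}{n}}.$$
   Context: $M_{n,m}(\mathbb{R})$ is the space of real $n\times m$ matrices with inner product $\mathrm{tr}(x^{\mathrm T}y)$ and the induced norm; $S^{nm-1}$ is its unit sphere and $du$ the spherical (Hausdorff) measure on it. $M_{n,1}(\mathbb{R})$ and $M_{1,m}(\mathbb{R})$ are identified with $\mathbb{R}^n$ and $\mathbb{R}^m$. $V_n$ and $V_{nm}$ denote volume (Lebesgue measure), $B_2^n$ is the Euclidean unit ball of $\mathbb{R}^n$, $\omega_n=V_n(B_2^n)$. $\mathcal{K}_o^{1,m}$ is the set of compact convex sets with nonempty interior in $M_{1,m}(\mathbb{R})$ containing the origin $o$. The support function is $h_Q(x)=\max\{x\cdot y:y\in Q\}$. For a smooth compactly supported $f:\mathbb{R}^n\to\mathbb{R}$ (i.e. $f\in C_c^\infty$) and $u\in S^{nm-1}$, put $\nabla_u f(x)=(\nabla f(x))^{\mathrm T}u\in M_{1,m}(\mathbb{R})$ (matrix product) and $\|h_Q(\nabla_u f)\|_p=\big(\int_{\mathbb{R}^n}h_Q(\nabla_u f(x))^p\,dx\big)^{1/p}$. For compact $K\subset\mathbb{R}^n$, the $m$th order $p$-affine capacity is $$C_{p,Q}(K)=\inf\Big\{\Big(\int_{S^{nm-1}}\|h_Q(\nabla_u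 f)\|_p^{-nm}\,du\Big)^{-\frac{p}{nm}}: f\in C_c^\infty,\ f\ge 1\text{ on }K\Big\},$$ with the conventions $0^{-a}=\infty$, $\infty^{-a}=0$ for $a>0$. The body $\Pi_{p,Q}B_2^n\subset M_{n,m}(\mathbb{R})$ is the convex body with support function $h_{\Pi_{p,Q}B_2^n}(x)=\big(\int_{S^{n-1}}h_Q(v^{\mathrm T}x)^p\,dv\big)^{1/p}$, $\Pi^*_{p,Q}B_2^n$ is its polar body, so $nm\,V_{nm}(\Pi_{p,Q}^*B_2^n)=\int_{S^{nm-1}}h_{\Pi_{p,Q}B_2^n}(u)^{-nm}\,du$, and $$d_{n,p}(Q)=(n\omega_n)^{-1}\big(nm\,V_{nm}(\Pi_{p,Q}^*B_2^n)\big)^{-\frac{p}{nm}}.$$ *)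

(* Defs.v *)
From HB Require Import structures.
From mathcomp Require Import all_boot all_order all_algebra.
From mathcomp Require Import all_classical all_reals all_analysis.

Set Implicit Arguments.
Unset Strict Implicit.
Unset Printing Implicit Defensive.
Import Order.TTheory GRing.Theory Num.Theory.
Import numFieldNormedType.Exports.

Local Open Scope classical_set_scope.
Local Open Scope ring_scope.

(* Outer measure obtained from a family of sets B i of weight w i by countable
   coverings.  [None] stands for an unused slot of the covering, so that finite
   coverings (and the empty one) are allowed. *)
Section covering.
Local Open Scope ereal_scope.
Context (R : realType) (T I : Type) (B : I -> set T) (w : I -> \bar R).

Definition covering_ext (A : set T) : \bar R :=
  ereal_inf [set \sum_(0 <= k <oo) oapp w 0 (F k) |
    F in [set F : nat -> option I | A `<=` \bigcup_k oapp B set0 (F k)]].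

Hypothesis w_ge0 : forall i, 0 <= w i.

Let ow_ge0 (o : option I) : 0 <= oapp w 0 o.
Proof. by case: o => //=. Qed.

Lemma covering_ext_ge0 A : 0 <= covering_ext A.
Proof.
by apply: le_ereal_inf_tmp => x [F AF <-{x}]; exact: nneseries_ge0.
Qed.

Lemma covering_ext0 : covering_ext set0 = 0.
Proof.
apply/eqP; rewrite eq_le covering_ext_ge0 andbT.
apply: ereal_inf_lbound; exists (fun=> None) => //=.
exact: eseries0.
Qed.

Lemma le_covering_ext : {homo covering_ext : A C / A `<=` C >-> A <= C}.
Proof.
move=> A C AC; apply/ereal_inf_le_tmp => x [F CF <-{x}].
by exists F => //; exact: subset_trans CF.
Qed.

Lemma covering_ext_sigma_subadditive : sigma_subadditive covering_ext.
Proof.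
move=> A; have [[i ioo]|] := pselect (exists i, covering_ext (A i) = +oo).
  rewrite (eseries_pinfty _ _ ioo) ?leey// => n _.
  by rewrite -ltNye (lt_le_trans _ (covering_ext_ge0 _)).
rewrite -forallNE => Aoo.
suff add2e (e : {posnum R}) : covering_ext (\bigcup_n A n) <=
    \sum_(0 <= i <oo) covering_ext (A i) + e%:num%:E.
  by apply/lee_addgt0Pr => _/posnumP[].
rewrite (le_trans _ (epsilon_trick _ _ _))//; last first.
  by move=> n; exact: covering_ext_ge0.
pose P n (F : nat -> option I) := A n `<=` \bigcup_k oapp B set0 (F k) /\
  \sum_(0 <= k <oo) oapp w 0 (F k) <=
    covering_ext (A n) + (e%:num / (2 ^ n.+1)%:R)%:E.
have [G PG] : {G : nat -> nat -> option I & forall n, P n (G n)}.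
  apply: (@choice _ _ P) => n; rewrite /P /covering_ext.
  set S := (X in ereal_inf X); move infS : (ereal_inf S) => iS.
  case: iS infS => [r Sr|Soo|Soo].
  - have en1 : (0 < e%:num / (2 ^ n.+1)%:R)%R by [].
    have /(lb_ereal_inf_adherent en1) : ereal_inf S \is a fin_num by rewrite Sr.
    move=> [x [F AnF wFx] xS].
    by exists F; split => //; rewrite wFx -Sr; exact/ltW.
  - by have := Aoo n; rewrite /covering_ext Soo.
  - suff : lbound S 0 by move/le_ereal_inf_tmp; rewrite Soo.
    by move=> /= _ [F AF <-]; exact: nneseries_ge0.
pose g := oapp w 0 \o uncurry G.
have g_ge0 x : 0 <= g x by exact: ow_ge0.
apply: (@le_trans _ _ (\esum_(i in setT) g i)).
  apply: ereal_inf_lbound => /=.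
  have /card_esym/ppcard_eqP[f] := card_nat2.
  exists (uncurry G \o f).
    apply: (@subset_trans _ (\bigcup_n \bigcup_k oapp B set0 (G n k))).
      by move=> t [i _] /(PG i).1 -[j _ ?]; exists i => //; exists j.
    move=> t [i _ [j _ Bijt]]; exists (f^-1%FUN (i, j)) => //=.
    by rewrite invK ?inE.
  rewrite -(esum_pred_image g _ xpredT) ?[fun=> _]set_true//.
  by rewrite image_eq.
rewrite (_ : esum _ _ =
    \sum_(0 <= i <oo) \sum_(0 <= j <oo) oapp w 0 (G i j)); last first.
  pose J : nat -> set (nat * nat) := fun i => [set (i, j) | j in setT].
  rewrite (_ : setT = \bigcup_k J k); last first.
    by rewrite predeqE => -[a b]; split => // _; exists a => //; exists b.
  rewrite esum_bigcupT /=; last 2 first.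
    - apply/trivIsetP => i j _ _ ij.
      rewrite predeqE => -[n m] /=; split => //= -[] [_] _ [<-{n} _].
      by move=> [m' _] [] /esym/eqP; rewrite (negbTE ij).
    - by move=> x; exact: g_ge0.
  rewrite -(image_id [set: nat]) -fun_true esum_pred_image//; last first.
    by move=> n _; exact: esum_ge0.
  apply: eq_eseriesr => /= j _.
  rewrite -(esum_pred_image g (pair j) predT)//=; last first.
    by move=> ? ? _ _; exact: (@can_inj _ _ _ snd).
  by congr esum; rewrite predeqE => -[a b]; split; move=> [i _ <-]; exists i.
apply: lee_nneseries => [n _ _|n _]; first exact: nneseries_ge0.
exact: (PG n).2.
Qed.

End covering.

Section euclidean.
Context {R : realType} {n m : nat}.
Implicit Types (x y u : 'M[R]_(n, m)) (A : set 'M[R]_(n, m)).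

(* The library norm `|x| on matrices is the max norm, hence [frob]. *)
Definition inner x y : R := \tr (x^T *m y).

Definition frob x : R := Num.sqrt (inner x x).

Definition sphere : set 'M[R]_(n, m) := [set u | frob u = 1].

Definition unit_ball : set 'M[R]_(n, m) := [set x | frob x <= 1].

Definition diam A : \bar R :=
  ereal_sup [set (frob (xy.1 - xy.2))%:E | xy in A `*` A].

(* The maximum is attained when A is compact and nonempty. *)
Definition support_fun A x : R := sup [set inner x y | y in A].

Definition polar A : set 'M[R]_(n, m) :=
  [set x | forall y, A y -> inner x y <= 1].

(* For a sublinear h, the unique closed convex set with support function h. *)
Definition body_of_support (h : 'M[R]_(n, m) -> \bar R) : set 'M[R]_(n, m) :=
  [set y | forall x, ((inner x y)%:E <= h x)%E].

End euclidean.

Section lebesgue.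
Context (R : realType) (n m : nat).
Implicit Types ab : 'M[R]_(n, m) * 'M[R]_(n, m).

Definition box ab : set 'M[R]_(n, m) :=
  [set x | forall i j, ab.1 i j <= x i j <= ab.2 i j].

Definition box_volume ab : \bar R :=
  (\prod_i \prod_j Num.max 0 (ab.2 i j - ab.1 i j))%:E.

Definition volume : set 'M[R]_(n, m) -> \bar R := covering_ext box box_volume.

Let box_volume_ge0 ab : (0 <= box_volume ab)%E.
Proof.
rewrite lee_fin; apply: prodr_ge0 => i _; apply: prodr_ge0 => j _.
by rewrite le_max lexx.
Qed.

HB.instance Definition _ := isOuterMeasure.Build R 'M[R]_(n, m) volume
  (covering_ext0 box box_volume_ge0) (covering_ext_ge0 box box_volume_ge0)
  (@le_covering_ext _ _ _ box box_volume)
  (covering_ext_sigma_subadditive box box_volume_ge0).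

End lebesgue.
Arguments volume {R n m}.

(* On its Caratheodory measurable sets, [volume] is the completed Lebesgue
   measure of R^(n * m). *)
Definition volume_measure {R : realType} {n m : nat} :
    {measure set (caratheodory_type (@volume R n m)) -> \bar R} :=
  (volume : {outer_measure set 'M[R]_(n, m) -> \bar R}).

Definition omega (R : realType) (n : nat) : R :=
  fine (volume (unit_ball : set 'cV[R]_n)).
Arguments omega {R}.

Section hausdorff.
Local Open Scope ereal_scope.
Context (R : realType) (n m s : nat).
Implicit Types A : set 'M[R]_(n, m).

(* The volume of the s-dimensional Euclidean ball of diameter diam A; with this
   normalization the s-dimensional Hausdorff measure agrees with Lebesgue
   measure on R^s and with surface area on s-dimensional submanifolds. *)
Definition hausdorff_weight (delta : R) A : \bar R :=
  if diam A <= delta%:E then (omega s / 2 ^+ s)%:E * diam A `^ s%:R else +oo.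

Definition hausdorff A : \bar R :=
  ereal_sup [set covering_ext id (hausdorff_weight delta) A |
    delta in [set delta : R | (0 < delta)%R]].

Let hausdorff_weight_ge0 delta A : 0 <= hausdorff_weight delta A.
Proof.
rewrite /hausdorff_weight; case: ifPn => // _.
rewrite mule_ge0 ?poweR_ge0// lee_fin divr_ge0// ?exprn_ge0//.
exact/fine_ge0/outer_measure_ge0.
Qed.

Let le_hausdorff_sup delta A : (0 < delta)%R ->
  covering_ext id (hausdorff_weight delta) A <= hausdorff A.
Proof. by move=> d0; apply: ereal_sup_ubound; exists delta. Qed.

Let hausdorff_ge0 A : 0 <= hausdorff A.
Proof.
by apply: le_trans (le_hausdorff_sup A ltr01); exact: covering_ext_ge0.
Qed.

Let hausdorff0 : hausdorff set0 = 0.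
Proof.
apply/eqP; rewrite eq_le hausdorff_ge0 andbT.
by apply: ge_ereal_sup => _ [d _ <-]; rewrite covering_ext0.
Qed.

Let le_hausdorff : {homo hausdorff : A C / A `<=` C >-> A <= C}.
Proof.
move=> A C AC; apply: ge_ereal_sup => _ [d d0 <-].
by apply: le_trans (le_hausdorff_sup C d0); exact: le_covering_ext.
Qed.

Let hausdorff_sigma_subadditive : sigma_subadditive hausdorff.
Proof.
move=> F; apply: ge_ereal_sup => _ [d d0 <-].
apply: le_trans (covering_ext_sigma_subadditive _ _ _) _ => //.
apply: lee_nneseries => [k _ _|k _]; first exact: covering_ext_ge0.
exact: le_hausdorff_sup.
Qed.

HB.instance Definition _ := isOuterMeasure.Build R 'M[R]_(n, m) hausdorff
  hausdorff0 hausdorff_ge0 le_hausdorff hausdorff_sigma_subadditive.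

End hausdorff.
Arguments hausdorff {R n m}.

Definition hausdorff_measure {R : realType} {n m : nat} (s : nat) :
    {measure set (caratheodory_type (@hausdorff R n m s)) -> \bar R} :=
  (hausdorff s : {outer_measure set 'M[R]_(n, m) -> \bar R}).

(* x^{-a} for a > 0, with 0^{-a} = +oo and (+oo)^{-a} = 0; the library powers
   give 0 `^ (- a) = 0 and +oo `^ (- a) = +oo instead. *)
Definition inv_poweR {R : realType} (x : \bar R) (a : R) : \bar R :=
  match x with
  | r%:E => if r == 0 then +oo%E else (r `^ (- a))%:E
  | _ => 0%E
  end.

Section smooth.
Context {R : realType} {n : nat}.
Implicit Type f : 'cV[R]_n -> R.

Fixpoint Ck (k : nat) f : Prop :=
  match k with
  | 0%N => continuous f
  | k.+1 => (forall x, differentiable f x) /\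
            (forall v : 'cV[R]_n, Ck k (fun x => 'D_v f x))
  end.

Definition Cc_infty f : Prop :=
  (forall k, Ck k f) /\ compact (closure [set x | f x != 0]).

Definition grad f (x : 'cV[R]_n) : 'cV[R]_n :=
  \col_i 'D_(delta_mx i 0) f x.

End smooth.

Section affine_capacity.
Local Open Scope ereal_scope.
Context {R : realType} {n m : nat}.
Implicit Types (p : R) (Q : set 'rV[R]_m) (K : set 'cV[R]_n).

Definition grad_dir (f : 'cV[R]_n -> R) (u : 'M[R]_(n, m)) (x : 'cV[R]_n) :
  'rV[R]_m := (grad f x)^T *m u.

(* The measure du on the unit sphere S^{nm-1} of M_{n,m}(R) is the
   (nm-1)-dimensional Hausdorff measure. *)
Definition affine_energy p Q (f : 'cV[R]_n -> R) : \bar R :=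
  inv_poweR
    (\int[hausdorff_measure (n * m).-1]_(u in (sphere : set 'M[R]_(n, m)))
       inv_poweR 'N[volume_measure]_(p%:E)[EFin \o support_fun Q \o grad_dir f u]
                 (n * m)%:R)
    (p / (n * m)%:R).

Definition affine_capacity p Q K : \bar R :=
  ereal_inf [set affine_energy p Q f |
    f in [set f | Cc_infty f /\ forall x, K x -> (1 <= f x)%R]].

(* Support function of the body Pi_{p,Q} B_2^n. *)
Definition h_Pi p Q (x : 'M[R]_(n, m)) : \bar R :=
  (\int[hausdorff_measure n.-1]_(v in (sphere : set 'cV[R]_n))
     (support_fun Q (v^T *m x) `^ p)%:E) `^ p^-1.

Definition Pi_body p Q : set 'M[R]_(n, m) := body_of_support (h_Pi p Q).

End affine_capacity.

Definition d_const {R : realType} (n : nat) {m : nat} (p : R)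
    (Q : set 'rV[R]_m) : \bar R :=
  ((n%:R * omega n)^-1%:E *
   inv_poweR ((n * m)%:R%:E * volume (polar (Pi_body p Q : set 'M[R]_(n, m))))
             (p / (n * m)%:R))%E.

(* Main.v *)
(** Write H = h_Q^p and P_f(u) = int H((grad f(x))^T u) dx.  Let L be the part of {P_f < 1} in a
    large ball, Psi(w) = int_L H(w^T u) du + eta |w|^p, and let G be the convex body polar to
    {Psi <= 1}.  Brunn-Minkowski along the level sets of f gives an isocapacitary inequality for
    the gauge of G, which bounds int_L P_f + eta int |grad f|^p = int Psi(grad f) from below by a
    multiple of |G|^(p/n).  In the other direction, let D be the set of affine minorants of H.
    Steiner symmetrization of the sets cone(G) + u D shows that replacing G by a ball of the same
    volume can only enlarge the sublevel sets of u |-> |cone(G) + u D|; the bathtub principle then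
    bounds |G| from below in terms of |L| and of the volume of {P_B <= 1}, where
    P_B(u) = int_B H((x/|x|)^T u) dx over the unit ball B.
    Letting eta tend to 0 and the large ball exhaust the space compares the volumes of {P_f < 1}
    and {P_B <= 1}.  Both the energy of f and the constant d_{n,p}(Q) are estimated by these volumes,
    since the Hausdorff measure of a spherical set A is at most N times the volume of the cone over A
    in the unit ball of R^N: the radial projection of a tangent hyperplane is 1-Lipschitz. *)

From HB Require Import structures.
Require Import Defs.
From mathcomp Require Import all_boot all_order all_algebra.
From mathcomp Require Import all_classical all_reals all_analysis.
From mathcomp Require Import measurable_realfun.
From mathcomp Require Import ring lra.
Set Implicit Arguments.
Unset Strict Implicit.
Unset Printing Implicit Defensive.
Import Order.TTheory GRing.Theory Num.Theory.
Import numFieldNormedType.Exports.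
Local Open Scope classical_set_scope.
Local Open Scope ring_scope.

(** A mixed integral becomes a volume through a first-order expansion: with the extra height
    coordinate, |cone(G) + s u D| exceeds |cone(G)| by about s^p times the integral over G of
    H((grad of the gauge of G)^T u), because H is the envelope of its affine minorants. Two
    one-sided forms of this are proved: an upper bound for G, where the gradient is replaced by a
    nearly maximizing xi in {Psi <= 1}, and a lower bound for the ball, where the gradient is
    radial. The term eta |w|^p keeps {Psi <= 1} bounded, since the integral over L may degenerate,
    and the large ball gives L finite volume. The radius r of the ball with the volume of G enters
    both final bounds only through r^p and cancels, so the shape of G never has to be known. The
    sphere integrals are estimated from above in both places: the energy of f decreases in its
    sphere integral, while d_{n,p}(Q) decreases in the volume of the polar body, which shrinks as
    [h_Pi] grows. *)

HB.instance Definition _ (R : realType) (a b : nat) :=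
  Measurable.copy 'M[R]_(a, b) (g_sigma_algebraType (@open 'M[R]_(a, b))).

(** * Lebesgue measure on matrix spaces *)

Section box_volume.
Context {R : realType}.

Lemma integral_itv_indic (a b : R) :
  (\int[lebesgue_measure]_t (\1_`[a, b] t)%:E)%E = (Num.max 0 (b - a))%:E.
Proof.
rewrite integral_indic// setIT [LHS](lebesgue_measure_itv `[a, b])/= lte_fin.
case: ltP => ab; first by rewrite -EFinD; congr EFin; rewrite max_r// subr_ge0 ltW.
by congr EFin; rewrite max_l// subr_le0.
Qed.

(** Integrating the pointwise inequality in one coordinate replaces the indicator of its interval by
    the length, which joins the weights [c] and [ck]; induction on the coordinates then compares
    volumes without any combinatorics of boxes. *)
Lemma prod_itv_cover (J : eqType) (s : seq J) (a b : J -> R) (ak bk : nat -> J -> R)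
    (c : R) (ck : nat -> R) : uniq s -> 0 <= c -> (forall k, 0 <= ck k) ->
  (forall x : J -> R, (c * \prod_(j <- s) \1_`[a j, b j] (x j))%:E <=
    \sum_(0 <= k <oo) (ck k * \prod_(j <- s) \1_`[ak k j, bk k j] (x j))%:E)%E ->
  ((c * \prod_(j <- s) Num.max 0 (b j - a j))%:E <=
    \sum_(0 <= k <oo) (ck k * \prod_(j <- s) Num.max 0 (bk k j - ak k j))%:E)%E.
Proof.
elim: s c ck => [c ck _ c0 ck0 /(_ (fun=> 0)) h|j s IH c ck /= /andP[js us] c0 ck0 h].
  move: h; rewrite !big_nil => /le_trans; apply.
  by apply: lee_nneseries => k _ //; rewrite ?lee_fin !big_nil// mulr1.
rewrite big_cons mulrA.
under eq_eseriesr do rewrite big_cons mulrA.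
have max0 (u v : R) : 0 <= Num.max 0 (u - v) by rewrite le_max lexx.
have ind0 (A : set R) (u : R) : 0 <= \1_A u :> R by rewrite indicE ler0n.
apply: IH => // [|k|x]; [by rewrite mulr_ge0|by rewrite mulr_ge0|].
have prod0 (u v : J -> R) : 0 <= \prod_(i <- s) \1_`[u i, v i] (x i) :> R.
  by apply: prodr_ge0 => i _.
pose y t i := if i == j then t else x i.
have ys t (u v : J -> R) : \prod_(i <- s) \1_`[u i, v i] (y t i) =
    \prod_(i <- s) \1_`[u i, v i] (x i) :> R.
  rewrite big_seq [RHS]big_seq; apply: eq_bigr => i iis; rewrite /y.
  by case: eqP => // ij; rewrite ij (negbTE js) in iis.
have intE (k u v d : R) : 0 <= k -> 0 <= d ->
    (\int[lebesgue_measure]_t (k * (\1_`[u, v] t * d))%:E)%E = (k * Num.max 0 (v - u) * d)%:E.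
  move=> k0 d0; under eq_integral do rewrite mulrCA mulrC EFinM.
  rewrite ge0_integralZl//.
  - by rewrite integral_itv_indic -EFinM; congr EFin; ring.
  - by apply/measurable_EFinP; exact: measurable_indic.
  - by rewrite lee_fin mulr_ge0.
rewrite -intE//.
under eq_eseriesr => k _ do rewrite -(intE (ck k) _ _ _ (ck0 k) (prod0 _ _)).
rewrite -integral_nneseries//; last 2 first.
- move=> k; apply/measurable_EFinP; apply: measurable_funM => //.
  by apply: measurable_funM => //; exact: measurable_indic.
- by move=> k t _; rewrite lee_fin !mulr_ge0.
apply: ge0_le_integral => //.
- by move=> t _; rewrite lee_fin !mulr_ge0.
- apply/measurable_EFinP; apply: measurable_funM => //.
  by apply: measurable_funM => //; exact: measurable_indic.
- apply: ge0_emeasurable_sum => [k t _ _|k _]; first by rewrite lee_fin !mulr_ge0.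
  apply/measurable_EFinP; apply: measurable_funM => //.
  by apply: measurable_funM => //; exact: measurable_indic.
(* [y t] changes only coordinate [j], which does not occur in [s], so the remaining factors stay
   those of [x]. *)
move=> t _; have := h (y t); rewrite big_cons ys {1}/y eqxx => /le_trans; apply.
apply: lee_nneseries => k _; last by rewrite big_cons ys {1}/y eqxx.
by rewrite lee_fin !mulr_ge0// prodr_ge0.
Qed.

Lemma max0_split (a b c : R) :
  Num.max 0 (b - a) = Num.max 0 (Num.min c b - a) + Num.max 0 (b - Num.max c a).
Proof.
rewrite /Num.max /Num.min; case: (ltP c b) => h1; case: (ltP c a) => h2;
  do ! [case: (ltP 0 _) => ?]; lra.
Qed.

Context {n m : nat}.
Local Notation M := 'M[R]_(n, m).

Lemma box_volumeE (ab : M * M) :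
  box_volume ab = (\prod_(ij : 'I_n * 'I_m)
    Num.max 0 (ab.2 ij.1 ij.2 - ab.1 ij.1 ij.2))%:E.
Proof. by rewrite /box_volume pair_bigA. Qed.

Lemma box_volume_ge0 (ab : M * M) : (0 <= box_volume ab)%E.
Proof. by rewrite box_volumeE lee_fin prodr_ge0// => i _; rewrite le_max lexx. Qed.

(** The box covers itself. Conversely its indicator is at most the sum of the indicators of any
    covering, which is the hypothesis of [prod_itv_cover]. *)
Lemma volume_box (ab : M * M) : volume (box ab) = box_volume ab.
Proof.
apply/eqP; rewrite eq_le; apply/andP; split.
  apply: ereal_inf_lbound.
  exists (fun k => if k == 0%N then Some ab else None) => /=.
    by move=> x abx; exists 0%N.
  rewrite (nneseries_split 0 1)//; last by move=> k _; case: eqP => //= _; exact: box_volume_ge0.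
  by rewrite big_nat1/= eseries0 ?adde0// => k /=; case: k.
apply: le_ereal_inf_tmp => _ [F abF <-].
pose ak k (ij : 'I_n * 'I_m) : R := oapp (fun ab : M * M => ab.1 ij.1 ij.2) 0 (F k).
pose bk k (ij : 'I_n * 'I_m) : R := oapp (fun ab : M * M => ab.2 ij.1 ij.2) 0 (F k).
pose ck k : R := if F k is Some _ then 1 else 0.
have -> : (\sum_(0 <= k <oo) oapp (@box_volume R n m) 0 (F k) =
    \sum_(0 <= k <oo) (ck k * \prod_(j <- index_enum ('I_n * 'I_m)%type) Num.max 0 (bk k j - ak k j))%:E)%E.
  apply: eq_eseriesr => k _; rewrite /ck /bk /ak.
  by case: (F k) => [cd|]; rewrite /= ?mul0r// mul1r box_volumeE.
rewrite box_volumeE -[X in (X%:E <= _)%E]mul1r.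
apply: (@prod_itv_cover _ (index_enum ('I_n * 'I_m)%type)
  (fun ij => ab.1 ij.1 ij.2) (fun ij => ab.2 ij.1 ij.2)) => //.
- exact: index_enum_uniq.
- by rewrite /ck => k; case: (F k).
move=> x; pose X : M := \matrix_(i, j) x (i, j).
have ind0 (A : set R) (u : R) : 0 <= \1_A u :> R by rewrite indicE ler0n.
have t0 k : (0 <= (ck k * \prod_(j <- index_enum ('I_n * 'I_m)%type) \1_`[ak k j, bk k j] (x j))%:E)%E.
  by rewrite lee_fin mulr_ge0 ?prodr_ge0// /ck; case: (F k).
have boxP (cd : M * M) : box cd X ->
    \prod_(j <- index_enum ('I_n * 'I_m)%type) \1_`[cd.1 j.1 j.2, cd.2 j.1 j.2] (x j) = 1 :> R.
  move=> cdX; rewrite big1// => -[i j] _; rewrite indicE mem_set//=.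
  by have := cdX i j; rewrite mxE in_itv.
have [abX|abX] := pselect (box ab X).
  have [k _] := abF X abX; case Fk: (F k) => [cd|//] /= cdX.
  rewrite (nneseries_split 0 k.+1)//; apply: le_trans (leeDl _ _); last first.
    by apply: nneseries_ge0.
  rewrite big_nat_recr//=; apply: le_trans (leeDr _ _); last by apply: sume_ge0.
  by rewrite /ck /ak /bk Fk /= !boxP.
rewrite [X in (X%:E <= _)%E](_ : _ = 0) ?nneseries_ge0//.
have [i [j]] : exists i j, ~~ (ab.1 i j <= x (i, j) <= ab.2 i j).
  apply: contrapT => h; apply: abX => i j; apply: contrapT => /negP hh.
  by apply: h; exists i, j; move: hh; rewrite mxE.
move=> hij; rewrite mul1r (bigD1_seq (i, j)) ?index_enum_uniq ?mem_index_enum//=.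
by rewrite indicE memNset ?mul0r//= in_itv/=; exact/negP.
Qed.

(** Cutting each box of a covering by the hyperplane at height [c] yields coverings of the two parts
    of the test set, and [max0_split] makes the box volumes add up exactly. *)
Lemma caratheodory_halfspace (i0 : 'I_n) (j0 : 'I_m) (c : R) :
  caratheodory_measurable (@volume R n m) [set x | x i0 j0 <= c].
Proof.
apply: (@le_caratheodory_measurable _ _ (@volume R n m : {outer_measure set M -> \bar R})) => X.
apply: le_ereal_inf_tmp => _ [F XF <-].
pose B1 (ab : M * M) : M * M := (ab.1, \matrix_(i, j)
  if (i, j) == (i0, j0) then Num.min c (ab.2 i j) else ab.2 i j).
pose B2 (ab : M * M) : M * M := (\matrix_(i, j)
  if (i, j) == (i0, j0) then Num.max c (ab.1 i j) else ab.1 i j, ab.2).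
have o0 (G : nat -> option (M * M)) k : (0 <= oapp (@box_volume R n m) 0 (G k))%E.
  by case: (G k) => //= ab; exact: box_volume_ge0.
have -> : (\sum_(0 <= k <oo) oapp (@box_volume R n m) 0 (F k) =
    \sum_(0 <= k <oo) oapp (@box_volume R n m) 0 (omap B1 (F k)) +
    \sum_(0 <= k <oo) oapp (@box_volume R n m) 0 (omap B2 (F k)))%E.
  rewrite -nneseriesD; last 2 first.
  - by move=> k _ _; exact: (o0 (omap B1 \o F)).
  - by move=> k _ _; exact: (o0 (omap B2 \o F)).
  apply: eq_eseriesr => k _; case: (F k) => [ab|] /=; last by rewrite adde0.
  rewrite !box_volumeE -EFinD; congr EFin.
  rewrite (bigD1 (i0, j0))//= [X in _ = X + _](bigD1 (i0, j0))//= [X in _ = _ + X](bigD1 (i0, j0))//=.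
  rewrite !mxE eqxx.
  set P := (\prod_(i | _) _ in LHS).
  have -> : \prod_(i | i != (i0, j0)) Num.max 0 ((B1 ab).2 i.1 i.2 - (B1 ab).1 i.1 i.2) = P.
    by apply: eq_bigr => -[i j] /= /negbTE ij; rewrite !mxE ij.
  have -> : \prod_(i | i != (i0, j0)) Num.max 0 ((B2 ab).2 i.1 i.2 - (B2 ab).1 i.1 i.2) = P.
    by apply: eq_bigr => -[i j] /= /negbTE ij; rewrite !mxE ij.
  rewrite -mulrDl; congr (_ * _).
  exact: max0_split.
apply: leeD; apply: ereal_inf_lbound.
- exists (omap B1 \o F) => //= x [/XF[k _ /= kx] xc]; exists k => //=.
  move: kx; case: (F k) => //= ab abx i j; rewrite mxE.
  case: eqP => [[-> ->]|_]; last exact: abx.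
  by rewrite le_min xc/= abx.
- exists (omap B2 \o F) => //= x [/XF[k _ /= kx] xc]; exists k => //=.
  move: kx; case: (F k) => //= ab abx i j; rewrite mxE.
  case: eqP => [[-> ->]|_]; last exact: abx.
  move/negP: xc; rewrite -ltNge => xc.
  by rewrite ge_max (ltW xc)/= abx.
Qed.

End box_volume.

Lemma measurable_fun_gt (R : realType) d (T : measurableType d) (f : T -> R) :
  (forall c, measurable [set t | c < f t]) -> measurable_fun setT f.
Proof.
move=> mf; move=> mT; apply: (measurability _ (RGenOInfty.measurableE R)) => //.
by move=> /= _ [_ [x ->] <-]; rewrite setTI preimage_itvoy.
Qed.

Section borel_matrix.
Context {R : realType} {n m : nat}.
Local Notation M := 'M[R]_(n, m).

Definition rat_box (q : 'M[rat]_(n, m) * 'M[rat]_(n, m)) : set M :=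
  box (map_mx ratr q.1, map_mx ratr q.2).

(** Countably many rational boxes form a base, so Borel measurability of a matrix-valued map can be
    tested on its entries. *)
Lemma open_rat_box (U : set M) : open U ->
  U = \bigcup_(q in [set q | rat_box q `<=` U]) rat_box q.
Proof.
move=> oU; apply/seteqP; split => [x Ux|x [q qU]]; last exact: qU.
have := open_nbhs_nbhs (conj oU Ux) => /nbhs_ballP[e /= e0 eU].
have /choice[q1 hq1] : forall ij : 'I_n * 'I_m, exists q : rat,
    ratr q \in `]x ij.1 ij.2 - e, x ij.1 ij.2[.
  by move=> ij; apply: rat_in_itvoo; rewrite gtrBl.
have /choice[q2 hq2] : forall ij : 'I_n * 'I_m, exists q : rat,
    ratr q \in `]x ij.1 ij.2, x ij.1 ij.2 + e[.
  by move=> ij; apply: rat_in_itvoo; rewrite ltrDl.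
exists (\matrix_(i, j) q1 (i, j), \matrix_(i, j) q2 (i, j)).
  move=> y hy; apply: eU; split=> // i j; rewrite /ball/=.
  have := hy i j; have := hq1 (i, j); have := hq2 (i, j).
  rewrite !in_itv/= !mxE => /andP[? ?] /andP[? ?] /andP[? ?].
  by rewrite ltr_norml; apply/andP; split; lra.
move=> i j; have := hq1 (i, j); have := hq2 (i, j).
by rewrite !in_itv/= !mxE => /andP[? ?] /andP[? ?]; apply/andP; split; lra.
Qed.

Lemma bigcup_count_measurable d (T : measurableType d) (I : countType) (P : set I) (F : I -> set T) :
  (forall i, P i -> measurable (F i)) -> measurable (\bigcup_(i in P) F i).
Proof.
move=> mF; have -> : \bigcup_(i in P) F i =
    \bigcup_k (oapp (fun i => if `[< P i >] then F i else set0) set0 (unpickle k)).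
  apply/seteqP; split => [x [i Pi Fx]|x [k _]].
    by exists (pickle i) => //; rewrite pickleK/= asboolT.
  by case: unpickle => //= i; case: asboolP => // Pi Fx; exists i.
apply: bigcup_measurable => k _; case: unpickle => //= i.
by case: asboolP => // Pi; exact: mF.
Qed.

Lemma measurable_mx d (T : measurableType d) (f : T -> M) :
  (forall i j, measurable_fun setT (fun t => f t i j)) -> measurable_fun setT f.
Proof.
move=> mf; apply: (measurability (@open M)) => //.
move=> _ [U oU <-]; rewrite setTI (open_rat_box oU) preimage_bigcup.
apply: bigcup_count_measurable => q _.
have -> : f @^-1` rat_box q = \bigcap_(i in [set: 'I_n]) \bigcap_(j in [set: 'I_m])
    (fun t => f t i j) @^-1` `[ratr (q.1 i j), ratr (q.2 i j)].
  apply/seteqP; split => [x h i _ j _|x h i j]; rewrite /= ?in_itv/=.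
    by have := h i j; rewrite !mxE.
  by have := h i I j I; rewrite /= in_itv/= !mxE.
apply: fin_bigcap_measurable => // i _; apply: fin_bigcap_measurable => // j _.
by rewrite -[X in measurable X]setTI; exact: mf.
Qed.

Lemma open_measurable_mx (U : set M) : open U -> measurable U.
Proof. by move=> oU; exact: sub_sigma_algebra. Qed.

Lemma closed_measurable_mx (U : set M) : closed U -> measurable U.
Proof.
move=> cU; rewrite -[U]setCK; apply: measurableC; apply: open_measurable_mx.
exact: closed_openC.
Qed.

Lemma continuous_measurable_mx (f : M -> R) : continuous f -> measurable_fun setT f.
Proof.
move=> cf; apply: measurable_fun_gt => c; apply: open_measurable_mx.
have -> : [set t | c < f t] = f @^-1` `]c, +oo[ by apply/seteqP; split => t /=; rewrite in_itv/= andbT.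
by apply: open_comp => //; exact: interval_open.
Qed.

Lemma measurable_coord i j : measurable_fun setT (fun x : M => x i j).
Proof. by apply: continuous_measurable_mx; exact: coord_continuous. Qed.

Lemma measurable_box ab : measurable (box ab : set M).
Proof.
have -> : box ab = \bigcap_(i in [set: 'I_n]) \bigcap_(j in [set: 'I_m])
    (fun t : M => t i j) @^-1` `[ab.1 i j, ab.2 i j].
  apply/seteqP; split => [x h i _ j _|x h i j]; rewrite /= ?in_itv/=; first exact: h.
  by have := h i I j I; rewrite /= in_itv/=.
apply: fin_bigcap_measurable => // i _; apply: fin_bigcap_measurable => // j _.
by rewrite -[X in measurable X]setTI; exact: measurable_coord.
Qed.

Lemma measurable_caratheodory_id :
  measurable_fun setT (id : caratheodory_type (@volume R n m) -> M).
Proof.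
apply: measurable_mx => i j.
apply: measurable_fun_gt => c.
have -> : [set t : caratheodory_type (@volume R n m) | c < (t : M) i j] =
    ~` [set t : M | t i j <= c].
  by apply/seteqP; split => t /=; rewrite ltNge => /negP.
by apply: measurableC; exact: caratheodory_halfspace.
Qed.

Lemma borel_caratheodory (A : set M) : measurable A ->
  measurable (A : set (caratheodory_type (@volume R n m))).
Proof.
by move=> mA; have := measurable_caratheodory_id measurableT mA; rewrite setTI.
Qed.

(** The same set function as [volume]; the separate name carries the measure structure on the Borel
    sets, on which products, Fubini and pushforwards are available. *)
Definition leb : set M -> \bar R := volume.

Let leb0 : leb set0 = 0%E. Proof. exact: outer_measure0. Qed.
Let leb_ge0 A : (0 <= leb A)%E. Proof. exact: outer_measure_ge0. Qed.
Let leb_sigma_additive : semi_sigma_additive leb.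
Proof.
move=> F mF tF mUF.
apply: (@measure_semi_sigma_additive _ _ _ (@volume_measure R n m)) => //.
- by move=> i; exact: borel_caratheodory.
- exact: borel_caratheodory.
Qed.

HB.instance Definition _ := isMeasure.Build _ M R leb leb0 leb_ge0 leb_sigma_additive.

Definition cube (k : R) : set M := box (const_mx (- k), const_mx k).

Lemma cube_cover : \bigcup_k cube k%:R = [set: M].
Proof.
apply/seteqP; split => // x _.
exists (Num.trunc `|x|).+1 => // i j; rewrite !mxE -ler_norml.
apply: (@le_trans _ _ `|x|); last by rewrite ltW// truncnS_gt.
rewrite [leRHS]mx_normrE.
exact: (le_bigmax _ (fun ij : 'I_n * 'I_m => `|x ij.1 ij.2|) (i, j)).
Qed.

Lemma leb_box ab : leb (box ab : set M) = box_volume ab.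
Proof. exact: volume_box. Qed.

Let leb_sigma_finite : sigma_finite setT leb.
Proof.
exists (fun k => cube k%:R); first by rewrite cube_cover.
by move=> k; split; [exact: measurable_box|rewrite /cube leb_box ltry].
Qed.
HB.instance Definition _ := @Measure_isSigmaFinite.Build _ M R leb leb_sigma_finite.

Lemma borel_boxE : @measurable _ M = <<s range (@box R n m) >>.
Proof.
apply/seteqP; split.
  apply: smallest_sub; first exact: smallest_sigma_algebra.
  move=> U oU; rewrite (open_rat_box oU).
  apply: (@bigcup_count_measurable _ (g_sigma_algebraType (range (@box R n m)))) => q _.
  by apply: sub_sigma_algebra; exists (map_mx ratr q.1, map_mx ratr q.2).
apply: smallest_sub; first exact: sigma_algebra_measurable.
by move=> _ [ab _ <-]; exact: measurable_box.
Qed.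

(** Boxes are stable under intersection and generate the Borel sets. Changes of variables below
    become comparisons of a pushforward of [leb] with box volumes. *)
Lemma leb_unique (mu : {measure set M -> \bar R}) :
  (forall ab, mu (box ab) = box_volume ab) ->
  forall A, measurable A -> leb A = mu A.
Proof.
move=> muE A mA.
apply: (measure_unique (range (@box R n m)) (fun k => cube k%:R)) => //.
- exact: borel_boxE.
- move=> _ _ [ab _ <-] [cd _ <-].
  exists (\matrix_(i, j) Num.max (ab.1 i j) (cd.1 i j), \matrix_(i, j) Num.min (ab.2 i j) (cd.2 i j)) => //.
  apply/seteqP; split => [x h|x [h1 h2] i j].
    split=> i j; have := h i j; rewrite !mxE ge_max le_min.
      by move=> /andP[/andP[-> _] /andP[-> _]].
    by move=> /andP[/andP[_ ->] /andP[_ ->]].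
  rewrite !mxE ge_max le_min.
  by have /andP[-> ->] := h1 i j; have /andP[-> ->] := h2 i j.
- exact: cube_cover.
- by move=> _ [ab _ <-]; exact: etrans (leb_box _) (esym (muE _)).
- by move=> k; rewrite [X in (X < _)%E]leb_box ltry.
Qed.

End borel_matrix.
Arguments leb {R n m}.
Arguments cube {R n m}.

Section fubini.
Context {R : realType}.

Lemma measurable_col_mx a b c :
  measurable_fun setT (fun xy : 'M[R]_(a, c) * 'M[R]_(b, c) => col_mx xy.1 xy.2).
Proof.
apply: measurable_mx => i j.
case: (split_ordP i) => k ->.
  under eq_fun do rewrite col_mxEu.
  by apply: (measurableT_comp (measurable_coord k j)); exact: measurable_fst.
under eq_fun do rewrite col_mxEd.
by apply: (measurableT_comp (measurable_coord k j)); exact: measurable_snd.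
Qed.

Lemma measurable_dsubmx a b c :
  measurable_fun setT (fun x : 'M[R]_(a + b, c) => dsubmx x).
Proof.
by apply: measurable_mx => i j; under eq_fun do rewrite mxE; exact: measurable_coord.
Qed.

(** A box of stacked matrices is a product of boxes. This is the source of Cavalieri's principle in
    both orders, [leb_col_mx] and [leb_col_mx2]. *)
Lemma leb_prod_col_mx a b c (A : set 'M[R]_(a + b, c)) : measurable A ->
  leb A = (leb \x leb)%E ((fun xy => col_mx xy.1 xy.2) @^-1` A).
Proof.
move=> mA; have mc := @measurable_col_mx a b c.
pose mu : {measure set 'M[R]_(a + b, c) -> \bar R} :=
  pushforward (product_measure1 (@leb R a c) (@leb R b c)) (fun xy => col_mx xy.1 xy.2).
apply: (@leb_unique _ _ _ (mu mc)) => // ab.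
have -> : mu mc (box ab) = (leb \x leb)%E
    (box (usubmx ab.1, usubmx ab.2) `*` box (dsubmx ab.1, dsubmx ab.2)).
  congr (product_measure1 _ _ _); apply/seteqP; split => -[x y] /= h.
    by split=> i j /=; rewrite !mxE; [have := h (lshift b i) j; rewrite col_mxEu|have := h (rshift a i) j; rewrite col_mxEd].
  move=> i j; case: (split_ordP i) => k ->; rewrite ?col_mxEu ?col_mxEd.
    by have := h.1 k j; rewrite /= !mxE.
  by have := h.2 k j; rewrite /= !mxE.
rewrite product_measure1E; [|exact: measurable_box|exact: measurable_box].
rewrite [X in (X * _)%E]leb_box [X in (_ * X)%E]leb_box /box_volume -EFinM big_split_ord/=; congr (_ * _)%:E.
  by apply: eq_bigr => i _; apply: eq_bigr => j _; rewrite !mxE.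
by apply: eq_bigr => i _; apply: eq_bigr => j _; rewrite !mxE.
Qed.

Lemma leb_col_mx a b c (A : set 'M[R]_(a + b, c)) : measurable A ->
  leb A = (\int[leb]_x leb [set y : 'M[R]_(b, c) | A (col_mx x y)])%E.
Proof.
move=> mA; rewrite leb_prod_col_mx// /product_measure1.
apply: eq_integral => x _; congr leb; apply/seteqP; split => y /=.
  by rewrite /xsection/= inE.
by rewrite /xsection/= inE.
Qed.

Lemma leb_col_mx2 a b c (A : set 'M[R]_(a + b, c)) : measurable A ->
  leb A = (\int[leb]_y leb [set x : 'M[R]_(a, c) | A (col_mx x y)])%E.
Proof.
move=> mA; rewrite leb_prod_col_mx//.
rewrite (@product_measure_unique _ _ _ _ _ _ _ (@product_measure2 _ _ _ _ R leb leb)); last first.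
- by rewrite -[X in measurable X]setTI; exact: measurable_col_mx.
- by move=> ? ? ? ?; exact: product_measure2E.
apply: eq_integral => y _; congr leb; apply/seteqP; split => x /=.
  by rewrite /ysection/= inE.
by rewrite /ysection/= inE.
Qed.

Lemma measurable_scalar_mx : measurable_fun setT (fun t : R => t%:M : 'M[R]_1).
Proof.
apply: measurable_mx => i j; under eq_fun do rewrite mxE.
by rewrite [i]ord1 [j]ord1; exact: measurable_id.
Qed.

Lemma leb_11 (A : set 'M[R]_1) : measurable A ->
  leb A = lebesgue_measure [set t | A t%:M].
Proof.
move=> mA.
have mS := measurable_scalar_mx.
pose mu : {measure set 'M[R]_1 -> \bar R} :=
  pushforward (@lebesgue_measure R) (fun t => t%:M).
apply: (@leb_unique _ _ _ (mu mS)) => // ab.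
have -> : mu mS (box ab) = lebesgue_measure `[ab.1 0 0, ab.2 0 0].
  congr lebesgue_measure; apply/seteqP; split => t /=; rewrite in_itv/=.
    by move/(_ 0 0); rewrite mxE eqxx.
  by move=> h i j; rewrite !ord1 mxE eqxx.
rewrite [LHS](lebesgue_measure_itv `[_, _])/= lte_fin /box_volume !big_ord1.
case: ltP => ab0; first by rewrite -EFinD; congr EFin; rewrite max_r// subr_ge0 ltW.
by congr EFin; rewrite max_l// subr_le0.
Qed.

End fubini.

(** * Euclidean geometry and continuity on matrix spaces *)

Section inner_theory.
Context {R : realType} {n m : nat}.
Implicit Types (x y z : 'M[R]_(n, m)) (c : R).

Lemma innerE x y : inner x y = \sum_j \sum_i x i j * y i j.
Proof.
rewrite /inner /mxtrace; apply: eq_bigr => j _; rewrite mxE.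
by apply: eq_bigr => i _; rewrite mxE.
Qed.

Lemma innerC x y : inner x y = inner y x.
Proof.
by rewrite !innerE; apply: eq_bigr => j _; apply: eq_bigr => i _; rewrite mulrC.
Qed.

Lemma innerDl x y z : inner (x + y) z = inner x z + inner y z.
Proof. by rewrite /inner linearD/= mulmxDl linearD. Qed.

Lemma innerZl c x y : inner (c *: x) y = c * inner x y.
Proof. by rewrite /inner linearZ/= -scalemxAl linearZ. Qed.

Lemma innerNl x y : inner (- x) y = - inner x y.
Proof. by rewrite -scaleN1r innerZl mulN1r. Qed.

Lemma innerBl x y z : inner (x - y) z = inner x z - inner y z.
Proof. by rewrite innerDl innerNl. Qed.

Lemma innerDr x y z : inner z (x + y) = inner z x + inner z y.
Proof. by rewrite innerC innerDl !(innerC z). Qed.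

Lemma innerZr c x y : inner x (c *: y) = c * inner x y.
Proof. by rewrite innerC innerZl innerC. Qed.

Lemma innerNr x y : inner x (- y) = - inner x y.
Proof. by rewrite innerC innerNl innerC. Qed.

Lemma innerBr x y z : inner z (x - y) = inner z x - inner z y.
Proof. by rewrite innerDr innerNr. Qed.

Lemma inner0l x : inner 0 x = 0.
Proof. by rewrite -(scale0r x) innerZl mul0r. Qed.

Lemma inner0r x : inner x 0 = 0.
Proof. by rewrite innerC inner0l. Qed.

Lemma inner_ge0 x : 0 <= inner x x.
Proof.
by rewrite innerE; apply: sumr_ge0 => j _; apply: sumr_ge0 => i _; rewrite -expr2 sqr_ge0.
Qed.

Lemma sqr_coord_le x i j : x i j ^+ 2 <= inner x x.
Proof.
rewrite innerE (bigD1 j)//= (bigD1 i)//= -expr2 -addrA lerDl addr_ge0//.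
  by apply: sumr_ge0 => k _; rewrite -expr2 sqr_ge0.
by apply: sumr_ge0 => l _; apply: sumr_ge0 => k _; rewrite -expr2 sqr_ge0.
Qed.

Lemma inner_eq0 x : inner x x = 0 -> x = 0.
Proof.
move=> x0; apply/matrixP => i j; rewrite mxE; apply/eqP; rewrite -sqrf_eq0.
by rewrite eq_le sqr_ge0 andbT -x0 sqr_coord_le.
Qed.

Lemma frob_ge0 x : 0 <= frob x.
Proof. exact: sqrtr_ge0. Qed.

Lemma sqr_frob x : frob x ^+ 2 = inner x x.
Proof. by rewrite sqr_sqrtr// inner_ge0. Qed.

Lemma frob_eq0 x : frob x = 0 -> x = 0.
Proof. by move=> x0; apply: inner_eq0; rewrite -sqr_frob x0 expr0n. Qed.

Lemma frob0 : frob (0 : 'M[R]_(n, m)) = 0.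
Proof. by rewrite /frob inner0l sqrtr0. Qed.

Lemma frob_gt0 x : x != 0 -> 0 < frob x.
Proof.
move=> x0; rewrite lt_neqAle frob_ge0 andbT eq_sym.
by apply: contra_neq x0; exact: frob_eq0.
Qed.

Lemma frobZ c x : frob (c *: x) = `|c| * frob x.
Proof.
rewrite /frob innerZl innerZr mulrA -expr2 sqrtrM ?sqr_ge0//.
by rewrite sqrtr_sqr.
Qed.

Lemma frobN x : frob (- x) = frob x.
Proof. by rewrite -scaleN1r frobZ normrN1 mul1r. Qed.

Lemma inner_le_frob x y : inner x y <= frob x * frob y.
Proof.
have [y0|y0] := eqVneq (inner y y) 0.
  by rewrite (inner_eq0 y0) inner0r frob0 mulr0.
have yy : 0 < inner y y by rewrite lt_neqAle eq_sym y0 inner_ge0.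
apply: le_trans (ler_norm _) _.
rewrite -(@ler_pXn2r _ 2)// ?nnegrE ?normr_ge0 ?mulr_ge0 ?frob_ge0//.
rewrite exprMn !sqr_frob real_normK ?num_real//.
have := inner_ge0 (inner y y *: x - inner x y *: y).
rewrite !(innerBl, innerBr, innerZl, innerZr) (innerC y x).
set a := inner x x; set b := inner x y; set c := inner y y => h.
have : 0 <= c * (a * c - b ^+ 2) by move: h; nra.
by rewrite pmulr_rge0// subr_ge0.
Qed.

Lemma frobD x y : frob (x + y) <= frob x + frob y.
Proof.
rewrite -(@ler_pXn2r _ 2)// ?nnegrE ?addr_ge0 ?frob_ge0//.
rewrite sqr_frob innerDl !innerDr sqrrD !sqr_frob (innerC y x).
have := inner_le_frob x y; lra.
Qed.

Lemma frobB x y : frob (x - y) <= frob x + frob y.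
Proof. by rewrite -(frobN y) frobD. Qed.

Lemma coord_le_frob x i j : `|x i j| <= frob x.
Proof. by rewrite -sqrtr_sqr ler_wsqrtr// sqr_coord_le. Qed.

Lemma frob_le_coord x (k : R) : (forall i j, `|x i j| <= k) -> frob x <= (n * m)%:R * k.
Proof.
move=> h; case: (posnP (n * m)%N) => [nm0|nm0].
  have -> : x = 0.
    apply/matrixP => i j; move/eqP: nm0; rewrite muln_eq0.
    by case/orP => /eqP e; exfalso; [move: (i)|move: (j)]; rewrite e => -[].
  by rewrite frob0 nm0 mul0r.
have k0 : 0 <= k.
  have [n0 m0] : (0 < n)%N /\ (0 < m)%N by apply/andP; rewrite -muln_gt0.
  exact: le_trans (normr_ge0 _) (h (Ordinal n0) (Ordinal m0)).
rewrite -(@ler_pXn2r _ 2)// ?nnegrE ?frob_ge0 ?mulr_ge0//.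
rewrite sqr_frob innerE.
apply: (@le_trans _ _ (\sum_(j < m) \sum_(i < n) k ^+ 2)).
  apply: ler_sum => j _; apply: ler_sum => i _.
  by rewrite -expr2 -real_normK ?num_real// ler_pXn2r// ?nnegrE.
rewrite !sumr_const !card_ord -mulrnA -[leLHS]mulr_natl exprMn ler_wpM2r ?sqr_ge0//.
by rewrite -natrX ler_nat -mulnn leq_pmulr.
Qed.

End inner_theory.

Lemma frob_trmx (R : realType) n m (x : 'M[R]_(n, m)) : frob x^T = frob x.
Proof. by rewrite /frob /inner trmxK mxtrace_mulC. Qed.

Lemma inner_col_mx (R : realType) a b c (x x' : 'M[R]_(a, c)) (y y' : 'M[R]_(b, c)) :
  inner (col_mx x y) (col_mx x' y') = inner x x' + inner y y'.
Proof. by rewrite /inner tr_col_mx mul_row_col linearD. Qed.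

Lemma sqr_frob_col_mx (R : realType) a b c (x : 'M[R]_(a, c)) (y : 'M[R]_(b, c)) :
  frob (col_mx x y) ^+ 2 = frob x ^+ 2 + frob y ^+ 2.
Proof. by rewrite !sqr_frob inner_col_mx. Qed.

Lemma inner_scalar_mx (R : realType) (s t : R) : inner (s%:M : 'M[R]_1) t%:M = s * t.
Proof. by rewrite innerE !big_ord1 !mxE !eqxx. Qed.

Lemma frob_scalar_mx (R : realType) (s : R) : frob (s%:M : 'M[R]_1) = `|s|.
Proof. by rewrite /frob inner_scalar_mx -expr2 sqrtr_sqr. Qed.

Section continuity.
Context {R : realType}.

Lemma continuous_mxP {T : topologicalType} n m (f : T -> 'M[R]_(n, m)) :
  (forall i j, continuous (fun t => f t i j)) -> continuous f.
Proof.
move=> cf t; apply/cvg_ballP => e e0.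
have h : \forall s \near t, forall ij : 'I_n * 'I_m, ball (f t ij.1 ij.2) e (f s ij.1 ij.2).
  apply: filter_forall => -[i j]; have /cvg_ballP := cf i j t; exact.
by apply: filterS h => s h; split=> // i j; exact: (h (i, j)).
Qed.

Context {T : topologicalType}.
Implicit Types f g : T -> R.

Lemma ctsD f g : continuous f -> continuous g -> continuous (fun x => f x + g x).
Proof. by move=> cf cg x; apply: cvgD; [exact: cf|exact: cg]. Qed.

Lemma ctsN f : continuous f -> continuous (fun x => - f x).
Proof. by move=> cf x; apply: cvgN; exact: cf. Qed.

Lemma ctsB f g : continuous f -> continuous g -> continuous (fun x => f x - g x).
Proof. by move=> cf cg; apply: ctsD => //; exact: ctsN. Qed.

Lemma ctsM f g : continuous f -> continuous g -> continuous (fun x => f x * g x).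
Proof. by move=> cf cg x; apply: cvgM; [exact: cf|exact: cg]. Qed.

Lemma cts_sum (I : Type) (r : seq I) (P : pred I) (f : I -> T -> R) :
  (forall i, continuous (f i)) -> continuous (fun x => \sum_(i <- r | P i) f i x).
Proof.
move=> cf; elim: r => [|i r IH].
  by under eq_fun do rewrite big_nil; exact: cst_continuous.
under eq_fun do rewrite big_cons.
by case: (P i) => //; exact: ctsD.
Qed.

Lemma cts_inner n m (f g : T -> 'M[R]_(n, m)) :
  continuous f -> continuous g -> continuous (fun t => inner (f t) (g t)).
Proof.
move=> cf cg; under eq_fun do rewrite innerE.
apply: cts_sum => j; apply: cts_sum => i; apply: ctsM => t.
  by apply: (@continuous_comp _ _ _ f (fun M => M i j)) ; [exact: cf|exact: coord_continuous].
by apply: (@continuous_comp _ _ _ g (fun M => M i j)) ; [exact: cg|exact: coord_continuous].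
Qed.

Lemma cts_frob n m (f : T -> 'M[R]_(n, m)) : continuous f -> continuous (fun t => frob (f t)).
Proof.
move=> cf t; apply: (@continuous_comp _ _ _ (fun t => inner (f t) (f t)) (@Num.sqrt R)).
  exact: cts_inner.
exact: sqrt_continuous.
Qed.

Lemma cts_mulmx n m p (f : T -> 'M[R]_(n, m)) (g : T -> 'M[R]_(m, p)) :
  continuous f -> continuous g -> continuous (fun t => f t *m g t).
Proof.
move=> cf cg; apply: continuous_mxP => i j; under eq_fun do rewrite mxE.
apply: cts_sum => k; apply: ctsM => t.
  by apply: (@continuous_comp _ _ _ f (fun M => M i k)) ; [exact: cf|exact: coord_continuous].
by apply: (@continuous_comp _ _ _ g (fun M => M k j)) ; [exact: cg|exact: coord_continuous].
Qed.

Lemma cts_coord n m (f : T -> 'M[R]_(n, m)) i j : continuous f -> continuous (fun t => f t i j).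
Proof.
by move=> cf t; apply: (@continuous_comp _ _ _ f (fun M => M i j)) ; [exact: cf|exact: coord_continuous].
Qed.

Lemma cts_trmx n m (f : T -> 'M[R]_(n, m)) : continuous f -> continuous (fun t => (f t)^T).
Proof.
by move=> cf; apply: continuous_mxP => i j; under eq_fun do rewrite mxE; exact: cts_coord.
Qed.

Lemma cts_mxD n m (f g : T -> 'M[R]_(n, m)) :
  continuous f -> continuous g -> continuous (fun t => f t + g t).
Proof.
move=> cf cg; apply: continuous_mxP => i j; under eq_fun do rewrite mxE.
by apply: ctsD; exact: cts_coord.
Qed.

Lemma cts_mxZ n m (c : T -> R) (f : T -> 'M[R]_(n, m)) :
  continuous c -> continuous f -> continuous (fun t => c t *: f t).
Proof.
move=> cc cf; apply: continuous_mxP => i j; under eq_fun do rewrite mxE.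
by apply: ctsM => //; exact: cts_coord.
Qed.

Lemma cts_mxN n m (f : T -> 'M[R]_(n, m)) : continuous f -> continuous (fun t => - f t).
Proof.
move=> cf; apply: continuous_mxP => i j; under eq_fun do rewrite mxE.
by apply: ctsN; exact: cts_coord.
Qed.

Lemma cts_col_mx a b c (f : T -> 'M[R]_(a, c)) (g : T -> 'M[R]_(b, c)) :
  continuous f -> continuous g -> continuous (fun t => col_mx (f t) (g t)).
Proof.
move=> cf cg; apply: continuous_mxP => i j; case: (split_ordP i) => k ->.
  by under eq_fun do rewrite col_mxEu; exact: cts_coord.
by under eq_fun do rewrite col_mxEd; exact: cts_coord.
Qed.

Lemma cts_usubmx a b c (f : T -> 'M[R]_(a + b, c)) : continuous f -> continuous (fun t => usubmx (f t)).
Proof.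
by move=> cf; apply: continuous_mxP => i j; under eq_fun do rewrite mxE; exact: cts_coord.
Qed.

Lemma cts_dsubmx a b c (f : T -> 'M[R]_(a + b, c)) : continuous f -> continuous (fun t => dsubmx (f t)).
Proof.
by move=> cf; apply: continuous_mxP => i j; under eq_fun do rewrite mxE; exact: cts_coord.
Qed.

Lemma open_lt f g : continuous f -> continuous g -> open [set t | f t < g t].
Proof.
move=> cf cg; have -> : [set t | f t < g t] = (fun t => g t - f t) @^-1` [set x | 0 < x].
  by apply/seteqP; split => t /=; rewrite subr_gt0.
by apply: open_comp; [move=> t _; exact: ctsB|exact: open_gt].
Qed.

Lemma closed_le f g : continuous f -> continuous g -> closed [set t | f t <= g t].
Proof.
move=> cf cg; have -> : [set t | f t <= g t] = (fun t => g t - f t) @^-1` [set x | 0 <= x].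
  by apply/seteqP; split => t /=; rewrite subr_ge0.
by apply: closed_comp; [move=> t _; exact: ctsB|exact: closed_ge].
Qed.

End continuity.

(** The open Euclidean ball, as opposed to the max-norm [ball] of the matrix topology. *)
Definition eball {R : realType} {n m : nat} (r : R) : set 'M[R]_(n, m) := [set x | frob x < r].

(** * Invariance of Lebesgue measure under affine and orthogonal maps *)

Section leb_invariance.
Context {R : realType}.

Lemma cts_id {T : topologicalType} : continuous (fun t : T => t).
Proof. by move=> t. Qed.

Lemma open_eball n m (r : R) : open (@eball R n m r).
Proof. by apply: open_lt; [apply: cts_frob; exact: cts_id|exact: cst_continuous]. Qed.

Lemma measurable_eball n m (r : R) : measurable (@eball R n m r).
Proof. by apply: open_measurable_mx; exact: open_eball. Qed.

Lemma cts_measurable_mx n m n' m' (f : 'M[R]_(n, m) -> 'M[R]_(n', m')) :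
  continuous f -> measurable_fun setT f.
Proof.
move=> cf; apply: measurable_mx => i j; apply: continuous_measurable_mx; exact: cts_coord.
Qed.

Lemma measurable_preimage_mx d d' (T : measurableType d) (T' : measurableType d')
    (f : T -> T') (A : set T') :
  measurable_fun setT f -> measurable A -> measurable [set x | A (f x)].
Proof. by move=> mf mA; rewrite -[X in measurable X]setTI; exact: mf. Qed.

Lemma leb_shift n m (v : 'M[R]_(n, m)) A : measurable A ->
  leb [set x | A (x + v)] = leb A.
Proof.
move=> mA.
have mf : measurable_fun setT (fun x : 'M[R]_(n, m) => x + v).
  by apply: cts_measurable_mx; apply: cts_mxD; [exact: cts_id|exact: cst_continuous].
pose mu : {measure set 'M[R]_(n, m) -> \bar R} := pushforward leb (fun x => x + v).
apply/esym; apply: (@leb_unique _ _ _ (mu mf)) => // ab.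
have -> : mu mf (box ab) = leb (box (ab.1 - v, ab.2 - v)).
  congr leb; apply/seteqP; split => x h i j; have := h i j; rewrite !mxE; lra.
rewrite leb_box /box_volume; congr EFin; apply: eq_bigr => i _; apply: eq_bigr => j _.
by rewrite !mxE; congr Num.max; ring.
Qed.

Lemma leb_opp n m (A : set 'M[R]_(n, m)) : measurable A -> leb [set x | A (- x)] = leb A.
Proof.
move=> mA.
have mf : measurable_fun setT (fun x : 'M[R]_(n, m) => - x).
  by apply: cts_measurable_mx; apply: cts_mxN; exact: cts_id.
pose mu : {measure set 'M[R]_(n, m) -> \bar R} := pushforward leb (fun x => - x).
apply/esym; apply: (@leb_unique _ _ _ (mu mf)) => // ab.
have -> : mu mf (box ab) = leb (box (- ab.2, - ab.1)).
  congr leb; apply/seteqP; split => x h i j; have := h i j; rewrite !mxE; lra.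
rewrite leb_box /box_volume; congr EFin; apply: eq_bigr => i _; apply: eq_bigr => j _.
by rewrite !mxE; congr Num.max; ring.
Qed.

Lemma leb_trmx n m (A : set 'M[R]_(n, m)) : measurable A -> leb [set x | A x^T] = leb A.
Proof.
move=> mA.
have mf : measurable_fun setT (fun x : 'M[R]_(m, n) => x^T).
  by apply: cts_measurable_mx; apply: cts_trmx; exact: cts_id.
pose mu : {measure set 'M[R]_(n, m) -> \bar R} := pushforward leb (fun x : 'M[R]_(m, n) => x^T).
apply/esym; apply: (@leb_unique _ _ _ (mu mf)) => // ab.
have -> : mu mf (box ab) = leb (box (ab.1^T, ab.2^T)).
  by congr leb; apply/seteqP; split => x h i j; have := h j i; rewrite !mxE.
rewrite leb_box /box_volume exchange_big; congr EFin; apply: eq_bigr => i _; apply: eq_bigr => j _.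
by rewrite !mxE.
Qed.

Lemma leb_mxvec n m (A : set 'M[R]_(n, m)) : measurable A ->
  leb [set x : 'rV_(n * m) | A (vec_mx x)] = leb A.
Proof.
move=> mA.
have mf : measurable_fun setT (fun x : 'rV[R]_(n * m) => vec_mx x).
  by apply: measurable_mx => i j; under eq_fun do rewrite mxE; exact: measurable_coord.
pose mu : {measure set 'M[R]_(n, m) -> \bar R} := pushforward leb (fun x : 'rV_(n * m) => vec_mx x).
apply/esym; apply: (@leb_unique _ _ _ (mu mf)) => // ab.
have -> : mu mf (box ab) = leb (box (mxvec ab.1, mxvec ab.2)).
  congr leb; apply/seteqP; split => x h i j.
    case/mxvec_indexP: j => k l; rewrite ord1 /= !mxvecE.
    by have := h k l; rewrite !mxE.
  by have := h 0 (mxvec_index i j); rewrite /= !mxvecE !mxE.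
rewrite leb_box /box_volume big_ord1; congr EFin.
rewrite pair_bigA/= (reindex _ (curry_mxvec_bij _ _))/=.
by apply: eq_bigr => -[i j] _ /=; rewrite !mxvecE.
Qed.

Lemma leb_scale n m (k : R) (A : set 'M[R]_(n, m)) : 0 < k -> measurable A ->
  (leb A = (k ^+ (n * m))%:E * leb [set x | A (k *: x)])%E.
Proof.
move=> k0 mA.
have mf : measurable_fun setT (fun x : 'M[R]_(n, m) => k *: x).
  by apply: cts_measurable_mx; apply: cts_mxZ; [exact: cst_continuous|exact: cts_id].
have kn0 : 0 <= k ^+ (n * m) by rewrite exprn_ge0// ltW.
pose mu : {measure set 'M[R]_(n, m) -> \bar R} := pushforward leb (fun x => k *: x).
pose nu : {measure set 'M[R]_(n, m) -> \bar R} := mscale (NngNum kn0) (mu mf).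
apply: (@leb_unique _ _ _ nu) => // ab.
have -> : nu (box ab) = ((k ^+ (n * m))%:E * leb (box (k^-1 *: ab.1, k^-1 *: ab.2)))%E.
  congr (_ * leb _)%E; apply/seteqP; split => x h i j; have := h i j; rewrite !mxE /=.
    by rewrite !(mulrC k^-1) ler_pdivrMr// ler_pdivlMr// (mulrC _ k).
  by rewrite !(mulrC k^-1) ler_pdivrMr// ler_pdivlMr// (mulrC _ k).
rewrite leb_box /box_volume -EFinM; congr EFin.
rewrite !pair_bigA/=.
have -> : k ^+ (n * m) = \prod_(p : 'I_n * 'I_m) k by rewrite prodr_const card_prod !card_ord.
rewrite -big_split/=; apply: eq_bigr => -[i j] _ /=; rewrite !mxE -mulrBr.
by rewrite maxr_pMr ?ltW// mulr0 mulrA mulfV ?gt_eqF// mul1r.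
Qed.

End leb_invariance.

Section tonelli.
Context {R : realType}.

Lemma tonelli_set d1 d2 (T1 : measurableType d1) (T2 : measurableType d2)
    (m1 : {sigma_finite_measure set T1 -> \bar R})
    (m2 : {sigma_finite_measure set T2 -> \bar R}) (A : set (T1 * T2)) : measurable A ->
  (\int[m1]_x m2 [set y | A (x, y)] = \int[m2]_y m1 [set x | A (x, y)])%E.
Proof.
move=> mA.
have sx x : xsection A x = [set y | A (x, y)].
  by apply/seteqP; split => y; rewrite /xsection/= inE.
have sy y : ysection A y = [set x | A (x, y)].
  by apply/seteqP; split => x; rewrite /ysection/= inE.
transitivity ((m1 \x m2)%E A).
  by apply: eq_integral => x _; rewrite /= sx.
rewrite (@product_measure_unique _ _ _ _ _ _ _ (@product_measure2 _ _ _ _ R m1 m2))//.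
  by apply: eq_integral => y _; rewrite /= sy.
by move=> ? ? ? ?; exact: product_measure2E.
Qed.

Lemma measurable_section d1 d2 (T1 : measurableType d1) (T2 : measurableType d2)
    (m2 : {sigma_finite_measure set T2 -> \bar R}) (A : set (T1 * T2)) : measurable A ->
  measurable_fun setT (fun x => m2 [set y | A (x, y)]).
Proof.
move=> mA; have -> : (fun x => m2 [set y | A (x, y)]) = m2 \o xsection A.
  apply/funext => x /=; congr (m2 _).
  by apply/seteqP; split => y; rewrite /xsection/= inE.
exact: measurable_fun_xsection.
Qed.

Lemma integral_fun_cst d (T : measurableType d) (mu : {measure set T -> \bar R})
    (A : set T) (f : T -> \bar R) (c : \bar R) : measurable A ->
  (forall x, A x -> f x = c) -> (forall x, ~ A x -> f x = 0%E) ->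
  (\int[mu]_x f x = c * mu A)%E.
Proof.
move=> mA fA fN; rewrite -integral_cst//.
rewrite [RHS]integral_mkcond; apply: eq_integral => x _.
by rewrite patchE; case: ifPn; rewrite ?inE ?notin_setE => h; [exact: fA|exact: fN].
Qed.

Lemma measurable_prod_fst d1 d2 (T1 : measurableType d1) (T2 : measurableType d2) (A : set T1) :
  measurable A -> measurable [set xy : T1 * T2 | A xy.1].
Proof. by move=> mA; exact: (measurable_preimage_mx measurable_fst). Qed.

Lemma measurable_prod_snd d1 d2 (T1 : measurableType d1) (T2 : measurableType d2) (A : set T2) :
  measurable A -> measurable [set xy : T1 * T2 | A xy.2].
Proof. by move=> mA; exact: (measurable_preimage_mx measurable_snd). Qed.

(** The product space carries the product sigma-algebra, so openness has to be transported: stacking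
    both matrices into one column, which is a measurable map, turns the open set into an open set of
    a single matrix space, hence into a countable union of boxes. *)
Lemma open_prod_measurable n m n' m' (U : set ('M[R]_(n, m) * 'M[R]_(n', m'))) :
  open U -> measurable U.
Proof.
move=> oU.
pose g (z : 'cV[R]_(n * m + n' * m')) := (vec_mx (usubmx z)^T : 'M[R]_(n, m), vec_mx (dsubmx z)^T : 'M[R]_(n', m')).
pose f (xy : 'M[R]_(n, m) * 'M[R]_(n', m')) := col_mx (mxvec xy.1)^T (mxvec xy.2)^T.
have fgK : cancel f g.
  by move=> [x y]; rewrite /f /g col_mxKu col_mxKd !trmxK !mxvecK.
have -> : U = [set xy | U (g (f xy))] by apply/seteqP; split => xy /=; rewrite fgK.
apply: (@measurable_preimage_mx _ _ _ _ f (g @^-1` U)).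
  apply: measurable_mx => i j; rewrite /f; case: (split_ordP i) => k ->.
    case/mxvec_indexP: k => a b.
    rewrite (_ : (fun xy => _) = (fun xy : 'M[R]_(n, m) * 'M[R]_(n', m') => xy.1 a b)).
      by apply: (measurableT_comp (measurable_coord a b)); exact: measurable_fst.
    by apply/funext => xy; rewrite col_mxEu mxE (ord1 j) mxvecE.
  case/mxvec_indexP: k => a b.
  rewrite (_ : (fun xy => _) = (fun xy : 'M[R]_(n, m) * 'M[R]_(n', m') => xy.2 a b)).
    by apply: (measurableT_comp (measurable_coord a b)); exact: measurable_snd.
  by apply/funext => xy; rewrite col_mxEd mxE (ord1 j) mxvecE.
have c1 : continuous (fun z : 'cV[R]_(n * m + n' * m') => vec_mx (usubmx z)^T : 'M[R]_(n, m)).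
  by apply: continuous_mxP => i j; under eq_fun do rewrite !mxE; exact: coord_continuous.
have c2 : continuous (fun z : 'cV[R]_(n * m + n' * m') => vec_mx (dsubmx z)^T : 'M[R]_(n', m')).
  by apply: continuous_mxP => i j; under eq_fun do rewrite !mxE; exact: coord_continuous.
apply: open_measurable_mx; apply: open_comp => // z _.
exact: (cvg_pair (c1 z) (c2 z)).
Qed.

End tonelli.

Section orthogonal.
Context {R : realType}.

Lemma eball_cube n m (r : R) : @eball R n m r `<=` cube r.
Proof.
move=> x xr i j; rewrite !mxE -ler_norml.
exact: le_trans (coord_le_frob _ _ _) (ltW xr).
Qed.

Lemma leb_eball_lty n m (r : R) : (leb (@eball R n m r) < +oo)%E.
Proof.
apply: le_lt_trans (le_measure _ _ _ (@eball_cube n m r)) _; rewrite ?inE.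
- exact: measurable_eball.
- exact: measurable_box.
- by rewrite [X in (X < _)%E]leb_box ltry.
Qed.

Lemma leb_eball_gt0 n m (r : R) : 0 < r -> (0 < leb (@eball R n m r))%E.
Proof.
move=> r0; pose e := r / (n * m).+1%:R.
have e0 : 0 < e by rewrite divr_gt0.
apply: (@lt_le_trans _ _ (leb (cube e : set 'M[R]_(n, m)))).
  rewrite [X in (_ < X)%E]leb_box /box_volume lte_fin.
  apply: prodr_gt0 => i _; apply: prodr_gt0 => j _; rewrite !mxE.
  by rewrite lt_max; apply/orP; right; lra.
apply: le_measure; rewrite ?inE; [exact: measurable_box|exact: measurable_eball|].
move=> x xe; rewrite /eball/=; apply: (@le_lt_trans _ _ ((n * m)%:R * e)).
  by apply: frob_le_coord => i j; have := xe i j; rewrite !mxE -ler_norml.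
by rewrite /e mulrA ltr_pdivrMr// mulrC ltr_pM2l// ltr_nat.
Qed.

Lemma inner_orthogonal n m (O : 'M[R]_n) (x y : 'M[R]_(n, m)) : O^T *m O = 1%:M ->
  inner (O *m x) (O *m y) = inner x y.
Proof. by move=> OO; rewrite /inner trmx_mul mulmxA -(mulmxA x^T) OO mulmx1. Qed.

Lemma frob_orthogonal n m (O : 'M[R]_n) (x : 'M[R]_(n, m)) : O^T *m O = 1%:M ->
  frob (O *m x) = frob x.
Proof. by move=> OO; rewrite /frob inner_orthogonal. Qed.

Lemma measurable_linear n m (O : 'M[R]_n) (A : set 'M[R]_(n, m)) : measurable A ->
  measurable [set x | A (O *m x)].
Proof.
move=> mA; apply: (@measurable_preimage_mx _ _ _ _ (fun x => O *m x)) => //.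
by apply: cts_measurable_mx; apply: cts_mulmx; [exact: cst_continuous|exact: cts_id].
Qed.

(* Both sides of  leb A * leb B = leb B * leb (O^-1 A),  for B the unit ball, evaluate the
   double integral of 1_A(x) 1_B(x - O y). *)
Lemma leb_orthogonal n m (O : 'M[R]_n) (A : set 'M[R]_(n, m)) : O^T *m O = 1%:M ->
  measurable A -> leb [set x | A (O *m x)] = leb A.
Proof.
move=> OO mA.
have OO' : O *m O^T = 1%:M by exact: mulmx1C.
have OtOt : (O^T)^T *m O^T = 1%:M by rewrite trmxK.
pose B := @eball R n m 1.
have mB : measurable B by exact: measurable_eball.
have mW : measurable [set xy : 'M[R]_(n, m) * 'M[R]_(n, m) | A xy.1 /\ B (xy.1 - O *m xy.2)].
  apply: measurableI; first exact: measurable_prod_fst.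
  apply: open_prod_measurable; apply: open_lt; last exact: cst_continuous.
  apply: cts_frob; apply: cts_mxD; first by move=> xy; exact: cvg_fst.
  apply: cts_mxN; apply: cts_mulmx; first exact: cst_continuous.
  by move=> xy; exact: cvg_snd.
have mW' : measurable [set xy : 'M[R]_(n, m) * 'M[R]_(n, m) | A (xy.1 + O *m xy.2) /\ B xy.1].
  apply: measurableI; last exact: measurable_prod_fst.
  apply: (@measurable_preimage_mx _ _ _ _ (fun xy : 'M[R]_(n, m) * 'M[R]_(n, m) => xy.1 + O *m xy.2)) => //.
  apply: measurable_mx => i j; under eq_fun do rewrite mxE.
  apply: measurable_funD.
    by apply: (measurableT_comp (measurable_coord i j)); exact: measurable_fst.
  apply: (measurableT_comp (f := fun y : 'M[R]_(n, m) => (O *m y) i j)); last exact: measurable_snd.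
  apply: continuous_measurable_mx; apply: cts_coord.
  by apply: cts_mulmx; [exact: cst_continuous|exact: cts_id].
have e1 : (\int[leb]_x leb [set y | A x /\ B (x - O *m y)%R] = leb B * leb A)%E.
  apply: integral_fun_cst => // x Ax; last first.
    by rewrite -[RHS](@measure0 _ _ _ (@leb R n m)); congr leb; apply/seteqP; split => y // [].
  have mB' : measurable [set y | B (- O *m y)] by exact: measurable_linear.
  transitivity (leb [set y | [set y | B (- O *m y)] (y + - (O^T *m x))]).
    congr leb; apply/seteqP; split => y /=.
      by move=> [_]; rewrite !mulNmx mulmxBr mulmxA OO' mul1mx opprB.
    by rewrite !mulNmx mulmxBr mulmxA OO' mul1mx opprB.
  rewrite leb_shift//; congr leb; apply/seteqP; split => y /=.
    by rewrite /B /eball/= mulNmx frobN frob_orthogonal.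
  by rewrite /B /eball/= mulNmx frobN frob_orthogonal.
have := e1; have /= -> := tonelli_set leb leb mW.
under eq_integral => y _.
  have -> : leb [set x | A x /\ B (x - O *m y)] = leb [set x | A (x + O *m y) /\ B x].
    rewrite -(@leb_shift _ _ _ (O *m y)); last first.
      apply: measurableI => //; apply: open_measurable_mx; apply: open_lt; last exact: cst_continuous.
      by apply: cts_frob; apply: cts_mxD; [exact: cts_id|exact: cst_continuous].
    by congr leb; apply/seteqP; split => x /=; rewrite addrK.
  over.
have /= <- := tonelli_set leb leb mW'.
rewrite (@integral_fun_cst _ _ _ _ B _ (leb [set y | A (O *m y)]))//; last 2 first.
- move=> x Bx; have mAO : measurable [set y | A (O *m y)] by exact: measurable_linear.
  rewrite -(leb_shift (O^T *m x) mAO); congr leb; apply/seteqP; split => y /=.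
    by rewrite mulmxDr mulmxA OO' mul1mx addrC => -[].
  by rewrite mulmxDr mulmxA OO' mul1mx addrC.
- move=> x Bx; rewrite -[RHS](@measure0 _ _ _ (@leb R n m)); congr leb.
  by apply/seteqP; split => y // [].
have B0 := leb_eball_gt0 n m (@ltr01 R); have Boo := leb_eball_lty n m (1 : R).
have Bf : leb B \is a fin_num by rewrite ge0_fin_numE// ltW.
rewrite [RHS]muleC => h; have {h} : (leb [set y | A (O *m y)%R] * leb B = leb A * leb B)%E by exact: h.
rewrite -(fineK Bf) => /(congr1 (fun z => z * ((fine (leb B))^-1)%:E)%E).
have b0 : fine (leb B) != 0 by rewrite gt_eqF// fine_gt0// B0.
by rewrite -!muleA -EFinM divff// !mule1.
Qed.

End orthogonal.

(** * Steiner symmetrization and the Brunn-Minkowski inequality *)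

Section steiner.
Context {R : realType}.
Notation lambda := (@lebesgue_measure R).

Lemma lebesgue_shift (Y : set R) t : measurable Y -> lambda [set s | Y (s + t)] = lambda Y.
Proof.
move=> mY.
have mZ : measurable [set s : 'M[R]_1 | Y (s 0 0)].
  by apply: (measurable_preimage_mx (measurable_coord 0 0)).
have := leb_shift (t%:M) mZ; rewrite !leb_11//; last first.
  apply: (@measurable_preimage_mx _ _ _ _ (fun x : 'M[R]_1 => x + t%:M) [set s | Y (s 0 0)]) => //.
  by apply: cts_measurable_mx; apply: cts_mxD; [exact: cts_id|exact: cst_continuous].
move=> h; transitivity (lambda [set s | Y ((s%:M + t%:M : 'M[R]_1) 0 0)]).
  by congr (lambda _); apply/seteqP; split => s /=; rewrite !mxE !eqxx.
by rewrite [LHS]h; congr (lambda _); apply/seteqP; split => s /=; rewrite !mxE !eqxx.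
Qed.

Lemma lebesgue_abs_lt (L : R) : 0 <= L -> lambda [set s | 2 * `|s| < L] = L%:E.
Proof.
move=> L0; have -> : [set s | 2 * `|s| < L] = `]- (L / 2), (L / 2)[%classic.
  by apply/seteqP; split => s /=; rewrite in_itv/= -ltr_norml ltr_pdivlMr// mulrC.
rewrite lebesgue_measure_itv/= lte_fin; case: ltP => h.
  by rewrite -EFinD; congr EFin; lra.
by congr EFin; lra.
Qed.

(** The translate of [X] by a point of [Y] near its infimum and the translate of [Y] by a point of
    [X] near its supremum both lie in [Z]; they overlap inside an interval of length [e]. *)
Lemma brunn_minkowski_1d (X Y Z : set R) : measurable X -> measurable Y -> measurable Z ->
  X !=set0 -> Y !=set0 -> (exists M, forall s, X s \/ Y s -> `|s| <= M) ->
  (forall s t, X s -> Y t -> Z (s + t)) -> (lambda X + lambda Y <= lambda Z)%E.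
Proof.
move=> mX mY mZ [x0 X0] [y0 Y0] [M hM] XYZ.
have hX : has_sup X.
  split; first by exists x0.
  by exists M => s Xs; apply: le_trans (ler_norm _) _; apply: hM; left.
have hY : has_inf Y.
  split; first by exists y0.
  by exists (- M) => s Ys; have := hM s (or_intror Ys); rewrite ler_norml => /andP[].
apply/lee_addgt0Pr => e e0.
have e20 : 0 < e / 2 by rewrite divr_gt0.
have [a Xa ha] := sup_adherent e20 hX; have [b Yb hb] := inf_adherent e20 hY.
pose c := sup X + inf Y.
pose U := [set s | X (s + (- b))]; pose V := [set s | Y (s + (- a))].
have mU : measurable U.
  by apply: (@measurable_preimage_mx _ _ _ _ (fun s : R => s + - b)) => //; apply: measurable_funD.
have mV : measurable V.
  by apply: (@measurable_preimage_mx _ _ _ _ (fun s : R => s + - a)) => //; apply: measurable_funD.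
have UZ : U `<=` Z by move=> s Us; have := XYZ _ _ Us Yb; rewrite subrK.
have VZ : V `<=` Z by move=> s Vs; have := XYZ _ _ Xa Vs; rewrite addrC subrK.
have UV : U `&` V `<=` `[c - e / 2, c + e / 2]%classic.
  move=> s [Us Vs]; rewrite /= in_itv/=.
  have h1 : s - b <= sup X by apply: ub_le_sup => //; case: hX.
  have h2 : inf Y <= s - a by apply: ge_inf => //; case: hY.
  by rewrite /c; apply/andP; split; lra.
have mUV : measurable (U `&` V) by exact: measurableI.
have ke : (lambda (U `&` V) <= e%:E)%E.
  apply: le_trans (le_measure lambda _ _ UV) _; rewrite ?inE//.
  rewrite [X in (X <= _)%E]lebesgue_measure_itv/= lte_fin; case: ltP => // _.
    by rewrite -EFinD lee_fin; lra.
  by rewrite lee_fin ltW.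
have <- : lambda U = lambda X by exact: lebesgue_shift.
have <- : lambda V = lambda Y by exact: lebesgue_shift.
have -> : (lambda U + lambda V = lambda (U `|` V) + lambda (U `&` V))%E.
  rewrite measureUfinr//; last first.
    apply: (@le_lt_trans _ _ (lambda `[- (M + `|a|), (M + `|a|)]%classic)).
      apply: le_measure; rewrite ?inE// => s Vs.
      rewrite /= in_itv/= -ler_norml -[s](subrK a).
      by apply: le_trans (ler_normD _ _) _; rewrite lerD2r; apply: hM; right.
    by rewrite [X in (X < _)%E]lebesgue_measure_itv/=; case: ifP => // _; rewrite ltry.
  rewrite subeK// ge0_fin_numE//; apply: le_lt_trans ke _; exact: ltry.
by apply: leeD => //; apply: le_measure; rewrite ?inE//; [exact: measurableU|rewrite subUset].
Qed.

Context {k : nat}.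
Notation V := 'cV[R]_(1 + k).
Implicit Types (A B C : set V) (y : 'cV[R]_k).

(** Symmetrization always acts on the first coordinate; [fib] is the section by a line in this
    direction, and other directions are reached by rotating the set beforehand. *)
Definition pt (s : R) y : V := col_mx s%:M y.
Definition fib A y : set R := [set s | A (pt s y)].

Lemma ptE (x : V) : pt (usubmx x 0 0) (dsubmx x) = x.
Proof.
rewrite /pt -[RHS]vsubmxK; congr col_mx.
by apply/matrixP => i j; rewrite !ord1 [LHS]mxE eqxx.
Qed.

Lemma ptD s t y z : pt s y + pt t z = pt (s + t) (y + z).
Proof. by rewrite /pt add_col_mx raddfD. Qed.

Lemma sqr_frob_pt s y : frob (pt s y) ^+ 2 = s ^+ 2 + frob y ^+ 2.
Proof. by rewrite sqr_frob_col_mx frob_scalar_mx real_normK ?num_real. Qed.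

Lemma usubmx_pt s y : usubmx (pt s y) 0 0 = s.
Proof. by rewrite /pt col_mxKu mxE eqxx. Qed.

Lemma dsubmx_pt s y : dsubmx (pt s y) = y.
Proof. by rewrite /pt col_mxKd. Qed.

Lemma frob_le_pt s y : `|s| <= frob (pt s y).
Proof.
by rewrite -(@ler_pXn2r _ 2)// ?nnegrE ?frob_ge0// sqr_frob_pt real_normK ?num_real// lerDl sqr_ge0.
Qed.

Lemma cts_pt (T : topologicalType) (f : T -> R) (g : T -> 'cV[R]_k) :
  continuous f -> continuous g -> continuous (fun t => pt (f t) (g t)).
Proof.
move=> cf cg; apply: cts_col_mx => //.
by apply: continuous_mxP => i j; under eq_fun do rewrite mxE (ord1 i) (ord1 j) eqxx.
Qed.

Lemma measurable_fib A y : measurable A -> measurable (fib A y).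
Proof.
move=> mA; apply: (@measurable_preimage_mx _ _ _ _ (fun s => pt s y)) => //.
apply: measurable_mx => i j; rewrite /pt; case: (split_ordP i) => l ->.
  under eq_fun do rewrite col_mxEu mxE (ord1 l) (ord1 j) eqxx.
  exact: measurable_id.
by under eq_fun do rewrite col_mxEd; exact: measurable_cst.
Qed.

Lemma measurable_slice A y : measurable A -> measurable [set x : 'M[R]_1 | A (col_mx x y)].
Proof.
move=> mA; apply: (@measurable_preimage_mx _ _ _ _ (fun x : 'M[R]_1 => (col_mx x y : V))) => //.
by apply: cts_measurable_mx; apply: cts_col_mx; [exact: cts_id|exact: cst_continuous].
Qed.

Lemma leb_sliceE A y : measurable A -> leb [set x : 'M[R]_1 | A (col_mx x y)] = lambda (fib A y).
Proof. by move=> mA; rewrite leb_11//; exact: measurable_slice. Qed.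

Lemma leb_fib A : measurable A -> leb A = (\int[leb]_y lambda (fib A y))%E.
Proof.
move=> mA; rewrite leb_col_mx2//; apply: eq_integral => y _; exact: leb_sliceE.
Qed.

Lemma measurable_len A : measurable A -> measurable_fun setT (fun y => lambda (fib A y)).
Proof.
move=> mA; under eq_fun do rewrite -leb_sliceE//.
have mB : measurable [set yx : 'cV[R]_k * 'M[R]_1 | A (col_mx yx.2 yx.1)].
  apply: (@measurable_preimage_mx _ _ _ _ (fun yx : 'cV[R]_k * 'M[R]_1 => (col_mx yx.2 yx.1 : V))) => //.
  apply: (measurableT_comp (f := fun xy : 'M[R]_1 * 'cV[R]_k => col_mx xy.1 xy.2)
    (g := fun yx : 'cV[R]_k * 'M[R]_1 => (yx.2, yx.1))).
    exact: measurable_col_mx.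
  by apply: measurable_fun_pair; [exact: measurable_snd|exact: measurable_fst].
exact: (measurable_section leb mB).
Qed.

(** The strict inequality makes every new fibre an open centred interval and leaves null fibres
    empty. Open sets then stay open, and a point of the result always comes from a fibre of positive
    length. *)
Definition steiner A : set V :=
  [set x | ((2 * `|usubmx x 0 0|)%:E < lambda (fib A (dsubmx x)))%E].

Lemma steiner_pt A s y : steiner A (pt s y) = ((2 * `|s|)%:E < lambda (fib A y))%E.
Proof. by rewrite /steiner/= usubmx_pt dsubmx_pt. Qed.

Lemma measurable_steiner A : measurable A -> measurable (steiner A).
Proof.
move=> mA.
have -> : steiner A = setT `&` [set x | (0 < lambda (fib A (dsubmx x)) - (2 * `|usubmx x 0 0|)%:E)%E].
  by rewrite setTI; apply/funext => x; rewrite /steiner /mkset sube_gt0.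
apply: emeasurable_fun_o_infty => //; apply: emeasurable_funB.
  apply: (measurableT_comp (measurable_len mA)); exact: measurable_dsubmx.
apply/measurable_EFinP; apply: measurable_funM => //.
apply: measurableT_comp => //; under eq_fun do rewrite mxE; exact: measurable_coord.
Qed.

Lemma fib_lty A y rho : A `<=` eball rho -> measurable A -> (lambda (fib A y) < +oo)%E.
Proof.
move=> Ar mA; apply: (@le_lt_trans _ _ (lambda `[- rho, rho]%classic)).
  apply: le_measure; rewrite ?inE//; first exact: measurable_fib.
  move=> s /Ar h; rewrite /= in_itv/= -ler_norml.
  exact: le_trans (frob_le_pt _ _) (ltW h).
by rewrite [X in (X < _)%E]lebesgue_measure_itv/=; case: ifP => // _; rewrite ltry.
Qed.

Lemma fib_fin A y rho : A `<=` eball rho -> measurable A -> lambda (fib A y) \is a fin_num.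
Proof. by move=> Ar mA; rewrite ge0_fin_numE//; exact: (fib_lty y Ar mA). Qed.

Lemma fib_steinerE A y rho : A `<=` eball rho -> measurable A ->
  fib (steiner A) y = [set s | 2 * `|s| < fine (lambda (fib A y))].
Proof.
move=> Ar mA; apply/funext => s; rewrite /fib/= steiner_pt.
by rewrite -[X in (_ < X)%E](fineK (fib_fin y Ar mA)) lte_fin.
Qed.

Lemma len_steiner A y rho : A `<=` eball rho -> measurable A ->
  lambda (fib (steiner A) y) = lambda (fib A y).
Proof.
move=> Ar mA; rewrite (fib_steinerE y Ar mA) lebesgue_abs_lt ?fine_ge0//.
by rewrite fineK// (fib_fin y Ar mA).
Qed.

Lemma leb_steiner A rho : A `<=` eball rho -> measurable A -> leb (steiner A) = leb A.
Proof.
move=> Ar mA; have mS := measurable_steiner mA; rewrite leb_fib// [RHS]leb_fib//.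
by apply: eq_integral => y _; rewrite (len_steiner y Ar mA).
Qed.

Lemma steinerS A B : measurable A -> measurable B -> A `<=` B -> steiner A `<=` steiner B.
Proof.
move=> mA mB AB x; rewrite /steiner/= => /lt_le_trans; apply.
by apply: le_measure; rewrite ?inE; [exact: measurable_fib|exact: measurable_fib|move=> s; exact: AB].
Qed.

Lemma steiner_eball (r : R) : 0 < r -> steiner (eball r) = eball r.
Proof.
move=> r0; apply/seteqP; suff h s y : steiner (eball r) (pt s y) <-> eball r (pt s y).
  by split=> x; rewrite -(ptE x) => /h.
have fibE : fib (eball r) y = [set t | t ^+ 2 < r ^+ 2 - frob y ^+ 2].
  have e t : (frob (pt t y) < r) = (t ^+ 2 < r ^+ 2 - frob y ^+ 2).
    by rewrite -(@ltr_pXn2r _ 2)// ?nnegrE ?frob_ge0 ?ltW// sqr_frob_pt ltrBrDr.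
  by apply/funext => t; rewrite /fib /eball/= e.
rewrite steiner_pt fibE.
have -> : eball r (pt s y) = (s ^+ 2 < r ^+ 2 - frob y ^+ 2).
  change (fib (eball r) y s = (s ^+ 2 < r ^+ 2 - frob y ^+ 2) :> Prop).
  by rewrite fibE.
set w := r ^+ 2 - frob y ^+ 2.
have [w0|w0] := leP w 0.
  have -> : [set t | t ^+ 2 < w] = set0.
    by apply/seteqP; split => // t /= h; have := sqr_ge0 t; lra.
  rewrite measure0 lte_fin; split => h; first by have := normr_ge0 s; lra.
  by have := sqr_ge0 s; lra.
have e t : (t ^+ 2 < w) = (2 * `|t| < 2 * Num.sqrt w).
  rewrite ltr_pM2l// -[RHS](@ltr_pXn2r _ 2)// ?nnegrE ?sqrtr_ge0//.
  by rewrite sqr_sqrtr ?ltW// real_normK ?num_real.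
under eq_set do rewrite e.
rewrite lebesgue_abs_lt; last by rewrite mulr_ge0// sqrtr_ge0.
by rewrite lte_fin e.
Qed.

Lemma steiner_sub_eball A (r : R) : 0 < r -> measurable A -> A `<=` eball r -> steiner A `<=` eball r.
Proof.
move=> r0 mA Ar; rewrite -[X in _ `<=` X](steiner_eball r0).
by apply: steinerS => //; exact: measurable_eball.
Qed.

(** Along each pair of lines this is the one-dimensional Brunn-Minkowski inequality together with |s
    + t| <= |s| + |t|; its nonemptiness conditions hold since the two fibres have positive
    length. *)
Lemma steiner_sum A B C rho : measurable A -> measurable B -> measurable C ->
  A `<=` eball rho -> B `<=` eball rho ->
  (forall x y : V, A x -> B y -> C (x + y)) ->
  forall x y : V, steiner A x -> steiner B y -> steiner C (x + y).
Proof.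
move=> mA mB mC Ar Br ABC x y.
rewrite -(ptE x) -(ptE y) ptD !steiner_pt.
set s := usubmx x 0 0; set t := usubmx y 0 0; set x' := dsubmx x; set y' := dsubmx y.
move=> h1 h2.
have ne (D : set V) z (u : R) : ((2 * `|u|)%:E < lambda (fib D z))%E -> fib D z !=set0.
  move=> h; apply/set0P/eqP => e; move: h; rewrite e measure0 lte_fin.
  by have := normr_ge0 u; lra.
have := @brunn_minkowski_1d (fib A x') (fib B y') (fib C (x' + y'))
  (measurable_fib _ mA) (measurable_fib _ mB) (measurable_fib _ mC) (ne _ _ _ h1) (ne _ _ _ h2).
move=> h; apply: lt_le_trans (h _ _); last 2 first.
- exists rho => u [/Ar|/Br] hu; exact: le_trans (frob_le_pt _ _) (ltW hu).
- by move=> u v Au Bv; rewrite /fib /= -ptD; exact: ABC.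
apply: (@le_lt_trans _ _ ((2 * `|s|)%:E + (2 * `|t|)%:E)).
  by rewrite -EFinD lee_fin -mulrDr ler_pM2l// ler_normD.
by apply: lteD.
Qed.

(** Fibre length is lower semicontinuous in the base point: a compact part of the fibre of nearly
    full length stays inside the open set when the line is shifted slightly. *)
Lemma open_steiner A rho : A `<=` eball rho -> open A -> open (steiner A).
Proof.
move=> Ar oA; have mA := open_measurable_mx oA.
rewrite openE => x; rewrite /interior -{1}(ptE x) steiner_pt.
set s := usubmx x 0 0; set x' := dsubmx x => hs.
have fA := fib_fin x' Ar mA; move: hs; rewrite -(fineK fA) lte_fin => hs.
set L := fine _ in hs.
have e0 : 0 < (L - 2 * `|s|) / 2 by rewrite divr_gt0// subr_gt0.
have [K [cK KA hK]] := lebesgue_regularity_inner (measurable_fib x' mA) (fib_lty x' Ar mA) e0.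
have mK : measurable K by apply: closed_measurable; apply: compact_closed.
have LK : ((L - (L - 2 * `|s|) / 2)%:E <= lambda K)%E.
  have hL : lambda (fib A x') = (lambda (fib A x' `\` K) + lambda K)%E.
    by rewrite -{2}(setIidr KA); exact: (measureDI lambda (measurable_fib x' mA) mK).
  have h : L%:E = (lambda (fib A x' `\` K) + lambda K)%E by rewrite -hL fineK.
  have : (L%:E <= ((L - 2 * `|s|) / 2)%:E + lambda K)%E by rewrite h leeD2r// ltW.
  by case: (lambda K) => [r||]; rewrite -?EFinD ?lee_fin ?leey//; lra.
have near1 : \forall z \near x, K `<=` fib A (dsubmx z).
  have /compact_near_coveringP/(_ _ (nbhs x) (fun z v => fib A (dsubmx z) v)) := cK.
  apply => v Kv.
  have c : continuous (fun vz : R * V => pt vz.1 (dsubmx vz.2)).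
    apply: cts_pt; first by move=> vz; exact: cvg_fst.
    by apply: cts_dsubmx => vz; exact: cvg_snd.
  have oN : open ((fun vz : R * V => pt vz.1 (dsubmx vz.2)) @^-1` A) by apply: open_comp.
  have := open_nbhs_nbhs (conj oN (KA _ Kv : ((fun vz : R * V => pt vz.1 (dsubmx vz.2)) @^-1` A) (v, x))).
  exact.
have near2 : \forall z \near x, 2 * `|usubmx z 0 0| < L - (L - 2 * `|s|) / 2.
  have oN : open [set z : V | 2 * `|usubmx z 0 0| < L - (L - 2 * `|s|) / 2].
    apply: open_lt; last exact: cst_continuous.
    apply: ctsM; first exact: cst_continuous.
    move=> z; apply: (@continuous_comp _ _ _ (fun z : V => usubmx z 0 0) (fun u : R => `|u|)).
      by apply: cts_coord; apply: cts_usubmx; exact: cts_id.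
    exact: norm_continuous.
  by apply: (open_nbhs_nbhs (conj oN _)) => /=; rewrite -/s; lra.
apply: filterS2 near1 near2 => z Kz hz.
rewrite -(ptE z) steiner_pt; apply: (@lt_le_trans _ _ (lambda K)).
  by apply: lt_le_trans LK; rewrite lte_fin.
by apply: le_measure; rewrite ?inE//; exact: measurable_fib.
Qed.

End steiner.

(** * Quantitative decrease of the distance to a ball *)

Section steiner_gain.
Context {R : realType} {k : nat}.
Notation lambda := (@lebesgue_measure R).
Notation V := 'cV[R]_(1 + k).
Implicit Types (A B C : set V) (y : 'cV[R]_k).

Lemma leb_sub_lty A rho : A `<=` eball rho -> measurable A -> (leb A < +oo)%E.
Proof.
move=> Ar mA; apply: le_lt_trans (leb_eball_lty (1 + k) 1 rho).
by apply: le_measure; rewrite ?inE//; exact: measurable_eball.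
Qed.

(* On each line D is centred, so the part of D missed by the symmetrization of B has length
   |D \ B| - |B \ D|, unless B is the longer of the two. *)
Lemma len_steiner_gain B rho (r : R) t y : 0 < r -> measurable B -> B `<=` eball rho ->
  (lambda (fib (eball r `\` steiner B) y) +
    lambda [set s | fib (B `\` eball r) y s /\ fib (eball r `\` B) y (s + t)%R] <=
  lambda (fib (eball r `\` B) y))%E.
Proof.
move=> r0 mB Br; set D := eball r.
have mD : measurable D by exact: measurable_eball.
have Dr : D `<=` eball r by [].
have mS := measurable_steiner mB.
have mfib (A : set V) : measurable A -> measurable (fib A y) by exact: measurable_fib.
have mX : measurable (fib (B `\` D) y) by apply: mfib; exact: measurableD.
have mY : measurable (fib (D `\` B) y) by apply: mfib; exact: measurableD.
have mY' : measurable [set s | fib (D `\` B) y (s + t)].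
  by apply: (@measurable_preimage_mx _ _ _ _ (fun s : R => s + t)) => //; apply: measurable_funD.
have SB := fib_steinerE y Br mB; have SD := fib_steinerE y Dr mD.
rewrite steiner_eball// in SD.
set b := lambda (fib B y) in SB *; set d := lambda (fib D y) in SD *.
have bf : b \is a fin_num by exact: fib_fin Br mB.
have df : d \is a fin_num by exact: fib_fin Dr mD.
have [db|bd] := leP (fine d) (fine b).
  have -> : fib (D `\` steiner B) y = set0.
    apply/seteqP; split => // s [Ds Bs]; apply: Bs.
    have : fib D y s by []. rewrite SD => /= h.
    have : fib (steiner B) y s by rewrite SB/=; apply: lt_le_trans h _.
    by [].
  rewrite measure0 add0e -(lebesgue_shift t mY).
  apply: le_measure; rewrite ?inE//; first exact: measurableI.
  by move=> s [].
have lD (E F : set V) : measurable E -> measurable F -> lambda (fib E y) \is a fin_num ->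
    lambda (fib (E `\` F) y) = (lambda (fib E y) - lambda (fib E y `&` fib F y))%E.
  move=> mE mF Efin; have Eoo : (lambda (fib E y) < +oo)%E by rewrite -ge0_fin_numE.
  rewrite -[LHS]/(lambda (fib E y `\` fib F y)).
  by rewrite measureD; [by []|exact: mfib|exact: mfib|exact: Eoo].
have e1 : lambda (fib (D `\` steiner B) y) = (d - b)%E.
  rewrite lD// (setIidr (_ : fib (steiner B) y `<=` fib D y)).
    by rewrite (len_steiner y Br mB).
  by rewrite SB SD => s /= h; apply: lt_trans h _.
have e2 : lambda (fib (B `\` D) y) = (b - lambda (fib B y `&` fib D y))%E by rewrite lD.
have e3 : lambda (fib (D `\` B) y) = (d - lambda (fib B y `&` fib D y))%E by rewrite lD// setIC.
rewrite e1 e3; apply: (@le_trans _ _ (d - b + lambda (fib (B `\` D) y))%E).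
  rewrite leeD2l//; apply: le_measure; rewrite ?inE//; first exact: measurableI.
  by move=> s [].
rewrite e2 addeA subeK//.
Qed.

Lemma leb_steiner_gain B rho (r : R) t : 0 < r -> measurable B -> B `<=` eball rho ->
  (leb (eball r `\` steiner B) +
    leb [set x : V | (B `\` eball r) x /\ (eball r `\` B) (x + pt t 0)%R]
  <= leb (eball r `\` B))%E.
Proof.
move=> r0 mB Br; set D := eball r.
have mD : measurable D by exact: measurable_eball.
have mS := measurable_steiner mB.
have m1 : measurable (D `\` steiner B) by exact: measurableD.
have m2 : measurable [set x : V | (B `\` D) x /\ (D `\` B) (x + pt t 0)].
  apply: measurableI; first exact: measurableD.
  apply: (@measurable_preimage_mx _ _ _ _ (fun x : V => x + pt t 0)) => //; last exact: measurableD.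
  by apply: cts_measurable_mx; apply: cts_mxD; [exact: cts_id|exact: cst_continuous].
have m3 : measurable (D `\` B) by exact: measurableD.
rewrite !leb_fib// -ge0_integralD//; try exact: measurable_len.
apply: ge0_le_integral => //.
- by move=> y _; rewrite adde_ge0.
- by apply: emeasurable_funD; exact: measurable_len.
- exact: measurable_len.
move=> y _; apply: le_trans (len_steiner_gain t y r0 mB Br); rewrite leeD2l//.
have -> // : fib [set x : V | (B `\` D) x /\ (D `\` B) (x + pt t 0)] y =
  [set s | fib (B `\` D) y s /\ fib (D `\` B) y (s + t)].
by apply/seteqP; split => s /=; rewrite /fib/= ptD addr0.
Qed.

Lemma leb_steiner_mono B rho (r : R) : 0 < r -> measurable B -> B `<=` eball rho ->
  (leb (eball r `\` steiner B) <= leb (eball r `\` B))%E.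
Proof. by move=> r0 mB Br; apply: le_trans (leb_steiner_gain 0 r0 mB Br); rewrite leeDl. Qed.

(** The transpose makes this the image of [A] under [O] when [O] is orthogonal. *)
Definition rot (O : 'M[R]_(1 + k)) A : set V := [set x | A (O^T *m x)].

Lemma orthogonalT n (O : 'M[R]_n) : O^T *m O = 1%:M -> (O^T)^T *m O^T = 1%:M.
Proof. by move=> OO; rewrite trmxK; exact: mulmx1C. Qed.

Lemma measurable_rot O A : measurable A -> measurable (rot O A).
Proof. exact: measurable_linear. Qed.

Lemma leb_rot O A : O^T *m O = 1%:M -> measurable A -> leb (rot O A) = leb A.
Proof. by move=> OO mA; rewrite /rot leb_orthogonal//; exact: orthogonalT. Qed.

Lemma rot_eball O r : O^T *m O = 1%:M -> rot O (eball r) = eball r.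
Proof.
by move=> /orthogonalT OO; apply/funext => x; rewrite /rot /eball/= frob_orthogonal.
Qed.

Lemma rotD O A B : rot O (A `\` B) = rot O A `\` rot O B.
Proof. by []. Qed.

(** The reflection in the hyperplane orthogonal to z - |z| e exchanges z and |z| e; it serves to
    turn an arbitrary direction into the first axis. *)
Lemma householder n (z e : 'cV[R]_n) : inner e e = 1 ->
  exists2 O : 'M[R]_n, O^T *m O = 1%:M & O *m z = frob z *: e.
Proof.
move=> e1; have [->|ze] := eqVneq z (frob z *: e).
  exists 1%:M; first by rewrite trmx1 mulmx1.
  by rewrite mul1mx frobZ ger0_norm ?frob_ge0// /frob e1 sqrtr1 mulr1.
pose w := z - frob z *: e.
have w0 : inner w w != 0.
  by apply: contra_neq ze => /inner_eq0 /eqP; rewrite subr_eq0 => /eqP.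
have ww : w^T *m w = (inner w w)%:M.
  by rewrite [LHS]mx11_scalar /inner /mxtrace big_ord1.
have wz : w^T *m z = (inner w z)%:M.
  by rewrite [LHS]mx11_scalar /inner /mxtrace big_ord1.
pose c := 2 / inner w w.
exists (1%:M - c *: (w *m w^T)).
  have -> : (1%:M - c *: (w *m w^T))^T = 1%:M - c *: (w *m w^T).
    apply/matrixP => i j; rewrite !mxE eq_sym; congr (_ - c * _).
    by rewrite !big_ord1 !mxE mulrC.
  have : (w *m w^T) *m (w *m w^T) = inner w w *: (w *m w^T).
    by rewrite mulmxA -(mulmxA w) ww mul_mx_scalar scalemxAl.
  move: (w *m w^T) => W WW.
  rewrite mulmxBl mul1mx mulmxBr mulmx1 -scalemxAl -scalemxAr WW !scalerA.
  have -> : c * c * inner w w = 2 * c by rewrite /c; field.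
  by apply/matrixP => i j; rewrite !mxE; ring.
rewrite mulmxBl mul1mx -scalemxAl -mulmxA wz mul_mx_scalar scalerA.
have -> : c * inner w z = 1.
  have h : inner w w = 2 * inner w z.
    rewrite /w !(innerBl, innerBr, innerZl, innerZr) e1 (innerC z e).
    by rewrite -(sqr_frob z); ring.
  have : inner w z != 0 by apply: contra_neq w0 => h0; rewrite h h0 mulr0.
  by rewrite /c h => ?; field.
by rewrite scale1r /w opprB addrC subrK.
Qed.

(** Averaging over translations, with D the ball: the integral over z of the volume of the x in A \
    D with x + z in D \ A equals |A \ D| |D \ A| = d^2, and only |z| < 2 rho contributes. Some z
    therefore has overlap at least d^2 / (2 W), and symmetrizing along z gains this overlap by
    [leb_steiner_gain]. *)
Lemma gain_direction A rho (r : R) : 0 < r -> r <= rho -> measurable A -> A `<=` eball rho ->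
  leb A = leb (@eball R (1 + k) 1 r) ->
  let d := fine (leb (eball r `\` A)) in let W := fine (leb (@eball R (1 + k) 1 (2 * rho))) in
  exists2 O : 'M[R]_(1 + k), O^T *m O = 1%:M &
    fine (leb (eball r `\` steiner (rot O A))) <= d - d ^+ 2 / (2 * W).
Proof.
move=> r0 rrho mA Arho AE d W; set D := @eball R (1 + k) 1 r in AE d *.
have mD : measurable D by exact: measurable_eball.
have Drho : D `<=` eball rho by move=> x xr; apply: lt_le_trans xr rrho.
have mX : measurable (A `\` D) by exact: measurableD.
have mY : measurable (D `\` A) by exact: measurableD.
have fins (U : set V) : measurable U -> U `<=` eball rho -> leb U \is a fin_num.
  by move=> mU Ur; rewrite ge0_fin_numE//; exact: leb_sub_lty Ur mU.
have fY : leb (D `\` A) \is a fin_num by apply: fins => // x [/Drho].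
have XY : leb (A `\` D) = leb (D `\` A).
  have e1 : leb (A `\` D) = (leb A - leb (A `&` D))%E.
    by apply: measureD => //; rewrite -ge0_fin_numE ?fins.
  have e2 : leb (D `\` A) = (leb D - leb (D `&` A))%E.
    by apply: measureD => //; rewrite -ge0_fin_numE ?fins.
  by rewrite e1 e2 AE setIC.
have W0 : 0 < W.
  by rewrite fine_gt0// leb_eball_gt0 ?leb_eball_lty// mulr_gt0// (lt_le_trans r0).
have mE : measurable [set zx : V * V | (A `\` D) zx.2 /\ (D `\` A) (zx.2 + zx.1)].
  apply: measurableI; first exact: measurable_prod_snd.
  apply: (@measurable_preimage_mx _ _ _ _ (fun zx : V * V => zx.2 + zx.1)) => //.
  apply: measurable_mx => i j; under eq_fun do rewrite mxE.
  by apply: measurable_funD; apply: (measurableT_comp (measurable_coord i j));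
    [exact: measurable_snd|exact: measurable_fst].
have int : (\int[leb]_z leb [set x : V | (A `\` D) x /\ (D `\` A) (x + z)%R] =
    leb (D `\` A) * leb (A `\` D))%E.
  have /= -> := tonelli_set leb leb mE.
  apply: integral_fun_cst => // x Xx; last first.
    by rewrite -[RHS](@measure0 _ _ _ (@leb R (1 + k) 1)); congr leb; apply/seteqP; split => z // [].
  rewrite -(leb_shift x mY); congr leb; apply/seteqP; split => z /=; first by rewrite addrC => -[].
  by rewrite addrC.
have [z hz] : exists z : V,
    d ^+ 2 / (2 * W) <= fine (leb [set x : V | (A `\` D) x /\ (D `\` A) (x + z)]).
  apply: contrapT => hn.
  have d0 : 0 <= d by exact: fine_ge0.
  have hlt z : fine (leb [set x : V | (A `\` D) x /\ (D `\` A) (x + z)]) < d ^+ 2 / (2 * W).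
    by rewrite ltNge; apply/negP => h; apply: hn; exists z.
  have dpos : 0 < d ^+ 2.
    have h := hlt 0; have {h} := le_lt_trans (fine_ge0 (measure_ge0 _ _)) h.
    by rewrite pmulr_lgt0// invr_gt0 mulr_gt0.
  have mz z : measurable [set x : V | (A `\` D) x /\ (D `\` A) (x + z)].
    apply: measurableI => //.
    apply: (@measurable_preimage_mx _ _ _ _ (fun x : V => x + z)) => //.
    by apply: cts_measurable_mx; apply: cts_mxD; [exact: cts_id|exact: cst_continuous].
  have : (leb (D `\` A) * leb (A `\` D) <= (d ^+ 2 / (2 * W))%:E * leb (@eball R (1 + k) 1 (2 * rho)))%E.
    have mE2 := @measurable_eball R (1 + k) 1 (2 * rho).
    rewrite -int -integral_cst//.
    rewrite (_ : (\int[leb]_z _)%E = (\int[leb]_(z in eball (2 * rho))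
        leb [set x : V | (A `\` D) x /\ (D `\` A) (x + z)%R])%E); last first.
      rewrite [RHS]integral_mkcond; apply: eq_integral => z _; rewrite patchE.
      case: ifPn => //; rewrite notin_setE => zr.
      rewrite -[RHS](@measure0 _ _ _ (@leb R (1 + k) 1)); congr leb.
      apply/seteqP; split => // x [[/Arho xr _] [/Drho xzr _]]; apply: zr.
      by rewrite /eball /= in xr xzr *; have := frobB (x + z) x; rewrite addrC addKr; lra.
    apply: ge0_le_integral => //.
      by apply: measurable_funTS; exact: (measurable_section leb mE).
    move=> z zr; rewrite -[leLHS]fineK ?lee_fin ?ltW//.
    by apply: fins => // x [[/Arho]].
  rewrite XY -(fineK fY) -/d -(fineK (_ : leb (@eball R (1 + k) 1 (2 * rho)) \is a fin_num)); last first.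
    by rewrite ge0_fin_numE// leb_eball_lty.
  (* The factor 2 in [2 * W] turns the failure of every z into d^2 <= d^2 / 2. *)
  rewrite -/W -!EFinM lee_fin -expr2.
  have -> : d ^+ 2 / (2 * W) * W = d ^+ 2 / 2 by field; rewrite gt_eqF.
  lra.
have e1 : inner (pt 1 (0 : 'cV[R]_k)) (pt 1 0) = 1.
  by rewrite -sqr_frob sqr_frob_pt frob0 expr0n/= addr0 expr1n.
case: (householder z e1) => O OO Oz; exists O => //.
have Or : rot O A `<=` eball rho by rewrite -(rot_eball rho OO) => x; apply: Arho.
have := leb_steiner_gain (frob z) r0 (measurable_rot O mA) Or.
have rD : rot O D = D by exact: rot_eball.
have rDx x : D x = D (O^T *m x) by rewrite -{1}rD.
rewrite -/D.
have -> : leb (D `\` rot O A) = leb (D `\` A) by rewrite -{1}rD -rotD leb_rot.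
have -> : leb [set x : V | (rot O A `\` D) x /\ (D `\` rot O A) (x + pt (frob z) 0)] =
    leb [set x : V | (A `\` D) x /\ (D `\` A) (x + z)].
  have mz : measurable [set x : V | (A `\` D) x /\ (D `\` A) (x + z)].
    apply: measurableI => //.
    apply: (@measurable_preimage_mx _ _ _ _ (fun x : V => x + z)) => //.
    by apply: cts_measurable_mx; apply: cts_mxD; [exact: cts_id|exact: cst_continuous].
  rewrite -[RHS](leb_rot OO)//; congr leb; apply/funext => x.
  (* [O] carries z to the first axis, so the overlap of [A] for the shift z is that of [rot O A] for
     a shift along the symmetrization direction. *)
  have -> : pt (frob z) 0 = O *m z.
    by rewrite Oz /pt scale_col_mx scaler0 scale_scalar_mx mulr1.
  by rewrite /rot /mkset /setD /= (rDx x) (rDx (x + O *m z)) mulmxDr mulmxA OO mul1mx.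
have m1 : measurable (D `\` steiner (rot O A)).
  by apply: measurableD => //; apply: measurable_steiner; exact: measurable_rot.
have f1 : leb (D `\` steiner (rot O A)) \is a fin_num by apply: fins => // x [/Drho].
have f2 : leb [set x : V | (A `\` D) x /\ (D `\` A) (x + z)] \is a fin_num.
  apply: fins => [|x [[/Arho]]//].
  apply: measurableI => //.
  apply: (@measurable_preimage_mx _ _ _ _ (fun x : V => x + z)) => //.
  by apply: cts_measurable_mx; apply: cts_mxD; [exact: cts_id|exact: cst_continuous].
rewrite -(fineK f1) -(fineK f2) -(fineK fY) -EFinD lee_fin -/d.
lra.
Qed.

(** The head of the list acts last, so [O :: Os] is one further step after [Os]. *)
Definition symmetrize (Os : seq 'M[R]_(1 + k)) A : set V :=
  foldr (fun O B => steiner (rot O B)) A Os.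

Definition orthogonals (Os : seq 'M[R]_(1 + k)) := forall O, O \in Os -> O^T *m O = 1%:M.

Lemma orthogonals_cons O Os : orthogonals (O :: Os) <-> O^T *m O = 1%:M /\ orthogonals Os.
Proof.
split=> [h|[h1 h2] P]; first by split => [|P PO]; apply: h; rewrite inE ?eqxx// PO orbT.
by rewrite inE => /orP[/eqP->|/h2].
Qed.

Lemma measurable_symmetrize Os A : measurable A -> measurable (symmetrize Os A).
Proof.
by move=> mA; elim: Os => //= O Os IH; apply: measurable_steiner; exact: measurable_rot.
Qed.

Lemma symmetrize_sub_eball Os A (rho : R) : orthogonals Os -> 0 < rho -> measurable A ->
  A `<=` eball rho -> symmetrize Os A `<=` eball rho.
Proof.
move=> + r0 mA Ar; elim: Os => //= O Os IH /orthogonals_cons[OO /IH {}IH].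
apply: steiner_sub_eball => //; first by apply: measurable_rot; exact: measurable_symmetrize.
by rewrite -(rot_eball rho OO) => x; exact: IH.
Qed.

Lemma leb_symmetrize Os A (rho : R) : orthogonals Os -> 0 < rho -> measurable A ->
  A `<=` eball rho -> leb (symmetrize Os A) = leb A.
Proof.
move=> + r0 mA Ar; elim: Os => //= O Os IH /orthogonals_cons[OO hOs].
have mS := measurable_symmetrize Os mA.
rewrite (@leb_steiner _ _ _ rho) ?leb_rot ?IH//; last exact: measurable_rot.
by rewrite -(rot_eball rho OO) => x; exact: (symmetrize_sub_eball hOs r0 mA Ar).
Qed.

Lemma symmetrize_sum Os A B C (rho : R) : orthogonals Os -> 0 < rho ->
  measurable A -> measurable B -> measurable C -> A `<=` eball rho -> B `<=` eball rho ->
  (forall x y : V, A x -> B y -> C (x + y)) ->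
  forall x y : V, symmetrize Os A x -> symmetrize Os B y -> symmetrize Os C (x + y).
Proof.
move=> + r0 mA mB mC Ar Br ABC; elim: Os => //= O Os IH /orthogonals_cons[OO hOs].
apply: (@steiner_sum _ _ _ _ _ rho); try by apply: measurable_rot; exact: measurable_symmetrize.
- by rewrite -(rot_eball rho OO) => x; exact: (symmetrize_sub_eball hOs r0 mA Ar).
- by rewrite -(rot_eball rho OO) => x; exact: (symmetrize_sub_eball hOs r0 mB Br).
by move=> x y; rewrite /rot/= mulmxDr; exact: IH.
Qed.

Lemma open_symmetrize Os A (rho : R) : orthogonals Os -> 0 < rho -> A `<=` eball rho ->
  open A -> open (symmetrize Os A).
Proof.
move=> + r0 Ar oA; have mA := open_measurable_mx oA.
elim: Os => //= O Os IH /orthogonals_cons[OO hOs].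
apply: (@open_steiner _ _ _ rho).
  by rewrite -(rot_eball rho OO) => x; exact: (symmetrize_sub_eball hOs r0 mA Ar).
apply: (@open_comp _ _ (fun x : V => O^T *m x)); last exact: IH.
by move=> x _; apply: cts_mulmx; [exact: cst_continuous|exact: cts_id].
Qed.

End steiner_gain.

Section brunn_minkowski.
Context {R : realType} {k : nat}.
Notation V := 'cV[R]_(1 + k).
Implicit Types (A B C : set V).

Definition defect A (a : R) Os : R := fine (leb (eball a `\` symmetrize Os A)).

Lemma defect_fin A (a : R) Os : measurable A ->
  leb (eball a `\` symmetrize Os A) \is a fin_num.
Proof.
move=> mA; rewrite ge0_fin_numE//; apply: (@leb_sub_lty _ _ _ a); first by move=> x [].
by apply: measurableD; [exact: measurable_eball|exact: measurable_symmetrize].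
Qed.

Lemma defect_cons_le A (a rho : R) O Os : orthogonals (O :: Os) -> 0 < a -> 0 < rho ->
  measurable A -> A `<=` eball rho -> defect A a (O :: Os) <= defect A a Os.
Proof.
move=> /orthogonals_cons[OO hOs] a0 rho0 mA Ar.
have mS := measurable_symmetrize Os mA; have Sr := symmetrize_sub_eball hOs rho0 mA Ar.
have mD := @measurable_eball R (1 + k) 1 a.
apply: fine_le; [exact: (defect_fin _ (O :: Os))|exact: defect_fin|].
rewrite [X in (_ <= X)%E](_ : _ = leb (eball a `\` rot O (symmetrize Os A))).
  apply: (@leb_steiner_mono _ _ _ rho) => //; first exact: measurable_rot.
  by rewrite -(rot_eball rho OO) => x; exact: Sr.
by rewrite -[in RHS](rot_eball a OO) -rotD leb_rot//; exact: measurableD.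
Qed.

Lemma defect_cons_gain A (a rho : R) Os : orthogonals Os -> 0 < a -> a <= rho ->
  measurable A -> A `<=` eball rho -> leb A = leb (@eball R (1 + k) 1 a) ->
  exists2 O : 'M[R]_(1 + k), O^T *m O = 1%:M & defect A a (O :: Os) <=
    defect A a Os - defect A a Os ^+ 2 / (2 * fine (leb (@eball R (1 + k) 1 (2 * rho)))).
Proof.
move=> hOs a0 arho mA Ar AE; have rho0 : 0 < rho by exact: lt_le_trans arho.
apply: (@gain_direction _ _ _ rho a) => //.
- exact: measurable_symmetrize.
- exact: symmetrize_sub_eball.
- by rewrite (leb_symmetrize hOs rho0 mA Ar).
Qed.

(** No sequence of directions is constructed. If the infimum over all finite sequences of the sum of
    both defects were at least [eps], a nearly optimal sequence would leave one defect at least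
    [eps / 2]; one more step lowers it by [del] without raising the other, and the sum falls below
    the infimum. Both sets get the same sequence, as [symmetrize_sum] requires. *)
Lemma symmetrize_to_balls A B (a b rho eps : R) : 0 < a -> a <= rho -> 0 < b -> b <= rho ->
  measurable A -> A `<=` eball rho -> leb A = leb (@eball R (1 + k) 1 a) ->
  measurable B -> B `<=` eball rho -> leb B = leb (@eball R (1 + k) 1 b) -> 0 < eps ->
  exists Os, [/\ orthogonals Os, defect A a Os < eps & defect B b Os < eps].
Proof.
move=> a0 arho b0 brho mA Ar AE mB Br BE eps0.
have rho0 : 0 < rho by exact: lt_le_trans arho.
pose W := fine (leb (@eball R (1 + k) 1 (2 * rho))).
have W0 : 0 < W by rewrite fine_gt0// leb_eball_gt0 ?leb_eball_lty// mulr_gt0.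
have def0 X x Os : 0 <= defect X x Os by exact: fine_ge0.
pose phi Os := defect A a Os + defect B b Os.
pose S := [set phi Os | Os in @orthogonals R k].
have infS : has_inf S.
  split; first by exists (phi [::]); exists [::].
  by exists 0 => _ [Os _ <-]; rewrite addr_ge0.
have [phi_eps|eps_phi] := ltP (inf S) eps.
  have e0 : 0 < eps - inf S by rewrite subr_gt0.
  have [_ [Os hOs <-] h] := inf_adherent e0 infS; exists Os; split => //.
    by rewrite /phi in h; have := def0 B b Os; lra.
  by rewrite /phi in h; have := def0 A a Os; lra.
pose del := (eps / 2) ^+ 2 / (2 * W).
have del0 : 0 < del by rewrite divr_gt0 ?mulr_gt0// exprn_gt0// divr_gt0.
have [_ [Os hOs <-] h] := inf_adherent del0 infS.
have inf_le Os' : orthogonals Os' -> inf S <= phi Os'.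
  by move=> h'; apply: ge_inf; [case: infS|exists Os'].
have gain x : eps / 2 <= x -> del <= x ^+ 2 / (2 * W).
  move=> hx; rewrite ler_pM2r ?invr_gt0 ?mulr_gt0//.
  by rewrite ler_pXn2r ?nnegrE// ?divr_ge0 ?ltW// (lt_le_trans _ hx)// divr_gt0.
have le_phi := inf_le _ hOs; exfalso.
have [hA|hA] := leP (eps / 2) (defect A a Os).
  have [ O OO hO] := defect_cons_gain hOs a0 arho mA Ar AE.
  have hOs' : orthogonals (O :: Os) by apply/orthogonals_cons.
  have := defect_cons_le hOs' b0 rho0 mB Br; have := inf_le _ hOs'; have := gain _ hA.
  by rewrite /phi in h *; rewrite -/W in hO; lra.
have hB : eps / 2 <= defect B b Os by rewrite /phi in le_phi; lra.
have [ O OO hO] := defect_cons_gain hOs b0 brho mB Br BE.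
have hOs' : orthogonals (O :: Os) by apply/orthogonals_cons.
have := defect_cons_le hOs' a0 rho0 mA Ar; have := inf_le _ hOs'; have := gain _ hB.
by rewrite /phi in h *; rewrite -/W in hO; lra.
Qed.

Lemma exists_avoiding (U X Y : set V) : measurable U -> measurable X -> measurable Y ->
  (leb X + leb Y < leb U)%E -> exists v, [/\ U v, ~ X v & ~ Y v].
Proof.
move=> mU mX mY h; apply: contrapT => hn; move: h; apply/negP; rewrite -leNgt.
apply: (@le_trans _ _ (leb (X `|` Y))); last exact: measureU2.
apply: le_measure; rewrite ?inE//; first exact: measurableU.
move=> v Uv; apply: contrapT => nv; apply: hn; exists v.
by split => // ?; apply: nv; [left|right].
Qed.

(** After a common symmetrization the two sets nearly fill the balls of radii [a] and [b]. A point x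
    with |x| < s is split in the ratio a : b, and the two parts are moved by opposite vectors from a
    small ball; the vectors for which a part misses its set have too small a measure to exhaust that
    ball. *)
Theorem brunn_minkowski A B C (a b rho s : R) : 0 < a -> 0 < b ->
  measurable A -> measurable B -> measurable C ->
  A `<=` eball rho -> B `<=` eball rho -> C `<=` eball rho ->
  leb A = leb (@eball R (1 + k) 1 a) -> leb B = leb (@eball R (1 + k) 1 b) ->
  (forall x y : V, A x -> B y -> C (x + y)) -> s < a + b ->
  (leb (@eball R (1 + k) 1 s) <= leb C)%E.
Proof.
move=> a0 b0 mA mB mC Ar Br Cr AE BE ABC sab.
have [s0|s0] := leP s 0.
  have -> : eball s = set0 :> set V.
    by apply/seteqP; split => // x; rewrite /eball/= => h; have := frob_ge0 x; lra.
  by rewrite measure0.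
pose rho' := Num.max rho (Num.max a b).
have rr : rho <= rho' by rewrite le_max lexx.
have arho : a <= rho' by rewrite !le_max lexx !orbT.
have brho : b <= rho' by rewrite !le_max lexx !orbT.
have rho0 : 0 < rho' by exact: lt_le_trans arho.
have sub (X : set V) : X `<=` eball rho -> X `<=` eball rho'.
  by move=> h x /h; rewrite /eball/= => /lt_le_trans; apply.
have ab0 : 0 < a + b by rewrite addr_gt0.
(* [e] is the relative room between s and a + b; a shift by less than [del], which is at most both a
   e and b e, keeps the two parts inside their balls. *)
pose e := 1 - s / (a + b).
have e0 : 0 < e by rewrite subr_gt0 ltr_pdivrMr// mul1r.
have se : s = (1 - e) * (a + b) by rewrite /e; field; rewrite gt_eqF.
pose del := Num.min a b * e.
have del0 : 0 < del by rewrite mulr_gt0// lt_min a0.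
have dela : del <= a * e by rewrite ler_pM2r// ge_min lexx.
have delb : del <= b * e by rewrite ler_pM2r// ge_min lexx orbT.
pose U : set V := eball del; have mU : measurable U by exact: measurable_eball.
have Uf : leb U \is a fin_num by rewrite ge0_fin_numE ?leb_eball_lty.
pose eta := fine (leb U) / 2.
have eta0 : 0 < eta by rewrite divr_gt0// fine_gt0// leb_eball_gt0//= leb_eball_lty.
have [Os [hOs hA hB]] := symmetrize_to_balls a0 arho b0 brho mA (sub _ Ar) AE mB (sub _ Br) BE eta0.
rewrite -(leb_symmetrize hOs rho0 mC (sub _ Cr)).
have mSA := measurable_symmetrize Os mA; have mSB := measurable_symmetrize Os mB.
apply: le_measure; rewrite ?inE; [exact: measurable_eball|exact: measurable_symmetrize|].
move=> x xs; rewrite /eball/= in xs.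
pose x1 := (a / (a + b)) *: x; pose x2 := (b / (a + b)) *: x.
have x12 : x1 + x2 = x.
  by rewrite -scalerDl -mulrDl divff ?scale1r// gt_eqF.
have hx1 : frob x1 < a * (1 - e).
  rewrite frobZ ger0_norm ?divr_ge0 ?ltW//.
  have -> : a * (1 - e) = a / (a + b) * s by rewrite se; field; rewrite gt_eqF.
  by rewrite ltr_pM2l// divr_gt0.
have hx2 : frob x2 < b * (1 - e).
  rewrite frobZ ger0_norm ?divr_ge0 ?ltW//.
  have -> : b * (1 - e) = b / (a + b) * s by rewrite se; field; rewrite gt_eqF.
  by rewrite ltr_pM2l// divr_gt0.
pose X := eball a `\` symmetrize Os A; pose Y := eball b `\` symmetrize Os B.
have mX : measurable X by apply: measurableD => //; exact: measurable_eball.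
have mY : measurable Y by apply: measurableD => //; exact: measurable_eball.
have mX' : measurable [set v | X (v + x1)].
  apply: (@measurable_preimage_mx _ _ _ _ (fun v : V => v + x1)) => //.
  by apply: cts_measurable_mx; apply: cts_mxD; [exact: cts_id|exact: cst_continuous].
have mY' : measurable [set v | Y (v + x2)].
  apply: (@measurable_preimage_mx _ _ _ _ (fun v : V => v + x2)) => //.
  by apply: cts_measurable_mx; apply: cts_mxD; [exact: cts_id|exact: cst_continuous].
have mY'' : measurable [set v | Y (- v + x2)].
  apply: (@measurable_preimage_mx _ _ _ _ (fun v : V => - v) [set v | Y (v + x2)]) => //.
  by apply: cts_measurable_mx; apply: cts_mxN; exact: cts_id.
have [v [Uv Xv Yv]] : exists v, [/\ U v, ~ X (v + x1) & ~ Y (- v + x2)].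
  apply: (@exists_avoiding U [set v | X (v + x1)] [set v | Y (- v + x2)]) => //.
  rewrite (leb_shift x1 mX) (leb_opp mY') (leb_shift x2 mY) -(fineK Uf).
  rewrite -(fineK (defect_fin a Os mA)) -(fineK (defect_fin b Os mB)) -EFinD lte_fin.
  by rewrite /defect /eta in hA hB; lra.
have -> : x = (v + x1) + (- v + x2) by rewrite addrACA subrr add0r x12.
have Av : symmetrize Os A (v + x1).
  apply: contrapT => nA; apply: Xv; split => //.
  rewrite /eball/=; apply: le_lt_trans (frobD _ _) _; rewrite /U /eball/= in Uv.
  have h : a * (1 - e) = a - a * e by ring.
  by move: dela hx1 Uv; rewrite h; clearbody del e x1; lra.
have Bv : symmetrize Os B (- v + x2).
  apply: contrapT => nB; apply: Yv; split => //.
  rewrite /eball/=; apply: le_lt_trans (frobD _ _) _; rewrite /U /eball/= in Uv.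
  have h : b * (1 - e) = b - b * e by ring.
  by move: delb hx2 Uv; rewrite frobN h; clearbody del e x2; lra.
exact: (symmetrize_sum hOs rho0 mA mB mC (sub _ Ar) (sub _ Br) ABC).
Qed.

End brunn_minkowski.

Lemma cts_pair (T T1 T2 : topologicalType) (f : T -> T1) (g : T -> T2) :
  continuous f -> continuous g -> continuous (fun t => (f t, g t)).
Proof. by move=> cf cg t; exact: (cvg_pair (cf t) (cg t)). Qed.

(** * The centroid functional under symmetrization *)

Section convexity_scaling.
Context {R : realType}.
Notation lambda := (@lebesgue_measure R).

Lemma leb_leD_fib k (A B C D : set 'cV[R]_(1 + k)) :
  measurable A -> measurable B -> measurable C -> measurable D ->
  (forall y, lambda (fib A y) + lambda (fib B y) <= lambda (fib C y) + lambda (fib D y))%E ->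
  (leb A + leb B <= leb C + leb D)%E.
Proof.
move=> mA mB mC mD h; rewrite (leb_fib mA) (leb_fib mB) (leb_fib mC) (leb_fib mD).
rewrite -ge0_integralD//; try exact: measurable_len.
rewrite -ge0_integralD//; try exact: measurable_len.
apply: ge0_le_integral => //.
- by move=> x _; rewrite adde_ge0.
- by apply: emeasurable_funD; exact: measurable_len.
- by apply: emeasurable_funD; exact: measurable_len.
Qed.

Lemma measurable_slice_len a b c (A : set 'M[R]_(a + b, c)) : measurable A ->
  measurable_fun setT (fun x : 'M[R]_(a, c) => leb [set y | A (col_mx x y)]).
Proof.
move=> mA.
have mB : measurable [set xy : 'M[R]_(a, c) * 'M[R]_(b, c) | A (col_mx xy.1 xy.2)].
  by apply: (measurable_preimage_mx (@measurable_col_mx R a b c)).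
exact: (measurable_section leb mB).
Qed.

Lemma leb_leD_slice a b c (A B C D : set 'M[R]_(a + b, c)) :
  measurable A -> measurable B -> measurable C -> measurable D ->
  (forall x, leb [set y | A (col_mx x y)] + leb [set y | B (col_mx x y)] <=
             leb [set y | C (col_mx x y)] + leb [set y | D (col_mx x y)])%E ->
  (leb A + leb B <= leb C + leb D)%E.
Proof.
move=> mA mB mC mD h; rewrite (leb_col_mx mA) (leb_col_mx mB) (leb_col_mx mC) (leb_col_mx mD).
rewrite -ge0_integralD//; try exact: measurable_slice_len.
rewrite -ge0_integralD//; try exact: measurable_slice_len.
apply: ge0_le_integral => //.
- by move=> x _; rewrite adde_ge0.
- by apply: emeasurable_funD; exact: measurable_slice_len.
- by apply: emeasurable_funD; exact: measurable_slice_len.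
Qed.

Lemma frob_mulmx n m q (A : 'M[R]_(n, m)) (B : 'M[R]_(m, q)) :
  frob (A *m B) <= frob A * frob B.
Proof.
rewrite -(@ler_pXn2r _ 2)// ?nnegrE ?mulr_ge0 ?frob_ge0//.
rewrite exprMn !sqr_frob.
have rowE : inner A A = \sum_i inner (row i A) (row i A).
  rewrite innerE exchange_big; apply: eq_bigr => i _; rewrite innerE.
  by apply: eq_bigr => j _; rewrite big_ord1 !mxE.
have colE : inner B B = \sum_j inner (col j B)^T (col j B)^T.
  rewrite innerE; apply: eq_bigr => j _; rewrite innerE.
  by apply: eq_bigr => i _; rewrite big_ord1 !mxE.
have entry i j : (A *m B) i j = inner (row i A) (col j B)^T.
  by rewrite innerE mxE; apply: eq_bigr => l _; rewrite big_ord1 !mxE.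
rewrite innerE rowE colE exchange_big mulr_suml; apply: ler_sum => i _.
rewrite mulr_sumr; apply: ler_sum => j _; rewrite entry -expr2.
rewrite -(real_normK (num_real (inner _ _))) -!sqr_frob -exprMn.
rewrite ler_pXn2r ?nnegrE ?mulr_ge0 ?frob_ge0// ler_norml inner_le_frob andbT.
by rewrite -lerNl -innerNl; apply: le_trans (inner_le_frob _ _) _; rewrite frobN.
Qed.

Lemma leb_eball n m (r : R) : 0 < r ->
  leb (@eball R n m r) = ((r ^+ (n * m))%:E * leb (@eball R n m 1))%E.
Proof.
move=> r0; rewrite (leb_scale r0)//; last exact: measurable_eball.
congr (_ * leb _)%E; apply/funext => x; rewrite /eball/= frobZ gtr0_norm//.
by rewrite -[X in _ < X]mulr1 ltr_pM2l.
Qed.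

Lemma lebesgue_scale (X : set R) a : 0 < a -> measurable X ->
  lambda [set s | X (a^-1 * s)] = (a%:E * lambda X)%E.
Proof.
move=> a0 mX; have ai0 : 0 < a^-1 by rewrite invr_gt0.
have mZ : measurable [set s : 'M[R]_1 | X (s 0 0)].
  by apply: (measurable_preimage_mx (measurable_coord 0 0)).
have mZ' : measurable [set s : 'M[R]_1 | X ((a^-1 *: s) 0 0)].
  apply: (@measurable_preimage_mx _ _ _ _ (fun s : 'M[R]_1 => a^-1 *: s) [set s | X (s 0 0)]) => //.
  by apply: cts_measurable_mx; apply: cts_mxZ; [exact: cst_continuous|exact: cts_id].
have := leb_scale ai0 mZ; rewrite !leb_11//= muln1 expr1.
have -> : [set t | X ((t%:M : 'M[R]_1) 0 0)] = X by apply/funext => t /=; rewrite mxE eqxx.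
have -> : [set t | X ((a^-1 *: (t%:M : 'M[R]_1)) 0 0)] = [set s | X (a^-1 * s)].
  by apply/funext => t /=; rewrite !mxE eqxx.
by move=> ->; rewrite muleA -EFinM mulfV ?gt_eqF// mul1e.
Qed.

Lemma le_lebesgue_width (X : set R) (a b : R) : measurable X -> a <= b ->
  (forall s, X s -> a <= s <= b) -> (lambda X <= (b - a)%:E)%E.
Proof.
move=> mX ab h; apply: (@le_trans _ _ (lambda `[a, b]%classic)).
  by apply: le_measure; rewrite ?inE// => s /h; rewrite /= in_itv.
rewrite [X in (X <= _)%E]lebesgue_measure_itv/= lte_fin; case: ltP => _; first by rewrite -EFinB.
by rewrite lee_fin subr_ge0.
Qed.

Lemma ge_lebesgue_width (I : set R) (a b : R) : measurable I ->
  (forall s, a < s < b -> I s) -> ((b - a)%:E <= lambda I)%E.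
Proof.
move=> mI h; have [ab|ab] := ltP a b; last first.
  by apply: (@le_trans _ _ 0%E); [rewrite lee_fin subr_le0|].
apply: (@le_trans _ _ (lambda `]a, b[%classic)).
  by rewrite [X in (_ <= X)%E]lebesgue_measure_itv/= lte_fin ab -EFinB.
by apply: le_measure; rewrite ?inE// => s; rewrite /= in_itv/=; exact: h.
Qed.

Definition mconvex {n m} (G : set 'M[R]_(n, m)) := forall x y (t : R), G x -> G y ->
  0 <= t <= 1 -> G (t *: x + (1 - t) *: y).

(** Empty for z <= 0, so that a slice of a cone at a nonpositive height is empty. *)
Definition dil {n m} (z : R) (G : set 'M[R]_(n, m)) : set 'M[R]_(n, m) :=
  [set x | 0 < z /\ G (z^-1 *: x)].

(** Convexity of the cone over [G], read on slices: [l] is the weight of the first point once the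
    combination is rescaled to height 1. *)
Lemma dil_convex n m (G : set 'M[R]_(n, m)) (a b : R) x y (t : R) : mconvex G ->
  dil a G x -> dil b G y -> 0 <= t <= 1 ->
  dil (t * a + (1 - t) * b) G (t *: x + (1 - t) *: y).
Proof.
move=> cG [a0 Gx] [b0 Gy] /andP[t0 t1].
have t1' : 0 <= 1 - t by rewrite subr_ge0.
set c := t * a + (1 - t) * b.
have c0 : 0 < c.
  rewrite /c; have [->|tn0] := eqVneq t 0; first by nra.
  have tp : 0 < t by rewrite lt_neqAle eq_sym tn0.
  by have := mulr_gt0 tp a0; have := mulr_ge0 t1' (ltW b0); lra.
split => //; pose l := t * a / c.
have -> : c^-1 *: (t *: x + (1 - t) *: y) = l *: (a^-1 *: x) + (1 - l) *: (b^-1 *: y).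
  rewrite scalerDr !scalerA; congr (_ *: _ + _ *: _).
    by rewrite /l; field; rewrite !gt_eqF.
  have -> : 1 - l = (1 - t) * b / c by rewrite /l /c; field; rewrite -/c gt_eqF.
  by field; rewrite !gt_eqF.
apply: cG => //; apply/andP; split; first by rewrite divr_ge0 ?mulr_ge0// ltW.
by rewrite ler_pdivrMr// mul1r /c lerDl mulr_ge0// ltW.
Qed.

Lemma open_dil n m (G : set 'M[R]_(n, m)) : open G ->
  open [set ax : R * 'M[R]_(n, m) | dil ax.1 G ax.2].
Proof.
move=> oG; rewrite openE => -[a x] [a0 Gx].
have c : ((fun ax : R * 'M[R]_(n, m) => ax.1^-1 *: ax.2) bx @[bx --> (a, x)]) --> a^-1 *: x.
  apply: cvgZ; last exact: cvg_snd.
  by apply: cvgV; [rewrite gt_eqF|exact: cvg_fst].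
have n1 : \forall bx \near (a, x), G (bx.1^-1 *: bx.2).
  by apply: c; exact: open_nbhs_nbhs.
have n2 : \forall bx \near (a, x), 0 < (bx.1 : R).
  have h : nbhs a [set b | 0 < b] by apply: open_nbhs_nbhs; split=> //; exact: open_gt.
  by have := @cvg_fst _ _ (nbhs a) (nbhs x) _ _ h; exact.
by apply: filterS2 n1 n2 => bx h1 h2; split.
Qed.

Lemma measurable_dil n m (G : set 'M[R]_(n, m)) z : measurable G -> measurable (dil z G).
Proof.
move=> mG; have [z0|z0] := ltP 0 z; last first.
  rewrite (_ : dil z G = set0)//; apply/seteqP; split => // x [z1 _]; lra.
rewrite (_ : dil z G = [set x | G (z^-1 *: x)]); last first.
  by apply/seteqP; split => x //= [].
apply: (@measurable_preimage_mx _ _ _ _ (fun x : 'M[R]_(n, m) => z^-1 *: x)) => //.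
by apply: cts_measurable_mx; apply: cts_mxZ; [exact: cst_continuous|exact: cts_id].
Qed.

Lemma leb_dil n m (G : set 'M[R]_(n, m)) z : 0 < z -> measurable G ->
  leb (dil z G) = ((z ^+ (n * m))%:E * leb G)%E.
Proof.
move=> z0 mG; rewrite (leb_scale z0); last exact: measurable_dil.
congr (_ * leb _)%E; apply/seteqP; split => x; rewrite /dil/= scalerA mulVf ?gt_eqF// scale1r.
  by case.
by move=> Gx; split.
Qed.

Context {k : nat}.
Notation V := 'cV[R]_(1 + k).

Lemma ptZ a s (y : 'cV[R]_k) : a *: pt s y = pt (a * s) (a *: y).
Proof. by rewrite /pt scale_col_mx scale_scalar_mx. Qed.

Lemma fib_dil z (G : set V) y : 0 < z ->
  fib (dil z G) y = [set s | fib G (z^-1 *: y) (z^-1 * s)].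
Proof.
move=> z0; apply/seteqP; split => s; rewrite /fib /dil/= ptZ; first by case.
by move=> h; split.
Qed.

Lemma steiner_dil z (G : set V) : 0 < z -> measurable G -> steiner (dil z G) = dil z (steiner G).
Proof.
move=> z0 mG; apply/funext => x; rewrite -(ptE x).
set s := usubmx x 0 0; set y := dsubmx x.
rewrite steiner_pt fib_dil// lebesgue_scale//; last exact: measurable_fib.
rewrite /dil/= ptZ steiner_pt normrM gtr0_norm ?invr_gt0//.
have -> : 2 * `|s| = z * (2 * (z^-1 * `|s|)) by field; rewrite gt_eqF.
by rewrite EFinM lte_pmul2l//; apply/propext; split => [//|[]//].
Qed.

(** Convexity says that the dilates of [G] by t and 1 - t have their sum inside [G]; [steiner_sum]
    preserves this, and symmetrization commutes with dilation. *)
Lemma steiner_convex (G : set V) rho : measurable G -> G `<=` eball rho -> mconvex G ->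
  mconvex (steiner G).
Proof.
move=> mG Gr cG x y t Sx Sy /andP[t0 t1].
have [->|tn0] := eqVneq t 0; first by rewrite scale0r add0r subr0 scale1r.
have [->|tn1] := eqVneq t 1; first by rewrite subrr scale0r addr0 scale1r.
have tp : 0 < t by rewrite lt_neqAle eq_sym tn0.
have tp' : 0 < 1 - t by rewrite subr_gt0 lt_neqAle tn1.
have sub a : 0 < a -> a <= 1 -> dil a G `<=` eball rho.
  move=> a0 a1 v [_ /Gr]; rewrite /eball/= => hv.
  have r0 := le_lt_trans (frob_ge0 _) hv; move: hv.
  rewrite frobZ gtr0_norm ?invr_gt0// mulrC ltr_pdivrMr// => /lt_le_trans; apply.
  by rewrite -[leRHS]mulr1 ler_wpM2l// ltW.
apply: (@steiner_sum _ _ (dil t G) (dil (1 - t) G) G rho) => //; try exact: measurable_dil.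
- exact: sub.
- by apply: sub => //; lra.
- move=> v w [_ Gv] [_ Gw]; have := cG _ _ t Gv Gw; rewrite !scalerA !mulfV ?gt_eqF// !scale1r.
  by apply; apply/andP.
- by rewrite steiner_dil//; split => //; rewrite scalerA mulVf ?gt_eqF// scale1r.
- by rewrite steiner_dil//; split => //; rewrite scalerA mulVf ?gt_eqF// scale1r.
Qed.

Lemma symmetrize_convex Os (G : set V) (rho : R) : orthogonals Os -> 0 < rho -> measurable G ->
  G `<=` eball rho -> mconvex G -> mconvex (symmetrize Os G).
Proof.
move=> + r0 mG Gr cG; elim: Os => //= O Os IH /orthogonals_cons[OO hOs].
apply: (@steiner_convex _ rho).
- by apply: measurable_rot; exact: measurable_symmetrize.
- by rewrite -(rot_eball rho OO) => x; exact: (symmetrize_sub_eball hOs r0 mG Gr).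
by move=> x y t hx hy ht; rewrite /rot/= mulmxDr -!scalemxAr; exact: IH.
Qed.

(** For |x| < r' the points v + x and - v + x with |v| < r - r' stay in the larger ball. The part of
    that ball missed by [G] is too small to meet every such pair, so for some v both points lie in
    [G], and x is their midpoint. *)
Lemma convex_near_ball (G : set V) (r r' : R) : measurable G -> mconvex G -> r' < r ->
  (2%:E * leb (eball r `\` G) < leb (@eball R (1 + k) 1 (r - r')))%E -> eball r' `<=` G.
Proof.
move=> mG cG rr' h x xr'; pose X := eball r `\` G.
have mX : measurable X by apply: measurableD => //; exact: measurable_eball.
have mX1 : measurable [set v | X (v + x)].
  apply: (@measurable_preimage_mx _ _ _ _ (fun v : V => v + x)) => //.
  by apply: cts_measurable_mx; apply: cts_mxD; [exact: cts_id|exact: cst_continuous].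
have mX2 : measurable [set v | X (- v + x)].
  apply: (@measurable_preimage_mx _ _ _ _ (fun v : V => - v) [set v | X (v + x)]) => //.
  by apply: cts_measurable_mx; apply: cts_mxN; exact: cts_id.
have [v [vr X1 X2]] : exists v, [/\ eball (r - r') v, ~ X (v + x) & ~ X (- v + x)].
  apply: (@exists_avoiding _ _ _ [set v | X (v + x)] [set v | X (- v + x)]) => //.
    exact: measurable_eball.
  by rewrite (leb_shift x mX) (leb_opp mX1) (leb_shift x mX) -mule2n -mule_natl.
rewrite /eball/= in vr xr'.
have inr w : frob w = frob v -> eball r (w + x).
  by move=> hw; rewrite /eball/=; apply: le_lt_trans (frobD _ _) _; rewrite hw; lra.
have G1 : G (v + x) by apply: contrapT => n1; apply: X1; split => //; exact: inr.
have G2 : G (- v + x) by apply: contrapT => n1; apply: X2; split => //; apply: inr; exact: frobN.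
have := cG _ _ (1 / 2) G1 G2; rewrite (_ : 1 - 1 / 2 = 1 / 2); last by lra.
have -> : (1 / 2) *: (v + x) + (1 / 2) *: (- v + x) = x.
  by apply/matrixP => i j; rewrite !mxE; lra.
by apply; lra.
Qed.

Lemma exists_radius (v : R) : 0 < v -> exists2 r : R, 0 < r & leb (@eball R (1 + k) 1 r) = v%:E.
Proof.
move=> v0; pose w := fine (leb (@eball R (1 + k) 1 1)).
have wf : leb (@eball R (1 + k) 1 1) \is a fin_num by rewrite ge0_fin_numE// leb_eball_lty.
have w0 : 0 < w by rewrite fine_gt0// leb_eball_gt0//= leb_eball_lty.
exists ((v / w) `^ (1 + k)%:R^-1); first by rewrite powR_gt0// divr_gt0.
rewrite leb_eball ?powR_gt0 ?divr_gt0// muln1 -powR_mulrn ?powR_ge0//.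
rewrite -powRrM mulVf ?pnatr_eq0// powRr1; last by rewrite divr_ge0// ltW.
by rewrite -(fineK wf) -EFinM -/w divfK// gt_eqF.
Qed.

(** The bound for all s < a + b passes to s = a + b, since the volume of a ball is continuous in its
    radius. *)
Corollary brunn_minkowski_le (A B C : set V) (a b rho : R) : 0 < a -> 0 < b ->
  measurable A -> measurable B -> measurable C ->
  A `<=` eball rho -> B `<=` eball rho -> C `<=` eball rho ->
  leb A = leb (@eball R (1 + k) 1 a) -> leb B = leb (@eball R (1 + k) 1 b) ->
  (forall x y : V, A x -> B y -> C (x + y)) ->
  (leb (@eball R (1 + k) 1 (a + b)) <= leb C)%E.
Proof.
move=> a0 b0 mA mB mC Ar Br Cr AE BE ABC.
have ab0 : 0 < a + b by rewrite addr_gt0.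
have Cf : leb C \is a fin_num by rewrite ge0_fin_numE//; exact: leb_sub_lty Cr mC.
have wf s : leb (@eball R (1 + k) 1 s) \is a fin_num by rewrite ge0_fin_numE// leb_eball_lty.
have h s : s < a + b -> (leb (@eball R (1 + k) 1 s) <= leb C)%E.
  exact: (@brunn_minkowski _ _ A B C a b rho).
rewrite leNgt; apply/negP => hlt.
move: h hlt; rewrite leb_eball// -(fineK Cf) -(fineK (wf 1)) -EFinM lte_fin.
set w := fine (leb (eball _)); set c := fine (leb C); rewrite muln1 => h hlt.
have w0 : 0 <= w by exact: fine_ge0.
have [s [s0 sab hs]] : exists s, [/\ 0 < s, s < a + b & c < s ^+ (1 + k) * w].
  have cts : continuous (fun s : R => s ^+ (1 + k) * w).
    by apply: ctsM; [exact: exprn_continuous|exact: cst_continuous].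
  have n1 : \forall s \near a + b, c < s ^+ (1 + k) * w.
    have hin : [set s | c < s ^+ (1 + k) * w] (a + b) by exact: hlt.
    exact: (open_nbhs_nbhs (conj (open_lt (@cst_continuous _ _ c) cts) hin)).
  have [e /= e0 he] := n1.
  pose d := Num.min (e / 2) ((a + b) / 2).
  have d0 : 0 < d by rewrite lt_min !divr_gt0.
  have d1 : d <= e / 2 by rewrite ge_min lexx.
  have d2 : d <= (a + b) / 2 by rewrite ge_min lexx orbT.
  exists (a + b - d); split; [lra|lra|apply: he].
  by rewrite /ball/= opprB addrC subrK gtr0_norm//; lra.
have := h s sab; rewrite leb_eball// -(fineK (wf 1)) -EFinM lee_fin -/w muln1.
by move/(lt_le_trans hs); rewrite ltxx.
Qed.

End convexity_scaling.

(** Brunn-Minkowski for A / 2 and - A / 2: each has the volume of a ball of half the radius that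
    belongs to [A], and their sum is contained in [B]. *)
Lemma leb_half_difference_col {R : realType} m (A B : set 'cV[R]_(1 + m)) (rho : R) :
  measurable A -> measurable B -> A `<=` eball rho -> B `<=` eball rho ->
  (forall t s, A t -> A s -> B (2^-1 *: (t - s))) -> (leb A <= leb B)%E.
Proof.
move=> mA mB Ar Br AB.
have Af : leb A \is a fin_num by rewrite ge0_fin_numE//; exact: leb_sub_lty Ar mA.
have [v0|v0] := leP (fine (leb A)) 0.
  by rewrite -(fineK Af); apply: le_trans (measure_ge0 leb B); rewrite lee_fin.
have [r r0] := @exists_radius R m _ v0; rewrite (fineK Af) => rE.
have h0 : 0 < 2^-1 :> R by rewrite invr_gt0.
have half0 : 0 < r / 2 by rewrite divr_gt0.
pose A2 := dil 2^-1 A; pose A3 := [set x | A2 (- x)].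
have mA2 : measurable A2 by exact: measurable_dil.
have mA3 : measurable A3.
  apply: (@measurable_preimage_mx _ _ _ _ (fun x : 'cV[R]_(1 + m) => - x)) => //.
  by apply: cts_measurable_mx; apply: cts_mxN; exact: cts_id.
have A2E : leb A2 = leb (@eball R (1 + m) 1 (r / 2)).
  rewrite leb_dil// -rE -leb_dil//; last exact: measurable_eball.
  congr leb; apply/funext => x; apply/propext; rewrite /dil /eball/= invrK frobZ gtr0_norm// ltr_pdivlMr// mulrC.
  by split=> [[]|].
have A3E : leb A3 = leb (@eball R (1 + m) 1 (r / 2)) by rewrite (leb_opp mA2).
have A2r : A2 `<=` eball rho.
  move=> x [_ /Ar]; rewrite /eball/= invrK frobZ gtr0_norm//.
  by have := frob_ge0 x; lra.
have A3r : A3 `<=` eball rho by move=> x /A2r; rewrite /eball/= frobN.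
have := @brunn_minkowski_le R m A2 A3 B (r / 2) (r / 2) rho half0 half0 mA2 mA3 mB A2r A3r Br A2E A3E.
rewrite (_ : r / 2 + r / 2 = r); last by lra.
rewrite rE; apply => x y [_ hx] [_ hy].
have := AB _ _ hx hy; rewrite -scalerBr scalerA mulfV ?scale1r ?opprK//.
Qed.

Lemma leb_half_difference {R : realType} m (A B : set 'rV[R]_(1 + m)) (rho : R) :
  measurable A -> measurable B -> A `<=` eball rho -> B `<=` eball rho ->
  (forall t s, A t -> A s -> B (2^-1 *: (t - s))) -> (leb A <= leb B)%E.
Proof.
move=> mA mB Ar Br AB.
have subT (X : set 'rV[R]_(1 + m)) : X `<=` eball rho -> [set x | X x^T] `<=` eball rho.
  by move=> Xr x /Xr; rewrite /eball/= frob_trmx.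
have mT (X : set 'rV[R]_(1 + m)) : measurable X -> measurable [set x : 'cV_(1 + m) | X x^T].
  move=> mX; apply: (@measurable_preimage_mx _ _ _ _ (fun x : 'cV[R]_(1 + m) => x^T)) => //.
  by apply: cts_measurable_mx; apply: cts_trmx; exact: cts_id.
rewrite -(leb_trmx mA) -(leb_trmx mB).
apply: (@leb_half_difference_col _ _ _ _ rho); [exact: mT|exact: mT|exact: subT|exact: subT|].
by move=> t s /= At As; rewrite linearZ/= linearB/=; exact: AB.
Qed.

(** * Sums of a cone with the affine minorants of [H] *)

Section slab.
Context {R : realType} {k m : nat} (H : 'rV[R]_m -> R).
Notation V := 'cV[R]_(1 + k).
Notation U := 'M[R]_(1 + k, m).
Notation lambda := (@lebesgue_measure R).
Implicit Types (G : set V) (u : U) (c z l : R) (y : 'rV[R]_m).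

(* The affine minorants w |-> w.y - c of H, i.e. the epigraph of its Legendre transform. *)
Definition minorant y c := forall w, inner w y - c <= H w.

Lemma minorant0 : (forall w, 0 <= H w) -> minorant 0 0.
Proof. by move=> h w; rewrite inner0r subr0. Qed.

Lemma minorant_convex y1 y2 c1 c2 t : minorant y1 c1 -> minorant y2 c2 -> 0 <= t <= 1 ->
  minorant (t *: y1 + (1 - t) *: y2) (t * c1 + (1 - t) * c2).
Proof.
move=> h1 h2 /andP[t0 t1] w; rewrite innerDr !innerZr.
have t1' : 0 <= 1 - t by rewrite subr_ge0.
have := ler_wpM2l t0 (h1 w); have := ler_wpM2l t1' (h2 w); lra.
Qed.

(** The slice at height z of the sum of the infinite cone over [G] and the points (c, u y^T) with
    (y, c) a minorant. [region] keeps the heights between 0 and 1, and [volF] measures the response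
    of the cone to u. *)
Definition slab G u z : set V :=
  [set x | exists y c, minorant y c /\ dil (z - c) G (x - u *m y^T)].

Definition region G u : set 'cV[R]_(1 + (1 + k)) :=
  [set w : 'cV[R]_(1 + (1 + k)) | 0 < (usubmx w 0 0 : R) < 1 /\ slab G u (usubmx w 0 0) (dsubmx w)].

Definition volF G u : \bar R := leb (region G u).

Lemma region_pt G u z x : region G u (pt z x) = (0 < z < 1 /\ slab G u z x).
Proof. by rewrite /region/= usubmx_pt dsubmx_pt. Qed.

(** The union over all minorants is uncountable; joint measurability in u and the point is obtained
    from the openness of each translate. *)
Lemma open_region2 G : open G -> open [set uw : U * 'cV[R]_(1 + (1 + k)) | region G uw.1 uw.2].
Proof.
move=> oG.
have cz : continuous (fun uw : U * 'cV[R]_(1 + (1 + k)) => usubmx uw.2 0 0).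
  by apply: cts_coord; apply: cts_usubmx => uw; exact: cvg_snd.
rewrite (_ : mkset _ = ([set uw | 0 < usubmx uw.2 0 0] `&` [set uw | usubmx uw.2 0 0 < 1]) `&`
   \bigcup_(yc in [set yc | minorant yc.1 yc.2])
     [set uw | dil (usubmx uw.2 0 0 - yc.2) G (dsubmx uw.2 - uw.1 *m yc.1^T)]); last first.
  apply/seteqP; split => [[u w] /= [/andP[z0 z1] [y [c [h1 h2]]]]|[u w] /= [[z0 z1] [[y c] h1 h2]]].
    by split => //; exists (y, c).
  by split; [apply/andP|exists y, c].
apply: openI; first by apply: openI; apply: open_lt => //; exact: cst_continuous.
apply: bigcup_open => -[y c] _ /=.
apply: (@open_comp _ _ (fun uw : U * 'cV[R]_(1 + (1 + k)) =>
  (usubmx uw.2 0 0 - c, dsubmx uw.2 - uw.1 *m y^T)) [set ax | dil ax.1 G ax.2]); last exact: open_dil.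
move=> uw _; apply: cts_pair; first by apply: ctsB => //; exact: cst_continuous.
apply: cts_mxD; first by apply: cts_dsubmx => x; exact: cvg_snd.
apply: cts_mxN; apply: cts_mulmx; last exact: cst_continuous.
by move=> x; exact: cvg_fst.
Qed.

Lemma open_region G u : open G -> open (region G u).
Proof.
move=> oG; apply: (@open_comp _ _ (fun w => (u, w)) [set uw | region G uw.1 uw.2]); last exact: open_region2.
by move=> w _; apply: cts_pair; [exact: cst_continuous|exact: cts_id].
Qed.

Lemma measurable_region G u : open G -> measurable (region G u).
Proof. by move=> oG; apply: open_measurable_mx; exact: open_region. Qed.

Lemma measurable_region2 G : open G ->
  measurable [set uw : U * 'cV[R]_(1 + (1 + k)) | region G uw.1 uw.2].
Proof. by move=> oG; apply: open_prod_measurable; exact: open_region2. Qed.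

Lemma measurable_volF G : open G -> measurable_fun setT (volF G).
Proof. by move=> oG; exact: (measurable_section leb (measurable_region2 oG)). Qed.

Lemma measurable_slab G u z : open G -> 0 < z < 1 -> measurable (slab G u z).
Proof.
move=> oG z01; rewrite (_ : slab G u z = [set x | region G u (pt z x)]); last first.
  by apply/funext => x /=; rewrite region_pt; apply/propext; split => [|[]].
apply: (@measurable_preimage_mx _ _ _ _ (fun x : V => pt z x)); last exact: measurable_region.
by apply: cts_measurable_mx; apply: cts_pt; [exact: cst_continuous|exact: cts_id].
Qed.

Lemma slab_convex G u z : mconvex G -> mconvex (slab G u z).
Proof.
move=> cG x1 x2 t [y1 [c1 [h1 d1]]] [y2 [c2 [h2 d2]]] ht.
exists (t *: y1 + (1 - t) *: y2), (t * c1 + (1 - t) * c2); split.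
  exact: minorant_convex.
have := dil_convex cG d1 d2 ht.
rewrite (_ : t * (z - c1) + (1 - t) * (z - c2) = z - (t * c1 + (1 - t) * c2)); last by ring.
rewrite (_ : t *: (x1 - u *m y1^T) + (1 - t) *: (x2 - u *m y2^T) =
  t *: x1 + (1 - t) *: x2 - u *m (t *: y1 + (1 - t) *: y2)^T)//.
have -> : (t *: y1 + (1 - t) *: y2)^T = t *: y1^T + (1 - t) *: y2^T.
  by apply/matrixP => i j; rewrite !mxE.
by rewrite mulmxDr -!scalemxAr !scalerBr opprD addrACA.
Qed.

Lemma slabS G G' u z : G `<=` G' -> slab G u z `<=` slab G' u z.
Proof. by move=> GG' x [y [c [h [zc Gx]]]]; exists y, c; split => //; split => //; exact: GG'. Qed.

Lemma volFS G G' u : open G -> open G' -> G `<=` G' -> (volF G u <= volF G' u)%E.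
Proof.
move=> oG oG' GG'; apply: le_measure; rewrite ?inE; try exact: measurable_region.
by move=> w [h1 h2]; split => //; exact: slabS h2.
Qed.

Definition row_cons (t : 'rV[R]_m) (u' : 'M[R]_(k, m)) : U := col_mx t u'.

Lemma row_cons_mul t (u' : 'M[R]_(k, m)) y : row_cons t u' *m y^T = pt (inner t y) (u' *m y^T).
Proof.
rewrite /row_cons /pt mul_col_mx; congr col_mx.
apply/matrixP => i j; rewrite !ord1 [RHS]mxE eqxx innerE mxE.
by apply: eq_bigr => l _; rewrite big_ord1 !mxE.
Qed.

(** The cut-off [frob u < r] keeps the volume finite; the factor [a] will be a step size tending to
    0. *)
Definition sublevel G (a r l : R) : set U := [set u | frob u < r /\ (volF G (a *: u) <= l%:E)%E].

Lemma measurable_sublevel G a r l : open G -> measurable (sublevel G a r l).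
Proof.
move=> oG; apply: measurableI; first exact: measurable_eball.
have mf : measurable_fun setT (fun u : U => volF G (a *: u)).
  apply: (measurableT_comp (measurable_volF oG)).
  by apply: cts_measurable_mx; apply: cts_mxZ; [exact: cst_continuous|exact: cts_id].
by rewrite -[X in measurable X]setTI; apply: emeasurable_fun_infty_c.
Qed.

Lemma volF_rot G (P : 'M[R]_(1 + k)) u : P^T *m P = 1%:M -> open G ->
  volF (rot P G) u = volF G (P^T *m u).
Proof.
move=> PP oG; have oP : open (rot P G).
  apply: (@open_comp _ _ (fun x : V => P^T *m x)) => // x _.
  by apply: cts_mulmx; [exact: cst_continuous|exact: cts_id].
rewrite /volF (leb_col_mx (measurable_region _ oP)) (leb_col_mx (measurable_region _ oG)).
apply: eq_integral => x _; rewrite -[RHS](leb_orthogonal (orthogonalT PP)); last first.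
  apply: (@measurable_preimage_mx _ _ _ _ (fun y : V => col_mx x y)); last exact: measurable_region.
  by apply: cts_measurable_mx; apply: cts_col_mx; [exact: cst_continuous|exact: cts_id].
congr leb; apply/funext => y; rewrite /mkset [x]mx11_scalar !region_pt.
apply/propext; split => -[z01 [w [c [hw [zc h]]]]]; split => //; exists w, c; split => //; split => //.
  by move: h; rewrite /rot/= -(scalemxAr _ P^T) mulmxBr mulmxA.
by rewrite /rot/= -(scalemxAr _ P^T) mulmxBr mulmxA.
Qed.

Lemma sublevel_rot G (P : 'M[R]_(1 + k)) a r l : P^T *m P = 1%:M -> open G ->
  leb (sublevel (rot P G) a r l) = leb (sublevel G a r l).
Proof.
move=> PP oG; rewrite -(leb_orthogonal (orthogonalT PP) (measurable_sublevel a r l oG)).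
congr leb; apply/funext => u.
have ve : volF (rot P G) (a *: u) = volF G (a *: (P^T *m u)) by rewrite volF_rot// scalemxAr.
have fe : frob (P^T *m u) = frob u by exact: frob_orthogonal (orthogonalT PP).
by rewrite /sublevel /mkset ve fe.
Qed.

End slab.

Lemma width_bounds {R : realType} (a i1 i2 b1 b2 c1 c2 : R) :
  2 * `|a - 2^-1 * (i1 - i2)| < (c1 - i1) - (b2 - i2) ->
  2 * `|a - 2^-1 * (i1 - i2)| < (c2 - i2) - (b1 - i1) -> 2 * a <= c1 - b2 /\ b1 - c2 <= 2 * a.
Proof.
have := ler_norm (a - 2^-1 * (i1 - i2)); have := ler_norm (- (a - 2^-1 * (i1 - i2))).
by rewrite normrN; split; lra.
Qed.

Lemma half_bounds {R : realType} (a b c : R) : 2 * a <= c -> b <= 2 * a -> b / 2 <= a <= c / 2.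
Proof. by move=> h1 h2; apply/andP; split; lra. Qed.

Section slab_average.
Context {R : realType} {k m : nat} (H : 'rV[R]_m -> R) (p M : R).
Notation V := 'cV[R]_(1 + k).
Notation U := 'M[R]_(1 + k, m).
Notation lambda := (@lebesgue_measure R).
Hypothesis p_gt1 : 1 < p.
Hypothesis M_ge0 : 0 <= M.
Hypothesis H_ge0 : forall w, 0 <= H w.
Hypothesis H_le : forall w, H w <= M * frob w `^ p.
Implicit Types (G : set V) (u : U) (c z l : R) (y : 'rV[R]_m).
Notation minorant := (minorant H).
Notation slab := (slab H).
Notation region := (region H).
Notation volF := (volF H).

Lemma H0 : H 0 = 0.
Proof.
apply/eqP; rewrite eq_le H_ge0 andbT.
by have := H_le 0; rewrite frob0 powR0 ?mulr0// gt_eqF// (lt_trans _ p_gt1).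
Qed.

Lemma minorant_ge0 y c : minorant y c -> 0 <= c.
Proof. by move/(_ 0); rewrite inner0l H0 sub0r oppr_le0. Qed.

(** Testing at the unit vector y / |y| gives |y| - c <= M. Thus only a bounded family of minorants
    contributes at heights below 1. *)
Lemma minorant_bound y c : minorant y c -> c <= 1 -> frob y <= 1 + M.
Proof.
move=> h c1; have [->|y0] := eqVneq y 0; first by rewrite frob0 addr_ge0.
have fy := frob_gt0 y0; have := h ((frob y)^-1 *: y).
have /le_trans := H_le ((frob y)^-1 *: y).
rewrite frobZ gtr0_norm ?invr_gt0// mulVf ?gt_eqF// powR1 mulr1 innerZl -sqr_frob expr2.
rewrite mulrA mulVf ?gt_eqF// mul1r => h1 h2.
have := le_trans h2 (h1 _ (lexx _)); lra.
Qed.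

Lemma slab_bound G u z rho : G `<=` eball rho -> z < 1 ->
  slab G u z `<=` eball (rho + frob u * (1 + M)).
Proof.
move=> Gr z1 x [y [c [h [zc Gx]]]].
have c0 := minorant_ge0 h.
have := Gr _ Gx; rewrite /eball/= => hx.
have r0 := le_lt_trans (frob_ge0 _) hx; move: hx.
rewrite frobZ gtr0_norm ?invr_gt0// mulrC ltr_pdivrMr// => hx.
have h1 : frob (x - u *m y^T) < rho by nra.
have h2 : frob (u *m y^T) <= frob u * (1 + M).
  apply: le_trans (frob_mulmx _ _) _; rewrite ler_wpM2l ?frob_ge0// frob_trmx.
  by apply: (minorant_bound h); lra.
rewrite -[x](subrK (u *m y^T)); have := frobD (x - u *m y^T) (u *m y^T); lra.
Qed.

(* If [F] is the fibre of a dilate of G entering the slab, its translates by t.y and s.y lie in the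
   fibres I of the slabs of G for the rows t and s, so the centred interval of length |F| shifted by
   (t - s).y / 2 lies in [(inf I_t - sup I_s) / 2, (sup I_t - inf I_s) / 2]. *)
Lemma slab_average G (t s : 'rV[R]_m) (u' : 'M[R]_(k, m)) z rho : open G -> mconvex G ->
  G `<=` eball rho -> 0 < z < 1 ->
  (leb (slab (steiner G) (row_cons (2^-1 *: (t - s)) u') z) +
    leb (slab (steiner G) (row_cons (2^-1 *: (t - s)) u') z) <=
  leb (slab G (row_cons t u') z) + leb (slab G (row_cons s u') z))%E.
Proof.
move=> oG cG Gr z01.
have oS := open_steiner Gr oG; have mG := open_measurable_mx oG.
have mS := measurable_slab H (row_cons (2^-1 *: (t - s)) u') oS z01.
have mt := measurable_slab H (row_cons t u') oG z01.
have ms := measurable_slab H (row_cons s u') oG z01.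
apply: leb_leD_fib => // x'.
pose Is := fib (slab (steiner G) (row_cons (2^-1 *: (t - s)) u') z) x'.
pose It := fib (slab G (row_cons t u') z) x'.
pose Ir := fib (slab G (row_cons s u') z) x'.
rewrite -/Is -/It -/Ir.
have [->|/set0P[a0 Ja0]] := eqVneq Is set0.
  by rewrite measure0 adde0 adde_ge0.
have mIs : measurable Is by exact: measurable_fib.
have mIt : measurable It by exact: measurable_fib.
have mIr : measurable Ir by exact: measurable_fib.
have bnd v b : fib (slab G v z) x' b -> `|b| <= rho + frob v * (1 + M).
  move=> h; apply: le_trans (frob_le_pt b x') _.
  by apply/ltW; apply: (slab_bound Gr _ h); case/andP: z01.
have cvx v b1 b2 b : fib (slab G v z) x' b1 -> fib (slab G v z) x' b2 -> b1 < b < b2 ->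
    fib (slab G v z) x' b.
  move=> h1 h2 /andP[l1 l2]; pose q := (b2 - b) / (b2 - b1).
  have b12 : 0 < b2 - b1 by lra.
  have hq : 0 <= q <= 1.
    by rewrite /q divr_ge0 ?ler_pdivrMr//=; lra.
  have := slab_convex (u := v) (z := z) cG h1 h2 hq; rewrite !ptZ ptD -scalerDl subrKC scale1r.
  have -> // : q * b1 + (1 - q) * b2 = b by rewrite /q; field; rewrite gt_eqF.
have sups v : fib (slab G v z) x' !=set0 -> has_sup (fib (slab G v z) x') /\ has_inf (fib (slab G v z) x').
  move=> ne; split; split => //.
    by exists (rho + frob v * (1 + M)) => b /bnd; exact: le_trans (ler_norm _).
  by exists (- (rho + frob v * (1 + M))) => b /bnd; rewrite ler_norml => /andP[].
(* The fibre is an interval by convexity, so its length is at least the distance between its infimum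
   and its supremum. *)
have lenI v : fib (slab G v z) x' !=set0 -> measurable (fib (slab G v z) x') ->
    ((sup (fib (slab G v z) x') - inf (fib (slab G v z) x'))%:E <= lambda (fib (slab G v z) x'))%E.
  move=> ne mI; have [hs hi] := sups v ne; apply: ge_lebesgue_width => // b /andP[bi bs].
  have e1 : 0 < b - inf (fib (slab G v z) x') by lra.
  have e2 : 0 < sup (fib (slab G v z) x') - b by lra.
  have [b1 Ib1 hb1] := inf_adherent e1 hi; have [b2 Ib2 hb2] := sup_adherent e2 hs.
  by apply: (cvx v b1 b2) => //; apply/andP; split; lra.
have key a : Is a -> [/\ It !=set0, Ir !=set0,
    2 * a <= sup It - inf Ir & inf It - sup Ir <= 2 * a].
  move=> [y [c [h]]]; rewrite row_cons_mul -[- pt _ _]scaleN1r ptZ ptD !mulN1r scaleN1r.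
  set x2 := x' - _; have [zc|zc] := ltP 0 (z - c); last by case; lra.
  rewrite -steiner_dil// steiner_pt; set F := fib _ _ => hF.
  have mF : measurable F by apply: measurable_fib; exact: measurable_dil.
  have FI v b : F b -> fib (slab G (row_cons v u') z) x' (b + inner v y).
    move=> Fb; exists y, c; split => //; rewrite row_cons_mul -[- pt _ _]scaleN1r ptZ ptD.
    by rewrite !mulN1r scaleN1r addrK.
  have [b0 Fb0] : F !=set0.
    apply/set0P/eqP => F0; move: hF; rewrite F0 measure0 lte_fin.
    by rewrite -subr_lt0 subr0 pmulr_rlt0// normr_lt0.
  have net : It !=set0 by exists (b0 + inner t y); exact: FI.
  have nes : Ir !=set0 by exists (b0 + inner s y); exact: FI.
  have [hst hit] := sups _ net; have [hss his] := sups _ nes.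
  have F1 b : F b -> inf It - inner t y <= b <= sup It - inner t y.
    move=> Fb; have hb := FI t b Fb; apply/andP; split.
      by rewrite lerBlDr; apply: ge_inf => //; case: hit.
    by rewrite lerBrDr; apply: ub_le_sup => //; case: hst.
  have F2 b : F b -> inf Ir - inner s y <= b <= sup Ir - inner s y.
    move=> Fb; have hb := FI s b Fb; apply/andP; split.
      by rewrite lerBlDr; apply: ge_inf => //; case: his.
    by rewrite lerBrDr; apply: ub_le_sup => //; case: hss.
  have w1 : 2 * `|a - inner (2^-1 *: (t - s)) y| < (sup It - inner t y) - (inf Ir - inner s y).
    rewrite -lte_fin; apply: lt_le_trans hF _; apply: le_lebesgue_width => //.
      have /andP[_ u1] := F1 _ Fb0; have /andP[u2 _] := F2 _ Fb0; exact: le_trans u2 u1.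
    by move=> b Fb; have /andP[_ ->] := F1 _ Fb; have /andP[->] := F2 _ Fb.
  have w2 : 2 * `|a - inner (2^-1 *: (t - s)) y| < (sup Ir - inner s y) - (inf It - inner t y).
    rewrite -lte_fin; apply: lt_le_trans hF _; apply: le_lebesgue_width => //.
      have /andP[u1 _] := F1 _ Fb0; have /andP[_ u2] := F2 _ Fb0; exact: le_trans u1 u2.
    by move=> b Fb; have /andP[-> _] := F1 _ Fb; have /andP[_ ->] := F2 _ Fb.
  move: w1 w2; rewrite innerZl innerBl; set i1 := inner t y; set i2 := inner s y.
  by move=> w1 w2; have [] := width_bounds w1 w2.
have [net nes _ _] := key _ Ja0.
apply: le_trans (leeD (lenI _ net mIt) (lenI _ nes mIr)).
(* All points of [Is] lie between two half differences of end points, whose gap is half the sum of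
   the lengths of the fibres [It] and [Ir]. *)
have : (lambda Is <= ((sup It - inf Ir) / 2 - (inf It - sup Ir) / 2)%:E)%E.
  apply: (le_lebesgue_width mIs) => [|a /key[_ _ h1 h2]]; last exact: half_bounds.
  by have [_ _ h1 h2] := key _ Ja0; have /andP[h3 h4] := half_bounds h1 h2; exact: le_trans h3 h4.
move=> h; apply: le_trans (leeD h h) _; rewrite -!EFinD lee_fin; lra.
Qed.

Lemma volF_average G (t s : 'rV[R]_m) (u' : 'M[R]_(k, m)) rho : open G -> mconvex G ->
  G `<=` eball rho ->
  (volF (steiner G) (row_cons (2^-1 *: (t - s)) u') + volF (steiner G) (row_cons (2^-1 *: (t - s)) u')
  <= volF G (row_cons t u') + volF G (row_cons s u'))%E.
Proof.
move=> oG cG Gr; have oS := open_steiner Gr oG.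
apply: leb_leD_slice; try exact: measurable_region.
move=> x; rewrite [x]mx11_scalar; set z := x 0 0.
have sl G' u : [set y | region G' u (col_mx z%:M y)] = [set y | 0 < z < 1 /\ slab G' u z y].
  by apply/funext => y; exact: region_pt.
rewrite !sl; have [z01|/negP z01] := boolP (0 < z < 1); last first.
  have e G' u : [set y | false /\ slab G' u z y] = set0 by apply/seteqP; split => // y [].
  by rewrite !e !measure0.
have e G' u : [set y | true /\ slab G' u z y] = slab G' u z.
  by apply/seteqP; split => // y [].
by rewrite !e; exact: slab_average Gr z01.
Qed.

End slab_average.

Section sublevel_monotone.
Context {R : realType} {k m : nat} (H : 'rV[R]_(1 + m) -> R) (p M : R).
Notation V := 'cV[R]_(1 + k).
Notation U := 'M[R]_(1 + k, 1 + m).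
Hypothesis p_gt1 : 1 < p.
Hypothesis M_ge0 : 0 <= M.
Hypothesis H_ge0 : forall w, 0 <= H w.
Hypothesis H_le : forall w, H w <= M * frob w `^ p.
Implicit Types (G : set V) (a r l : R).
Notation E := (@sublevel R k (1 + m) H).

(** With the rows of u below the first one fixed, [volF_average] shows that t and s in a slice of
    the sublevel set of [G] put (t - s) / 2 in the slice for [steiner G]. The volume of the slice
    can then only grow, by [leb_half_difference]. *)
Lemma sublevel_steiner G a r l rho : open G -> mconvex G -> G `<=` eball rho ->
  (leb (E G a r l) <= leb (E (steiner G) a r l))%E.
Proof.
move=> oG cG Gr; have oS := open_steiner Gr oG.
have mE := measurable_sublevel H a r l oG; have mES := measurable_sublevel H a r l oS.
rewrite (leb_col_mx2 mE) (leb_col_mx2 mES).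
have sl (A : set U) : measurable A ->
    measurable_fun setT (fun y : 'M[R]_(k, 1 + m) => leb [set x : 'rV[R]_(1 + m) | A (col_mx x y)]).
  move=> mA.
  have mB : measurable [set yx : 'M[R]_(k, 1 + m) * 'rV[R]_(1 + m) | A (col_mx yx.2 yx.1)].
    apply: (@measurable_preimage_mx _ _ _ _ (fun yx : 'M[R]_(k, 1 + m) * 'rV[R]_(1 + m) => (col_mx yx.2 yx.1 : U))) => //.
    apply: (measurableT_comp (f := fun xy : 'rV[R]_(1 + m) * 'M[R]_(k, 1 + m) => col_mx xy.1 xy.2)
      (g := fun yx : 'M[R]_(k, 1 + m) * 'rV[R]_(1 + m) => (yx.2, yx.1))).
      exact: measurable_col_mx.
    by apply: measurable_fun_pair; [exact: measurable_snd|exact: measurable_fst].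
  exact: (measurable_section leb mB).
apply: ge0_le_integral => //; [exact: sl|exact: sl|].
move=> u' _.
have msl (A : set U) : measurable A -> measurable [set x : 'rV[R]_(1 + m) | A (col_mx x u')].
  move=> mA; apply: (@measurable_preimage_mx _ _ _ _ (fun x : 'rV[R]_(1 + m) => (col_mx x u' : U))) => //.
  by apply: cts_measurable_mx; apply: cts_col_mx; [exact: cts_id|exact: cst_continuous].
have bnd (A : set U) : A `<=` eball r -> [set x : 'rV[R]_(1 + m) | A (col_mx x u')] `<=` eball r.
  move=> Ar x /Ar; rewrite /eball/=; apply: le_lt_trans.
  rewrite -(@ler_pXn2r _ 2)// ?nnegrE ?frob_ge0// sqr_frob_col_mx lerDl sqr_ge0//.
apply: (@leb_half_difference _ _ _ _ r).
- exact: msl.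
- exact: msl.
- by apply: bnd => u [].
- by apply: bnd => u [].
move=> t s /= [tr tl] [sr sl']; split.
  (* The norm cut-off survives because |t - s|^2 <= 2 |t|^2 + 2 |s|^2. *)
  have : frob (col_mx (2^-1 *: (t - s)) u') <= Num.max (frob (col_mx t u')) (frob (col_mx s u')).
    set mx := Num.max _ _.
    have mx1 : frob (col_mx t u') <= mx by rewrite le_max lexx.
    have mx2 : frob (col_mx s u') <= mx by rewrite le_max lexx orbT.
    have mx0 : 0 <= mx by apply: le_trans mx1; exact: frob_ge0.
    have sq (v : U) : (frob v <= mx) = (inner v v <= mx ^+ 2).
      by rewrite -(@ler_pXn2r _ 2)// ?nnegrE ?frob_ge0// sqr_frob.
    move: mx1 mx2; rewrite !sq !inner_col_mx innerZl innerZr innerBl !innerBr (innerC s t).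
    by have := inner_ge0 (t + s); rewrite innerDl !innerDr (innerC s t); lra.
  by move=> h; apply: le_lt_trans h _; rewrite gt_max tr sr.
have rE v : a *: (col_mx v u' : U) = row_cons (a *: v) (a *: u') by rewrite scale_col_mx.
rewrite !rE in tl sl' *.
have -> : a *: (2^-1 *: (t - s)) = 2^-1 *: (a *: t - a *: s).
  by rewrite !scalerA mulrC -scalerA scalerBr.
have := leeD tl sl'.
have := volF_average p_gt1 M_ge0 H_ge0 H_le (a *: t) (a *: s) (a *: u') oG cG Gr.
set x := volF H (steiner G) _ => h1 h2; have := le_trans h1 h2.
have : (0 <= x)%E by exact: measure_ge0.
by case: x {h1 h2} => [x||] //=; rewrite -!EFinD !lee_fin; lra.
Qed.

Lemma sublevel_symmetrize Os G a r l rho : orthogonals Os -> 0 < rho -> open G -> mconvex G ->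
  G `<=` eball rho -> (leb (E G a r l) <= leb (E (symmetrize Os G) a r l))%E.
Proof.
move=> + r0 oG cG Gr; have mG := open_measurable_mx oG.
elim: Os => //= P Os IH hPOs; have [PP hOs] := (orthogonals_cons _ _).1 hPOs.
have oS := open_symmetrize hOs r0 Gr oG.
have oP : open (rot P (symmetrize Os G)).
  apply: (@open_comp _ _ (fun x : V => P^T *m x)) => // x _.
  by apply: cts_mulmx; [exact: cst_continuous|exact: cts_id].
apply: le_trans (IH hOs) _; rewrite -(sublevel_rot H a r l PP oS).
apply: (@sublevel_steiner _ _ _ _ rho) => //.
  by move=> x y t hx hy ht; rewrite /rot/= mulmxDr -!scalemxAr; exact: (symmetrize_convex hOs r0 mG Gr cG).
by rewrite -(rot_eball rho PP) => x; exact: (symmetrize_sub_eball hOs r0 mG Gr).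
Qed.

Lemma symmetrize_contains_ball G (r r' rho : R) : 0 < r -> r <= rho -> r' < r ->
  open G -> mconvex G -> G `<=` eball rho -> leb G = leb (@eball R (1 + k) 1 r) ->
  exists2 Os, orthogonals Os & eball r' `<=` symmetrize Os G.
Proof.
move=> r0 rrho rr' oG cG Gr GE; have mG := open_measurable_mx oG.
pose W := leb (@eball R (1 + k) 1 (r - r')).
have Wf : W \is a fin_num by rewrite /W ge0_fin_numE// leb_eball_lty.
have W0 : 0 < fine W by rewrite fine_gt0// /W leb_eball_gt0 ?subr_gt0//= leb_eball_lty.
have eps0 : 0 < fine W / 2 by rewrite divr_gt0.
have rho0 := lt_le_trans r0 rrho.
have [Os [hOs h _]] := symmetrize_to_balls r0 rrho r0 rrho mG Gr GE mG Gr GE eps0.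
exists Os => //; apply: (@convex_near_ball _ _ _ r r') => //.
- exact: measurable_symmetrize.
- exact: (symmetrize_convex hOs rho0 mG Gr cG).
rewrite -/W -(fineK Wf) -(fineK (defect_fin r Os mG)) -EFinM lte_fin.
by rewrite /defect in h; lra.
Qed.

(** For each smaller radius some symmetrization of [G] contains that ball, but none need be a ball
    itself, so the comparison is first made with radii [e j] increasing to [rG]. Along these balls
    [volF] increases to its value at the limiting ball, hence the sublevel sets decrease to the
    limiting one. *)
Lemma sublevel_ball G a r l (rG rho : R) : 0 < rG -> rG <= rho -> open G -> mconvex G ->
  G `<=` eball rho -> leb G = leb (@eball R (1 + k) 1 rG) ->
  (leb (E G a r l) <= leb (E (eball rG) a r l))%E.
Proof.
move=> rG0 rGrho oG cG Gr GE; have rho0 := lt_le_trans rG0 rGrho.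
pose e (j : nat) := rG * (1 - j.+2%:R^-1).
have e_lt j : e j < rG by rewrite gtr_pMr// gtrBl invr_gt0.
have e_mono i j : (i <= j)%N -> e i <= e j.
  by move=> ij; rewrite ler_pM2l// lerD2l lerN2 lef_pV2 ?posrE// ler_nat.
have h j : (leb (E G a r l) <= leb (E (eball (e j)) a r l))%E.
  have [Os hOs hb] := symmetrize_contains_ball rG0 rGrho (e_lt j) oG cG Gr GE.
  apply: le_trans (sublevel_symmetrize a r l hOs rho0 oG cG Gr) _.
  have oS := open_symmetrize hOs rho0 Gr oG.
  apply: le_measure; rewrite ?inE; try by apply: measurable_sublevel => //; exact: open_eball.
  move=> u [ur ul]; split => //; apply: le_trans ul.
  by apply: volFS => //; exact: open_eball.
have oe j := @open_eball R (1 + k) 1 (e j).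
have mE j := measurable_sublevel H a r l (oe j).
have EE : E (eball rG) a r l = \bigcap_j E (eball (e j)) a r l.
  apply/seteqP; split => [u [ur ul] j _|u hu].
    split => //; apply: le_trans ul; apply: volFS => //; first exact: open_eball.
    by move=> x; rewrite /eball/= => /lt_trans; apply.
  split; first by have [] := hu 0%N I.
  have -> : volF H (eball rG) (a *: u) = leb (\bigcup_j region H (eball (e j)) (a *: u)).
    congr leb; apply/seteqP; split => [w [w01 [y [c [hy [zc hx]]]]]|w [j _ [w01 [y [c [hy [zc hx]]]]]]].
      rewrite /eball/= in hx.
      have [j hj] : exists j, frob ((usubmx w 0 0 - c)^-1 *: (dsubmx w - (a *: u) *m y^T)) < e j.
        set q := frob _ in hx *.
        pose d := 1 - q / rG.
        have d0 : 0 < d by rewrite subr_gt0 ltr_pdivrMr// mul1r.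
        exists (Num.trunc d^-1); rewrite /e.
        have : d^-1 < (Num.trunc d^-1).+2%:R.
          by apply: lt_trans (truncnS_gt _) _; rewrite ltr_nat.
        rewrite -ltf_pV2 ?posrE ?invr_gt0// invrK => hd.
        have -> : q = rG * (1 - d) by rewrite /d; field; rewrite gt_eqF.
        by rewrite ltr_pM2l// ltrD2l ltrN2.
      by exists j => //; split => //; exists y, c; split.
    split => //; exists y, c; split => //; split => //.
    by rewrite /eball/= in hx *; exact: lt_trans hx (e_lt j).
  pose F j := region H (eball (e j)) (a *: u).
  have mF j : measurable (F j) by exact: measurable_region.
  have ndF : nondecreasing_seq F.
    move=> i j ij; apply/subsetPset => w [w01 hw]; split => //; apply: slabS hw => x.
    by rewrite /eball/= => /lt_le_trans; apply; exact: e_mono.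
  have cv := nondecreasing_cvg_mu (mu := leb) mF (bigcup_measurable (fun j _ => mF j)) ndF.
  rewrite -(cvg_lim _ cv)//; apply: lime_le; first exact: (cvgP _ cv).
  by apply: nearW => j; have [] := hu j I.
pose F j := E (eball (e j)) a r l.
have mF j : measurable (F j) by exact: mE.
have niF : nonincreasing_seq F.
  move=> i j ij; apply/subsetPset => w [wr hw]; split => //; apply: le_trans hw.
  apply: volFS => // x; rewrite /eball/= => /lt_le_trans; apply; exact: e_mono.
have F0 : (leb (F 0%N) < +oo)%E.
  apply: le_lt_trans (leb_eball_lty _ _ r); apply: le_measure; rewrite ?inE//.
    exact: measurable_eball.
  by move=> w [].
have cv := nonincreasing_cvg_mu (mu := leb) F0 mF (bigcap_measurableType (fun j _ => mF j)) niF.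
rewrite EE -(cvg_lim _ cv)//; apply: lime_ge; first exact: (cvgP _ cv).
by apply: nearW => j; exact: h.
Qed.

End sublevel_monotone.

Section integration_tools.
Context {R : realType}.

Lemma integral_col_mx2 a b c (f : 'M[R]_(a + b, c) -> \bar R) : measurable_fun setT f ->
  (forall x, (0 <= f x)%E) ->
  (\int[leb]_w f w = \int[leb]_y \int[leb]_(x in [set: 'M[R]_(a, c)]) f (col_mx x y))%E.
Proof.
move=> mf f0; have mc := @measurable_col_mx R a b c.
pose mu : {measure set 'M[R]_(a + b, c) -> \bar R} :=
  pushforward (product_measure1 (@leb R a c) (@leb R b c)) (fun xy => col_mx xy.1 xy.2).
rewrite (@eq_measure_integral _ _ _ _ (mu mc)); last by move=> A mA _; exact: leb_prod_col_mx.
rewrite ge0_integral_pushforward// preimage_setT.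
rewrite (@fubini_tonelli2 _ _ _ _ _ leb leb)//.
  exact: (measurableT_comp mf mc).
by move=> x; exact: f0.
Qed.

Lemma limn_einfE (u : (\bar R)^nat) : limn_einf u = ereal_sup (range (einfs u)).
Proof.
rewrite limn_einf_lim; apply/cvg_lim => //; apply: ereal_nondecreasing_cvgn.
exact: nondecreasing_einfs.
Qed.

Lemma le_limn_einf (u : (\bar R)^nat) (h : \bar R) :
  (forall y : R, (y%:E < h)%E -> exists N, forall n, (N <= n)%N -> (y%:E <= u n)%E) ->
  (h <= limn_einf u)%E.
Proof.
move=> H; rewrite limn_einfE.
have sup_ge (y : R) : (y%:E < h)%E -> (y%:E <= ereal_sup (range (einfs u)))%E.
  move=> /H[N hN]; apply: le_trans (ereal_sup_ubound _); last by exists N.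
  by apply: le_ereal_inf_tmp => _ [n /= hn <-]; exact: hN.
case: h H sup_ge => [h||] _ sup_ge; last by rewrite leNye.
  apply/lee_addgt0Pr => e e0; rewrite -leeBlDr// -EFinB.
  by apply: sup_ge; rewrite lte_fin; lra.
move: sup_ge; case: (ereal_sup _) => [s||] sup_ge //.
  by have := sup_ge (s + 1)%R (ltry _); rewrite lee_fin gerDl ler10.
by have := sup_ge 0 (ltry _).
Qed.

Lemma limn_einf_gt (u : (\bar R)^nat) (y : \bar R) : (y < limn_einf u)%E ->
  exists N, forall n, (N <= n)%N -> (y <= u n)%E.
Proof.
rewrite limn_einfE => /ereal_sup_gt[_ [N _ <-] hN]; exists N => n Nn.
apply: ltW; apply: lt_le_trans hN _.
by apply: ereal_inf_lbound; exists n.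
Qed.

Lemma limn_einf_le (u : (\bar R)^nat) (c : R) :
  (forall e : R, 0 < e -> exists N, forall n, (N <= n)%N -> (u n <= (c + e)%:E)%E) ->
  (limn_einf u <= c%:E)%E.
Proof.
move=> h; apply/lee_addgt0Pr => e e0; rewrite -EFinD leNgt; apply/negP => /limn_einf_gt[N1 h1].
have e20 : 0 < e / 2 by rewrite divr_gt0.
have [N2 h2] := h _ e20.
have := le_trans (h1 _ (leq_maxl N1 N2)) (h2 _ (leq_maxr N1 N2)).
by rewrite lee_fin; lra.
Qed.

Lemma leb_itv_subset (A : set 'M[R]_1) (a b : R) : measurable A -> a <= b ->
  (forall x, A x -> a <= x 0 0 <= b) -> (leb A <= (b - a)%:E)%E.
Proof.
move=> mA ab h; rewrite leb_11//; apply: le_lebesgue_width => //.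
  by apply: (measurable_preimage_mx measurable_scalar_mx).
by move=> s /h; rewrite mxE eqxx.
Qed.

Lemma leb_itv_superset (A : set 'M[R]_1) (a b : R) : measurable A ->
  (forall x : 'M[R]_1, a < x 0 0 < b -> A x) -> ((b - a)%:E <= leb A)%E.
Proof.
move=> mA h; rewrite leb_11//; apply: ge_lebesgue_width => //.
  by apply: (measurable_preimage_mx measurable_scalar_mx).
by move=> s hs; apply: h; rewrite mxE eqxx.
Qed.

Lemma measurable_hypograph n m (A : set 'M[R]_(n, m)) (f : 'M[R]_(n, m) -> R) (l : R) :
  measurable A -> measurable_fun setT f ->
  measurable [set zu : 'M[R]_1 * 'M[R]_(n, m) |
    A zu.2 /\ 0 < zu.1 0 0 < l /\ zu.1 0 0 < f zu.2].
Proof.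
move=> mA mf.
have mz : measurable_fun setT (fun zu : 'M[R]_1 * 'M[R]_(n, m) => (zu.1 0 0 : R)).
  by apply: (measurableT_comp (measurable_coord 0 0)); exact: measurable_fst.
have mfz : measurable_fun setT (fun zu : 'M[R]_1 * 'M[R]_(n, m) => f zu.2 - (zu.1 0 0 : R)).
  apply: measurable_funB => //.
  by apply: (measurableT_comp mf); exact: measurable_snd.
apply: measurableI; first exact: measurable_prod_snd.
apply: measurableI.
  rewrite [X in measurable X](_ : _ = setT `&`
      (fun zu : 'M[R]_1 * 'M[R]_(n, m) => (zu.1 0 0 : R)) @^-1` `]0, l[%classic).
    by apply: mz => //; exact: measurable_itv.
  by rewrite setTI; apply/seteqP; split => zu /=; rewrite in_itv.
rewrite [X in measurable X](_ : _ = setT `&`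
    (fun zu : 'M[R]_1 * 'M[R]_(n, m) => f zu.2 - (zu.1 0 0 : R)) @^-1` `]0, +oo[%classic).
  by apply: mfz => //; exact: measurable_itv.
by rewrite setTI; apply/seteqP; split => zu /=; rewrite in_itv/= andbT subr_gt0.
Qed.

(* Layer cake: min (f u) l is the length of {z in ]0, l[ | z < f u}. *)
Lemma integral_min_layer n m (A : set 'M[R]_(n, m)) (f : 'M[R]_(n, m) -> R) (l : R) :
  measurable A -> measurable_fun setT f -> (forall u, 0 <= f u) -> 0 <= l ->
  (\int[leb]_(u in A) (Num.min (f u) l)%:E =
   \int[leb]_(z in [set: 'M[R]_1])
     leb [set u | A u /\ (0 < z 0%R 0%R < l)%R /\ (z 0%R 0%R < f u)%R])%E.
Proof.
move=> mA mf f0 l0; have mE := measurable_hypograph l mA mf.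
have /= -> := tonelli_set leb leb mE.
rewrite integral_mkcond; apply: eq_integral => u _; rewrite patchE.
have mEu : measurable [set z : 'M[R]_1 | A u /\ 0 < z 0 0 < l /\ z 0 0 < f u].
  apply: (@measurable_preimage_mx _ _ _ _ (fun z : 'M[R]_1 => (z, u))) mE.
  by apply: measurable_fun_pair.
case: ifPn; rewrite ?inE ?notin_setE => Au; last first.
  by rewrite (_ : mkset _ = set0) ?measure0//; apply/seteqP; split => // z [].
have mn0 : 0 <= Num.min (f u) l by rewrite le_min f0.
apply/eqP; rewrite eq_le; apply/andP; split.
  rewrite -[Num.min _ _]subr0; apply: leb_itv_superset => // z /andP[z0].
  by rewrite lt_min => /andP[zf zl]; split => //; split => //; apply/andP.
rewrite -[Num.min _ _]subr0; apply: leb_itv_subset => // z [_ [/andP[z0 zl] zf]].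
by rewrite (ltW z0) le_min (ltW zl) (ltW zf).
Qed.

(** In the layer cake formula each layer is |A| minus a sublevel volume, so the function with the
    larger sublevel sets has the smaller truncated integral. *)
Lemma integral_min_le n m (A : set 'M[R]_(n, m)) (f g : 'M[R]_(n, m) -> R) (l : R) :
  measurable A -> (leb A < +oo)%E -> measurable_fun setT f -> measurable_fun setT g ->
  (forall u, 0 <= f u) -> (forall u, 0 <= g u) -> 0 <= l ->
  (forall z : R, (leb [set u | A u /\ (g u <= z)%R] <= leb [set u | A u /\ (f u <= z)%R])%E) ->
  (\int[leb]_(u in A) (Num.min (f u) l)%:E <= \int[leb]_(u in A) (Num.min (g u) l)%:E)%E.
Proof.
move=> mA Aoo mf mg f0 g0 l0 h; rewrite !integral_min_layer//.
have mset (e : 'M[R]_(n, m) -> R) (z : R) : measurable_fun setT e ->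
    measurable [set u | A u /\ e u <= z].
  move=> me; apply: measurableI => //.
  rewrite [X in measurable X](_ : _ = setT `&` e @^-1` `]-oo, z]%classic).
    by apply: me => //; exact: measurable_itv.
  by rewrite setTI; apply/seteqP; split => u /=; rewrite in_itv.
have layer (e : 'M[R]_(n, m) -> R) : measurable_fun setT e -> measurable_fun setT
    (fun z : 'M[R]_1 => leb [set u | A u /\ 0 < z 0 0 < l /\ z 0 0 < e u]).
  by move=> me; exact: (measurable_section leb (measurable_hypograph l mA me)).
apply: ge0_le_integral => //; [exact: layer|exact: layer|].
move=> z _; have [z01|/negP z01] := boolP (0 < z 0 0 < l); last first.
  by rewrite (_ : mkset _ = set0) ?measure0//; apply/seteqP; split => // u [_ []].
have e (f' : 'M[R]_(n, m) -> R) : [set u | A u /\ true /\ z 0 0 < f' u] =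
    A `\` [set u | A u /\ f' u <= z 0 0].
  apply/seteqP; split => u /= [Au]; first by move=> [_ hu]; split => // -[_]; rewrite leNgt hu.
  by move=> hn; split => //; split => //; rewrite ltNge; apply/negP => hu; apply: hn.
rewrite !e.
have mD (f' : 'M[R]_(n, m) -> R) : measurable_fun setT f' -> leb (A `\` [set u | A u /\ f' u <= z 0 0]) =
    (leb A - leb [set u | A u /\ (f' u <= z 0%R 0%R)%R])%E.
  move=> mf'; have := measureD mA (mset f' (z 0 0) mf') Aoo.
  rewrite setIidr; last by move=> u [].
  exact.
by rewrite !mD//; apply: leeB => //; exact: h.
Qed.

End integration_tools.

(** * The gauge of a polar body and the upper estimate for its cone *)

Section gauge.
Context {R : realType} {k : nat} (W : set 'cV[R]_(1 + k)) (del rho : R).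
Notation V := 'cV[R]_(1 + k).
Hypothesis del_gt0 : 0 < del.
Hypothesis W_del : eball del `<=` W.
Hypothesis W_rho : W `<=` eball rho.

(** The support function of [W], that is, the Minkowski gauge of the polar body of [W]; [gauge_ball]
    is the interior of that body. *)
Definition gauge (x : V) : R := sup [set inner xi x | xi in W].

Lemma rho_gt0 : 0 < rho.
Proof.
have /W_rho : W 0 by apply: W_del; rewrite /eball/= frob0.
by rewrite /eball/= frob0.
Qed.

Lemma has_sup_gauge x : has_sup [set inner xi x | xi in W].
Proof.
split; first by exists (inner 0 x); exists 0 => //; apply: W_del; rewrite /eball/= frob0.
exists (rho * frob x) => _ [xi /W_rho h <-].
by apply: le_trans (inner_le_frob _ _) _; rewrite ler_wpM2r ?frob_ge0// ltW.
Qed.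

Lemma gauge_ge x xi : W xi -> inner xi x <= gauge x.
Proof. by move=> Wxi; apply: ub_le_sup; [case: (has_sup_gauge x)|exists xi]. Qed.

Lemma gauge_le x c : (forall xi, W xi -> inner xi x <= c) -> gauge x <= c.
Proof.
move=> h; apply: ge_sup; first by case: (has_sup_gauge x).
by move=> _ [xi Wxi <-]; exact: h.
Qed.

Lemma gaugeZ a x : 0 < a -> gauge (a *: x) = a * gauge x.
Proof.
move=> a0; apply/eqP; rewrite eq_le; apply/andP; split.
  by apply: gauge_le => xi Wxi; rewrite innerZr ler_pM2l// gauge_ge.
rewrite -ler_pdivlMl//; apply: gauge_le => xi Wxi.
by rewrite ler_pdivlMl// -innerZr gauge_ge.
Qed.

Lemma gaugeD x y : gauge (x + y) <= gauge x + gauge y.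
Proof. by apply: gauge_le => xi Wxi; rewrite innerDr lerD// gauge_ge. Qed.

Lemma gauge_le_frob x : gauge x <= rho * frob x.
Proof.
apply: gauge_le => xi /W_rho h; apply: le_trans (inner_le_frob _ _) _.
by rewrite ler_wpM2r ?frob_ge0// ltW.
Qed.

Lemma frob_le_gauge x : del / 2 * frob x <= gauge x.
Proof.
have [->|x0] := eqVneq x 0.
  by rewrite frob0 mulr0 -(inner0l (0 : V)); apply: gauge_ge; apply: W_del; rewrite /eball/= frob0.
have fx := frob_gt0 x0.
(* Half the radius is used since the ball inside [W] is open. *)
have <- : inner ((del / 2 / frob x) *: x) x = del / 2 * frob x.
  by rewrite innerZl -sqr_frob expr2 mulrA divfK// gt_eqF.
apply: gauge_ge; apply: W_del; rewrite /eball/= frobZ ger0_norm ?divr_ge0 ?ltW// divfK ?gt_eqF//.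
by rewrite ltr_pdivrMr// mulr_natr mulr2n ltrDl.
Qed.

Definition gauge_ball : set V := [set x | gauge x < 1].

Lemma gauge_ball_sub : gauge_ball `<=` eball (2 / del).
Proof.
move=> x; rewrite /gauge_ball /eball/= => h; rewrite ltr_pdivlMr// mulrC.
by have := frob_le_gauge x; lra.
Qed.

Lemma gauge_ball_convex : mconvex gauge_ball.
Proof.
move=> x y t hx hy /andP[t0 t1]; rewrite /gauge_ball/= in hx hy *.
have [->|tn0] := eqVneq t 0; first by rewrite scale0r add0r subr0 scale1r.
have [->|tn1] := eqVneq t 1; first by rewrite subrr scale0r addr0 scale1r.
have tp : 0 < t by rewrite lt_neqAle eq_sym tn0.
have tp' : 0 < 1 - t by rewrite subr_gt0 lt_neqAle tn1.
apply: le_lt_trans (gaugeD _ _) _; rewrite !gaugeZ//; nra.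
Qed.

Lemma open_gauge_ball : open gauge_ball.
Proof.
rewrite openE => x hx; rewrite /gauge_ball/= in hx.
have op : open [set y : V | frob (y - x) < (1 - gauge x) / rho].
  apply: open_lt; last exact: cst_continuous.
  by apply: cts_frob; apply: cts_mxD; [exact: cts_id|exact: cst_continuous].
have inx : [set y : V | frob (y - x) < (1 - gauge x) / rho] x.
  by rewrite /= subrr frob0 divr_gt0 ?rho_gt0// subr_gt0.
apply: filterS (open_nbhs_nbhs (conj op inx)) => y /=.
rewrite ltr_pdivlMr ?rho_gt0// /gauge_ball/= => h.
rewrite -[y](subrK x); apply: le_lt_trans (gaugeD _ _) _.
by have := gauge_le_frob (y - x); lra.
Qed.

Lemma dil_gauge_ball q x : 0 < q -> dil q gauge_ball x = (gauge x < q).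
Proof.
move=> q0; rewrite /dil /gauge_ball/= gaugeZ ?invr_gt0// mulrC ltr_pdivrMr// mul1r.
by apply/propext; split => [[]|].
Qed.

End gauge.

Section cone.
Context {R : realType} {k m : nat} (H : 'rV[R]_m -> R).
Notation V := 'cV[R]_(1 + k).

(** For a gauge ball the part over y is the interval from the gauge of y to 1, so a change of the
    gauge is seen as a vertical length. *)
Definition cone (G : set V) : set 'cV[R]_(1 + (1 + k)) :=
  [set w : 'cV[R]_(1 + (1 + k)) | 0 < (usubmx w 0 0 : R) < 1 /\ dil (usubmx w 0 0) G (dsubmx w)].

Lemma cone_pt G z x : cone G (pt z x) = (0 < z < 1 /\ dil z G x).
Proof. by rewrite /cone/= usubmx_pt dsubmx_pt. Qed.

Lemma measurable_cone G : open G -> measurable (cone G).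
Proof.
move=> oG; apply: open_measurable_mx.
have cz : continuous (fun w : 'cV[R]_(1 + (1 + k)) => usubmx w 0 0).
  by apply: cts_coord; apply: cts_usubmx; exact: cts_id.
have -> : cone G = ([set w | 0 < usubmx w 0 0] `&` [set w | usubmx w 0 0 < 1]) `&`
    (fun w => (usubmx w 0 0, dsubmx w)) @^-1` [set ax | dil ax.1 G ax.2].
  by apply/seteqP; split => w /= [h1 h2]; split => //; apply/andP.
apply: openI; first by apply: openI; apply: open_lt => //; exact: cst_continuous.
apply: open_comp; last exact: open_dil.
by move=> w _; apply: cts_pair => //; apply: cts_dsubmx; exact: cts_id.
Qed.

Lemma cone_region G u : (forall w, 0 <= H w) -> cone G `<=` region H G u.
Proof.
move=> H_ge0 w [w01 hw]; split => //; exists 0, 0; split; first exact: minorant0.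
by rewrite trmx0 mulmx0 !subr0.
Qed.

Lemma leb_cone_eq G G' : open G -> open G' -> leb G = leb G' -> leb (cone G) = leb (cone G').
Proof.
move=> oG oG' GG'; rewrite (leb_col_mx (measurable_cone oG)) (leb_col_mx (measurable_cone oG')).
apply: eq_integral => x _; rewrite [x]mx11_scalar; set z := x 0 0.
have sl A : [set y | cone A (col_mx z%:M y)] = [set y | 0 < z < 1 /\ dil z A y].
  by apply/funext => y; exact: cone_pt.
rewrite !sl; have [/andP[z0 z1]|z01] := boolP (0 < z < 1); last first.
  have e A : [set y : V | false /\ dil z A y] = set0 by apply/seteqP; split => // y [].
  by rewrite !e.
have e A : [set y : V | true /\ dil z A y] = dil z A by apply/seteqP; split => // y [].
by rewrite !e !leb_dil ?GG'//; exact: open_measurable_mx.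
Qed.

End cone.

Section centroid_upper.
Context {R : realType} {k m : nat} (H : 'rV[R]_m -> R) (p M del rho Rr : R).
Notation V := 'cV[R]_(1 + k).
Notation U := 'M[R]_(1 + k, m).
Variables (W : set V) (L : set U).
Hypothesis p_gt1 : 1 < p.
Hypothesis M_ge0 : 0 <= M.
Hypothesis H_ge0 : forall w, 0 <= H w.
Hypothesis H_le : forall w, H w <= M * frob w `^ p.
Hypothesis H_hom : forall s w, 0 < s -> H (s *: w) = s `^ p * H w.
Hypothesis H_cts : continuous H.
Hypothesis del_gt0 : 0 < del.
Hypothesis W_del : eball del `<=` W.
Hypothesis W_rho : W `<=` eball rho.
Hypothesis mL : measurable L.
Hypothesis L_sub : L `<=` eball Rr.
Hypothesis W_int : forall xi, W xi -> (\int[leb]_(u in L) (H (xi^T *m u))%:E <= 1)%E.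
Notation G := (gauge_ball W).

(** Pairing with xi bounds the cone part by z - c and the added part, for a minorant (w, c), by s
    <xi^T u, w> <= H(s xi^T u) + c; the costs c cancel. *)
Lemma slab_gauge s u z y xi : 0 < s -> W xi -> slab H G (s *: u) z y ->
  inner xi y < z + s `^ p * H (xi^T *m u).
Proof.
move=> s0 Wxi [w [c [hwc [zc hd]]]].
have : gauge W (y - (s *: u) *m w^T) < z - c.
  by rewrite -(dil_gauge_ball del_gt0 W_del W_rho _ zc).
move/(le_lt_trans (gauge_ge del_gt0 W_del W_rho _ Wxi)); rewrite innerBr.
have := hwc (s *: (xi^T *m u)); rewrite H_hom// innerZl.
have -> : inner xi ((s *: u) *m w^T) = s * inner (xi^T *m u) w.
  rewrite -scalemxAl innerZr; congr (_ * _).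
  by rewrite [RHS]innerC /inner [RHS]mxtrace_mulC mulmxA.
lra.
Qed.

Lemma measurable_H_row (xi : V) : measurable_fun setT (fun u : U => (H (xi^T *m u))).
Proof.
apply: continuous_measurable_mx => u.
apply: (@continuous_comp _ _ _ (fun u : U => xi^T *m u) H); last exact: H_cts.
by apply: cts_mulmx; [exact: cst_continuous|exact: cts_id].
Qed.

Lemma H_row_le xi u : W xi -> L u -> H (xi^T *m u) <= M * (rho * Rr) `^ p.
Proof.
move=> Wxi Lu; apply: le_trans (H_le _) _; rewrite ler_wpM2l// ge0_ler_powR ?nnegrE ?frob_ge0//.
- by apply: ltW; apply: lt_trans p_gt1.
- have := W_rho Wxi; have := L_sub Lu; rewrite /eball/= => h1 h2.
  by rewrite mulr_ge0//; apply/ltW; [apply: le_lt_trans h2|apply: le_lt_trans h1]; exact: frob_ge0.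
apply: le_trans (frob_mulmx _ _) _; rewrite frob_trmx.
by apply: ler_pM; rewrite ?frob_ge0//; apply/ltW; [exact: W_rho|exact: L_sub].
Qed.

Let M' := M * (rho * Rr) `^ p.
Let VL := fine (leb L).
Let v := fine (leb G).

Lemma measurable_col_section (A : set 'cV[R]_(1 + (1 + k))) y : measurable A ->
  measurable [set x : 'M[R]_1 | A (col_mx x y)].
Proof.
move=> mA; apply: (@measurable_preimage_mx _ _ _ _ (fun x : 'M[R]_1 => col_mx x y)) mA.
by apply: cts_measurable_mx; apply: cts_col_mx; [exact: cts_id|exact: cst_continuous].
Qed.

Let oG : open G := open_gauge_ball del_gt0 W_del W_rho.

(** A functional xi that attains the gauge of y up to e shows that over y the sum reaches below the
    cone by at most e + s^p H(xi^T u). *)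
Lemma leb_slab_len s y xi u (e : R) : 0 < s -> 0 < e -> W xi -> gauge W y - e < inner xi y ->
  (leb [set x : 'M[R]_1 | region H G (s *: u)%R (col_mx x y)] <=
   leb [set x : 'M[R]_1 | cone G (col_mx x y)] + (e + s `^ p * H (xi^T *m u))%:E)%E.
Proof.
move=> s0 e0 Wxi hxi; set h := e + _.
have h0 : 0 < h by rewrite /h ltr_pwDl// mulr_ge0 ?powR_ge0.
have mS : measurable [set x : 'M[R]_1 | region H G (s *: u) (col_mx x y)].
  by apply: measurable_col_section; exact: measurable_region.
have mD : measurable [set x : 'M[R]_1 | cone G (col_mx x y)].
  by apply: measurable_col_section; exact: measurable_cone.
have g0 : 0 <= gauge W y.
  by apply: le_trans (frob_le_gauge del_gt0 W_del W_rho y); rewrite mulr_ge0 ?frob_ge0// divr_ge0// ltW.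
have lo (x : 'M[R]_1) : region H G (s *: u) (col_mx x y) -> 0 < x 0 0 < 1 /\ gauge W y - h < x 0 0.
  rewrite /region/= col_mxKu col_mxKd => -[-> /(slab_gauge s0 Wxi)]; rewrite /h; split=> //; lra.
have [g1|g1] := ltP (gauge W y) 1; last first.
  apply: (@le_trans _ _ h%:E); last by rewrite leeDr.
  rewrite -[h](_ : 1 - (1 - h) = h); last by ring.
  apply: leb_itv_subset => //; first by lra.
  by move=> z /lo[/andP[]]; lra.
apply: (@le_trans _ _ ((1 - (gauge W y - h))%:E)).
  apply: leb_itv_subset => //; first by lra.
  by move=> z /lo[/andP[]]; lra.
rewrite (_ : 1 - _ = (1 - gauge W y) + h)%R; last by ring.
rewrite EFinD leeD2r//; apply: leb_itv_superset => // z /andP[z1 z2].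
have z0 : 0 < z 0 0 by apply: le_lt_trans z1.
rewrite /cone/= col_mxKu col_mxKd.
by split; [apply/andP|rewrite (dil_gauge_ball del_gt0 W_del W_rho)].
Qed.

Lemma leb_slab_eq0 s y xi u (e : R) : 0 < s -> W xi -> gauge W y - e < inner xi y -> L u ->
  1 + s `^ p * M' + e <= gauge W y ->
  leb [set x : 'M[R]_1 | region H G (s *: u) (col_mx x y)] = 0%E.
Proof.
move=> s0 Wxi hxi Lu hq; rewrite (_ : mkset _ = set0) ?measure0//.
apply/seteqP; split => // z; rewrite /region/= col_mxKu col_mxKd => -[/andP[z0 z1] hz].
have := slab_gauge s0 Wxi hz; have := ler_wpM2l (powR_ge0 s p) (H_row_le Wxi Lu).
rewrite -/M'; lra.
Qed.

Hypothesis L_fin : (leb L < +oo)%E.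
Hypothesis G_fin : (leb G < +oo)%E.

Lemma measurable_region_row s : measurable [set uw : U * 'cV[R]_(1 + (1 + k)) | L uw.1 /\ region H G (s *: uw.1) uw.2].
Proof.
apply: measurableI; first exact: measurable_prod_fst.
apply: (@measurable_preimage_mx _ _ _ _ (fun uw : U * 'cV[R]_(1 + (1 + k)) => (s *: uw.1, uw.2))
  [set uw | region H G uw.1 uw.2]); last exact: measurable_region2.
apply: measurable_fun_pair; last exact: measurable_snd.
apply: (measurableT_comp (f := fun u : U => s *: u)); last exact: measurable_fst.
by apply: cts_measurable_mx; apply: cts_mxZ; [exact: cst_continuous|exact: cts_id].
Qed.

Lemma measurable_len_row s y :
  measurable_fun L (fun u => leb [set x : 'M[R]_1 | region H G (s *: u) (col_mx x y)]).
Proof.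
apply: (measurable_funS measurableT) => //.
have mE : measurable [set ux : U * 'M[R]_1 | region H G (s *: ux.1) (col_mx ux.2 y)].
  apply: (@measurable_preimage_mx _ _ _ _ (fun uw : U * 'M[R]_1 => (s *: uw.1, col_mx uw.2 y))
    [set uw | region H G uw.1 uw.2]); last exact: measurable_region2.
  apply: measurable_fun_pair.
    apply: (measurableT_comp (f := fun u : U => s *: u)); last exact: measurable_fst.
    by apply: cts_measurable_mx; apply: cts_mxZ; [exact: cst_continuous|exact: cts_id].
  apply: (measurableT_comp (f := fun x : 'M[R]_1 => col_mx x y)); last exact: measurable_snd.
  by apply: cts_measurable_mx; apply: cts_col_mx; [exact: cts_id|exact: cst_continuous].
exact: (measurable_section leb mE).
Qed.

(** Bounds the gauge of every y over which the sum has positive length, uniformly for u in [L]. *)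
Let q s := 1 + s `^ p * M' + s `^ p * s.

(** One xi serves all u in [L]: integrating the estimate for single u and using the integral bound
    on [W] leaves s^p. The error is taken as s^p s, of smaller order than this main term. *)
Lemma integral_len_row s y : 0 < s ->
  (\int[leb]_(u in L) leb [set x : 'M[R]_1 | region H G (s *: u)%R (col_mx x y)] <=
   leb L * leb [set x : 'M[R]_1 | cone G (col_mx x y)] +
   (s `^ p * (1 + s * VL))%:E * (\1_[set y | (gauge W y < q s)%R] y)%:E)%E.
Proof.
move=> s0; have sp0 : 0 < s `^ p by rewrite powR_gt0.
have e0 : 0 < s `^ p * s by rewrite mulr_gt0.
have VL0 : 0 <= VL by rewrite /VL fine_ge0.
have [_ [xi Wxi <-] hxi] := sup_adherent e0 (has_sup_gauge del_gt0 W_del W_rho y).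
have [gq|gq] := ltP (gauge W y) (q s); last first.
  rewrite (eq_integral (fun=> 0%E)).
    by rewrite integral0 adde_ge0 ?mule_ge0// lee_fin// mulr_ge0 ?addr_ge0 ?mulr_ge0// ltW.
  move=> u; rewrite inE => Lu; apply: leb_slab_eq0 hxi Lu gq => //.
set D := [set x | cone G _].
rewrite indicE mem_set//= mule1.
apply: (@le_trans _ _ (\int[leb]_(u in L) (leb D + ((s `^ p * s)%:E + (s `^ p)%:E * (H (xi^T *m u))%:E)))%E).
  apply: ge0_le_integral => //.
  - exact: measurable_len_row.
  - apply: emeasurable_funD; first exact: measurable_cst.
    apply: emeasurable_funD; first exact: measurable_cst.
    apply: emeasurable_funM; first exact: measurable_cst.
    apply/measurable_EFinP; apply: (measurable_funS measurableT) => //; exact: measurable_H_row.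
  - by move=> u Lu; rewrite -EFinM -EFinD; exact: leb_slab_len.
have mH : measurable_fun L (fun u => (H (xi^T *m u))%:E).
  apply/measurable_EFinP; apply: (measurable_funS measurableT) => //; exact: measurable_H_row.
rewrite ge0_integralD//; [|by move=> u _; rewrite -EFinM -EFinD lee_fin addr_ge0 ?mulr_ge0// ltW| ].
rewrite ge0_integralD//; last 3 first.
- by move=> u _; rewrite lee_fin ltW.
- by move=> u _; rewrite -EFinM lee_fin mulr_ge0// ltW.
- by apply: emeasurable_funM => //; exact: measurable_cst.
rewrite ge0_integralZl//; [|by move=> u _; rewrite lee_fin|by rewrite lee_fin ltW].
rewrite !integral_cst// muleC leeD2l//.
rewrite (_ : s `^ p * (1 + s * VL) = s `^ p * s * VL + s `^ p)%R; last by ring.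
rewrite [in leRHS]EFinD [in leRHS]EFinM /VL fineK ?ge0_fin_numE// leeD2l// -[leRHS]mule1 lee_pmul2l ?lte_fin//; exact: W_int.
apply: emeasurable_funD; first exact: measurable_cst.
by apply: emeasurable_funM => //; exact: measurable_cst.
Qed.

(** The integrals over u and over the points are exchanged and [integral_len_row] is integrated over
    y: to first order in s^p, the total excess over [L] is at most s^p |G|. *)
Lemma volF_upper s : 0 < s ->
  (\int[leb]_(u in L) volF H G (s *: u)%R <= leb L * leb (cone G) +
    (s `^ p * (1 + s * VL) * (q s ^+ (1 + k) * v))%:E)%E.
Proof.
move=> s0; have mE := measurable_region_row s.
have VL0 : 0 <= VL by rewrite /VL fine_ge0.
have q0 : 0 < q s.
  rewrite /q ltr_pwDr ?mulr_gt0 ?powR_gt0// addr_ge0// mulr_ge0 ?powR_ge0//.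
  by rewrite /M' mulr_ge0// powR_ge0.
have -> : (\int[leb]_(u in L) volF H G (s *: u)%R =
    \int[leb]_u leb [set w : 'cV[R]_(1 + (1 + k)) | L u /\ region H G (s *: u)%R w])%E.
  rewrite integral_mkcond; apply: eq_integral => u _; rewrite patchE /volF.
  case: ifPn; rewrite ?inE ?notin_setE => Lu.
    by congr leb; apply/seteqP; split => w //= [].
  by rewrite (_ : mkset _ = set0) ?measure0//; apply/seteqP; split => w // [].
have /= -> := tonelli_set leb leb mE.
have mE' : measurable [set wu : 'cV[R]_(1 + (1 + k)) * U | L wu.2 /\ region H G (s *: wu.2) wu.1].
  apply: (@measurable_preimage_mx _ _ _ _ (fun wu : 'cV[R]_(1 + (1 + k)) * U => (wu.2, wu.1))
    [set uw | L uw.1 /\ region H G (s *: uw.1) uw.2]) => //.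
  by apply: measurable_fun_pair; [exact: measurable_snd|exact: measurable_fst].
rewrite integral_col_mx2//; last exact: (measurable_section leb mE').
have mcol y : measurable [set ux : U * 'M[R]_1 | L ux.1 /\ region H G (s *: ux.1) (col_mx ux.2 y)].
  have mf : measurable_fun setT (fun uw : U * 'M[R]_1 => (uw.1, col_mx uw.2 y)).
    apply: measurable_fun_pair; first exact: measurable_fst.
    apply: (measurableT_comp (f := fun x : 'M[R]_1 => col_mx x y)); last exact: measurable_snd.
    by apply: cts_measurable_mx; apply: cts_col_mx; [exact: cts_id|exact: cst_continuous].
  exact: (measurable_preimage_mx mf mE).
have swap y : (\int[leb]_(x in [set: 'M[R]_1]) leb [set u | L u /\ region H G (s *: u)%R (col_mx x y)] =
    \int[leb]_(u in L) leb [set x : 'M[R]_1 | region H G (s *: u)%R (col_mx x y)])%E.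
  have /= <- := tonelli_set leb leb (mcol y).
  rewrite [RHS]integral_mkcond; apply: eq_integral => u _; rewrite patchE.
  case: ifPn; rewrite ?inE ?notin_setE => Lu.
    by congr leb; apply/seteqP; split => w //= [].
  by rewrite (_ : mkset _ = set0) ?measure0//; apply/seteqP; split => w // [].
under eq_integral do rewrite swap.
have mq : measurable [set y | gauge W y < q s].
  rewrite (_ : mkset _ = dil (q s) G); first by apply: measurable_dil; exact: open_measurable_mx.
  by apply/funext => y; rewrite (dil_gauge_ball del_gt0 W_del W_rho).
have mC : measurable_fun setT (fun y : V => leb [set x : 'M[R]_1 | cone G (col_mx x y)]).
  have mc : measurable [set yx : V * 'M[R]_1 | cone G (col_mx yx.2 yx.1)].
    apply: (@measurable_preimage_mx _ _ _ _ (fun yx : V * 'M[R]_1 => col_mx yx.2 yx.1)); last exact: measurable_cone.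
    apply: (measurableT_comp (f := fun xy : 'M[R]_1 * V => col_mx xy.1 xy.2)
      (g := fun yx : V * 'M[R]_1 => (yx.2, yx.1))); first exact: measurable_col_mx.
    by apply: measurable_fun_pair; [exact: measurable_snd|exact: measurable_fst].
  exact: (measurable_section leb mc).
have c0 : 0 <= s `^ p * (1 + s * VL) by rewrite mulr_ge0 ?powR_ge0// addr_ge0// mulr_ge0// ltW.
apply: (@le_trans _ _ (\int[leb]_y (leb L * leb [set x : 'M[R]_1 | cone G (col_mx x y)] +
   (s `^ p * (1 + s * VL))%:E * (\1_[set y | (gauge W y < q s)%R] y)%:E))%E).
  apply: ge0_le_integral => //.
  - by move=> y _; exact: integral_ge0.
  - have mf : measurable_fun setT (fun w => leb [set u | L u /\ region H G (s *: u) w]).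
      exact: (measurable_section leb mE').
    have mfc := measurableT_comp mf (@measurable_col_mx R 1 (1 + k) 1).
    have mG := @measurable_fun_fubini_tonelli_G _ _ 'M[R]_1 V R leb _ mfc (fun=> measure_ge0 _ _).
    by apply: eq_measurable_fun mG => y _; exact: swap.
  - apply: emeasurable_funD; first by apply: emeasurable_funM => //; exact: measurable_cst.
    apply: emeasurable_funM; first exact: measurable_cst.
    by apply/measurable_EFinP; exact: measurable_indic.
  - by move=> y _; exact: integral_len_row.
rewrite ge0_integralD//; last 4 first.
- by move=> y _; rewrite mule_ge0.
- by apply: emeasurable_funM => //; exact: measurable_cst.
- by move=> y _; rewrite mule_ge0// lee_fin.
- by apply: emeasurable_funM; [exact: measurable_cst|apply/measurable_EFinP; exact: measurable_indic].
rewrite ge0_integralZl// ge0_integralZl//; last by apply/measurable_EFinP; exact: measurable_indic.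
rewrite integral_indic// setIT leeD//.
  by rewrite (leb_col_mx2 (measurable_cone oG)).
rewrite [in leRHS]EFinM lee_wpmul2l ?lee_fin//.
rewrite (_ : mkset _ = dil (q s) G); last by apply/funext => y; rewrite (dil_gauge_ball del_gt0 W_del W_rho).
have e : leb (dil (q s) G) = _ := leb_dil q0 (open_measurable_mx oG).
by rewrite [X in (X <= _)%E]e muln1 EFinM /v fineK ?ge0_fin_numE.
Qed.

End centroid_upper.

Section integral_monotone.
Local Open Scope ereal_scope.

(* No measurability is needed: the integral of a nonnegative function is a supremum over simple minorants. *)
Lemma ge0_le_integral_gen d (T : measurableType d) (R : realType) (mu : {measure set T -> \bar R})
    (D : set T) (f g : T -> \bar R) :
  (forall x, D x -> 0 <= f x) -> (forall x, D x -> f x <= g x) ->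
  \int[mu]_(x in D) f x <= \int[mu]_(x in D) g x.
Proof.
move=> f0 fg; have g0 x : D x -> 0 <= g x by move=> Dx; exact: le_trans (f0 _ Dx) (fg _ Dx).
rewrite !ge0_integralE//; apply: ereal_sup_le => _ [h hf <-].
exists h => // x; apply: le_trans (hf x) _.
by rewrite !patchE; case: ifPn; rewrite ?inE// => Dx; exact: fg.
Qed.

End integral_monotone.

Section unit_vector.
Context {R : realType}.

Definition unitv {n m} (y : 'M[R]_(n, m)) : 'M[R]_(n, m) := (frob y)^-1 *: y.

Lemma measurable_frobV n m : measurable_fun setT (fun y : 'M[R]_(n, m) => (frob y)^-1).
Proof.
apply: measurable_fun_gt => a; have [a0|a0] := ltP a 0.
  rewrite (_ : mkset _ = setT) //; apply/seteqP; split => // y _ /=.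
  by apply: lt_le_trans a0 _; rewrite invr_ge0 frob_ge0.
rewrite (_ : mkset _ = [set y : 'M[R]_(n, m) | 0 < frob y] `&` [set y | a * frob y < 1]); last first.
  apply/seteqP; split => y /=.
    move=> h; have : 0 < (frob y)^-1 by apply: le_lt_trans h.
    by rewrite invr_gt0 => fy; split => //; move: h; rewrite -ltr_pdivlMr// div1r.
  by move=> [fy]; rewrite -ltr_pdivlMr// div1r.
apply: measurableI; apply: open_measurable_mx; apply: open_lt; try exact: cst_continuous.
  by apply: cts_frob; exact: cts_id.
by apply: ctsM; [exact: cst_continuous|apply: cts_frob; exact: cts_id].
Qed.

Lemma measurable_unitv n m : measurable_fun setT (@unitv n m).
Proof.
apply: measurable_mx => i j; rewrite (_ : (fun y => _) = (fun y : 'M[R]_(n, m) => (frob y)^-1 * y i j)).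
  by apply: measurable_funM; [exact: measurable_frobV|exact: measurable_coord].
by apply/funext => y; rewrite mxE.
Qed.

Lemma unitv0 n m : unitv (0 : 'M[R]_(n, m)) = 0.
Proof. by rewrite /unitv scaler0. Qed.

Lemma frob_unitv n m (y : 'M[R]_(n, m)) : y != 0 -> frob (unitv y) = 1.
Proof.
move=> y0; have fy := frob_gt0 y0.
by rewrite /unitv frobZ gtr0_norm ?invr_gt0// mulVf// gt_eqF.
Qed.

Lemma frob_unitv_le1 n m (y : 'M[R]_(n, m)) : frob (unitv y) <= 1.
Proof. by have [->|y0] := eqVneq y 0; rewrite ?unitv0 ?frob0// frob_unitv. Qed.

End unit_vector.

(** * The lower estimate for the cone over a ball *)

Section ball_lower.
Context {R : realType} {k m : nat} (H : 'rV[R]_m -> R) (p M r : R).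
Notation V := 'cV[R]_(1 + k).
Notation U := 'M[R]_(1 + k, m).
Hypothesis p_gt1 : 1 < p.
Hypothesis M_ge0 : 0 <= M.
Hypothesis H_ge0 : forall w, 0 <= H w.
Hypothesis H_le : forall w, H w <= M * frob w `^ p.
Hypothesis H_hom : forall s w, 0 < s -> H (s *: w) = s `^ p * H w.
Hypothesis H_cts : continuous H.
Hypothesis H_sub : forall w0, exists y c, minorant H y c /\ inner w0 y - c = H w0.
Hypothesis r_gt0 : 0 < r.
Notation B := (@eball R (1 + k) 1 r).

(** By homogeneity v |-> s^p H(v / s) is [H] again, which rescales slopes by s^(p - 1) and costs by
    s^p. *)
Lemma minorant_scale s w c : 0 < s -> minorant H w c ->
  minorant H ((s `^ p / s) *: w) (s `^ p * c).
Proof.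
move=> s0 h v; have -> : H v = s `^ p * H (s^-1 *: v).
  by rewrite -H_hom// scalerA divff ?gt_eqF// scale1r.
by rewrite innerZr -mulrA -mulrBr -innerZl ler_pM2l ?powR_gt0.
Qed.

(** In the expansion of the squared norm the linear term lowers |y| by sg times the radial component
    of q, and the allowance [kap] absorbs the quadratic term. *)
Lemma frob_sub_le (y q : V) (sg tau kap : R) : 0 < sg -> 0 < kap -> sg * tau <= frob y ->
  sg * inner q q <= 2 * frob y * kap ->
  inner (unitv y) q - kap = tau -> frob (y - sg *: q) <= frob y - sg * tau.
Proof.
move=> sg0 k0 h1 h2 ht; rewrite -(@ler_pXn2r _ 2)// ?nnegrE ?frob_ge0 ?subr_ge0//.
rewrite sqr_frob innerBl !innerBr !innerZl !innerZr (innerC q y).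
have [y0|y0] := eqVneq y 0.
  by move: h1 h2 ht; rewrite y0 unitv0 frob0 !inner0l mulr0 mul0r; have := inner_ge0 q; nra.
have fy := frob_gt0 y0.
have yq : inner y q = frob y * (tau + kap).
  by rewrite -ht subrK /unitv innerZl mulVKf// gt_eqF.
by rewrite -sqr_frob yq; nra.
Qed.

(** The minorant touching [H] at (unitv y)^T u / r, rescaled to step s, shifts the cone so that over
    y it starts lower by nearly s^p times that value of [H]; [kap] is the loss. *)
Lemma slab_ball_ge y u kap : y != 0 -> frob y < r -> 0 < kap ->
  exists2 sg0 : R, 0 < sg0 & forall s, 0 < s -> s `^ p <= sg0 ->
   ((1 - frob y / r + s `^ p * (H (r^-1 *: ((unitv y)^T *m u)) - kap))%:E <=
     leb [set x : 'M[R]_1 | region H B (s *: u)%R (col_mx x y)])%E.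
Proof.
move=> y0 yr k0; have fy := frob_gt0 y0.
have [w [c [hwc hc]]] := H_sub (r^-1 *: ((unitv y)^T *m u)).
set h := H _ in hc *; pose q := u *m w^T; pose tau := inner (unitv y) q - kap * r.
have hq : inner (unitv y) q = r * (h + c).
  rewrite -hc subrK [in RHS]innerZl mulVKf ?gt_eqF// [RHS]innerC /inner /q [RHS]mxtrace_mulC mulmxA//.
have ft : tau = r * (h - kap + c) by rewrite /tau hq; ring.
(* Thresholds for s^p: [d1] makes the quadratic error at most the linear allowance, [d2] keeps the
   shortened norm nonnegative, and [d3] keeps the lower end of the vertical interval nonnegative. *)
pose d1 := 2 * frob y * (kap * r) / (inner q q + 1).
pose d2 := frob y / (`|tau| + 1).
pose d3 := frob y / r / (`|h - kap| + 1).
have qq : 0 < inner q q + 1 by rewrite ltr_wpDl ?inner_ge0.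
have d10 : 0 < d1 by rewrite divr_gt0// mulr_gt0 ?mulr_gt0.
have d20 : 0 < d2 by rewrite divr_gt0// ltr_wpDl.
have d30 : 0 < d3 by rewrite !divr_gt0// ltr_wpDl.
exists (Num.min d1 (Num.min d2 d3)); first by rewrite !lt_min d10 d20 d30.
move=> s s0; set sg := s `^ p; have sg0 : 0 < sg by rewrite /sg powR_gt0.
rewrite !le_min => /andP[s1 /andP[s2 s3]].
have e1 : sg * inner q q <= 2 * frob y * (kap * r).
  move: s1; rewrite /d1 ler_pdivlMr// => s1; apply: le_trans s1.
  by rewrite ler_pM2l// lerDl.
have e2 : sg * tau <= frob y.
  move: s2; rewrite /d2 ler_pdivlMr ?ltr_wpDl// => s2; apply: le_trans s2.
  by rewrite ler_pM2l//; apply: le_trans (ler_norm _) _; rewrite lerDl.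
have e3 : sg * (h - kap) <= frob y / r.
  move: s3; rewrite /d3 ler_pdivlMr ?ltr_wpDl// => s3; apply: le_trans s3.
  by rewrite ler_pM2l//; apply: le_trans (ler_norm _) _; rewrite lerDl.
have kr0 : 0 < kap * r by rewrite mulr_gt0.
have main := frob_sub_le sg0 kr0 e2 e1 (erefl : inner (unitv y) q - kap * r = tau).
set t := frob y / r - sg * (h - kap).
rewrite (_ : 1 - _ + _ = 1 - t); last by rewrite /t; ring.
have oB : open B by exact: open_eball.
apply: leb_itv_superset.
  apply: (@measurable_preimage_mx _ _ _ _ (fun x : 'M[R]_1 => col_mx x y)); last exact: measurable_region.
  by apply: cts_measurable_mx; apply: cts_col_mx; [exact: cts_id|exact: cst_continuous].
move=> x; set z : R := x 0 0 => /andP[tz z1].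
have z0 : 0 < z by apply: le_lt_trans tz; rewrite /t subr_ge0.
rewrite /region/= col_mxKu col_mxKd; split; first by apply/andP.
exists ((sg / s) *: w), (sg * c); split; first exact: minorant_scale.
have -> : s *: u *m ((sg / s) *: w)^T = sg *: q.
  have -> : ((sg / s) *: w)^T = (sg / s) *: w^T by apply/matrixP => i j; rewrite !mxE.
  by rewrite -scalemxAl -scalemxAr scalerA mulrC divfK ?gt_eqF.
have key : frob (y - sg *: q) < r * (z - sg * c).
  apply: le_lt_trans main _; rewrite ft.
  have : frob y / r * r = frob y by rewrite divfK ?gt_eqF.
  move: tz; rewrite /t -(ltr_pM2l r_gt0) => tz e; nra.
have zc : 0 < z - sg * c by rewrite -(pmulr_rgt0 _ r_gt0); apply: le_lt_trans key; exact: frob_ge0.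
split => //; rewrite /eball/= frobZ gtr0_norm ?invr_gt0// mulrC ltr_pdivrMr//.
Qed.

Notation s_ := (@harmonic R).

Let s_gt0 j : 0 < s_ j := harmonic_gt0 j.

Lemma s_small (e : R) : 0 < e -> exists N, forall j, (N <= j)%N -> s_ j <= e.
Proof.
move=> e0; have [N hN] : exists N, forall n, (N <= n)%N -> harmonic n < e.
  have /cvgrPdist_lt/(_ e e0)[N _ hN] := @cvg_harmonic R; exists N => n Nn.
  by have := hN n Nn; rewrite sub0r normrN ger0_norm ?invr_ge0.
by exists N => j /hN/ltW.
Qed.

Lemma s_powR_small (e : R) : 0 < e -> exists N, forall j, (N <= j)%N -> s_ j `^ p <= e.
Proof.
move=> e0; have [N hN] := s_small e0; exists N => j /hN; apply: le_trans.
have s1 : s_ j <= 1 by rewrite invf_le1// ler1n.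
have s0 := s_gt0 j.
by rewrite -[leRHS]powRr1 ?(ltW s0)// (@ger_powR _ (harmonic j)) ?s0 ?s1// ltW.
Qed.

Let oB : open B := @open_eball R (1 + k) 1 r.

Lemma leb_region_fin (G : set V) rho u : open G -> G `<=` eball rho -> (volF H G u < +oo)%E.
Proof.
move=> oG Gr; rewrite /volF.
pose D := rho + frob u * (1 + M).
apply: (@leb_sub_lty _ _ _ (1 + D)); last exact: measurable_region.
move=> w [/andP[w0 w1] hw]; have := slab_bound p_gt1 M_ge0 H_ge0 H_le Gr w1 hw.
rewrite -[w]vsubmxK /eball/= -/D => hD.
have D0 : 0 < D by apply: le_lt_trans hD; exact: frob_ge0.
rewrite -(@ltr_pXn2r _ 2)// ?nnegrE ?frob_ge0//; last by rewrite addr_ge0// ltW.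
rewrite sqr_frob_col_mx sqr_frob innerE big_ord1 big_ord1 -expr2.
have : frob (dsubmx w) ^+ 2 < D ^+ 2.
  by rewrite ltr_pXn2r// ?nnegrE ?frob_ge0 ?(ltW D0)//; move: hD; rewrite col_mxKd.
by have : (usubmx w 0 0 : R) ^+ 2 <= 1; [rewrite expr_le1// ltW|nra].
Qed.

Lemma leb_cone_fin (G : set V) rho : open G -> G `<=` eball rho -> (leb (cone G) < +oo)%E.
Proof.
move=> oG Gr; apply: le_lt_trans (leb_region_fin 0 oG Gr).
apply: le_measure; rewrite ?inE; [exact: measurable_cone|exact: measurable_region|].
exact: cone_region.
Qed.

Lemma measurable_col_len (A : set 'cV[R]_(1 + (1 + k))) : measurable A ->
  measurable_fun setT (fun y : V => leb [set x : 'M[R]_1 | A (col_mx x y)]).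
Proof.
move=> mA.
have mf : measurable_fun setT (fun yx : V * 'M[R]_1 => col_mx yx.2 yx.1).
  apply: (measurableT_comp (f := fun xy : 'M[R]_1 * V => col_mx xy.1 xy.2)
    (g := fun yx : V * 'M[R]_1 => (yx.2, yx.1))); first exact: measurable_col_mx.
  by apply: measurable_fun_pair; [exact: measurable_snd|exact: measurable_fst].
exact: (measurable_section leb (measurable_preimage_mx mf mA)).
Qed.

Lemma cone_len_le1 (G : set V) y : open G -> (leb [set x : 'M[R]_1 | cone G (col_mx x y)] <= 1)%E.
Proof.
move=> oG; rewrite -[1]subr0 EFinB; apply: leb_itv_subset => //.
  apply: (@measurable_preimage_mx _ _ _ _ (fun x : 'M[R]_1 => col_mx x y)); last exact: measurable_cone.
  by apply: cts_measurable_mx; apply: cts_col_mx; [exact: cts_id|exact: cst_continuous].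
by move=> x; rewrite /cone/= col_mxKu => -[/andP[/ltW-> /ltW->]].
Qed.

Lemma cone_ball_len y : frob y < r ->
  (leb [set x : 'M[R]_1 | cone B (col_mx x y)] <= (1 - frob y / r)%:E)%E.
Proof.
move=> yr; apply: leb_itv_subset.
- apply: (@measurable_preimage_mx _ _ _ _ (fun x : 'M[R]_1 => col_mx x y)); last exact: measurable_cone.
  by apply: cts_measurable_mx; apply: cts_col_mx; [exact: cts_id|exact: cst_continuous].
- by rewrite ler_pdivrMr// mul1r ltW.
move=> x; rewrite /cone/= col_mxKu col_mxKd => -[/andP[x0 x1] [_ ]].
rewrite /eball/= frobZ gtr0_norm ?invr_gt0// mulrC ltr_pdivrMr// => h.
by rewrite (ltW x1) andbT ler_pdivrMr// ltW// mulrC.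
Qed.

(** Fatou's lemma in y, applied to the vertical gain divided by s^p: each y of the punctured ball
    contributes in the limit at least the value of [H] minus [kap], for every [kap]. *)
Lemma ball_liminf u :
  (\int[leb]_(y in B) (H (r^-1 *: ((unitv y)^T *m u)))%:E <=
   limn_einf (fun j => ((s_ j `^ p)^-1)%:E * (volF H B (s_ j *: u)%R - leb (cone B))))%E.
Proof.
pose D y := leb [set x : 'M[R]_1 | cone B (col_mx x y)].
pose S j y := leb [set x : 'M[R]_1 | region H B (s_ j *: u) (col_mx x y)].
have mD : measurable_fun setT D by apply: measurable_col_len; exact: measurable_cone.
have mS j : measurable_fun setT (S j) by apply: measurable_col_len; exact: measurable_region.
have Dfin y : D y \is a fin_num.
  by rewrite ge0_fin_numE//; apply: le_lt_trans (cone_len_le1 y oB) (ltry _).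
have DS j y : (D y <= S j y)%E.
  apply: le_measure; rewrite ?inE.
  - apply: (@measurable_preimage_mx _ _ _ _ (fun x : 'M[R]_1 => col_mx x y)); last exact: measurable_cone.
    by apply: cts_measurable_mx; apply: cts_col_mx; [exact: cts_id|exact: cst_continuous].
  - apply: (@measurable_preimage_mx _ _ _ _ (fun x : 'M[R]_1 => col_mx x y)); last exact: measurable_region.
    by apply: cts_measurable_mx; apply: cts_col_mx; [exact: cts_id|exact: cst_continuous].
  by move=> x; exact: cone_region.
pose g j y := (((s_ j `^ p)^-1)%:E * (S j y - D y))%E.
have g0 j y : (0 <= g j y)%E.
  by rewrite mule_ge0 ?lee_fin ?invr_ge0 ?powR_ge0// sube_ge0// Dfin.
have mSD j : measurable_fun setT (fun y => S j y - D y)%E by exact: emeasurable_funB.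
have mg j : measurable_fun setT (g j) by apply: emeasurable_funM => //; exact: measurable_cst.
have Dint : (\int[leb]_y D y = leb (cone B))%E by rewrite (leb_col_mx2 (measurable_cone oB)).
have Cfin : leb (cone B) \is a fin_num by rewrite ge0_fin_numE// (leb_cone_fin oB (fun=> id)).
have gint j : (\int[leb]_y g j y =
    ((s_ j `^ p)^-1)%:E * (volF H B (s_ j *: u)%R - leb (cone B)))%E.
  rewrite ge0_integralZl//; [|by move=> y _; rewrite sube_ge0// Dfin|by rewrite lee_fin invr_ge0 powR_ge0].
  congr (_ * _)%E; rewrite -Dint.
  have <- : (\int[leb]_y (S j y - D y) + \int[leb]_y D y = volF H B (s_ j *: u)%R)%E.
    rewrite -ge0_integralD//; last by move=> y _; rewrite sube_ge0// Dfin.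
    rewrite /volF (leb_col_mx2 (measurable_region _ _ oB)).
    by apply: eq_integral => y _; rewrite subeK.
  by rewrite addeK// Dint.
rewrite (_ : (fun j => _) = (fun j => \int[leb]_y g j y)%E); last by apply/funext => j; rewrite gint.
apply: le_trans (fatou leb measurableT mg (fun j y _ => g0 j y)).
rewrite [leLHS]integral_mkcond; apply: ge0_le_integral_gen => [y _|].
  by rewrite erestrict_ge0// => x _; rewrite lee_fin.
move=> y _; rewrite patchE; case: ifPn; rewrite ?inE ?notin_setE => yr; last first.
  by apply: le_limn_einf => x x0; exists 0%N => j _; exact: le_trans (ltW x0) (g0 _ _).
have [->|y0] := eqVneq y 0.
  rewrite unitv0 trmx0 mul0mx scaler0 (H0 p_gt1 H_ge0 H_le).
  by apply: le_limn_einf => x x0; exists 0%N => j _; exact: le_trans (ltW x0) (g0 _ _).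
apply: le_limn_einf => x; rewrite lte_fin => hx.
have kap0 : 0 < H (r^-1 *: ((unitv y)^T *m u)) - x by rewrite subr_gt0.
have [sg0 sg0_gt0 hs] := slab_ball_ge u y0 yr kap0.
have [N hN] := s_powR_small sg0_gt0; exists N => j /hN/(hs _ (s_gt0 j)).
rewrite subKr => h; have sp : 0 < s_ j `^ p by rewrite powR_gt0// s_gt0.
rewrite /g muleC lee_pdivlMr// -EFinM.
have := cone_ball_len yr; rewrite -/(D y) -(fineK (Dfin y)).
have S0 : (0 <= S j y)%E by exact: measure_ge0.
move: h; rewrite -/(S j y); have [Sf|] := boolP (S j y \is a fin_num).
  by rewrite -(fineK Sf) -EFinB !lee_fin => h1 h2; lra.
by rewrite ge0_fin_numE// ltey negbK => /eqP ->; rewrite addye ?leey.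
Qed.

End ball_lower.

(** * Passage to the limit and the bathtub inequality *)

Section centroid.
Context {R : realType} {k m : nat} (H : 'rV[R]_(1 + m) -> R) (p M del rho Rr r : R).
Notation V := 'cV[R]_(1 + k).
Notation U := 'M[R]_(1 + k, 1 + m).
Variables (W : set V) (L : set U).
Hypothesis p_gt1 : 1 < p.
Hypothesis M_ge0 : 0 <= M.
Hypothesis H_ge0 : forall w, 0 <= H w.
Hypothesis H_le : forall w, H w <= M * frob w `^ p.
Hypothesis H_hom : forall s w, 0 < s -> H (s *: w) = s `^ p * H w.
Hypothesis H_cts : continuous H.
Hypothesis H_sub : forall w0, exists y c, minorant H y c /\ inner w0 y - c = H w0.
Hypothesis r_gt0 : 0 < r.
Hypothesis del_gt0 : 0 < del.
Hypothesis W_del : eball del `<=` W.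
Hypothesis W_rho : W `<=` eball rho.
Hypothesis mL : measurable L.
Hypothesis L_sub : L `<=` eball Rr.
Hypothesis W_int : forall xi, W xi -> (\int[leb]_(u in L) (H (xi^T *m u))%:E <= 1)%E.
Notation G := (gauge_ball W).
Notation B := (@eball R (1 + k) 1 r).
Hypothesis G_ball : leb G = leb B.
Notation s_ := (@harmonic R).

Let oG : open G := open_gauge_ball del_gt0 W_del W_rho.
Let oB : open B := @open_eball R (1 + k) 1 r.
Let C := leb (cone G).
Let BR : set U := eball Rr.
Let CB : leb (cone B) = C. Proof. by rewrite (leb_cone_eq oB oG). Qed.
Let sp j : 0 < s_ j `^ p. Proof. by rewrite powR_gt0// harmonic_gt0. Qed.
Let mBR : measurable BR. Proof. exact: measurable_eball. Qed.
Let G_sub : G `<=` eball (2 / del). Proof. exact: gauge_ball_sub W_rho. Qed.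
Let C_fin : C \is a fin_num.
Proof.
rewrite /C ge0_fin_numE//; exact: (leb_cone_fin p_gt1 M_ge0 H_ge0 H_le oG G_sub).
Qed.
Let L_fin : (leb L < +oo)%E.
Proof.
apply: le_lt_trans (leb_eball_lty (1 + k) (1 + m) Rr).
by apply: le_measure; rewrite ?inE.
Qed.

(** The difference quotient at step [s_ j]; its truncated integrals for the ball and for [G] are
    compared before the limit is taken. *)
Let F (A : set V) j u := (s_ j `^ p)^-1 * (fine (volF H A (s_ j *: u)) - fine C).

Let volF_fin (A : set V) rho' u : open A -> A `<=` eball rho' -> volF H A u \is a fin_num.
Proof.
by move=> oA Ar; rewrite ge0_fin_numE// (leb_region_fin p_gt1 M_ge0 H_ge0 H_le _ oA Ar).
Qed.

Let C_le (A : set V) u : open A -> leb (cone A) = C -> (C <= volF H A u)%E.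
Proof.
move=> oA <-; apply: le_measure; rewrite ?inE; [exact: measurable_cone|exact: measurable_region|].
exact: cone_region.
Qed.

Let F_ge0 (A : set V) rho' j u : open A -> A `<=` eball rho' -> leb (cone A) = C -> 0 <= F A j u.
Proof.
move=> oA Ar cA; rewrite /F mulr_ge0 ?invr_ge0 ?powR_ge0// subr_ge0 fine_le//.
  exact: volF_fin oA Ar.
exact: C_le.
Qed.

Let measurable_F (A : set V) j : open A -> measurable_fun setT (F A j).
Proof.
move=> oA; apply: measurable_funM => //; apply: measurable_funB => //.
apply: (measurableT_comp (f := fine)); first exact: fine_measurable.
apply: (measurableT_comp (measurable_volF H oA)).
by apply: cts_measurable_mx; apply: cts_mxZ; [exact: cst_continuous|exact: cts_id].
Qed.

Let F_le (A : set V) rho' j z : open A -> A `<=` eball rho' ->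
  [set u | BR u /\ F A j u <= z] = sublevel H A (s_ j) Rr (s_ j `^ p * z + fine C).
Proof.
move=> oA Ar; apply/seteqP; split => u [hu]; rewrite /F.
  rewrite ler_pdivrMl ?invr_gt0// lerBlDr => h; split => //.
  by rewrite -(fineK (volF_fin _ oA Ar)) lee_fin.
rewrite -(fineK (volF_fin _ oA Ar)) lee_fin => h; split => //.
by rewrite ler_pdivrMl ?invr_gt0// lerBlDr.
Qed.

Let min_compare j l : 0 <= l ->
  (\int[leb]_(u in BR) (Num.min (F B j u) l)%:E <= \int[leb]_(u in BR) (Num.min (F G j u) l)%:E)%E.
Proof.
move=> l0; have Bid : B `<=` eball r by [].
apply: integral_min_le => //.
- exact: leb_eball_lty.
- exact: measurable_F.
- exact: measurable_F.
- by move=> u; exact: F_ge0 oB Bid CB.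
- by move=> u; exact: F_ge0 oG G_sub erefl.
move=> z; rewrite (F_le _ _ oB Bid) (F_le _ _ oG G_sub).
have rr : r <= Num.max r (2 / del) by rewrite le_max lexx.
apply: (sublevel_ball p_gt1 M_ge0 H_ge0 H_le _ _ _ r_gt0 rr oG) => //.
  exact: (gauge_ball_convex del_gt0 W_del W_rho).
by move=> x /G_sub; rewrite /eball/= => h; rewrite lt_max h orbT.
Qed.

Let v := fine (leb G).
Let G_fin : (leb G < +oo)%E. Proof. exact: (leb_sub_lty G_sub (open_measurable_mx oG)). Qed.
(** The excess bound of [volF_upper] divided by s^p; it tends to |G| as s tends to 0. *)
Let q s := (1 + s * fine (leb L)) * (1 + s `^ p * (M * (rho * Rr) `^ p) + s `^ p * s) ^+ (1 + k) * v.

Let upper j l : 0 <= l ->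
  (\int[leb]_(u in BR) (Num.min (F G j u) l)%:E <= (q (s_ j))%:E + l%:E * leb (BR `\` L))%E.
Proof.
move=> l0; have mBL : measurable (BR `\` L) by exact: measurableD.
have LB : BR = L `|` (BR `\` L) by rewrite setDE setUIr setUCr setIT setUidr.
have F0 u : 0 <= F G j u by exact: F_ge0 oG G_sub erefl.
rewrite [in leLHS]LB ge0_integral_setU//; last 3 first.
- rewrite -LB; apply: (measurable_funS measurableT) => //.
  by apply/measurable_EFinP; apply: measurable_minr => //; exact: measurable_F.
- by move=> u _; rewrite lee_fin le_min F0.
- by apply/disj_setPS => u [Lu []].
apply: leeD; last first.
  rewrite -integral_cst//; apply: ge0_le_integral_gen => u _; first by rewrite lee_fin le_min F0.
  by rewrite lee_fin ge_min lexx orbT.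
apply: (@le_trans _ _ (\int[leb]_(u in L) (F G j u)%:E)%E).
  apply: ge0_le_integral_gen => u _; first by rewrite lee_fin le_min F0.
  by rewrite lee_fin ge_min lexx.
have sj := harmonic_gt0 (R := R) j.
have up := volF_upper p_gt1 M_ge0 H_ge0 H_le H_hom H_cts del_gt0 W_del W_rho mL L_sub W_int L_fin G_fin sj.
have mF : measurable_fun L (fun u => (F G j u)%:E).
  apply: (measurable_funS measurableT) => //; apply/measurable_EFinP; exact: measurable_F.
have e : (\int[leb]_(u in L) volF H G (s_ j *: u)%R =
    (s_ j `^ p)%:E * \int[leb]_(u in L) (F G j u)%:E + C * leb L)%E.
  rewrite -ge0_integralZl//; [|by move=> u _; rewrite lee_fin|by rewrite lee_fin ltW].
  rewrite -integral_cst// -ge0_integralD//; last 2 first.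
  - by move=> u _; rewrite -EFinM lee_fin mulr_ge0// ltW.
  - by apply: emeasurable_funM => //; exact: measurable_cst.
  apply: eq_integral => u _.
  rewrite -(fineK C_fin) -(fineK (volF_fin _ oG G_sub)) -EFinM -EFinD; congr _%:E.
  by rewrite /F mulVKf ?gt_eqF// subrK.
have Lf : leb L \is a fin_num by rewrite ge0_fin_numE.
have LCf : (C * leb L)%E \is a fin_num by rewrite fin_numM.
move: up; rewrite e -/C (muleC (leb L)) [X in (X <= _)%E]addeC leeD2lE//.
rewrite -lee_pdivlMl// => h; apply: le_trans h _.
by rewrite -EFinM lee_fin -!mulrA mulKf ?gt_eqF// /q -!mulrA.
Qed.

Let q_small (e : R) : 0 < e -> exists N, forall j, (N <= j)%N -> q (s_ j) <= v + e.
Proof.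
move=> e0; pose K := `|M * (rho * Rr) `^ p| + 1.
have K0 : 0 <= K by rewrite addr_ge0.
have v0 : 0 <= v by rewrite fine_ge0.
have VL0 : 0 <= fine (leb L) by rewrite fine_ge0.
pose b (s : R) := (1 + s * fine (leb L)) * (1 + s * K) ^+ (1 + k) * v.
have bc : (b (s_ j) @[j --> \oo] --> v)%classic.
  have -> : v = b 0 by rewrite /b !mul0r addr0 expr1n !mul1r.
  have cb : continuous b.
    move=> s; apply: cvgM; last exact: cvg_cst.
    apply: cvgM; first by apply: cvgD; [exact: cvg_cst|apply: cvgM; [exact: cvg_id|exact: cvg_cst]].
    apply: (@continuous_comp _ _ _ (fun s : R => 1 + s * K) (fun x => x ^+ (1 + k))).
      by apply: cvgD; [exact: cvg_cst|apply: cvgM; [exact: cvg_id|exact: cvg_cst]].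
    exact: exprn_continuous.
  by apply: continuous_cvg; [exact: cb|exact: cvg_harmonic].
move/cvgrPdist_lt : bc => /(_ e e0)[N _ hN]; exists N => j Nj.
have : b (s_ j) <= v + e by have := hN j Nj; rewrite ltr_distlC => /andP[_ /ltW].
apply: le_trans; rewrite /q /b ler_wpM2r// ler_wpM2l//.
  by rewrite addr_ge0// mulr_ge0// harmonic_ge0.
have s0 := harmonic_gt0 (R := R) j.
have s1 : s_ j <= 1 by rewrite /harmonic/= invf_le1// ler1n.
have sps : s_ j `^ p <= s_ j.
  by rewrite -[leRHS]powRr1 ?(ltW s0)// (@ger_powR _ (s_ j)) ?s0 ?s1// ltW.
have M0 : 0 <= M * (rho * Rr) `^ p by rewrite mulr_ge0 ?powR_ge0.
rewrite lerXn2r ?nnegrE//.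
- by rewrite !addr_ge0// ?mulr_ge0 ?powR_ge0// ltW.
- by rewrite addr_ge0// mulr_ge0// ltW.
rewrite -addrA lerD2l /K (ger0_norm M0) mulrDr mulr1 lerD//; first by rewrite ler_wpM2r.
rewrite -[leRHS]mulr1; apply: ler_pM => //; rewrite ?powR_ge0// ltW//.
Qed.

(** On [L] the difference quotients for [G] integrate to at most |G| in the limit; off [L] they are
    bounded by the truncation level. The ball has larger sublevel sets at each step, hence smaller
    truncated integrals, and Fatou's lemma bounds the limit for the ball from below. *)
Theorem centroid_bathtub (l : R) : 0 <= l ->
  (\int[leb]_(u in eball Rr)
      mine (\int[leb]_(y in B) (H (r^-1 *: ((unitv y)^T *m u)))%:E) l%:E <=
   leb G + l%:E * leb (eball Rr `\` L))%E.
Proof.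
move=> l0; have Bid : B `<=` eball r by [].
have BLf : leb (BR `\` L) \is a fin_num.
  rewrite ge0_fin_numE//; apply: le_lt_trans (leb_eball_lty (1 + k) (1 + m) Rr).
  by apply: le_measure; rewrite ?inE//; try exact: measurableD; move=> x [].
have F0 j u : 0 <= F B j u by exact: F_ge0 oB Bid CB.
pose f j u := (Num.min (F B j u) l)%:E.
have mf j : measurable_fun BR (f j).
  apply: (measurable_funS measurableT) => //.
  by apply/measurable_EFinP; apply: measurable_minr => //; exact: measurable_F.
have f0 j u : BR u -> (0 <= f j u)%E by rewrite lee_fin le_min F0.
have Gf : leb G \is a fin_num by rewrite ge0_fin_numE.
rewrite -(fineK Gf) -/v -(fineK BLf) -EFinM -EFinD.
apply: (@le_trans _ _ (limn_einf (fun j => \int[leb]_(u in BR) f j u)))%E; last first.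
  apply: limn_einf_le => e e0; have [N hN] := q_small e0; exists N => j /hN hq.
  apply: le_trans (min_compare j l0) _; apply: le_trans (upper j l0) _.
  by rewrite -(fineK BLf) -EFinM -EFinD lee_fin; lra.
apply: le_trans (fatou leb mBR mf f0).
apply: ge0_le_integral_gen => u _.
  by rewrite le_min integral_ge0//= ?lee_fin// => y _; rewrite lee_fin.
have low := ball_liminf p_gt1 M_ge0 H_ge0 H_le H_hom H_sub r_gt0 u.
apply: le_limn_einf => x; rewrite lt_min lte_fin => /andP[x1 x2].
have [N hN] := limn_einf_gt (lt_le_trans x1 low); exists N => j /hN.
rewrite CB /f lee_fin le_min (ltW x2) andbT.
by rewrite -(fineK C_fin) -(fineK (volF_fin _ oB Bid)) -EFinB -EFinM lee_fin.
Qed.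

End centroid.

(** * The isocapacitary inequality for a gauge *)

Section calculus.
Context {R : realType} {k : nat}.
Notation V := 'cV[R]_(1 + k).
Implicit Types f g : V -> R.

Lemma derive_inner f x v : differentiable f x -> 'D_v f x = inner (grad f x) v.
Proof.
move=> df; rewrite deriveE// [in LHS](matrix_sum_delta v) linear_sum innerE [RHS]big_ord1.
apply: eq_bigr => i _; rewrite big_ord1 linearZ /= -deriveE// !mxE mulrC.
by rewrite -[ord0]/(0 : 'I_1).
Qed.

Lemma mean_value f x v : (forall x, differentiable f x) ->
  exists2 t : R, 0 < t < 1 & f (x + v) - f x = inner (grad f (x + t *: v)) v.
Proof.
move=> df; pose phi (t : R) := f (x + t *: v).
have qE (t : R) : (fun h : R => h^-1 *: ((phi \o shift t) (h *: 1) - phi t)) =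
    (fun h : R => h^-1 *: ((f \o shift (x + t *: v)) (h *: v) - f (x + t *: v))).
  apply/funext => h /=; congr (_ *: (f _ - _)).
  by rewrite /= scalerDl addrCA [h *: 1]mulr1.
have dphi (t : R) : is_derive t 1 phi ('D_v f (x + t *: v)).
  apply: DeriveDef; last by rewrite /derive qE.
  rewrite /derivable qE; exact: diff_derivable.
have cphi : {within `[0, 1], continuous phi}.
  by apply: derivable_within_continuous => t _; case: (dphi t).
have [t t01] := MVT ltr01 (fun t _ => dphi t) cphi.
rewrite /phi scale1r scale0r addr0 subr0 mulr1 => ->; exists t; first by rewrite in_itv/= in t01.
exact: derive_inner.
Qed.

Lemma compact_cts_bounded (g : V -> R) (A : set V) : compact A -> continuous g ->
  exists2 C : R, 0 < C & forall x, A x -> `|g x| <= C.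
Proof.
move=> cA cg; have := compact_bounded (continuous_compact (continuous_subspaceT cg) cA).
move=> [C [_ hC]]; exists (`|C| + 1); first by rewrite ltr_wpDl.
move=> x Ax; apply: (hC (`|C| + 1)); last by exists x.
by rewrite (le_lt_trans (ler_norm _))// ltrDl.
Qed.

Lemma derive_support f (A : set V) v x : closed A -> (forall x, ~ A x -> f x = 0) -> ~ A x ->
  'D_v f x = 0.
Proof.
move=> cA fA nAx; rewrite -[RHS](derive_cst (0 : R) x v).
apply: near_eq_derive.
have oA : open (~` A) by rewrite openC.
by apply: filterS (open_nbhs_nbhs (conj oA nAx)) => y /fA.
Qed.

Lemma frob_bounded_col (w : V) (C : R) : (forall i, `|w i 0| <= C) -> frob w <= C * (1 + k)%:R.
Proof.
move=> h; have := @frob_le_coord _ _ _ w C; rewrite muln1 mulrC; apply => i j.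
by rewrite ord1.
Qed.

Lemma lipschitz f (C : R) x v : (forall x, differentiable f x) -> (forall x, frob (grad f x) <= C) ->
  `|f (x + v) - f x| <= C * frob v.
Proof.
move=> df gC; have [t _ ->] := mean_value x v df.
have up w : inner w v <= frob w * frob v := inner_le_frob w v.
rewrite ler_norml; apply/andP; split.
  rewrite lerNl -innerNl; apply: le_trans (up _) _.
  by rewrite frobN ler_wpM2r ?frob_ge0.
by apply: le_trans (up _) _; rewrite ler_wpM2r ?frob_ge0.
Qed.

Lemma cts_grad f : (forall v, continuous ('D_v f)) -> continuous (grad f).
Proof.
move=> cD; apply/continuous_mxP => i j.
rewrite (_ : (fun x => _) = 'D_(delta_mx i 0) f)//.
by apply/funext => x; rewrite mxE.
Qed.

Section Cc.
Variable f : V -> R.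
Hypothesis fC : Cc_infty f.

Lemma Cc_differentiable x : differentiable f x.
Proof. by have [/(_ 1%N)[]] := fC. Qed.

Lemma Cc_continuous : continuous f.
Proof. by have [/(_ 0%N)] := fC. Qed.

Lemma Cc_grad_continuous : continuous (grad f).
Proof. by apply: cts_grad => v; have [/(_ 1%N)[_ /(_ v)]] := fC. Qed.

Let K := closure [set x | f x != 0].
Let K_closed : closed K := @closed_closure _ _.
Let f_out x : ~ K x -> f x = 0.
Proof. by move=> nK; apply/eqP/negPn/negP => h; apply: nK; exact: subset_closure. Qed.

Lemma Cc_support : exists2 rho : R, 0 < rho & forall x, f x != 0 -> frob x < rho.
Proof.
have [C C0 hC] := compact_cts_bounded fC.2 (cts_frob (@cts_id _)).
exists (C + 1); first by rewrite ltr_wpDl// ltW.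
move=> x fx; have := hC x (@subset_closure _ [set x | f x != 0] _ fx).
by rewrite ger0_norm ?frob_ge0// => h; apply: le_lt_trans h _; rewrite ltrDl.
Qed.

Lemma Cc_bounded g : continuous g -> (forall x, ~ K x -> g x = 0) ->
  exists2 C : R, 0 < C & forall x, `|g x| <= C.
Proof.
move=> cg gK; have [C C0 hC] := compact_cts_bounded fC.2 cg; exists C => // x.
by have [/hC//|/gK->] := pselect (K x); rewrite normr0 ltW.
Qed.

Lemma Cc_bounded_family (g : 'I_(1 + k) -> V -> R) : (forall i, continuous (g i)) ->
  (forall i x, ~ K x -> g i x = 0) -> exists2 C : R, 0 < C & forall i x, `|g i x| <= C.
Proof.
move=> cg gK.
have /choice[C hC] i : exists C : R, 0 < C /\ forall x, `|g i x| <= C.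
  by have [C C0 hC] := Cc_bounded (cg i) (gK i); exists C.
exists (\sum_i C i); first by rewrite (bigD1 0)//= ltr_pwDl ?(hC 0).1// sumr_ge0// => i _; rewrite ltW// (hC i).1.
move=> i x; apply: le_trans ((hC i).2 x) _.
by rewrite (bigD1 i)//= lerDl sumr_ge0// => j _; rewrite ltW// (hC j).1.
Qed.

Lemma Cc_grad_bounded : exists2 C : R, 0 < C & forall x, frob (grad f x) <= C.
Proof.
have [C C0 hC] := @Cc_bounded_family (fun i => 'D_(delta_mx i 0) f)
  (fun i => (fC.1 1%N).2 _) (fun i x => @derive_support f K _ x K_closed f_out).
exists (C * (1 + k)%:R); first by rewrite mulr_gt0.
by move=> x; apply: frob_bounded_col => i; rewrite mxE.
Qed.

Lemma Cc_grad_lipschitz : exists2 C : R, 0 < C &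
  forall x v, frob (grad f (x + v) - grad f x) <= C * frob v.
Proof.
have d1 i : forall x, differentiable ('D_(delta_mx i 0) f : V -> R) x.
  by move=> x; exact: ((fC.1 2%N).2 (delta_mx i 0)).1.
have out1 i : forall x, ~ K x -> 'D_(delta_mx i 0) f x = 0.
  by move=> x; apply: derive_support.
have /choice[C hC] i : exists C : R, 0 < C /\ forall x, frob (grad ('D_(delta_mx i 0) f) x) <= C.
  have [C C0 hC] := @Cc_bounded_family (fun j => 'D_(delta_mx j 0) ('D_(delta_mx i 0) f))
    (fun j => ((fC.1 2%N).2 (delta_mx i 0)).2 _) (fun j x => @derive_support _ K _ x K_closed (out1 i)).
  exists (C * (1 + k)%:R); split; first by rewrite mulr_gt0.
  by move=> x; apply: frob_bounded_col => j; rewrite mxE.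
pose S := \sum_i C i.
have CS i : C i <= S by rewrite /S (bigD1 i)//= lerDl sumr_ge0// => j _; rewrite ltW// (hC j).1.
have S0 : 0 < S by apply: lt_le_trans (CS 0); exact: (hC 0).1.
exists (S * (1 + k)%:R); first by rewrite mulr_gt0.
move=> x v; rewrite mulrAC; apply: frob_bounded_col => i; rewrite !mxE.
apply: le_trans (lipschitz x v (d1 i) (hC i).2) _.
by rewrite ler_wpM2r ?frob_ge0.
Qed.

(** The constant is uniform in x because the second derivatives have compact support; the slack
    [kap] in the level set estimate will absorb the remainder. *)
Lemma Cc_taylor : exists2 C : R, 0 < C &
  forall x v, f (x + v) <= f x + inner (grad f x) v + C * frob v ^+ 2.
Proof.
have [C C0 hC] := Cc_grad_lipschitz; exists C => // x v.
have [t /andP[t0 t1] h] := mean_value x v Cc_differentiable.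
have : inner (grad f (x + t *: v) - grad f x) v <= C * frob v ^+ 2.
  apply: le_trans (inner_le_frob _ _) _; rewrite expr2 mulrA ler_wpM2r ?frob_ge0//.
  apply: le_trans (hC _ _) _; rewrite ler_pM2l// frobZ gtr0_norm//.
  by rewrite ler_piMl ?frob_ge0// ltW.
by rewrite innerBl -h; lra.
Qed.

End Cc.
End calculus.

(** The tangent to t^p at [sg], obtained from Young's inequality with the conjugate exponent p / (p
    - 1). *)
Lemma young_tangent {R : realType} (p x sg : R) : 1 < p -> 0 <= x -> 0 <= sg ->
  p * sg `^ (p - 1) * x <= x `^ p + (p - 1) * sg `^ p.
Proof.
move=> p1 x0 s0; have p0 : 0 < p by apply: lt_trans p1.
have q0 : 0 < p - 1 by rewrite subr_gt0.
have := @conjugate_powR R x (sg `^ (p - 1)) p (p / (p - 1)) x0 (powR_ge0 _ _) p0.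
rewrite divr_gt0// => /(_ isT); rewrite -powRrM mulrCA divff ?gt_eqF// mulr1 invf_div.
have -> : p^-1 + (p - 1) / p = 1 by field; rewrite gt_eqF.
move=> /(_ erefl); rewrite -(ler_pM2l p0).
have -> : p * (x `^ p / p + sg `^ p * ((p - 1) / p)) = x `^ p + (p - 1) * sg `^ p.
  by field; rewrite gt_eqF.
by rewrite -mulrA (mulrC x).
Qed.

Lemma powRDp {R : realType} (x a b : R) : 0 < x -> x `^ (a + b) = x `^ a * x `^ b.
Proof. by move=> x0; rewrite powRD// (gt_eqF x0) implybT. Qed.

(** The tangent at x to the convex function t^(1 - g); it follows from [young_tangent] applied to
    powers of z = y / x. *)
Lemma powR_neg_tangent {R : realType} (g x y : R) : 1 < g -> 0 < x -> 0 < y ->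
  (g - 1) * (x `^ (- g) * (x - y)) <= y `^ (1 - g) - x `^ (1 - g).
Proof.
move=> g1 x0 y0; have g0 : 0 < g by apply: lt_trans g1.
pose z := y / x; have z0 : 0 < z by rewrite divr_gt0.
have := @young_tangent R g (z `^ ((1 - g) / g)) (z `^ g^-1) g1 (powR_ge0 _ _) (powR_ge0 _ _).
rewrite -!powRrM divfK ?gt_eqF// mulVf ?gt_eqF// powRr1 ?(ltW z0)// -mulrA -powRDp//.
rewrite (_ : g^-1 * (g - 1) + (1 - g) / g = 0); last by field; rewrite gt_eqF.
rewrite powRr0 mulr1 => h.
have xy : y `^ (1 - g) = x `^ (1 - g) * z `^ (1 - g).
  by rewrite -powRM ?ltW// /z mulrCA divff ?mulr1// gt_eqF.
have xx : x `^ (- g) * x = x `^ (1 - g).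
  by rewrite -[in X in _ * X](powRr1 (ltW x0)) -powRDp// addrC.
have yE : y = x * z by rewrite /z mulrCA divff ?mulr1// gt_eqF.
have -> : x `^ (- g) * (x - y) = x `^ (1 - g) * (1 - z) by rewrite yE -xx; ring.
rewrite xy; have := ler_wpM2l (powR_ge0 x (1 - g)) h; lra.
Qed.

Lemma powR_ge_ln {R : realType} (x a : R) : 0 < x -> 1 + a * ln x <= x `^ a.
Proof. by move=> x0; rewrite /powR gt_eqF//; exact: expR_ge1Dx. Qed.

(** One step of a telescoping sum over levels. The slope lam vs^(- a / (p - 1)) has p-th power lam^p
    vs^(- g), controlled by differences of v^(1 - g) / (g - 1), while its (p - 1)-th power turns
    vt^a into (vt / vs)^a >= 1 + a ln (vt / vs); the logarithms telescope as well. *)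
Lemma level_step {R : realType} (p a g lam c d vs vt J l1 w1 : R) : 1 < p -> g = a * p / (p - 1) ->
  1 < g -> 0 < lam -> 0 <= c -> 0 <= d -> 0 < vs -> 0 < vt ->
  (p * lam `^ (p - 1) * c * d) * (J + 1 - 1 + a * (ln vt - l1))
    - (p - 1) * lam `^ p * ((vt `^ (1 - g) - w1) / (g - 1)) <=
  (p * lam `^ (p - 1) * c * d) * (J - 1 + a * (ln vs - l1))
    - (p - 1) * lam `^ p * ((vs `^ (1 - g) - w1) / (g - 1)) +
  (p * (lam * vs `^ (- (a / (p - 1)))) `^ (p - 1) * (d * (c * vt `^ a))
    - (p - 1) * (lam * vs `^ (- (a / (p - 1)))) `^ p * (vs - vt)).
Proof.
move=> p1 gE g1 lam0 c0 d0 vs0 vt0; have p0 : 0 < p - 1 by rewrite subr_gt0.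
have pp : 0 < p by apply: lt_trans p1.
have g0 : 0 < g - 1 by rewrite subr_gt0.
rewrite !powRM ?powR_ge0 ?(ltW lam0)// -!powRrM !mulNr divfK ?gt_eqF// [a / (p - 1) * p]mulrAC -gE.
have h1 : 1 + a * (ln vt - ln vs) <= vs `^ (- a) * vt `^ a.
  have := @powR_ge_ln R (vt / vs) a (divr_gt0 vt0 vs0).
  rewrite ln_div ?posrE// powRM ?invr_ge0 ?(ltW vt0) ?(ltW vs0)// -powR_inv1 ?(ltW vs0)// -powRrM mulN1r.
  by rewrite [X in _ <= X]mulrC.
have h2 := powR_neg_tangent g1 vs0 vt0; rewrite -ler_pdivlMl// in h2.
have A0 : 0 <= p * lam `^ (p - 1) * c * d by rewrite !mulr_ge0 ?powR_ge0// ltW.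
have B0 : 0 <= (p - 1) * lam `^ p by rewrite mulr_ge0 ?powR_ge0// ltW.
have := ler_wpM2l A0 h1; have := ler_wpM2l B0 h2.
move: (vs `^ (- a)) (vt `^ a) (vs `^ (- g)) (vt `^ (1 - g)) (vs `^ (1 - g)) (ln vt) (ln vs) => x1 x2 x3 x4 x5 x6 x7.
move: (lam `^ (p - 1)) (lam `^ p) => y1 y2 i1 i2.
rewrite -subr_ge0; apply: le_trans (_ : 0 <= (p * y1 * c * d * (x1 * x2) - p * y1 * c * d * (1 + a * (x6 - x7))) +
  ((p - 1) * y2 * ((g - 1)^-1 * (x4 - x5)) - (p - 1) * y2 * (x3 * (vs - vt)))) _.
  by rewrite addr_ge0 ?subr_ge0.
by rewrite le_eqVlt; apply/orP; left; apply/eqP; field; rewrite gt_eqF.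
Qed.

(** The expression p lam^(p - 1) c - (p - 1) lam^p D is maximal at lam = c / D, with value c^p D^(1
    - p). *)
Lemma capacity_constant {R : realType} (n p q g rG om v c D : R) : 1 < p -> 0 < n ->
  0 < rG -> 0 < om -> 0 < v -> 0 < q -> g - 1 = q / n ->
  c = n * rG * om `^ n^-1 -> D = v `^ (1 - g) / (g - 1) ->
  p * (c / D) `^ (p - 1) * c - (p - 1) * (c / D) `^ p * D =
  n * rG `^ p * om `^ (p / n) * q `^ (p - 1) * v `^ (q / n * (p - 1)).
Proof.
move=> p1 n0 r0 om0 v0 q0 gE cE DE; have p0 : 0 < p - 1 by rewrite subr_gt0.
have g0 : 0 < g - 1 by rewrite gE !divr_gt0.
have c0 : 0 < c by rewrite cE !mulr_gt0// powR_gt0.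
have D0 : 0 < D by rewrite DE divr_gt0// powR_gt0.
have cp : c `^ p = c `^ (p - 1) * c by rewrite -[X in _ = _ * X](powRr1 (ltW c0)) -powRDp// subrK.
have -> : (c / D) `^ p = (c / D) `^ (p - 1) * (c / D).
  by rewrite -[X in _ = _ * X](powRr1 (ltW (divr_gt0 c0 D0))) -powRDp ?divr_gt0// subrK.
have -> : p * (c / D) `^ (p - 1) * c - (p - 1) * ((c / D) `^ (p - 1) * (c / D)) * D = (c / D) `^ (p - 1) * c.
  by field; rewrite gt_eqF.
have e1 : D^-1 `^ (p - 1) = v `^ (q / n * (p - 1)) * q `^ (p - 1) * n `^ (1 - p).
  rewrite DE invf_div -powRN opprB gE.
  have -> : q / n * v `^ (q / n) = v `^ (q / n) * q * n^-1 by ring.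
  rewrite powRM ?mulr_ge0 ?powR_ge0 ?invr_ge0 ?(ltW q0) ?(ltW n0)//.
  rewrite powRM ?powR_ge0 ?(ltW q0)// -powRrM; congr (_ * _).
  by rewrite -powR_inv1 ?(ltW n0)// -powRrM mulN1r opprB.
have -> : (c / D) `^ (p - 1) * c = c `^ p * D^-1 `^ (p - 1).
  by rewrite powRM ?invr_ge0 ?(ltW c0) ?(ltW D0)// cp mulrAC.
have nn : n = n `^ p * n `^ (1 - p) by rewrite -powRDp// subrKC powRr1// ltW.
rewrite e1 cE !powRM ?mulr_ge0 ?powR_ge0 ?(ltW n0) ?(ltW r0)// -powRrM (mulrC n^-1).
rewrite [X in _ = X * _ * _ * _ * _]nn.
move: (n `^ p) (n `^ (1 - p)) (v `^ _) (_ `^ (p - 1)) (rG `^ p) (om `^ _) => *; ring.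
Qed.

(** The first two binomial terms; the second becomes the surface term in the growth of volume. *)
Lemma exprD_ge {R : realType} (a b : R) k : 0 <= a -> 0 <= b ->
  a ^+ k.+1 + k.+1%:R * b * a ^+ k <= (a + b) ^+ k.+1.
Proof.
move=> a0 b0; elim: k => [|k IH]; first by rewrite !expr1 expr0 mulr1 mul1r.
rewrite exprS; apply: le_trans (ler_wpM2l (addr_ge0 a0 b0) IH).
rewrite -[k.+2%:R]natr1 [a ^+ k.+1]exprS.
have : 0 <= k.+1%:R * b * b * a ^+ k by rewrite !mulr_ge0 ?exprn_ge0.
by set c := k.+1%:R; set x := a ^+ k; nra.
Qed.

Lemma measurable_lt_set {R : realType} d (T : measurableType d) (u v : T -> R) :
  measurable_fun setT u -> measurable_fun setT v -> measurable [set x | u x < v x].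
Proof.
move=> mu mv; rewrite [X in measurable X](_ : _ = setT `&` (fun x => v x - u x) @^-1` `]0, +oo[%classic).
  by apply: measurable_funB => //; exact: measurable_itv.
by rewrite setTI; apply/seteqP; split => x /=; rewrite in_itv/= andbT subr_gt0.
Qed.

Lemma measurable_le_set {R : realType} d (T : measurableType d) (u v : T -> R) :
  measurable_fun setT u -> measurable_fun setT v -> measurable [set x | u x <= v x].
Proof.
move=> mu mv; rewrite [X in measurable X](_ : _ = ~` [set x | v x < u x]).
  by apply: measurableC; exact: measurable_lt_set.
by apply/seteqP; split => x /=; [rewrite leNgt => /negP|move/negP; rewrite -leNgt].
Qed.

(** * Level sets of f: a discrete form of the coarea inequality *)

Section coarea.
Context {R : realType} {k : nat} (f : 'cV[R]_(1 + k) -> R) (h : 'cV[R]_(1 + k) -> R).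
Notation V := 'cV[R]_(1 + k).
Variables (G : set V) (Mh rho rG : R).
Hypothesis fC : Cc_infty f.
Hypothesis mh : measurable_fun setT h.
Hypothesis h_ge0 : forall w, 0 <= h w.
Hypothesis h_le : forall w, h w <= Mh * frob w.
Hypothesis Mh_ge0 : 0 <= Mh.
Hypothesis G_h : forall w y, G y -> inner w y <= h w.
Hypothesis oG : open G.
Hypothesis G_sub : G `<=` eball rho.
Hypothesis rG_gt0 : 0 < rG.
Hypothesis G_ball : leb G = leb (@eball R (1 + k) 1 rG).

Let om := fine (leb (@eball R (1 + k) 1 1)).
Let om_gt0 : 0 < om.
Proof. by rewrite /om fine_gt0// leb_eball_gt0//= leb_eball_lty. Qed.
Let leb_ballE r : 0 < r -> leb (@eball R (1 + k) 1 r) = (r ^+ (1 + k) * om)%:E.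
Proof.
by move=> r0; rewrite leb_eball// muln1 EFinM /om fineK// ge0_fin_numE// leb_eball_lty.
Qed.

Let cf := Cc_continuous fC.

Let mf : measurable_fun setT f. Proof. exact: continuous_measurable_mx. Qed.

Let open_gt t : open [set x | t < f x].
Proof. by apply: open_lt => //; exact: cst_continuous. Qed.

Lemma measurable_ge t : measurable [set x | t <= f x].
Proof. by apply: closed_measurable_mx; apply: closed_le => //; exact: cst_continuous. Qed.

Lemma measurable_band s t : measurable [set x | s <= f x < t].
Proof.
rewrite (_ : mkset _ = [set x | s <= f x] `&` [set x | f x < t]).
  apply: measurableI; first exact: measurable_ge.
  by apply: open_measurable_mx; apply: open_lt => //; exact: cst_continuous.
by apply/seteqP; split => x /= => [/andP[]|[? ?]] //; apply/andP.
Qed.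

Lemma measurable_h_grad : measurable_fun setT (fun x => h (grad f x)).
Proof.
apply: (measurableT_comp mh); apply: cts_measurable_mx; exact: Cc_grad_continuous.
Qed.

Lemma ge_sub t : 0 < t -> exists2 rf : R, 0 < rf & [set x | t <= f x] `<=` eball rf.
Proof.
move=> t0; have [rf rf0 hrf] := Cc_support fC; exists rf => // x /= tx.
by apply: hrf; rewrite gt_eqF// (lt_le_trans t0 tx).
Qed.

Lemma leb_ge_lty t : 0 < t -> (leb [set x | t <= f x]%R < +oo)%E.
Proof. by move=> t0; have [rf _ h'] := ge_sub t0; exact: leb_sub_lty h' (measurable_ge t). Qed.

(** The sum of {f > tau} and - eps G lies in {f + eps (h(grad f) + kap) > tau}, so Brunn-Minkowski
    bounds the volume between the two superlevel sets from below. The ball with the volume of {f >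
    tau} has radius at least [Rt], as tau < t. *)
Lemma band_tau (s' t Rt kap eps : R) : 0 < s' -> 0 < t -> 0 < Rt -> 0 < kap -> 0 < eps ->
  leb [set x | t <= f x] = leb (@eball R (1 + k) 1 Rt) ->
  (forall x y, G y -> f (x + eps *: y) <= f x + eps * (h (grad f x) + kap)) ->
  forall tau, s' < tau < t ->
  (((1 + k)%:R * (eps * rG) * Rt ^+ k * om)%:E <=
    leb [set x | (f x <= tau < f x + eps * (h (grad f x) + kap))%R])%E.
Proof.
move=> s'0 t0 Rt0 k0 e0 RtE hf tau /andP[s'tau taut].
have tau0 : 0 < tau by apply: lt_trans s'tau.
have [rf rf0 hrf] := Cc_support fC.
pose A := [set x | tau < f x].
have mA : measurable A by apply: open_measurable_mx; exact: open_gt.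
have Ar : A `<=` eball rf by move=> x /= hx; apply: hrf; rewrite gt_eqF// (lt_trans tau0 hx).
have tA : (leb [set x | t <= f x]%R <= leb A)%E.
  by apply: le_measure; rewrite ?inE//; [exact: measurable_ge|move=> x /=; exact: lt_le_trans].
have Alty := leb_sub_lty Ar mA.
have Af : leb A \is a fin_num by rewrite ge0_fin_numE.
have A0 : 0 < fine (leb A).
  rewrite fine_gt0// Alty andbT; apply: lt_le_trans tA.
  by rewrite RtE leb_eball_gt0.
have [a a0 aE] := @exists_radius R k _ A0.
rewrite fineK// in aE.
have Rta : Rt <= a.
  move: tA; rewrite RtE -aE !leb_ballE// lee_fin ler_pM2r// => hp.
  by rewrite -(@ler_pXn2r _ (1 + k))// ?nnegrE ltW.
pose B := [set x : V | dil eps G (- x)].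
have mB' : measurable (dil eps G) by apply: measurable_dil; exact: open_measurable_mx.
have mB : measurable B.
  apply: (@measurable_preimage_mx _ _ _ _ (fun x : V => - x)) => //.
  by apply: cts_measurable_mx; apply: cts_mxN; exact: cts_id.
have BE : leb B = leb (@eball R (1 + k) 1 (eps * rG)).
  rewrite /B leb_opp// leb_dil//; last exact: open_measurable_mx.
  by rewrite G_ball !leb_ballE ?mulr_gt0// -EFinM exprMn mulrA muln1.
have er : 0 < eps * rG by rewrite mulr_gt0.
have rho0 : 0 <= rho.
  have [y Gy] : G !=set0.
    apply/set0P/eqP => G0; have := leb_eball_gt0 (1 + k) 1 rG_gt0.
    by rewrite -G_ball G0 measure0 ltxx.
  by apply: le_trans (ltW (G_sub Gy)); exact: frob_ge0.
have Br : B `<=` eball (rf + eps * rho + 1).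
  move=> x [_ /G_sub]; rewrite /eball/= frobZ gtr0_norm ?invr_gt0// mulrC ltr_pdivrMr// frobN => hx.
  by nra.
pose g x := eps * (h (grad f x) + kap).
pose C := [set x | tau < f x + g x] `&` eball (rf + eps * rho + 1).
have mg : measurable_fun setT g.
  apply: measurable_funM => //; apply: measurable_funD => //; exact: measurable_h_grad.
have mC' : measurable [set x | tau < f x + g x].
  by apply: measurable_lt_set => //; exact: measurable_funD.
have mC : measurable C by apply: measurableI => //; exact: measurable_eball.
have ABC x y : A x -> B y -> C (x + y).
  move=> Ax By; have := hf (x + y) (eps^-1 *: - y) By.2.
  rewrite scalerA divff ?gt_eqF// scale1r addrK -/(g _) => hxy; split.
    exact: lt_le_trans Ax hxy.
  have := Ar _ Ax; have := By.2 => /G_sub; rewrite /eball/= frobZ gtr0_norm ?invr_gt0//.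
  rewrite mulrC ltr_pdivrMr// frobN => h1 h2; apply: le_lt_trans (frobD _ _) _; nra.
have Ar' : A `<=` eball (rf + eps * rho + 1).
  by move=> x /Ar; rewrite /eball/= => hx; have : 0 <= eps * rho by [exact: mulr_ge0 (ltW e0) rho0]; lra.
have Cr : C `<=` eball (rf + eps * rho + 1) by move=> x [].
have BM := brunn_minkowski_le a0 er mA mB mC Ar' Br Cr (esym aE) BE ABC.
have g0 x : 0 < g x by rewrite /g mulr_gt0// ltr_wpDl.
have AC : A `<=` C.
  by move=> x Ax; split; [rewrite /=; apply: lt_trans Ax _; rewrite ltrDl|exact: Ar'].
have mP : measurable [set x | f x <= tau < f x + g x].
  rewrite (_ : mkset _ = [set x | tau < f x + g x] `\` A); first exact: measurableD.
  apply/seteqP; split => x /=; first by move=> /andP[h1 h2]; split => //; rewrite /A/= ltNge h1.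
  by move=> [h1 /negP]; rewrite -leNgt => h2; apply/andP.
apply: (@le_trans _ _ (leb (C `\` A))); last first.
  apply: le_measure; rewrite ?inE//; first exact: measurableD.
  by move=> x [[h1 _] /negP]; rewrite -leNgt => h2 /=; apply/andP.
have Clty := leb_sub_lty Cr mC.
have e : leb (C `\` A) = (leb C - leb A)%E.
  have := measureD mC mA Clty; rewrite setIidr//; exact.
rewrite e leeBrDr// -aE; apply: le_trans BM.
rewrite !leb_ballE ?addr_gt0// -EFinD lee_fin -mulrDl ler_pM2r// addrC.
apply: le_trans (exprD_ge k (ltW a0) (ltW er)).
rewrite lerD2l ler_wpM2l//; first by rewrite mulr_ge0// ltW.
by rewrite lerXn2r// nnegrE ltW.
Qed.

(** [band_tau] is integrated over the levels tau between s + d and t. By Tonelli each x contributes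
    at most the length eps (h(grad f(x)) + kap) of its interval of levels, and division by eps
    leaves the integral of h(grad f). *)
Lemma coarea_band (s t Rt : R) : 0 < s -> s < t -> 0 < Rt ->
  leb [set x | t <= f x] = leb (@eball R (1 + k) 1 Rt) ->
  (((t - s) * ((1 + k)%:R * rG * Rt ^+ k * om))%:E <=
    \int[leb]_(x in [set x | (s <= f x < t)%R]) (h (grad f x))%:E)%E.
Proof.
move=> s0 st Rt0 RtE; set c := (1 + k)%:R * _ * _ * _; set I := (\int[leb]_(_ in _) _)%E.
have t0 := lt_trans s0 st.
have c0 : 0 <= c by rewrite !mulr_ge0 ?exprn_ge0 ?ltW.
pose Ub := [set x | s <= f x < t].
have mU : measurable Ub by exact: measurable_band.
have Ulty : (leb Ub < +oo)%E.
  apply: le_lt_trans (leb_ge_lty s0); apply: le_measure; rewrite ?inE//; first exact: measurable_ge.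
  by move=> x /andP[].
pose vU := fine (leb Ub); have vU0 : 0 <= vU by rewrite fine_ge0.
have [Cg Cg0 hCg] := Cc_grad_bounded fC.
have [Ct Ct0 hCt] := Cc_taylor fC.
suff main (d kap : R) : 0 < d -> d < t - s -> 0 < kap -> (((t - s - d) * c)%:E <= I + (kap * vU)%:E)%E.
  apply/lee_addgt0Pr => e e0.
  pose d := Num.min (e / 2 / (c + 1)) ((t - s) / 2).
  pose kap := e / 2 / (vU + 1).
  have c1 : 0 < c + 1 by rewrite ltr_wpDl.
  have v1 : 0 < vU + 1 by rewrite ltr_wpDl.
  have ts : 0 < t - s by rewrite subr_gt0.
  have d0 : 0 < d by rewrite lt_min !divr_gt0.
  have d1 : d < t - s by rewrite gt_min; apply/orP; right; rewrite ltr_pdivrMr// mulr_natr mulr2n ltrDl.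
  have k0 : 0 < kap by rewrite !divr_gt0.
  have dc : d * c <= e / 2.
    apply: le_trans (_ : d * (c + 1) <= _); first by rewrite ler_pM2l// lerDl.
    by rewrite -ler_pdivlMr// ge_min lexx.
  have kv : kap * vU <= e / 2.
    apply: le_trans (_ : kap * (vU + 1) <= _); first by rewrite ler_pM2l// lerDl.
    by rewrite /kap divfK// gt_eqF.
  have := main d kap d0 d1 k0.
  rewrite (_ : ((t - s) * c)%:E = (((t - s - d) * c)%:E + (d * c)%:E)%E); last by rewrite -EFinD; congr _%:E; ring.
  move=> hm; apply: le_trans (leeD hm (_ : ((d * c)%:E <= (e / 2)%:E)%E)) _; first by rewrite lee_fin.
  rewrite -addeA leeD2l// -EFinD lee_fin; lra.
move=> d0 dts k0.
have s'0 : 0 < s + d by rewrite addr_gt0.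
(* So small that the Taylor remainder stays below eps kap and that an interval of levels has length
   at most [d]; the latter confines the contributing x to f(x) >= s. *)
pose eps := Num.min (kap / (Ct * rho ^+ 2 + 1)) (d / (Mh * Cg + kap)).
have q1 : 0 < Ct * rho ^+ 2 + 1 by rewrite ltr_wpDl// mulr_ge0 ?sqr_ge0 ?ltW.
have q2 : 0 < Mh * Cg + kap by rewrite ltr_wpDl// mulr_ge0// ltW.
have e0 : 0 < eps by rewrite lt_min !divr_gt0.
have e1 : eps * (Ct * rho ^+ 2) <= kap.
  apply: le_trans (_ : eps * (Ct * rho ^+ 2 + 1) <= _); first by rewrite ler_pM2l// lerDl.
  by rewrite -ler_pdivlMr// ge_min lexx.
have e2 : eps * (Mh * Cg + kap) <= d by rewrite -ler_pdivlMr// ge_min lexx orbT.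
pose g x := eps * (h (grad f x) + kap).
have g0 x : 0 < g x by rewrite /g mulr_gt0// ltr_wpDl.
have gd x : g x <= d.
  apply: le_trans e2; rewrite /g ler_pM2l// lerD2r; apply: le_trans (h_le _) _.
  by rewrite ler_wpM2l.
have mg : measurable_fun setT g.
  apply: measurable_funM => //; apply: measurable_funD => //; exact: measurable_h_grad.
have hf x y : G y -> f (x + eps *: y) <= f x + g x.
  move=> Gy; apply: le_trans (hCt _ _) _; rewrite innerZr frobZ gtr0_norm//.
  have hy := G_h (grad f x) Gy; have ny := G_sub Gy; rewrite /eball/= in ny.
  have ny2 : frob y ^+ 2 <= rho ^+ 2 by rewrite lerXn2r ?nnegrE ?frob_ge0 ?(ltW ny)//; apply: le_trans (ltW ny); exact: frob_ge0.
  rewrite /g -addrA lerD2l exprMn mulrDr lerD//; first by rewrite ler_pM2l.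
  rewrite mulrCA expr2 -mulrA ler_pM2l// -mulrCA; apply: le_trans e1.
  by rewrite [leLHS]mulrCA ler_pM2l// ler_wpM2l// ltW.
have low := band_tau s'0 t0 Rt0 k0 e0 RtE hf.
have ec0 : 0 <= eps * c by exact: mulr_ge0 (ltW e0) c0.
pose P := [set zx : 'M[R]_1 * V | (s + d < zx.1 0 0 < t) /\ (f zx.2 <= zx.1 0 0 < f zx.2 + g zx.2)].
have mz : measurable_fun setT (fun zx : 'M[R]_1 * V => (zx.1 0 0 : R)).
  by apply: (measurableT_comp (measurable_coord 0 0)); exact: measurable_fst.
have mfx : measurable_fun setT (fun zx : 'M[R]_1 * V => f zx.2).
  by apply: (measurableT_comp mf); exact: measurable_snd.
have mgx : measurable_fun setT (fun zx : 'M[R]_1 * V => g zx.2).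
  by apply: (measurableT_comp mg); exact: measurable_snd.
have mP : measurable P.
  rewrite (_ : P = ([set zx : 'M[R]_1 * V | s + d < zx.1 0 0] `&` [set zx : 'M[R]_1 * V | zx.1 0 0 < t]) `&`
      ([set zx : 'M[R]_1 * V | f zx.2 <= zx.1 0 0] `&`
       [set zx : 'M[R]_1 * V | zx.1 0 0 < f zx.2 + g zx.2])).
    apply: measurableI; apply: measurableI.
    - exact: (measurable_lt_set (u := fun=> s + d)).
    - exact: (measurable_lt_set (v := fun=> t)).
    - exact: measurable_le_set.
    - by apply: measurable_lt_set => //; exact: measurable_funD.
  apply/seteqP; split => zx /=; first by move=> [/andP[? ?] /andP[? ?]].
  by move=> [[? ?] [? ?]]; split; apply/andP.
have tot := tonelli_set leb leb mP.
have lhs : (((t - s - d) * (eps * c))%:E <= \int[leb]_(z in [set: 'M[R]_1]) leb [set x | P (z, x)])%E.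
  pose Z := [set z : 'M[R]_1 | s + d < (z 0 0 : R) < t].
  have mZ : measurable Z.
    rewrite (_ : Z = [set z | s + d < z 0 0] `&` [set z | z 0 0 < t]).
      by apply: measurableI; apply: measurable_lt_set => //; exact: measurable_coord.
    by apply/seteqP; split => z /=; [move/andP|move=> [? ?]; apply/andP].
  have lZ : ((t - (s + d))%:E <= leb Z)%E by exact: leb_itv_superset.
  apply: (@le_trans _ _ ((eps * c)%:E * leb Z)%E).
    rewrite mulrC EFinM; apply: lee_wpmul2l; first by rewrite lee_fin.
    by apply: le_trans lZ; rewrite lee_fin opprD addrA.
  rewrite -integral_cst// integral_mkcond; apply: ge0_le_integral_gen => z _.
    by rewrite erestrict_ge0// => x _; rewrite lee_fin.
  rewrite patchE; case: ifPn; rewrite ?inE => zZ; last exact: measure_ge0.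
  have := low _ zZ; rewrite (_ : (1 + k)%:R * (eps * rG) * Rt ^+ k * om = eps * c); last by rewrite /c; ring.
  move=> hl; apply: le_trans hl _; rewrite (_ : [set x | P (z, x)] = [set x | f x <= z 0 0 < f x + g x])//.
  by apply/seteqP; split => x //= [].
have rhs : (\int[leb]_x leb [set z : 'M[R]_1 | P (z, x)] <= eps%:E * (I + (kap * vU)%:E))%E.
  have mhU : measurable_fun Ub (fun x => (h (grad f x))%:E).
    apply: (measurable_funS measurableT) => //; apply/measurable_EFinP; exact: measurable_h_grad.
  apply: (@le_trans _ _ (\int[leb]_(x in Ub) (g x)%:E)%E); last first.
    under eq_integral do rewrite /g EFinM EFinD.
    rewrite ge0_integralZl//; last 3 first.
    - by apply: emeasurable_funD => //; exact: measurable_cst.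
    - by move=> x _; rewrite -EFinD lee_fin addr_ge0// ltW.
    - by rewrite lee_fin ltW.
    rewrite ge0_integralD//; [|by move=> x _; rewrite lee_fin|by move=> x _; rewrite lee_fin ltW].
    by rewrite integral_cst// EFinM /vU fineK// ge0_fin_numE.
  rewrite [leRHS]integral_mkcond; apply: ge0_le_integral_gen => x _ //.
  rewrite patchE; case: ifPn; rewrite ?inE ?notin_setE => hx.
    rewrite (_ : g x = f x + g x - f x); last by rewrite addrAC subrr add0r.
    apply: leb_itv_subset; last by move=> z [_ /andP[-> /ltW->]].
      exact: (measurable_preimage_mx (f := fun z : 'M[R]_1 => (z, x)) (measurable_fun_pair (@measurable_id _ _ _) (measurable_cst _)) mP).
    by rewrite lerDl ltW.
  rewrite (_ : mkset _ = set0) ?measure0//; apply/seteqP; split => // z [/andP[/= h1 h2] /andP[h3 h4]].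
  apply: hx; apply/andP; split; last by apply: le_lt_trans h3 h2.
  by rewrite leNgt; apply/negP => fs; have := gd x; have := lt_trans h1 h4; lra.
have := le_trans lhs (le_trans (_ : _ <= _)%E rhs); rewrite mulrCA EFinM lee_pmul2l//; apply.
by rewrite [leLHS](tonelli_set leb leb mP).
Qed.

Variable p : R.
Hypothesis p_gt1 : 1 < p.
Hypothesis p_lt : p < (1 + k)%:R.

Let n : R := (1 + k)%:R.
(** [a] = 1 - 1 / n is the isoperimetric exponent, [g] - 1 = (n - p) / (n (p - 1)) is positive by p
    < n, and [c] is the anisotropic isoperimetric constant attached to [G]. *)
Let a := k%:R / n.
Let g := a * p / (p - 1).
Let c := n * rG * om `^ n^-1.
Let hp x := (h (grad f x)) `^ p.

Let n_gt0 : 0 < n. Proof. by rewrite ltr0n. Qed.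
Let p1_gt0 : 0 < p - 1. Proof. by rewrite subr_gt0. Qed.
Let p_gt0 : 0 < p. Proof. exact: lt_trans p_gt1. Qed.
Let nE : n = 1 + k%:R. Proof. by rewrite /n natrD. Qed.
Let g_gt1 : 1 < g.
Proof.
rewrite /g ltr_pdivlMr// mul1r /a mulrAC ltr_pdivlMr//.
by move: p_lt p_gt1; rewrite -/n nE; nra.
Qed.
Let a_ge0 : 0 <= a. Proof. by rewrite divr_ge0// ltW. Qed.
Let c_gt0 : 0 < c. Proof. by rewrite !mulr_gt0// powR_gt0. Qed.
Let vol t := fine (leb [set x | t <= f x]).
Let volE t : 0 < t -> leb [set x | t <= f x] = (vol t)%:E.
Proof. by move=> t0; rewrite /vol fineK// ge0_fin_numE// leb_ge_lty. Qed.

Lemma measurable_hp : measurable_fun setT hp.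
Proof. exact: (measurableT_comp (measurable_powR p) measurable_h_grad). Qed.

Lemma coarea_vol s t : 0 < s -> s < t -> 0 < vol t ->
  (((t - s) * (c * vol t `^ a))%:E <=
    \int[leb]_(x in [set x | (s <= f x < t)%R]) (h (grad f x))%:E)%E.
Proof.
move=> s0 st v0; have t0 := lt_trans s0 st.
have [Rt Rt0 RtE] := @exists_radius R k _ v0.
have vE : vol t = Rt ^+ (1 + k) * om.
  by apply/eqP; rewrite -eqe -RtE leb_ballE.
have := @coarea_band s t Rt s0 st Rt0 (etrans (volE t0) (esym RtE)).
rewrite (_ : c * vol t `^ a = (1 + k)%:R * rG * Rt ^+ k * om)//.
rewrite vE powRM ?exprn_ge0 ?ltW// -powR_mulrn ?(ltW Rt0)// -powRrM.
rewrite (_ : (1 + k)%:R * a = k%:R); last by rewrite /a mulrCA divff ?mulr1// gt_eqF.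
rewrite powR_mulrn ?(ltW Rt0)//.
have : om `^ n^-1 * om `^ a = om.
  rewrite -powRDp// (_ : n^-1 + a = 1) ?powRr1 ?ltW//.
  by rewrite /a -{1}[n^-1]mul1r -mulrDl -nE divff// gt_eqF.
rewrite /c -/n => e; rewrite -[in RHS]e; ring.
Qed.

(** The tangent of t^p at [sg], integrated over the band; [sg] is free and will depend on the
    level. *)
Lemma band_energy s t sg : 0 < s -> s < t -> 0 < vol t -> 0 <= sg ->
  ((p * sg `^ (p - 1) * ((t - s) * (c * vol t `^ a)) - (p - 1) * sg `^ p * (vol s - vol t))%:E <=
    \int[leb]_(x in [set x | (s <= f x < t)%R]) (hp x)%:E)%E.
Proof.
move=> s0 st v0 sg0; have t0 := lt_trans s0 st; set U := [set x | _].
have mU : measurable U by exact: measurable_band.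
have UE : leb U = (vol s - vol t)%:E.
  rewrite (_ : U = [set x | s <= f x] `\` [set x | t <= f x]); last first.
    apply/seteqP; split => x /=; first by move=> /andP[-> h']; split => //; rewrite leNgt h'.
    by move=> [h1 /negP]; rewrite -ltNge => h2; apply/andP.
  have := measureD (measurable_ge s) (measurable_ge t) (leb_ge_lty s0).
  rewrite setIidr; last by move=> x /= tx; apply: le_trans tx; exact: ltW.
  by rewrite EFinB -!volE//; exact.
rewrite EFinB leeBlDr//.
have mhU : measurable_fun U (fun x => (h (grad f x))%:E).
  apply: (measurable_funS measurableT) => //; apply/measurable_EFinP; exact: measurable_h_grad.
have mhpU : measurable_fun U (fun x => (hp x)%:E).
  apply: (measurable_funS measurableT) => //; apply/measurable_EFinP; exact: measurable_hp.
have ps0 : 0 <= p * sg `^ (p - 1) by rewrite mulr_ge0 ?powR_ge0// ltW.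
apply: (@le_trans _ _ ((p * sg `^ (p - 1))%:E * \int[leb]_(x in U) (h (grad f x))%:E)%E).
  by rewrite EFinM lee_wpmul2l ?lee_fin//; exact: coarea_vol.
rewrite -ge0_integralZl//.
have cst0 : 0 <= (p - 1) * sg `^ p by rewrite mulr_ge0 ?powR_ge0// ltW.
rewrite [in leRHS]EFinM -UE -integral_cst// -ge0_integralD//; last by move=> x _; rewrite lee_fin powR_ge0.
apply: ge0_le_integral_gen => x _; first by rewrite -EFinM lee_fin mulr_ge0.
by rewrite -EFinM -EFinD lee_fin; exact: young_tangent.
by move=> x _; rewrite lee_fin.
Qed.

Lemma vol_le s t : 0 < s -> s <= t -> vol t <= vol s.
Proof.
move=> s0 st; rewrite -lee_fin -!volE ?(lt_le_trans s0 st)//.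
by apply: le_measure; rewrite ?inE//; try exact: measurable_ge; move=> x /=; exact: le_trans.
Qed.

(** Induction over the levels j / N, starting at 1 / N since {f >= 0} has infinite volume; each band
    uses the slope prepared in [level_step]. *)
Lemma energy_levels (N j : nat) (lam : R) : 0 < vol 1 -> (0 < j <= N)%N -> 0 < lam ->
  (((p * lam `^ (p - 1) * c / N%:R) * ((j%:R - 1) + a * (ln (vol (j%:R / N%:R)) - ln (vol N%:R^-1)))
    - (p - 1) * lam `^ p * ((vol (j%:R / N%:R) `^ (1 - g) - vol N%:R^-1 `^ (1 - g)) / (g - 1)))%:E <=
   \int[leb]_(x in [set x | (N%:R^-1 <= f x < j%:R / N%:R)%R]) (hp x)%:E)%E.
Proof.
move=> v1 + lam0; elim: j => [//|j IH] /andP[_ jN].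
have N0 : 0 < N%:R :> R by rewrite ltr0n (leq_ltn_trans _ jN).
have Ni0 : 0 < N%:R^-1 :> R by rewrite invr_gt0.
have vpos t : 0 < t -> t <= 1 -> 0 < vol t by move=> t0 t1; apply: lt_le_trans v1 (vol_le t0 t1).
have [->|j0] := posnP j.
  rewrite mul1r subrr !subrr mulr0 addr0 mulr0 mul0r mulr0 subr0.
  by apply: integral_ge0 => x _; rewrite lee_fin powR_ge0.
pose s := j%:R / N%:R : R; pose t := j.+1%:R / N%:R : R.
have s0 : 0 < s by rewrite divr_gt0// ltr0n.
have ts : t - s = N%:R^-1 by rewrite /t /s -natr1 mulrDl mul1r addrAC subrr add0r.
have st : s < t by rewrite -subr_gt0 ts.
have t1 : t <= 1 by rewrite /t ler_pdivrMr// mul1r ler_nat.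
have vt := vpos _ (lt_trans s0 st) t1.
have vs := vpos _ s0 (le_trans (ltW st) t1).
have Ns : N%:R^-1 <= s by rewrite /s -[leLHS]mul1r ler_wpM2r ?(ltW Ni0)// ler1n.
have dU : [set x | N%:R^-1 <= f x < t] = [set x | N%:R^-1 <= f x < s] `|` [set x | s <= f x < t].
  apply/seteqP; split => x /=.
    by move=> /andP[h1 h2]; have [h3|h3] := ltP (f x) s; [left; rewrite h1|right].
  by move=> [/andP[h1 h2]|/andP[h1 h2]]; apply/andP; split => //; [exact: lt_trans st|exact: le_trans h1].
rewrite -/t dU ge0_integral_setU//=; last 5 first.
- exact: measurable_band.
- exact: measurable_band.
- by apply: (measurable_funS measurableT) => //; apply/measurable_EFinP; exact: measurable_hp.
- by move=> x _; rewrite lee_fin powR_ge0.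
- by apply/disj_setPS => x [/andP[_ h1] /andP[h2 _]]; have := lt_le_trans h1 h2; rewrite ltxx.
have jN' : (0 < j <= N)%N by rewrite j0 (ltnW jN).
pose sg := lam * vol s `^ (- (a / (p - 1))).
have sg0 : 0 <= sg by rewrite mulr_ge0 ?powR_ge0// ltW.
apply: le_trans (leeD (IH jN') (band_energy s0 st vt sg0)); rewrite -/s.
rewrite -EFinD lee_fin ts -natr1.
exact: (level_step j%:R _ _ p_gt1 erefl g_gt1 lam0 (ltW c_gt0) (ltW Ni0) vs vt).
Qed.

(** As N grows the logarithmic terms cost only O(1 / N), because all volumes involved lie between
    [vol 1] and that of a ball containing the support. The power of the volume at level 1 / N has
    the favourable sign and is dropped. *)
Lemma energy_lam (lam : R) : 0 < vol 1 -> 0 < lam ->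
  ((p * lam `^ (p - 1) * c - (p - 1) * lam `^ p * (vol 1 `^ (1 - g) / (g - 1)))%:E <=
   \int[leb]_x (hp x)%:E)%E.
Proof.
move=> v1 lam0; set X := p * _ * c; set D := _ / _.
have g10 : 0 < g - 1 by rewrite subr_gt0.
have X0 : 0 <= X by rewrite !mulr_ge0 ?powR_ge0 ?ltW.
have [rf rf0 hrf] := Cc_support fC.
pose S := fine (leb (@eball R (1 + k) 1 rf)).
have volS t : 0 < t -> vol t <= S.
  move=> t0; rewrite -lee_fin -volE// /S fineK ?ge0_fin_numE ?leb_eball_lty//.
  apply: le_measure; rewrite ?inE; [exact: measurable_ge|exact: measurable_eball|].
  by move=> x /= tx; apply: hrf; rewrite gt_eqF// (lt_le_trans t0 tx).
have S0 : 0 < S by apply: lt_le_trans v1 (volS 1 ltr01).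
pose Cl := 1 + a * (ln S - ln (vol 1)).
have Cl0 : 0 < Cl by rewrite ltr_pwDl// mulr_ge0// subr_ge0 ler_ln ?posrE// volS.
apply/lee_addgt0Pr => e e0.
pose N := (Num.bound (X * Cl / e)).+1.
have N0 : 0 < N%:R :> R by rewrite ltr0n.
have NX : X * Cl / N%:R <= e.
  rewrite ler_pdivrMr// [leRHS]mulrC -ler_pdivrMr// ltW//.
  apply: lt_le_trans (archi_boundP _) _; first exact: divr_ge0 (mulr_ge0 X0 (ltW Cl0)) (ltW e0).
  by rewrite ler_nat.
have hN : (0 < N <= N)%N by rewrite /N ltnS leqnn.
have := energy_levels v1 hN lam0; rewrite divff ?gt_eqF// => h'.
have h2 : (\int[leb]_(x in [set x | (N%:R^-1 <= f x < 1)%R]) (hp x)%:E <= \int[leb]_x (hp x)%:E)%E.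
  apply: ge0_subset_integral => //; first exact: measurable_band.
    by apply/measurable_EFinP; exact: measurable_hp.
  by move=> x _; rewrite lee_fin powR_ge0.
have h3 := le_trans h' h2; rewrite -leeBlDr// -EFinB.
apply: le_trans h3; rewrite lee_fin -/X.
set vN := vol N%:R^-1.
have Ni0 : 0 < N%:R^-1 :> R by rewrite invr_gt0.
have vN0 : 0 < vN by apply: lt_le_trans v1 _; rewrite vol_le// invf_le1// ler1n.
have lnS : ln vN <= ln S by rewrite ler_ln ?posrE// volS.
have i1 : X - e <= X / N%:R * (N%:R - 1 + a * (ln (vol 1) - ln vN)).
  have : X / N%:R * (N%:R - Cl) <= X / N%:R * (N%:R - 1 + a * (ln (vol 1) - ln vN)).
    rewrite ler_wpM2l ?divr_ge0 ?(ltW N0)// /Cl.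
    by have := ler_wpM2l a_ge0 lnS; lra.
  apply: le_trans; rewrite mulrBr divfK ?gt_eqF//.
  by rewrite lerD2l lerN2 mulrAC.
have i2 : (p - 1) * lam `^ p * ((vol 1 `^ (1 - g) - vN `^ (1 - g)) / (g - 1)) <= (p - 1) * lam `^ p * D.
  rewrite ler_wpM2l ?mulr_ge0 ?powR_ge0 ?(ltW p1_gt0)// /D ler_pM2r ?invr_gt0//.
  by rewrite gerBl powR_ge0.
by rewrite addrAC lerB.
Qed.

(** The choice lam = c / D in [energy_lam] is optimal, and [capacity_constant] evaluates it. *)
Theorem isocapacitary : 0 < vol 1 ->
  ((n * rG `^ p * om `^ (p / n) * ((n - p) / (p - 1)) `^ (p - 1) * vol 1 `^ ((n - p) / n))%:E <=
   \int[leb]_x (hp x)%:E)%E.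
Proof.
move=> v1; have g10 : 0 < g - 1 by rewrite subr_gt0.
have np : 0 < n - p by rewrite subr_gt0.
pose D := vol 1 `^ (1 - g) / (g - 1).
have D0 : 0 < D by rewrite divr_gt0// powR_gt0.
have := energy_lam v1 (divr_gt0 c_gt0 D0); rewrite -/D; apply: le_trans.
have gE : g - 1 = (n - p) / (p - 1) / n.
  rewrite /g /a; have -> : k%:R = n - 1 by rewrite nE addrAC subrr add0r.
  by field; rewrite !gt_eqF.
have q0 : 0 < (n - p) / (p - 1) by rewrite divr_gt0.
rewrite (capacity_constant p_gt1 n_gt0 rG_gt0 om_gt0 v1 q0 gE erefl erefl).
have p1n0 : p - 1 != 0 by rewrite gt_eqF.
rewrite (mulrAC (_ / _)) (divfK p1n0); exact: lexx.
Qed.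

End coarea.

(** The form in which scaling arguments with a factor r > 1 pass to the limit r = 1. *)
Lemma le_exprM_gt1 {R : realType} N (a b : R) : (forall r, 1 < r -> a <= r ^+ N * b) -> a <= b.
Proof.
move=> h; rewrite leNgt; apply/negP => ba.
have cts : continuous (fun s : R => s ^+ N * b).
  by apply: ctsM; [exact: exprn_continuous|exact: cst_continuous].
have in1 : [set s | s ^+ N * b < a] 1 by rewrite /= expr1n mul1r.
have [e /= e0 he] := open_nbhs_nbhs (conj (open_lt cts (@cst_continuous _ _ a)) in1).
have r1 : 1 < 1 + e / 2 by rewrite ltrDl divr_gt0.
have := h _ r1; rewrite leNgt => /negP; apply; apply: he.
rewrite /ball/= opprD addrA subrr sub0r normrN gtr0_norm ?divr_gt0//.
by rewrite ltr_pdivrMr// mulr_natr mulr2n ltrDl.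
Qed.

(** * Hausdorff measure of spherical sets *)

Section closed_ball.
Context {R : realType} {n m : nat}.

Lemma measurable_unit_ball : measurable (unit_ball : set 'M[R]_(n, m)).
Proof.
apply: closed_measurable_mx; apply: closed_le; last exact: cst_continuous.
by apply: cts_frob; exact: cts_id.
Qed.

(** Dilating the open ball by r > 1 shows that its boundary carries no volume. [omega] is defined by
    the closed ball, whereas the estimates use open ones. *)
Lemma leb_unit_ball : leb (unit_ball : set 'M[R]_(n, m)) = leb (@eball R n m 1).
Proof.
apply/eqP; rewrite eq_le; apply/andP; split; last first.
  apply: le_measure; rewrite ?inE; [exact: measurable_eball|exact: measurable_unit_ball|].
  by move=> x /ltW.
have sub r : 1 < r -> (unit_ball : set 'M[R]_(n, m)) `<=` eball r.
  by move=> r1 x; rewrite /unit_ball/= => x1; apply: le_lt_trans r1.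
have le r : 1 < r -> (leb (unit_ball : set 'M[R]_(n, m)) <= leb (@eball R n m r))%E.
  move=> /sub s; apply: le_measure; rewrite ?inE//; [exact: measurable_unit_ball|exact: measurable_eball].
have f1 : leb (@eball R n m 1) \is a fin_num by rewrite ge0_fin_numE// leb_eball_lty.
have f2 : leb (unit_ball : set 'M[R]_(n, m)) \is a fin_num.
  rewrite ge0_fin_numE//; apply: le_lt_trans (le 2 _) (leb_eball_lty _ _ _); by rewrite ltr1n.
rewrite -(fineK f1) -(fineK f2) lee_fin; apply: (@le_exprM_gt1 _ (n * m)) => r r1.
have := le r r1; rewrite leb_eball ?(lt_trans ltr01 r1)//.
by rewrite -[in leRHS](fineK f1) -EFinM -[in leLHS](fineK f2) lee_fin.
Qed.

End closed_ball.

Lemma omegaE {R : realType} n : omega n = fine (leb (@eball R n 1 1)).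
Proof. by rewrite -leb_unit_ball. Qed.

Section hausdorff_content.
Context {R : realType}.
Local Open Scope ereal_scope.

Lemma omega_ge0 s : (0 <= omega s :> R)%R.
Proof. by apply: fine_ge0; exact: outer_measure_ge0. Qed.

Lemma hausdorff_weight_ge0 n m s d (A : set 'M[R]_(n, m)) : 0 <= hausdorff_weight s d A.
Proof.
rewrite /hausdorff_weight; case: ifPn => // _.
by rewrite mule_ge0 ?poweR_ge0// lee_fin divr_ge0 ?omega_ge0// exprn_ge0.
Qed.

(** The inner term of [hausdorff] at one scale [d]. It is itself an outer measure, and estimates
    uniform in [d] pass to the supremum. *)
Definition hcov {n m} s d (A : set 'M[R]_(n, m)) : \bar R := covering_ext id (hausdorff_weight s d) A.

Section outer.
Variables (n m s : nat) (d : R).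
Let hcov0 : @hcov n m s d set0 = 0.
Proof. exact: (covering_ext0 id (@hausdorff_weight_ge0 n m s d)). Qed.
Let hcov_ge0 A : 0 <= @hcov n m s d A.
Proof. exact: (covering_ext_ge0 id (@hausdorff_weight_ge0 n m s d)). Qed.
Let le_hcov : {homo @hcov n m s d : A C / A `<=` C >-> A <= C}.
Proof. exact: le_covering_ext. Qed.
Let hcov_ssub : sigma_subadditive (@hcov n m s d).
Proof. exact: (covering_ext_sigma_subadditive id (@hausdorff_weight_ge0 n m s d)). Qed.
HB.instance Definition _ := isOuterMeasure.Build R 'M[R]_(n, m) (@hcov n m s d) hcov0 hcov_ge0 le_hcov hcov_ssub.
End outer.

Lemma hcovU n m s d (A B : set 'M[R]_(n, m)) : hcov s d (A `|` B) <= hcov s d A + hcov s d B.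
Proof. exact: outer_measureU2. Qed.

Lemma diam_ge0 n m (A : set 'M[R]_(n, m)) x : A x -> 0 <= diam A.
Proof.
move=> Ax; apply: ereal_sup_ubound; exists (x, x) => //=.
by rewrite subrr frob0.
Qed.

Lemma diam_le n m (A : set 'M[R]_(n, m)) c : (forall x y, A x -> A y -> (frob (x - y) <= c)%R) ->
  diam A <= c%:E.
Proof. by move=> h; apply: ge_ereal_sup => _ [[x y] [/= Ax Ay] <-]; rewrite lee_fin h. Qed.

Lemma hausdorff_weight_le n m n' m' s d (A : set 'M[R]_(n, m)) (B : set 'M[R]_(n', m')) x : A x ->
  diam A <= diam B -> hausdorff_weight s d A <= hausdorff_weight s d B.
Proof.
move=> Ax AB; rewrite /hausdorff_weight; case: (leP (diam B)) => [Bd|]; last by rewrite leey.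
rewrite (le_trans AB Bd) lee_wpmul2l ?lee_fin ?divr_ge0 ?omega_ge0 ?exprn_ge0//.
have A0 := diam_ge0 Ax.
by apply: gt0_ler_poweR; rewrite ?in_itv/= ?leey ?andbT// (le_trans A0 AB).
Qed.

(** Each piece of a covering is cut down to [A], where [f] does not increase distances, and then
    mapped; pieces missing [A] are dropped. *)
Lemma hcov_lipschitz n m n' m' s d (f : 'M[R]_(n, m) -> 'M[R]_(n', m')) A :
  (forall x y, A x -> A y -> (frob (f x - f y) <= frob (x - y))%R) ->
  hcov s d (f @` A) <= hcov s d A.
Proof.
move=> fL; apply: le_ereal_inf_tmp => _ [F AF <-].
pose g (S : set 'M[R]_(n, m)) := if pselect ((S `&` A) !=set0) then Some (f @` (S `&` A)) else None.
apply: le_trans (ereal_inf_lbound _) _.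
  exists (fun k => obind g (F k)) => //= _ [x Ax <-]; have [k _ Fx] := AF _ Ax.
  exists k => //; case: (F k) Fx => [S|] //= Sx; rewrite /g.
  by case: pselect => [_|[]] /=; [exists x|exists x].
apply: lee_nneseries => [k _ _|k _].
  by case: (obind _ _) => //= S; exact: hausdorff_weight_ge0.
case: (F k) => [S|] //=; rewrite /g; case: pselect => [[x [Sx Ax]]|_] /=; last exact: hausdorff_weight_ge0.
apply: (@hausdorff_weight_le _ _ _ _ _ _ _ _ (f x)); first by exists x.
apply: ge_ereal_sup => _ [[_ _] [/= [y [Sy Ay] <-] [z [Sz Az] <-]] <-].
apply: (@le_trans _ _ (frob (y - z))%:E); first by rewrite lee_fin fL.
by apply: ereal_sup_ubound; exists (y, z).
Qed.

Lemma hcov_single n m s d (A : set 'M[R]_(n, m)) c : (0 <= c <= d)%R ->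
  (forall x y, A x -> A y -> (frob (x - y) <= c)%R) ->
  hcov s d A <= (omega s / 2 ^+ s * c ^+ s)%:E.
Proof.
move=> /andP[c0 cd] hc; have w0 : (0 <= omega s / 2 ^+ s :> R)%R by rewrite divr_ge0 ?omega_ge0// exprn_ge0.
have [[x Ax]|A0] := pselect (A !=set0); last first.
  have -> : A = set0 by apply/seteqP; split => // x Ax; apply: A0; exists x.
  by rewrite outer_measure0 lee_fin mulr_ge0// exprn_ge0.
have dA := diam_le hc.
apply: (@le_trans _ _ (hausdorff_weight s d A)); last first.
  have dd : diam A <= d%:E by apply: le_trans dA _; rewrite lee_fin.
  rewrite /hausdorff_weight dd [in leRHS]EFinM lee_wpmul2l ?lee_fin//.
  have -> : (c ^+ s)%:E = c%:E `^ s%:R by rewrite poweR_EFin powR_mulrn.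
  by apply: gt0_ler_poweR; rewrite ?in_itv/= ?leey ?andbT ?lee_fin// (diam_ge0 Ax).
apply: le_trans (ereal_inf_lbound _) _.
  exists (fun k => if k is 0%N then Some A else None) => //= y Ay; by exists 0%N.
rewrite (@nneseries_split _ _ 0 1)//; last first.
  by move=> [|k] _ //=; exact: hausdorff_weight_ge0.
by rewrite big_nat1 /= eseries0 ?adde0// => -[].
Qed.

End hausdorff_content.

Section grid.
Context {R : realType} {n m : nat}.
Notation U := 'M[R]_(n, m).
Notation Z := 'M[int]_(n, m).

(** Half-open cubes, so that those of one mesh are disjoint and cover the space. *)
Definition cell (e : R) (z : Z) : set U :=
  [set x | forall i j, (z i j)%:~R * e <= x i j < ((z i j)%:~R + 1) * e].

Lemma cell_cover e x : 0 < e -> exists z, cell e z x.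
Proof.
move=> e0; exists (\matrix_(i, j) Num.floor (x i j / e)) => i j; rewrite mxE.
have /andP[h1 h2] := floor_itv (x i j / e).
by rewrite -ler_pdivlMr// -ltr_pdivrMr// h1/=; rewrite intrD in h2.
Qed.

Lemma cell_inj e z z' x : 0 < e -> cell e z x -> cell e z' x -> z = z'.
Proof.
move=> e0 hz hz'; apply/matrixP => i j.
have /andP[a1 a2] := hz i j; have /andP[b1 b2] := hz' i j.
have lt_int (a b : int) : a%:~R * e <= x i j -> x i j < (b%:~R + 1) * e -> a <= b.
  move=> h1 h2; have := le_lt_trans h1 h2; rewrite ltr_pM2r// -intrD1 ltr_int.
  by rewrite ltzD1.
by apply/eqP; rewrite eq_le !lt_int.
Qed.

Lemma measurable_cell e z : measurable (cell e z).
Proof.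
rewrite (_ : cell e z = \bigcap_i \bigcap_j
    ([set x : U | (z i j)%:~R * e <= x i j] `&` [set x : U | x i j < ((z i j)%:~R + 1) * e])).
  apply: fin_bigcap_measurable => [|i _]; first exact: finite_finset.
  apply: fin_bigcap_measurable => [|j _]; first exact: finite_finset.
  apply: measurableI; first by apply: measurable_le_set => //; exact: measurable_coord.
  by apply: measurable_lt_set => //; exact: measurable_coord.
apply/seteqP; split => x h; first by move=> i _ j _; have /andP[] := h i j.
by move=> i j; have [] := h i I j I => /= -> ->.
Qed.

Lemma leb_cell e z : 0 < e -> leb (cell e z) = (e ^+ (n * m))%:E.
Proof.
move=> e0; pose bx (t : R) := box (\matrix_(i, j) ((z i j)%:~R * e), \matrix_(i, j) ((z i j)%:~R * e + t)) : set U.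
have bxE t : 0 <= t -> leb (bx t) = (t ^+ (n * m))%:E.
  move=> t0; rewrite leb_box /box_volume; congr _%:E.
  rewrite (eq_bigr (fun=> t ^+ m)) => [|i _]; first by rewrite prodr_const card_ord -exprM mulnC.
  rewrite (eq_bigr (fun=> t)) => [|j _]; first by rewrite prodr_const card_ord.
  by rewrite !mxE addrAC subrr add0r; apply/max_idPr.
have up : (leb (cell e z) <= (e ^+ (n * m))%:E)%E.
  rewrite -bxE ?(ltW e0)//; apply: le_measure; rewrite ?inE; [exact: measurable_cell|exact: measurable_box|].
  by move=> x h i j; have /andP[h1 h2] := h i j; rewrite !mxE h1/=; rewrite mulrDl mul1r in h2; exact: ltW.
have cf : leb (cell e z) \is a fin_num by rewrite ge0_fin_numE// (le_lt_trans up)// ltry.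
apply/eqP; rewrite eq_le up /= -(fineK cf) lee_fin; apply: (@le_exprM_gt1 _ (n * m)) => r r1.
have r0 : 0 < r by apply: lt_trans r1.
rewrite -ler_pdivrMl ?exprn_gt0// mulrC -expr_div_n -lee_fin fineK// -bxE ?divr_ge0 ?(ltW e0) ?(ltW r0)//.
apply: le_measure; rewrite ?inE; [exact: measurable_box|exact: measurable_cell|].
move=> x h i j; have := h i j; rewrite !mxE => /andP[-> h2] /=; apply: le_lt_trans h2 _.
by rewrite mulrDl mul1r ltrD2l ltr_pdivrMr// ltr_pMr.
Qed.

Definition enlarge (a b : U) (e : R) : set U :=
  box (\matrix_(i, j) (a i j - e), \matrix_(i, j) (b i j + e)).

Lemma enlarge_cvg (a b : U) (x : R) : (forall e, 0 < e -> (x%:E <= leb (enlarge a b e))%E) ->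
  (x%:E <= leb (box (a, b) : set U))%E.
Proof.
move=> h; pose B := enlarge a b.
pose F j := B (harmonic j).
have mF j : measurable (F j) by exact: measurable_box.
have F0 : (leb (F 0%N) < +oo)%E by rewrite leb_box ltry.
have FS i j : (i <= j)%N -> F j `<=` F i.
  move=> ij y hy r c; have := hy r c; rewrite !mxE => /andP[h1 h2].
  have hh : @harmonic R j <= harmonic i by rewrite lef_pV2 ?posrE ?ler_nat.
  by apply/andP; split; lra.
have cap : \bigcap_j F j = box (a, b).
  apply/seteqP; split => y hy.
    move=> r c /=; have lim (u v : R) : (forall j, u <= v + harmonic j) -> u <= v.
      move=> huv; rewrite leNgt; apply/negP => vu.
      have uv : 0 < (u - v) / 2 by rewrite divr_gt0// subr_gt0.
      have [N hN] := s_small uv.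
      by have := huv N; have := hN N (leqnn N); lra.
    have hj j : a r c - harmonic j <= y r c <= b r c + harmonic j.
      by have := hy j I r c; rewrite !mxE.
    apply/andP; split; apply: lim => j; first by rewrite -lerBlDr; have /andP[] := hj j.
    by have /andP[] := hj j.
  move=> j _ r c; have /andP[/= h1 h2] := hy r c; rewrite !mxE.
  by apply/andP; split; [apply: le_trans h1; rewrite gerBl|apply: le_trans h2 _; rewrite lerDl]; rewrite invr_ge0.
have ndF : nonincreasing_seq F by move=> i j ij; apply/subsetPset; exact: FS.
have cv := nonincreasing_cvg_mu (mu := leb) F0 mF (bigcap_measurableType (fun j _ => mF j)) ndF.
rewrite -cap -(cvg_lim _ cv)//; apply: lime_ge; first exact: (cvgP _ cv).
by apply: nearW => j; apply: h; exact: harmonic_gt0.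
Qed.

(** The cells of mesh e that meet the box lie in the box enlarged by e; the bound is summed over
    them, and shrinking e removes the enlargement. *)
Lemma hcov_box_le s d (C e0 : R) (a b : U) : 0 < C -> 0 < e0 ->
  (forall e z, 0 < e <= e0 -> (hcov s d (cell e z) <= (C * e ^+ (n * m))%:E)%E) ->
  (hcov s d (box (a, b)) <= C%:E * leb (box (a, b) : set U))%E.
Proof.
move=> C0 e00 hc; pose E := enlarge a b.
have main (t : R) : 0 < t -> (hcov s d (box (a, b)) <= C%:E * leb (E t))%E.
  move=> t0; pose e := Num.min e0 t; have e_gt0 : 0 < e by rewrite lt_min e00.
  have ee : 0 < e <= e0 by rewrite e_gt0 ge_min lexx.
  have et : e <= t by rewrite ge_min lexx orbT.
  pose g (z : Z) : set U := if pselect ((cell e z `&` box (a, b)) !=set0) then cell e z else set0.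
  pose F k : set U := oapp g set0 (@pickle_inv Z k).
  have gc z : g z `<=` cell e z by rewrite /g /=; case: pselect => ? /= x.
  have mg z : measurable (g z) by rewrite /g /=; case: pselect => _ /=; [exact: measurable_cell|exact: measurable0].
  have mF k : measurable (F k) by rewrite /F; case: pickle_inv => //=; exact: measurable0.
  have tF : trivIset setT F.
    apply/trivIsetP => i j _ _ ij; apply/seteqP; split => // x []; rewrite /F.
    have := @pickle_invK Z i; have := @pickle_invK Z j.
    case: (pickle_inv i) => [zi|] //=; case: (pickle_inv j) => [zj|] //= pj pi /gc hi /gc hj.
    by move/eqP: ij; apply; rewrite -pi -pj (cell_inj e_gt0 hi hj).
  have cov : box (a, b) `<=` \bigcup_k F k.
    move=> x bx; have [z hz] := cell_cover x e_gt0; exists (pickle z) => //.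
    by rewrite /F pickleK_inv/= /g /=; case: pselect => // -[]; exists x.
  have FE : \bigcup_k F k `<=` E t.
    move=> x [k _]; rewrite /F; case: pickle_inv => [z|] //=; rewrite /g /=.
    case: pselect => [[y [cy by']]|] // cx i j; have /andP[c1 c2] := cx i j.
    have /andP[c3 c4] := cy i j; have /andP[/= b1 b2] := by' i j.
    by rewrite mulrDl mul1r in c2 c4; rewrite !mxE; apply/andP; split; lra.
  apply: le_trans (le_outer_measure (hcov s d) _ _ cov) _.
  apply: le_trans (outer_measure_sigma_subadditive (hcov s d) F) _.
  apply: (@le_trans _ _ (\sum_(0 <= k <oo) (C%:E * leb (F k)))%E).
    apply: lee_nneseries => [k _ _|k _]; first exact: outer_measure_ge0.
    rewrite /F; case: pickle_inv => [z|] /=; last by rewrite outer_measure0 mule_ge0// lee_fin ltW.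
    rewrite /g /=; case: pselect => _ /=; last by rewrite outer_measure0 mule_ge0// lee_fin ltW.
    by rewrite leb_cell// -EFinM; exact: hc.
  rewrite nneseriesZl//; apply: lee_wpmul2l; first by rewrite lee_fin ltW.
  rewrite -measure_semi_bigcup//; last exact: bigcup_measurable.
  by apply: le_measure; rewrite ?inE//; [exact: bigcup_measurable|exact: measurable_box].
have bf e : leb (E e) \is a fin_num by rewrite /E /enlarge leb_box.
have hf : hcov s d (box (a, b)) \is a fin_num.
  rewrite ge0_fin_numE ?outer_measure_ge0//; apply: le_lt_trans (main 1 ltr01) _.
  by rewrite -(fineK (bf 1)) -EFinM ltry.
rewrite muleC -lee_pdivrMr// -(fineK hf) -EFinM; apply: enlarge_cvg => e e0'.
by rewrite EFinM fineK// lee_pdivrMr// muleC; exact: main.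
Qed.

(** A bound on small cubes extends to boxes and, through coverings by boxes, to every set. *)
Lemma hcov_volume_le s d (C e0 : R) (A : set U) : 0 < C -> 0 < e0 ->
  (forall e z, 0 < e <= e0 -> (hcov s d (cell e z) <= (C * e ^+ (n * m))%:E)%E) ->
  (hcov s d A <= C%:E * volume A)%E.
Proof.
move=> C0 e00 hc; rewrite muleC -lee_pdivrMr//; apply: le_ereal_inf_tmp => _ [F AF <-].
rewrite lee_pdivrMr// muleC.
apply: le_trans (le_outer_measure (hcov s d) _ _ AF) _.
apply: le_trans (outer_measure_sigma_subadditive (hcov s d) _) _.
rewrite -nneseriesZl; last by move=> k _; case: (F k) => //= ab; rewrite -leb_box.
apply: lee_nneseries => [k _ _|k _]; first exact: outer_measure_ge0.
case: (F k) => [[a b]|] /=; last by rewrite outer_measure0 mule0.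
by rewrite -leb_box; exact: hcov_box_le hc.
Qed.

End grid.

(** * Hausdorff content against volume in full dimension *)

Section hausdorff_le_volume.
Context {R : realType} {n m : nat}.
Notation U := 'M[R]_(n, m).
Notation s := (n * m)%N.
Hypothesis s_gt0 : (0 < s)%N.
Variable d : R.
Hypothesis d_gt0 : 0 < d.
Hypothesis om_nm : omega s = fine (leb (@eball R n m 1)).

Let kap : R := omega s / 2 ^+ s.
Let om_gt0 : 0 < (omega s : R).
Proof. by rewrite om_nm fine_gt0// leb_eball_gt0//= leb_eball_lty. Qed.
Let kap_gt0 : 0 < kap. Proof. by rewrite divr_gt0// exprn_gt0. Qed.

Lemma frob_cell e z x y : 0 < e -> cell e z x -> cell e z y -> frob (x - y : U) <= s%:R * e.
Proof.
move=> e0 hx hy; apply: frob_le_coord => i j; rewrite !mxE.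
have /andP[x1 x2] := hx i j; have /andP[y1 y2] := hy i j.
by rewrite mulrDl mul1r in x2 y2; rewrite ler_norml; apply/andP; split; lra.
Qed.

Let center e (z : 'M[int]_(n, m)) : U := \matrix_(i, j) (((z i j)%:~R + 2^-1) * e).
Let ball e z := [set x | eball (e / 2) (x - center e z)].

Let ball_cell e z : 0 < e -> ball e z `<=` cell e z.
Proof.
move=> e0 x; rewrite /ball /eball/= => h i j.
have := le_lt_trans (coord_le_frob (x - center e z) i j) h.
by rewrite !mxE mulrDl mulrDl mul1r ltr_norml => /andP[h1 h2]; apply/andP; split; lra.
Qed.

Let measurable_ball e z : measurable (ball e z).
Proof.
apply: (@measurable_preimage_mx _ _ _ _ (fun x : U => x - center e z)); last exact: measurable_eball.
by apply: cts_measurable_mx; apply: cts_mxD; [exact: cts_id|exact: cst_continuous].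
Qed.

Let leb_ball e z : 0 < e -> leb (ball e z) = (kap * e ^+ s)%:E.
Proof.
move=> e0; rewrite /ball (leb_shift (- center e z)); last exact: measurable_eball.
have f1 : leb (@eball R n m 1) = (omega s)%:E by rewrite om_nm fineK// ge0_fin_numE// leb_eball_lty.
by rewrite leb_eball ?divr_gt0// f1 -EFinM /kap expr_div_n mulrC mulrA mulrAC.
Qed.

Let kap_le1 : kap <= 1.
Proof.
have : (leb (ball 1 0%R) <= leb (cell (n := n) (m := m) 1 0%R))%E.
  by apply: le_measure; rewrite ?inE; [exact: measurable_ball|exact: measurable_cell|exact: ball_cell].
by rewrite leb_ball// leb_cell// !expr1n mulr1 lee_fin.
Qed.

Let good (C : R) := forall A : set U, (hcov s d A <= C%:E * volume A)%E.

(** A starting constant: a cube of side e has diameter at most s e, so it can serve as its own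
    covering set. *)
Let good_init : exists2 C, 0 < C & good C.
Proof.
exists (kap * s%:R ^+ s) => [|A]; first by rewrite mulr_gt0// exprn_gt0// ltr0n.
apply: (@hcov_volume_le _ _ _ _ _ _ (d / s%:R)); rewrite ?divr_gt0 ?ltr0n ?mulr_gt0 ?exprn_gt0 ?ltr0n//.
move=> e z /andP[e0 ed]; rewrite -mulrA -exprMn.
have h : 0 <= s%:R * e <= d by rewrite mulr_ge0 ?(ltW e0)//= mulrC -ler_pdivlMr// ltr0n.
by apply: hcov_single h _ => x y hx hy; exact: frob_cell.
Qed.

(* A cube contains a ball, which is covered by itself at the cost of its volume. *)
Let good_step C : 0 < C -> good C -> good (kap + C * (1 - kap)).
Proof.
move=> C0 hC A; have k1 : 0 <= 1 - kap by rewrite subr_ge0.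
apply: (@hcov_volume_le _ _ _ _ _ _ d) => //; first by rewrite ltr_pwDl// mulr_ge0// ltW.
move=> e z /andP[e0 ed].
have -> : cell e z = ball e z `|` (cell e z `\` ball e z).
  apply/seteqP; split => x; first by have [?|?] := pselect (ball e z x); [left|right].
  by move=> [/(ball_cell e0)|[]].
apply: le_trans (hcovU _ _ _ _) _.
have h1 : (hcov s d (ball e z) <= (kap * e ^+ s)%:E)%E.
  apply: hcov_single; first by rewrite ltW.
  move=> x y hx hy; rewrite (_ : x - y = (x - center e z) - (y - center e z)); last first.
    by rewrite opprB addrA subrK.
  apply: le_trans (frobB _ _) _; move: hx hy; rewrite /ball /eball/= => hx hy; lra.
have h2 : (hcov s d (cell e z `\` ball e z) <= (C * ((1 - kap) * e ^+ s))%:E)%E.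
  apply: le_trans (hC _) _; rewrite EFinM lee_wpmul2l ?lee_fin ?(ltW C0)//.
  have Eoo : (leb (cell e z) < +oo)%E by rewrite leb_cell// ltry.
  have E : leb (cell e z `\` ball e z) = (leb (cell e z) - leb (ball e z))%E.
    have := measureD (measurable_cell e z) (measurable_ball e z) Eoo.
    by rewrite setIidr; [exact|exact: ball_cell].
  by rewrite -[volume _]/(leb _) E leb_cell// leb_ball// -EFinB lee_fin mulrBl mul1r.
apply: le_trans (leeD h1 h2) _; rewrite -EFinD lee_fin; lra.
Qed.

(** [good_step] maps C to kap + C (1 - kap), an affine contraction with fixed point 1, so iteration
    brings the constant down to 1. *)
Lemma hcov_le_volume (A : set U) : (hcov s d A <= volume A)%E.
Proof.
have [C C0 hC] := good_init; have k1 : 0 <= 1 - kap by rewrite subr_ge0.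
have hj j : 0 < 1 + (C - 1) * (1 - kap) ^+ j /\ good (1 + (C - 1) * (1 - kap) ^+ j).
  elim: j => [|j [IH1 IH2]]; first by rewrite expr0 mulr1 subrKC.
  rewrite (_ : 1 + _ = kap + (1 + (C - 1) * (1 - kap) ^+ j) * (1 - kap)); last by rewrite exprS; ring.
  by split; [rewrite ltr_pwDl// mulr_ge0// ltW|exact: good_step].
have [voo|vf] := eqVneq (volume A) +oo%E; first by rewrite voo leey.
have vfin : volume A \is a fin_num by rewrite ge0_fin_numE ?outer_measure_ge0// ltey.
have v0 : 0 <= fine (volume A) by rewrite fine_ge0// outer_measure_ge0.
apply/lee_addgt0Pr => e e0.
have k2 : `|1 - kap| < 1 by rewrite ger0_norm// gtrBl.
have cv := cvg_geometric (C * fine (volume A)) k2.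
have /cvgrPdist_lt/(_ e e0)[N _ hN] := cv.
have := hN N (leqnn N); rewrite sub0r normrN /geometric/= => hn.
apply: le_trans ((hj N).2 A) _; rewrite -(fineK vfin) -EFinM -EFinD lee_fin mulrDl mul1r lerD2l.
apply: le_trans (ltW hn); apply: le_trans (ler_norm _); rewrite mulrAC.
by rewrite ler_wpM2r ?exprn_ge0// ler_wpM2r// gerDl oppr_le0.
Qed.

End hausdorff_le_volume.

(** * Central projection from a tangent hyperplane to the sphere *)

Section sphere_chart.
Context {R : realType} {s : nat}.
Notation W := 'cV[R]_(1 + s).
Notation Y := 'cV[R]_s.

(** With c the inner product of the unit vectors, the difference of the squared distances is (|x| -
    |y|)^2 + 2 (|x| |y| - 1) (1 - c), a sum of nonnegative terms. *)
Lemma unitv_lipschitz n m (x y : 'M[R]_(n, m)) : 1 <= frob x -> 1 <= frob y ->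
  frob (unitv x - unitv y) <= frob (x - y).
Proof.
move=> x1 y1; have x0 : 0 < frob x by apply: lt_le_trans x1.
have y0 : 0 < frob y by apply: lt_le_trans y1.
rewrite -(@ler_pXn2r _ 2)// ?nnegrE ?frob_ge0// !sqr_frob.
rewrite !innerBl !innerBr (innerC y x) (innerC (unitv y) (unitv x)) -!(sqr_frob).
have un (w : 'M[R]_(n, m)) : 0 < frob w -> frob (unitv w) = 1.
  by move=> w0; rewrite /unitv frobZ gtr0_norm ?invr_gt0// mulVf// gt_eqF.
rewrite !un// expr1n.
have e : inner x y = frob x * frob y * inner (unitv x) (unitv y).
  rewrite /unitv innerZl innerZr; field; by rewrite !gt_eqF.
have c1 : inner (unitv x) (unitv y) <= 1.
  by apply: le_trans (inner_le_frob _ _) _; rewrite !un// mulr1.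
rewrite e; set c := inner _ _ in c1 *.
have xy : 1 <= frob x * frob y by rewrite -[1]mulr1 ler_pM.
have : 0 <= (frob x - frob y) ^+ 2 by rewrite sqr_ge0.
have : 0 <= (frob x * frob y - 1) * (1 - c) by rewrite mulr_ge0// subr_ge0.
nra.
Qed.

(** An open cone, not only its trace on the sphere, so that membership is unchanged by radial
    projection. For a unit vector [theta], the number [zeta] is the cosine of its half-angle. *)
Definition cap (zeta : R) (theta : W) : set W := [set w | zeta * frob w < inner w theta].

Lemma measurable_cap zeta theta : measurable (cap zeta theta).
Proof.
apply: open_measurable_mx; apply: open_lt.
  by apply: ctsM; [exact: cst_continuous|apply: cts_frob; exact: cts_id].
by apply: cts_inner; [exact: cts_id|exact: cst_continuous].
Qed.

Lemma integral_powR_01 (c zeta : R) : 0 < zeta -> 0 <= c ->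
  (\int[leb]_(x in [set x : 'M[R]_1 | (0 < (x 0%R 0%R : R) < zeta)%R]) ((x 0%R 0%R) ^+ s * c)%:E)%E =
  (zeta ^+ s.+1 / s.+1%:R * c)%:E.
Proof.
move=> z0 c0; set D := [set x | _].
have mf : measurable_fun setT (fun x : 'M[R]_1 => ((x 0 0) ^+ s * c)%:E).
  apply/measurable_EFinP; apply: measurable_funM => //.
  by apply: measurable_funX; exact: measurable_coord.
have mS := @measurable_scalar_mx R.
pose mu : {measure set 'M[R]_1 -> \bar R} := pushforward (@lebesgue_measure R) (fun t => t%:M).
have mD : measurable D.
  rewrite (_ : D = [set x | 0 < x 0 0] `&` [set x | x 0 0 < zeta]).
    by apply: measurableI; apply: measurable_lt_set => //; exact: measurable_coord.
  by apply/seteqP; split => x /=; [move/andP|move=> [? ?]; apply/andP].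
rewrite (@eq_measure_integral _ _ _ _ (mu mS)); last by move=> A mA _; exact: leb_11.
rewrite ge0_integral_pushforward//; last 2 first.
- exact: (measurable_funS measurableT).
- by move=> x; rewrite inE => /andP[/ltW x0 _]; rewrite lee_fin mulr_ge0// exprn_ge0.
rewrite (_ : _ @^-1` D = `]0, zeta[%classic); last first.
  by apply/seteqP; split => t /=; rewrite /D/= mxE eqxx mulr1n in_itv.
pose F : R -> R := (c / s.+1%:R) \*: (@id R ^+ s.+1).
have dF (t : R) : is_derive t 1 F (t ^+ s * c).
  rewrite (_ : t ^+ s * c = (c / s.+1%:R) *: ((s.+1%:R * t ^+ s) *: 1)); last first.
    by rewrite /GRing.scale/= mulr1 mulrA divfK ?pnatr_eq0// mulrC.
  exact: is_deriveZ.
have cF : continuous F.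
  by move=> t; apply: differentiable_continuous; apply/derivable1_diffP; case: (dF t).
have cf : continuous (fun t : R => t ^+ s * c).
  by apply: ctsM; [exact: exprn_continuous|exact: cst_continuous].
rewrite [LHS](_ : _ = \int[lebesgue_measure]_(t in `]0%R, zeta[) (t ^+ s * c)%:E)%E; last first.
  by apply: eq_integral => t _; rewrite /= mxE eqxx mulr1n.
have mI (I : interval R) : measurable_fun [set` I] (fun t : R => (t ^+ s * c)%:E).
  apply: (measurable_funS measurableT) => //; apply/measurable_EFinP.
  by apply: measurable_funM => //; apply: measurable_funX; exact: measurable_id.
rewrite integral_itv_bndo_bndc// integral_itv_obnd_cbnd//.
rewrite (continuous_FTC2 (F := F) z0)//.
- have FE t : F t = c / s.+1%:R * t ^+ s.+1 by rewrite /F exprfctE.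
  rewrite -EFinB !FE expr0n/= mulr0 subr0; congr _%:E; ring.
- exact: continuous_subspaceT.
- split; first by move=> t _; case: (dF t).
  + by apply: cvg_at_right_filter; exact: cF.
  + by apply: cvg_at_left_filter; exact: cF.
- by move=> t _; rewrite derive1E; exact: derive_val.
Qed.

Let e1 : W := pt 1 0.

(** The flat set on the left is the slice at height 1 of the cone on the right taken without the
    norm bound, and its z-multiple is the slice at height z. For z < zeta this multiple lies in the
    unit ball, since zeta |(1, y)| < 1 in the cap; integrating z^s up to zeta gives the constant. *)
Lemma leb_chart zeta (A : set W) : 0 < zeta -> measurable A ->
  (leb [set y : Y | A (unitv (pt 1 y)) /\ cap zeta e1 (pt 1 y)] <=
   ((zeta ^+ s.+1)^-1 * s.+1%:R)%:E * leb [set w | [/\ (frob w < 1)%R, A (unitv w) & cap zeta e1 w]])%E.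
Proof.
move=> z0 mA; pose E := [set y : Y | A (unitv (pt 1 y)) /\ cap zeta e1 (pt 1 y)].
pose D := [set w : W | [/\ frob w < 1, A (unitv w) & cap zeta e1 w]].
have mpt : measurable_fun setT (fun y : Y => pt 1 y).
  by apply: cts_measurable_mx; apply: cts_pt; [exact: cst_continuous|exact: cts_id].
have mE : measurable E.
  apply: measurableI.
    by apply: (measurable_preimage_mx (f := fun y : Y => unitv (pt 1 y))) => //; exact: (measurableT_comp (@measurable_unitv R (1 + s) 1) mpt).
  by apply: (measurable_preimage_mx mpt); exact: measurable_cap.
have mD : measurable D.
  rewrite (_ : D = eball 1 `&` ([set w | A (unitv w)] `&` cap zeta e1)); last first.
    by apply/seteqP; split => w [] //= ? [].
  apply: measurableI; first exact: measurable_eball.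
  apply: measurableI; last exact: measurable_cap.
  exact: (measurable_preimage_mx (@measurable_unitv _ _ _)).
have e1E y : inner (pt 1 y) e1 = 1.
  by rewrite /e1 /pt inner_col_mx inner0r addr0 inner_scalar_mx mulr1.
have Er : E `<=` eball zeta^-1.
  move=> y [_]; rewrite /cap/= e1E mulrC -ltr_pdivlMr// div1r /eball/=; apply: le_lt_trans.
  by rewrite -(@ler_pXn2r _ 2)// ?nnegrE ?frob_ge0// sqr_frob_pt lerDr sqr_ge0.
have Ef : leb E \is a fin_num.
  rewrite ge0_fin_numE//; apply: le_lt_trans (leb_eball_lty s 1 zeta^-1).
  by apply: le_measure; rewrite ?inE//; exact: measurable_eball.
have zs : 0 < zeta ^+ s.+1 by rewrite exprn_gt0.
suff : ((zeta ^+ s.+1 / s.+1%:R * fine (leb E))%:E <= leb D)%E.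
  rewrite -/E -[in X in _ -> X](fineK Ef) => h.
  rewrite (_ : fine (leb E) = (zeta ^+ s.+1)^-1 * s.+1%:R * (zeta ^+ s.+1 / s.+1%:R * fine (leb E))); last first.
    have n0 : s.+1%:R != 0 :> R by rewrite pnatr_eq0.
    by rewrite -mulrA [s.+1%:R * _]mulrA [s.+1%:R * _]mulrC divfK// mulrA mulVf ?mul1r// gt_eqF.
  by rewrite EFinM lee_wpmul2l// lee_fin mulr_ge0// invr_ge0 ltW.
rewrite -integral_powR_01 ?fine_ge0// (leb_col_mx mD) integral_mkcond.
apply: ge0_le_integral_gen => x _.
  rewrite erestrict_ge0// => z /= /andP[/ltW z0' _].
  by rewrite lee_fin mulr_ge0 ?exprn_ge0// fine_ge0.
rewrite patchE; case: ifPn => [|_]; last exact: measure_ge0.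
rewrite inE => /andP[x0 xz].
set z : R := x 0 0 in x0 xz *.
rewrite EFinM fineK// [E in leb E](_ : _ = [set y : Y | E y])//.
have -> : (z ^+ s)%:E = (z ^+ (s * 1))%:E by rewrite muln1.
rewrite -(leb_dil x0 mE); apply: le_measure; rewrite ?inE.
- exact: measurable_dil.
- apply: (@measurable_preimage_mx _ _ _ _ (fun y : Y => col_mx x y)) mD.
  by apply: cts_measurable_mx; apply: cts_col_mx; [exact: cst_continuous|exact: cts_id].
move=> y [_ [hA hc]]; rewrite /= [x]mx11_scalar -/z -/(pt z y).
have pE : pt z y = z *: pt 1 (z^-1 *: y).
  by rewrite ptZ mulr1 scalerA divff ?gt_eqF// scale1r.
have fE : frob (pt z y) = z * frob (pt 1 (z^-1 *: y)) by rewrite pE frobZ gtr0_norm.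
have iE := e1E (z^-1 *: y).
have f1 : zeta * frob (pt 1 (z^-1 *: y)) < 1 by have := hc; rewrite /cap/= iE.
have fp : 0 < frob (pt 1 (z^-1 *: y)).
  by apply: frob_gt0; apply/eqP => h; move: iE; rewrite h inner0l => /eqP; rewrite eq_sym oner_eq0.
have uE : unitv (pt z y) = unitv (pt 1 (z^-1 *: y)).
  rewrite /unitv fE [in LHS]pE scalerA invfM mulrAC mulVf ?mul1r// gt_eqF//.
split.
- by rewrite fE; apply: lt_trans f1; rewrite ltr_pM2r.
- by rewrite uE.
- by rewrite /cap/= fE pE innerZl mulrCA ltr_pM2l.
Qed.

Hypothesis s_gt0 : (0 < s)%N.
Variable d : R.
Hypothesis d_gt0 : 0 < d.

(** The flat set of [leb_chart] is mapped by [unitv] onto a set containing the spherical one,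
    without increasing distances; in the hyperplane the content is at most the volume. *)
Lemma hcov_cap1 zeta (A : set W) : 0 < zeta -> measurable A ->
  (hcov s d [set u : W | [/\ frob u = 1%R, A u & cap zeta e1 u]] <=
   ((zeta ^+ s.+1)^-1 * s.+1%:R)%:E * leb [set w | [/\ (frob w < 1)%R, A (unitv w) & cap zeta e1 w]])%E.
Proof.
move=> z0 mA; apply: le_trans (leb_chart z0 mA).
pose E := [set y : Y | A (unitv (pt 1 y)) /\ cap zeta e1 (pt 1 y)].
have hv : (hcov s d E <= leb E)%E.
  have := @hcov_le_volume R s 1 _ d d_gt0; by rewrite muln1; apply => //; exact: omegaE.
apply: le_trans hv; pose psi (y : Y) := unitv (pt 1 y).
apply: (@le_trans _ _ (hcov s d (psi @` E))); last first.
  apply: hcov_lipschitz => x y _ _.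
  have f1 (v : Y) : 1 <= frob (pt 1 v).
    by rewrite -(@ler_pXn2r _ 2)// ?nnegrE ?frob_ge0// sqr_frob_pt expr1n lerDl sqr_ge0.
  apply: le_trans (unitv_lipschitz (f1 x) (f1 y)) _.
  rewrite (_ : pt 1 x - pt 1 y = pt 0 (x - y)); last first.
    by rewrite -scaleN1r ptZ ptD mulN1r subrr scaleN1r.
  rewrite -(@ler_pXn2r _ 2)// ?nnegrE ?frob_ge0// sqr_frob_pt expr0n/= add0r//.
apply: le_outer_measure => u [fu Au cu].
have iE : inner u e1 = usubmx u 0 0.
  by rewrite -[in LHS](ptE u) /e1 /pt inner_col_mx inner0r addr0 inner_scalar_mx mulr1.
have z1 : 0 < usubmx u 0 0.
  by move: cu; rewrite /cap/= fu mulr1 iE; apply: lt_trans.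
set z : R := usubmx u 0 0 in iE z1 *.
have pu : pt 1 (z^-1 *: dsubmx u) = z^-1 *: u.
  by rewrite -[in RHS](ptE u) ptZ mulVf// gt_eqF.
have up : unitv (pt 1 (z^-1 *: dsubmx u)) = u.
  by rewrite pu /unitv frobZ fu mulr1 gtr0_norm ?invr_gt0// invrK scalerA divff ?scale1r// gt_eqF.
exists (z^-1 *: dsubmx u) => //; split; first by rewrite up.
rewrite pu /cap/= frobZ gtr0_norm ?invr_gt0// mulrCA innerZl ltr_pM2l ?invr_gt0//.
Qed.

Lemma hcov_cap zeta theta (A : set W) : 0 < zeta -> frob theta = 1 -> measurable A ->
  (hcov s d [set u : W | [/\ frob u = 1%R, A u & cap zeta theta u]] <=
   ((zeta ^+ s.+1)^-1 * s.+1%:R)%:E * leb [set w | [/\ (frob w < 1)%R, A (unitv w) & cap zeta theta w]])%E.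
Proof.
move=> z0 t1 mA.
have e11 : inner e1 e1 = 1.
  by rewrite /e1 /pt inner_col_mx inner0r addr0 inner_scalar_mx mulr1.
have [P PP PE] := householder theta e11; rewrite t1 scale1r in PE.
have PP' := orthogonalT PP.
have tE : theta = P^T *m e1 by rewrite -PE mulmxA PP mul1mx.
have PPt : P *m P^T = 1%:M by exact: mulmx1C.
have capE w : cap zeta theta (P^T *m w) = cap zeta e1 w.
  by rewrite /cap/= tE frob_orthogonal// inner_orthogonal.
pose A' := [set w : W | A (P^T *m w)].
have mA' : measurable A' by exact: measurable_linear.
have h := hcov_cap1 z0 mA'.
apply: (@le_trans _ _ (hcov s d [set u : W | [/\ frob u = 1%R, A' u & cap zeta e1 u]])).
  apply: le_trans (@hcov_lipschitz _ _ _ _ _ _ _ (fun w : W => P^T *m w) _ _); last first.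
    by move=> x y _ _; rewrite -mulmxBr frob_orthogonal.
  apply: le_outer_measure => u [fu Au cu]; exists (P *m u); last by rewrite mulmxA PP mul1mx.
  split; first by rewrite frob_orthogonal.
    by rewrite /A'/= mulmxA PP mul1mx.
  by rewrite -capE mulmxA PP mul1mx.
apply: le_trans h _; apply: lee_wpmul2l.
  by rewrite lee_fin mulr_ge0// invr_ge0 exprn_ge0// ltW.
rewrite -[leRHS](leb_orthogonal PP'); last first.
  rewrite (_ : mkset _ = eball 1 `&` ([set w | A (unitv w)] `&` cap zeta theta)); last first.
    by apply/seteqP; split => w [] //= ? [].
  apply: measurableI; first exact: measurable_eball.
  apply: measurableI; last exact: measurable_cap.
  exact: (measurable_preimage_mx (@measurable_unitv _ _ _)).
rewrite le_eqVlt; apply/orP; left; apply/eqP; congr leb; apply/funext => w /=.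
rewrite capE frob_orthogonal// /A'/= /unitv frob_orthogonal//.
by rewrite -(scalemxAr _ P^T w).
Qed.

End sphere_chart.

Section hausdorff_sphere.
Context {R : realType}.

(** The condition is open in the axis and, since zeta < 1, holds for the axis u itself. *)
Lemma rational_center {N} (u : 'cV[R]_N) zeta : frob u = 1 -> zeta < 1 ->
  exists q : 'cV[rat]_N, zeta * frob (map_mx ratr q : 'cV[R]_N) < inner u (map_mx ratr q).
Proof.
move=> u1 z1; pose P := [set q : 'cV[R]_N | zeta * frob q < inner u q].
have oP : open P.
  apply: open_lt; first by apply: ctsM; [exact: cst_continuous|apply: cts_frob; exact: cts_id].
  by apply: cts_inner; [exact: cst_continuous|exact: cts_id].
have Pu : P u by rewrite /P/= u1 mulr1 -sqr_frob u1 expr1n.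
have := open_nbhs_nbhs (conj oP Pu) => /nbhs_ballP[e /= e0 he].
have ex i : exists r : rat, `|u i 0 - ratr r| < e.
  have [r] : exists q : rat, ratr q \in `]u i 0 - e, u i 0 + e[.
    by apply: rat_in_itvoo; rewrite ltrD2l (lt_trans _ e0)// oppr_lt0.
  by rewrite in_itv/= => /andP[h1 h2]; exists r; rewrite distrC ltr_distl; apply/andP.
have [g gP] := choice ex.
exists (\col_i g i); apply: (he _ _); split=> // i j.
by rewrite !mxE ord1; exact: gP.
Qed.

(** The sphere is cut into countably many disjoint pieces, each in a cap of cosine [zeta] = 1 / r
    with a rational axis. The bound on a cap loses the factor r^(s + 1), and r tends to 1. *)
Lemma hcov_sphere s (d : R) (A : set 'cV[R]_(1 + s)) : (0 < s)%N -> 0 < d -> measurable A ->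
  (hcov s d [set u : 'cV[R]_(1 + s) | frob u = 1%R /\ A u] <=
   s.+1%:R%:E * leb [set w : 'cV[R]_(1 + s) | (frob w < 1)%R /\ A (unitv w)])%E.
Proof.
move=> s0 d0 mA; set S := [set u | _]; set V := [set w | _].
have mV : measurable V.
  apply: measurableI; first exact: measurable_eball.
  exact: (measurable_preimage_mx (@measurable_unitv _ _ _)).
have Vf : leb V \is a fin_num.
  rewrite ge0_fin_numE//; apply: le_lt_trans (leb_eball_lty (1 + s) 1 1).
  by apply: le_measure; rewrite ?inE//; [exact: measurable_eball|move=> w []].
suff h r : 1 < r -> (hcov s d S <= (r ^+ s.+1 * (s.+1%:R * fine (leb V)))%:E)%E.
  have Sf : hcov s d S \is a fin_num.
    rewrite ge0_fin_numE; last exact: outer_measure_ge0.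
    by apply: le_lt_trans (h 2 _) _; rewrite ?ltry// ltr1n.
  rewrite -(fineK Vf) -EFinM -(fineK Sf) lee_fin; apply: (@le_exprM_gt1 _ s.+1) => r r1.
  by rewrite -lee_fin (fineK Sf); exact: h.
move=> r1; have r0 : 0 < r by apply: lt_trans r1.
pose zeta := r^-1; have z0 : 0 < zeta by rewrite invr_gt0.
have z1 : zeta < 1 by rewrite invf_lt1.
pose q k : 'cV[R]_(1 + s) := map_mx ratr (odflt (0 : 'cV[rat]_(1 + s)) (unpickle k)).
pose F k := [set w : 'cV[R]_(1 + s) | zeta * frob (q k) * frob w < inner w (q k)].
have mF k : measurable (F k).
  apply: open_measurable_mx; apply: open_lt.
    by apply: ctsM; [exact: cst_continuous|apply: cts_frob; exact: cts_id].
  by apply: cts_inner; [exact: cts_id|exact: cst_continuous].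
pose D k := A `&` seqDU F k.
have mD k : measurable (D k).
  by apply: measurableI => //; apply: measurableD => //; apply: bigsetU_measurable.
pose G k := [set w : 'cV[R]_(1 + s) | frob w < 1 /\ D k (unitv w)].
have mG k : measurable (G k).
  apply: measurableI; first exact: measurable_eball.
  exact: (measurable_preimage_mx (@measurable_unitv _ _ _)).
have SG k : (hcov s d [set u : 'cV[R]_(1 + s) | frob u = 1%R /\ D k u] <= (r ^+ s.+1 * s.+1%:R)%:E * leb (G k))%E.
  have [qk|qk] := eqVneq (q k) 0.
    rewrite [X in hcov s d X](_ : _ = set0) ?outer_measure0.
      by rewrite mule_ge0// lee_fin mulr_ge0// exprn_ge0// ltW.
    apply/seteqP; split => // u [_ [_ [Fu _]]].
    by move: Fu; rewrite /F/= qk frob0 inner0r mulr0 mul0r ltxx.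
  have q0 : 0 < frob (q k) by apply: frob_gt0.
  have capE w : F k w -> cap zeta (unitv (q k)) w.
    by rewrite /F/cap/= /unitv innerZr mulrAC -ltr_pdivlMr// [inner _ _ / _]mulrC.
  apply: le_trans (le_outer_measure _ _ _ _) _; last first.
    apply: le_trans (@hcov_cap _ _ s0 _ d0 zeta (unitv (q k)) (D k) z0 (frob_unitv qk) (mD k)) _.
    rewrite /zeta exprVn invrK lee_wpmul2l ?lee_fin ?mulr_ge0 ?exprn_ge0 ?(ltW r0)//.
    apply: le_measure; rewrite ?inE//; last by move=> w [].
    rewrite (_ : mkset _ = G k `&` cap zeta (unitv (q k))).
      by apply: measurableI => //; exact: measurable_cap.
    by apply/seteqP; split => w; [case|case=> -[]].
  by move=> u /= [u1 Du]; split => //; apply: capE; case: Du => _ [].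
have Ssub : S `<=` \bigcup_k [set u : 'cV[R]_(1 + s) | frob u = 1 /\ D k u].
  move=> u [u1 Au]; have [q1 hq] := rational_center u1 z1.
  have : (\bigcup_k F k) u.
    by exists (pickle q1) => //; rewrite /F/= u1 mulr1 /q pickleK.
  by rewrite seqDU_bigcup_eq => -[k _ Fk]; exists k.
apply: le_trans (le_outer_measure _ _ _ Ssub) _.
apply: le_trans (outer_measure_sigma_subadditive _ _) _.
apply: (@le_trans _ _ (\sum_(0 <= k <oo) ((r ^+ s.+1 * s.+1%:R)%:E * leb (G k)))%E).
  by apply: lee_nneseries => [k _ _|k _]; [exact: outer_measure_ge0|exact: SG].
rewrite nneseriesZl//.
rewrite mulrA [in leRHS]EFinM (fineK Vf) lee_wpmul2l ?lee_fin ?mulr_ge0 ?exprn_ge0 ?(ltW r0)//.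
have tG : trivIset setT G.
  move=> i j _ _ [w [[_ [_ wi]] [_ [_ wj]]]].
  by apply: (trivIset_seqDU F) => //; exists (unitv w).
rewrite -(@measure_semi_bigcup _ _ _ leb G)//; last exact: bigcup_measurable.
apply: le_measure; rewrite ?inE//; first exact: bigcup_measurable.
by move=> w [k _ [w1 [Aw _]]].
Qed.

Lemma hcov_sphere_col N s (d : R) (A : set 'cV[R]_N) : N = s.+1 -> (0 < s)%N -> 0 < d -> measurable A ->
  (hcov s d [set u : 'cV[R]_N | frob u = 1%R /\ A u] <=
   N%:R%:E * leb [set w : 'cV[R]_N | (frob w < 1)%R /\ A (unitv w)])%E.
Proof. by move=> NE; subst N; exact: hcov_sphere. Qed.

Lemma frob_mxvec n m (x : 'M[R]_(n, m)) : frob (mxvec x) = frob x.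
Proof.
rewrite /frob !innerE; congr Num.sqrt; under eq_bigr do rewrite big_ord1.
rewrite exchange_big pair_bigA/= (reindex _ (curry_mxvec_bij _ _))/=.
by apply: eq_bigr => -[i j] _ /=; rewrite !mxvecE.
Qed.

(** Matrices are flattened to columns, an isometry for [frob]; there one coordinate can be singled
    out as the normal of a tangent hyperplane. *)
Lemma hausdorff_sphere_le n m (A : set 'M[R]_(n, m)) : (1 < n * m)%N -> measurable A ->
  (hausdorff (n * m).-1 (sphere `&` A) <=
   (n * m)%:R%:E * leb [set w : 'M[R]_(n, m) | (frob w < 1)%R /\ A (unitv w)])%E.
Proof.
move=> nm1 mA; apply: ge_ereal_sup => _ [d /= d0 <-].
have nmE : (n * m = (n * m).-1.+1)%N by rewrite prednK// (ltn_trans _ nm1).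
pose f (w : 'cV[R]_(n * m)) : 'M[R]_(n, m) := vec_mx w^T.
have frobf w : frob (f w) = frob w by rewrite /f -frob_mxvec vec_mxK frob_trmx.
have fZ a w : f (a *: w) = a *: f w by rewrite /f !linearZ.
have fB v w : f (v - w) = f v - f w by rewrite /f !linearB.
have mV : measurable [set w : 'M[R]_(n, m) | frob w < 1 /\ A (unitv w)].
  apply: measurableI; first exact: measurable_eball.
  exact: (measurable_preimage_mx (@measurable_unitv _ _ _)).
have mf : measurable_fun setT f.
  apply: measurable_mx => i j; under eq_fun do rewrite !mxE.
  exact: measurable_coord.
have mfA : measurable [set w | A (f w)] by exact: (measurable_preimage_mx mf).
have d00 := d0.
apply: (@le_trans _ _ (hcov (n * m).-1 d [set w : 'cV[R]_(n * m) | frob w = 1%R /\ A (f w)])).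
  rewrite -[leLHS]/(hcov (n * m).-1 d (sphere `&` A)).
  apply: le_trans (@hcov_lipschitz _ _ _ _ _ _ _ f _ _); last by move=> x y _ _; rewrite -fB frobf.
  apply: le_outer_measure => u [u1 Au]; exists (mxvec u)^T; last by rewrite /f trmxK mxvecK.
  by rewrite /= frob_trmx frob_mxvec /f trmxK mxvecK.
apply: le_trans (hcov_sphere_col nmE _ d0 mfA) _; first by rewrite -ltnS -nmE.
pose V := [set w : 'M[R]_(n, m) | frob w < 1 /\ A (unitv w)].
have mV' : measurable [set v : 'rV[R]_(n * m) | V (vec_mx v)].
  apply: (measurable_preimage_mx (f := fun v : 'rV[R]_(n * m) => vec_mx v)) => //.
  by apply: measurable_mx => i j; under eq_fun do rewrite mxE; exact: measurable_coord.
rewrite -[leb V](leb_mxvec mV) -[in leRHS](leb_trmx mV').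
rewrite le_eqVlt; apply/orP; left; apply/eqP; congr (_ * leb _)%E.
apply/funext => w /=; rewrite /V/= -/(f w) frobf /unitv frobf; congr (_ /\ A _).
by rewrite fZ.
Qed.

End hausdorff_sphere.

Lemma integral_le_sum_indic {R : realType} d (T : measurableType d) (mu : {measure set T -> \bar R})
    (f : T -> \bar R) (E : nat -> set T) (c : R) K : 0 <= c -> (forall k, measurable (E k)) ->
  (forall x, (0 <= f x)%E) -> (forall x, (f x <= \sum_(k < K) (c * \1_(E k) x)%:E)%E) ->
  (\int[mu]_x f x <= \sum_(k < K) c%:E * mu (E k))%E.
Proof.
move=> c0 mE f0 fE.
rewrite [leRHS](eq_bigr (fun k : 'I_K => \int[mu]_u (c * \1_(E k) u)%:E)%E); last first.
  move=> k _; rewrite (@integral_fun_cst _ _ _ mu (E k) _ c%:E)//.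
    by move=> u Eu; rewrite indicE mem_set ?mulr1.
  by move=> u Eu; rewrite indicE memNset ?mulr0.
rewrite -ge0_integral_sum//; last 2 first.
- by move=> k; apply/measurable_EFinP; apply: measurable_funM => //; exact: measurable_indic.
- by move=> k u _; rewrite lee_fin mulr_ge0.
by apply: ge0_le_integral_gen.
Qed.

(** * From spherical sets to integrals over the sphere *)

Section hausdorff_integral.
Import HBNNSimple.
Context {R : realType} {n m : nat}.
Hypothesis nm_gt1 : (1 < n * m)%N.
Notation M := 'M[R]_(n, m).
Variable g : M -> \bar R.
Hypothesis g_ge0 : forall u, (0 <= g u)%E.
Hypothesis mg : forall t : R, 0 <= t -> measurable [set u | (t%:E < g u)%E].

Let C (t : R) : set M := [set w | (frob w < 1)%R /\ (t%:E < g (unitv w))%E].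

Lemma measurable_superlevel_unitv t : 0 <= t -> measurable [set w : M | (t%:E < g (unitv w))%E].
Proof.
move=> t0; exact: (measurable_preimage_mx (A := [set u | (t%:E < g u)%E]) (@measurable_unitv _ _ _) (mg t0)).
Qed.

Let mC t : 0 <= t -> measurable (C t).
Proof.
move=> t0; apply: measurableI; [exact: measurable_eball|exact: measurable_superlevel_unitv].
Qed.

Let mu := @hausdorff_measure R n m (n * m).-1.

(** Layer cake with step [d] for a simple minorant h of g. The superlevel sets of h are measurable
    for the Hausdorff measure and lie in those of g, which are Borel. The layer at level 0, not
    covered by the hypothesis, is estimated separately. *)
Lemma integral_sphere_layer (X : \bar R) :
  (forall (d : R) K, (0 < d)%R -> (\sum_(k < K) d%:E * leb (C (d * k.+1%:R)) <= X)%E) ->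
  (\int[mu]_(u in sphere) g u <= (n * m)%:R%:E * X)%E.
Proof.
move=> hX; have X0 : (0 <= X)%E by apply: le_trans (hX 1 0%N ltr01); rewrite big_ord0.
rewrite integral_mkcond ge0_integralTE; last by move=> u; rewrite erestrict_ge0.
apply: ge_ereal_sup => _ [h hg <-].
have [K0 hK] : exists K0 : R, forall u, h u <= K0.
  have [k [kr hk]] := simple_bounded h.
  exists (k + 1) => u; apply: le_trans (ler_norm _) _; apply: hk => //.
  by rewrite ltrDl.
have fB : leb (@eball R n m 1) \is a fin_num by rewrite ge0_fin_numE// leb_eball_lty.
apply/lee_addgt0Pr => e e0.
pose b := (n * m)%:R * fine (leb (@eball R n m 1)).
have b0 : 0 <= b by rewrite mulr_ge0// fine_ge0.
(* The bottom layer costs at most [d] times [b], hence at most [e]. *)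
pose d := e / (b + 1); have d0 : 0 < d by rewrite divr_gt0// ltr_wpDl.
pose K := Num.bound (K0 / d).
pose E k := [set u : caratheodory_type (@hausdorff R n m (n * m).-1) | d * k%:R < h u].
have mE k : measurable (E k).
  rewrite (_ : E k = setT `&` h @^-1` `]d * k%:R, +oo[%classic); last first.
    by apply/seteqP; split => u /=; rewrite in_itv/= andbT //; case.
  exact: measurable_funP.
have Ele k : (mu (E k) <= (n * m)%:R%:E * leb (C (d * k%:R)))%E.
  have t0 : 0 <= d * k%:R by rewrite mulr_ge0// ltW.
  apply: le_trans (hausdorff_sphere_le nm_gt1 (mg t0)).
  apply: (@le_outer_measure _ _ (hausdorff (n * m).-1)) => u Eu.
  have := hg u; rewrite /= patchE; case: ifPn => [|_].
    by rewrite inE => Su hu; split => //; apply: lt_le_trans hu; rewrite lte_fin.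
  by rewrite lee_fin => h0; have := lt_le_trans Eu h0; rewrite ltNge t0.
rewrite -integralT_nnsfun.
have hsum u : ((h u)%:E <= \sum_(k < K.+1) (d * \1_(E k) u)%:E)%E.
  rewrite sumEFin lee_fin; have : h u <= d * K.+1%:R.
    apply: le_trans (hK u) _; rewrite mulrC -ler_pdivrMr//.
    apply: le_trans (ler_norm _) _; apply: le_trans (ltW (archi_boundP (normr_ge0 _))) _.
    by rewrite ler_nat /K /Num.bound normr_id leqnSn.
  elim: (K.+1) => [|k IH]; first by rewrite mulr0 big_ord0.
  rewrite big_ord_recr/= indicE => hk; have [hu|hu] := leP (h u) (d * k%:R).
    by apply: le_trans (IH hu) _; rewrite lerDl mulr_ge0// ltW.
  have Ei i : (i <= k)%N -> \1_(E i) u = 1 :> R.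
    move=> ik; rewrite indicE mem_set//; apply: le_lt_trans hu.
    by rewrite ler_pM2l// ler_nat.
  rewrite -indicE Ei// mulr1; apply: le_trans hk _.
  rewrite (eq_bigr (fun=> d)); last by move=> i _; rewrite Ei ?mulr1// ltnW.
  by rewrite sumr_const card_ord -natr1 mulrDr mulr1 -[X in _ <= X + _]mulr_natr.
apply: (@le_trans _ _ (\sum_(k < K.+1) d%:E * mu (E k))%E).
  apply: integral_le_sum_indic => //; first exact: ltW.
  by move=> u; rewrite lee_fin.
rewrite big_ord_recl/= addeC; apply: leeD.
  apply: (@le_trans _ _ (\sum_(k < K) (n * m)%:R%:E * (d%:E * leb (C (d * k.+1%:R))))%E).
    apply: lee_sum => k _; rewrite muleCA lee_wpmul2l ?lee_fin ?(ltW d0)//.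
    exact: Ele.
  rewrite -ge0_sume_distrr; last by move=> k _; rewrite mule_ge0// lee_fin ltW.
  by rewrite lee_wpmul2l ?lee_fin// hX.
apply: (@le_trans _ _ (d%:E * b%:E)%E).
  apply: lee_wpmul2l; first by rewrite lee_fin ltW.
  apply: le_trans (Ele _) _.
  rewrite mulr0 /b EFinM fineK// lee_wpmul2l ?lee_fin//; apply: le_measure; rewrite ?inE.
  - exact: mC.
  - exact: measurable_eball.
  - by move=> w [].
by rewrite -EFinM lee_fin /d mulrAC ler_pdivrMr ?ltr_wpDl// ler_pM2l// lerDl.
Qed.

(** At each w the levels d (k + 1) below g(unitv w) contribute [d] each, in total at most g(unitv
    w), whatever the step. *)
Lemma integral_sphere_le : measurable_fun setT (fun w : M => g (unitv w)) ->
  (\int[mu]_(u in sphere) g u <= (n * m)%:R%:E * \int[leb]_(w in eball 1) g (unitv w))%E.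
Proof.
move=> mgu; apply: integral_sphere_layer => d K d0.
have t0 k : 0 <= d * k.+1%:R by rewrite mulr_ge0// ltW.
apply: (@le_trans _ _ (\sum_(k < K) \int[leb]_(w in eball 1) (d * \1_(C (d * k.+1%:R)) w)%:E)%E).
  apply: lee_sum => k _; rewrite integral_mkcond (@integral_fun_cst _ _ _ leb (C (d * k.+1%:R)) _ d%:E)//.
  - exact: mC.
  - move=> w Cw; rewrite patchE mem_set; last by case: Cw.
    by rewrite indicE mem_set// mulr1.
  - by move=> w Cw; rewrite patchE; case: ifP => // _; rewrite indicE memNset// mulr0.
rewrite -ge0_integral_sum//; last 3 first.
- exact: measurable_eball.
- move=> k; apply/measurable_EFinP; apply: measurable_funM => //.
  by apply: (measurable_funS measurableT) => //; apply: measurable_indic; exact: mC.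
- by move=> k w _; rewrite lee_fin mulr_ge0// ltW.
apply: ge0_le_integral_gen => w _.
  by apply: sume_ge0 => k _; rewrite lee_fin mulr_ge0// ltW.
elim: K => [|K IH]; first by rewrite big_ord0.
rewrite big_ord_recr/=; have [hw|hw] := leP (g (unitv w)) (d * K.+1%:R)%:E.
  rewrite indicE memNset ?mulr0 ?adde0// => -[_]; by rewrite ltNge hw.
apply: le_trans (ltW hw); rewrite sumEFin -EFinD lee_fin.
rewrite -natr1 mulrDr mulr1; apply: lerD; last by rewrite ger_pMr// indicE lern1 leq_b1.
rewrite -[K in leRHS]card_ord -sum1_card natr_sum mulr_sumr; apply: ler_sum => k _.
by rewrite ler_pM2l// indicE lern1 leq_b1.
Qed.

(** The ball is cut into shells between radii [r k] with (r k)^N = d k, N = n m. Shell k meets the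
    cone over {g > d (k + 1)} in volume d |C|, and on this part |w|^N < d (k + 1) < g(unitv w); the
    parts are disjoint. *)
Lemma integral_sphere_le_leb :
  measurable [set w : M | ((frob w ^+ (n * m))%:E < g (unitv w))%E] ->
  (\int[mu]_(u in sphere) g u <=
   (n * m)%:R%:E * leb [set w : M | ((frob w ^+ (n * m))%:E < g (unitv w))%E])%E.
Proof.
move=> mD; apply: integral_sphere_layer => d K d0.
have N0 : (0 < n * m)%N by apply: ltn_trans nm_gt1.
pose r k := (d * k%:R) `^ ((n * m)%:R^-1).
have rN k : r k ^+ (n * m) = d * k%:R.
  by rewrite -powR_mulrn ?powR_ge0// -powRrM mulVf ?pnatr_eq0 ?lt0n_neq0// powRr1// mulr_ge0// ltW.
have r_ge0 k : 0 <= r k by exact: powR_ge0.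
have r_homo k l : (k <= l)%N -> r k <= r l.
  by move=> kl; apply: ge0_ler_powR; rewrite ?invr_ge0 ?nnegrE ?mulr_ge0 ?(ltW d0)// ler_pM2l// ler_nat.
pose A k : set M := [set w | frob w < r k].
pose cone k : set M := [set w | (d * k.+1%:R)%:E < g (unitv w)]%E.
have mcone k : measurable (cone k) by apply: measurable_superlevel_unitv; rewrite mulr_ge0// ltW.
have mA k : measurable (A k) by exact: measurable_eball.
have VA k l : leb (A l `&` cone k) = ((d * l%:R)%:E * leb (C (d * k.+1%:R)))%E.
  case: l => [|l].
    rewrite mulr0 mul0e (_ : _ `&` _ = set0) ?measure0//.
    apply/seteqP; split => // w [+ _]; rewrite /A/= => /(le_lt_trans (frob_ge0 w)).
    by move=> /(exprn_gt0 (n * m)); rewrite rN mulr0 ltxx.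
  have r0 : 0 < r l.+1 by rewrite powR_gt0// mulr_gt0.
  rewrite (leb_scale r0) ?rN; last exact: measurableI.
  congr (_ * leb _)%E; apply/funext => w /=; apply/propext.
  rewrite /A /cone /C /= /unitv frobZ gtr0_norm// scalerA invfM mulrAC mulVf ?gt_eqF// mul1r.
  by rewrite -[X in _ < X]mulr1 ltr_pM2l.
have -> : (\sum_(k < K) d%:E * leb (C (d * k.+1%:R)) = \sum_(k < K) leb ((A k.+1 `\` A k) `&` cone k))%E.
  apply: eq_bigr => k _.
  have -> : (A k.+1 `\` A k) `&` cone k = (A k.+1 `&` cone k) `\` A k.
    by apply/seteqP; split => w; [case=> -[]|case=> -[]].
  have Cf : leb (C (d * k.+1%:R)) \is a fin_num.
    rewrite ge0_fin_numE//; apply: le_lt_trans (leb_eball_lty n m 1).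
    by apply: le_measure; rewrite ?inE//; [apply: mC; rewrite mulr_ge0// ltW|exact: measurable_eball|move=> w []].
  have E : leb ((A k.+1 `&` cone k) `\` A k) = (leb (A k.+1 `&` cone k) - leb (A k.+1 `&` cone k `&` A k))%E.
    have fV : leb (A k.+1 `&` cone k) \is a fin_num by rewrite VA fin_numM.
    by rewrite measureD//; [exact: measurableI|rewrite -ge0_fin_numE].
  have sub : A k.+1 `&` cone k `&` A k = A k `&` cone k.
    apply/seteqP; split => w; first by case=> -[].
    by case=> Aw cw; split => //; split => //; apply: lt_le_trans Aw _; exact: r_homo.
  rewrite E sub !VA -(fineK Cf) -!EFinM -EFinB -natr1; congr _%:E; ring.
rewrite -(@measure_bigsetU _ _ _ leb (fun k => (A k.+1 `\` A k) `&` cone k)); last 2 first.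
- by move=> k; apply: measurableI => //; apply: measurableD.
- move=> i j _ _ [w [[[Ai Ni] _] [[Aj Nj] _]]].
  case: (ltngtP i j) => // ij; exfalso.
    by apply: Nj; apply: lt_le_trans Ai _; exact: r_homo.
  by apply: Ni; apply: lt_le_trans Aj _; exact: r_homo.
apply: le_measure; rewrite ?inE//.
  by apply: bigsetU_measurable => k _; apply: measurableI => //; apply: measurableD.
move=> w; rewrite -(bigcup_mkord K (fun k => (A k.+1 `\` A k) `&` cone k)) => -[k _ [[Ak _]]]; apply: lt_trans.
by rewrite lte_fin -rN ltr_pXn2r// nnegrE ?frob_ge0.
Qed.

End hausdorff_integral.

(** * Comparison of the energies of f and of the ball *)

Section distribution.
Context {R : realType}.
Local Notation unit_itv := [set z : 'M[R]_1 | (0 < (z 0%R 0%R : R) < 1)%R].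

Lemma measurable_unit_itv : measurable unit_itv.
Proof.
rewrite (_ : mkset _ = [set z : 'M[R]_1 | 0 < z 0 0] `&` [set z | z 0 0 < 1]).
  by apply: measurableI; apply: measurable_lt_set => //; exact: measurable_coord.
by apply/seteqP; split => z /=; [move/andP|move=> [? ?]; apply/andP].
Qed.

Lemma leb_unit_itv : leb unit_itv = 1%E.
Proof.
have := integral_powR_01 (R := R) (s := 0) ltr01 ler01; rewrite expr1n divr1 mulr1 => <-.
rewrite -[LHS]mul1e -integral_cst; last exact: measurable_unit_itv.
by apply: eq_integral => z _.
Qed.

Lemma integral_layer_split n m (A : set 'M[R]_(n, m)) (f : 'M[R]_(n, m) -> R) :
  measurable A -> (leb A < +oo)%E -> measurable_fun setT f -> (forall u, 0 <= f u) ->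
  (\int[leb]_(u in A) (Num.min (f u) 1)%:E +
   \int[leb]_(z in unit_itv) leb [set u : 'M[R]_(n, m) | A u /\ (f u <= z 0%R 0%R)%R] = leb A)%E.
Proof.
move=> mA Aoo mf f0; rewrite integral_min_layer//.
pose P := fun z : 'M[R]_1 => leb [set u : 'M[R]_(n, m) | A u /\ 0 < z 0 0 < 1 /\ z 0 0 < f u].
pose N := fun z : 'M[R]_1 => leb [set u : 'M[R]_(n, m) | A u /\ f u <= z 0 0].
have mle z : measurable [set u : 'M[R]_(n, m) | A u /\ f u <= z].
  by apply: measurableI => //; apply: measurable_le_set.
have mP : measurable_fun setT P.
  exact: (measurable_section leb (measurable_hypograph 1 mA mf)).
have PN z : unit_itv z -> (P z + N z = leb A)%E.
  move=> z01; rewrite /P /N -measureU//; first last.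
  - apply/seteqP; split => // u [[_ [_ h1]] [_ h2]]; by move: h2; rewrite leNgt h1.
  - rewrite (_ : mkset _ = A `&` [set u | z 0 0 < f u]).
      by apply: measurableI => //; apply: measurable_lt_set.
    by apply/seteqP; split => u [Au]; [case|].
  congr leb; apply/seteqP; split => u; first by case=> -[].
  by move=> Au; have [h|h] := leP (f u) (z 0 0); [right|left].
have -> : (\int[leb]_z P z = \int[leb]_(z in unit_itv) P z)%E.
  rewrite [RHS]integral_mkcond; apply: eq_integral => z _; rewrite patchE; case: ifPn => //.
  rewrite notin_setE => nz; rewrite /P (_ : mkset _ = set0) ?measure0//.
  by apply/seteqP; split => // u [_ []].
have m1 := measurable_unit_itv.
have Afin : leb A \is a fin_num by rewrite ge0_fin_numE.
have mN : measurable_fun unit_itv N.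
  apply: (eq_measurable_fun (fun z => leb A - P z)%E).
    move=> z /[!inE] z01; have e := PN z z01.
    have Pf : P z \is a fin_num.
      by move: Afin; rewrite -e fin_numD => /andP[].
    by rewrite -e addeAC subee// add0e.
  by apply: emeasurable_funB => //; apply: (measurable_funS measurableT).
rewrite -ge0_integralD//; last by apply: (measurable_funS measurableT).
transitivity (\int[leb]_(z in unit_itv) leb A)%E.
  by apply: eq_integral => z /[!inE]; exact: PN.
by rewrite integral_cst// [X in (_ * X)%E]leb_unit_itv mule1.
Qed.

Variable a : R.
Hypothesis a_ge1 : 1 <= a.

(* Equals 1/(1 + a), but only the bound powR_mean < 1 matters. *)
Definition powR_mean : R := fine (\int[leb]_(z in unit_itv) ((z 0%R 0%R) `^ a)%:E).

Let int_half : (\int[leb]_(z in unit_itv) ((z 0%R 0%R : R))%:E = (2^-1)%:E)%E.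
Proof.
have := integral_powR_01 (R := R) (s := 1) ltr01 ler01; rewrite expr1n mulr1 div1r => <-.
by apply: eq_integral => z _; rewrite expr1 mulr1.
Qed.

Let int_le : (\int[leb]_(z in unit_itv) ((z 0%R 0%R) `^ a)%:E <= (2^-1)%:E)%E.
Proof.
rewrite -int_half; apply: ge0_le_integral_gen => z /andP[z0 z1]; rewrite lee_fin ?powR_ge0//.
by apply: ge1r_powR; rewrite // z0 ltW.
Qed.

Lemma powR_meanE : (\int[leb]_(z in unit_itv) ((z 0%R 0%R) `^ a)%:E)%E = powR_mean%:E.
Proof.
rewrite /powR_mean fineK// ge0_fin_numE; first exact: le_lt_trans int_le (ltry _).
by apply: integral_ge0 => z _; rewrite lee_fin powR_ge0.
Qed.

Lemma powR_mean_lt1 : powR_mean < 1.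
Proof.
have := int_le; rewrite powR_meanE lee_fin => /le_lt_trans; apply.
by rewrite invf_lt1// ltr1n.
Qed.

Let int_scale (v : R) : 0 <= v ->
  (\int[leb]_(z in unit_itv) (v * (z 0%R 0%R) `^ a)%:E = (v * powR_mean)%:E)%E.
Proof.
move=> v0; rewrite EFinM -powR_meanE -ge0_integralZl_EFin//; first exact: measurable_unit_itv.
  by move=> z _; rewrite lee_fin powR_ge0.
apply/measurable_EFinP; apply: (measurable_funS measurableT) => //.
by apply: (measurableT_comp (measurable_powR a)); exact: measurable_coord.
Qed.

(** The deficit of the truncated integral is the integral of the sublevel volumes over the levels in
    ]0, 1[; a bound v z^a on these volumes leaves v times the mean of z^a. *)
Lemma integral_min1_ge n m (A : set 'M[R]_(n, m)) (f : 'M[R]_(n, m) -> R) (v : R) :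
  measurable A -> (leb A < +oo)%E -> measurable_fun setT f -> (forall u, 0 <= f u) -> 0 <= v ->
  (forall z : R, (0 < z < 1)%R -> leb [set u : 'M[R]_(n, m) | A u /\ (f u <= z)%R] <= (v * z `^ a)%:E)%E ->
  (leb A <= \int[leb]_(u in A) (Num.min (f u) 1)%:E + (v * powR_mean)%:E)%E.
Proof.
move=> mA Aoo mf f0 v0 h; rewrite -(integral_layer_split mA Aoo mf f0) leeD2l// -int_scale//.
by apply: ge0_le_integral_gen => z z01; rewrite ?measure_ge0// h.
Qed.

Lemma integral_min1_le n m (A : set 'M[R]_(n, m)) (f : 'M[R]_(n, m) -> R) (v : R) :
  measurable A -> (leb A < +oo)%E -> measurable_fun setT f -> (forall u, 0 <= f u) -> 0 <= v ->
  (forall z : R, (0 < z < 1)%R -> (v * z `^ a)%:E <= leb [set u : 'M[R]_(n, m) | A u /\ (f u <= z)%R])%E ->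
  (\int[leb]_(u in A) (Num.min (f u) 1)%:E + (v * powR_mean)%:E <= leb A)%E.
Proof.
move=> mA Aoo mf f0 v0 h; rewrite -(integral_layer_split mA Aoo mf f0) leeD2l// -int_scale//.
apply: ge0_le_integral_gen => z z01; last exact: h.
by rewrite lee_fin mulr_ge0// powR_ge0.
Qed.

End distribution.

Section homogeneous_integral.
Context {R : realType} {a b c d : nat}.
Variables (D : set 'M[R]_(a, b)) (F : 'M[R]_(a, b) -> 'M[R]_(c, d) -> R) (p B : R).
Hypothesis p_gt0 : 0 < p.
Hypothesis mD : measurable D.
Hypothesis D_lty : (leb D < +oo)%E.
Hypothesis mF : measurable_fun setT (fun yu : 'M[R]_(a, b) * 'M[R]_(c, d) => F yu.1 yu.2).
Hypothesis F_ge0 : forall y u, 0 <= F y u.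
Hypothesis F_le : forall y u, D y -> F y u <= B * frob u `^ p.
Hypothesis F_hom : forall y u s, 0 < s -> F y (s *: u) = s `^ p * F y u.

(** Common form of P_f, P_B and the integral part of Psi; the growth bound [F_le] makes the integral
    finite, so [fine] loses nothing. *)
Definition hint u : R := fine (\int[leb]_(y in D) (F y u)%:E).

Let D_fin : leb D \is a fin_num. Proof. by rewrite ge0_fin_numE. Qed.

Let int_le u : (\int[leb]_(y in D) (F y u)%:E <= (B * frob u `^ p * fine (leb D))%:E)%E.
Proof.
rewrite EFinM fineK// -integral_cst//; apply: ge0_le_integral_gen => y Dy; rewrite lee_fin//.
exact: F_le.
Qed.

Lemma hintE u : (hint u)%:E = (\int[leb]_(y in D) (F y u)%:E)%E.
Proof.
rewrite /hint fineK// ge0_fin_numE; first exact: le_lt_trans (int_le u) (ltry _).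
by apply: integral_ge0 => y _; rewrite lee_fin.
Qed.

Lemma hint_ge0 u : 0 <= hint u.
Proof. by apply: fine_ge0; apply: integral_ge0 => y _; rewrite lee_fin. Qed.

Lemma hint_le u : hint u <= B * fine (leb D) * frob u `^ p.
Proof. by rewrite -lee_fin hintE mulrAC; exact: int_le. Qed.

Let mFu u : measurable_fun setT (fun y => (F y u)%:E).
Proof.
apply/measurable_EFinP.
exact: (measurableT_comp mF (measurable_fun_pair (@measurable_id _ _ _) (measurable_cst u))).
Qed.

Lemma hintZ s u : 0 < s -> hint (s *: u) = s `^ p * hint u.
Proof.
move=> s0; apply: EFin_inj; rewrite EFinM !hintE -ge0_integralZl_EFin ?powR_ge0//.
- by apply: eq_integral => y _; rewrite F_hom.
- by move=> y _; rewrite lee_fin.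
- exact: (measurable_funS measurableT _ (mFu u)).
Qed.

Let f L (yu : 'M[R]_(a, b) * 'M[R]_(c, d)) : \bar R := (F yu.1 yu.2 * (\1_D yu.1 * \1_L yu.2))%:E.

Let mf L : measurable L -> measurable_fun setT (f L).
Proof.
move=> mL; apply/measurable_EFinP; apply: measurable_funM => //; apply: measurable_funM.
  have m1 : measurable [set yu : 'M[R]_(a, b) * 'M[R]_(c, d) | D yu.1].
    exact: (measurable_preimage_mx measurable_fst mD).
  by rewrite [X in measurable_fun _ X](_ : _ = \1_[set yu : 'M[R]_(a, b) * 'M[R]_(c, d) | D yu.1]).
have m2 : measurable [set yu : 'M[R]_(a, b) * 'M[R]_(c, d) | L yu.2].
  exact: (measurable_preimage_mx measurable_snd mL).
by rewrite [X in measurable_fun _ X](_ : _ = \1_[set yu : 'M[R]_(a, b) * 'M[R]_(c, d) | L yu.2]).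
Qed.

Let f_ge0 L yu : (0 <= f L yu)%E.
Proof. by rewrite lee_fin !mulr_ge0// indicE. Qed.

Let int_f L u : (\int[leb]_y f L (y, u) = \int[leb]_(y in D) (F y u)%:E * (\1_L u)%:E)%E.
Proof.
have i0 : (0 <= \1_L u :> R) by rewrite indicE.
rewrite muleC -ge0_integralZl_EFin//; last 2 first.
- by move=> y _; rewrite lee_fin.
- exact: (measurable_funS measurableT _ (mFu u)).
rewrite [RHS]integral_mkcond; apply: eq_integral => y _; rewrite patchE /f/=.
case: ifPn => [yD|]; rewrite indicE.
  by rewrite yD mul1r mulrC.
by move=> /negbTE ->; rewrite mul0r mulr0.
Qed.

Lemma measurable_hint : measurable_fun setT hint.
Proof.
apply/measurable_EFinP.
have mG := @measurable_fun_fubini_tonelli_G _ _ 'M[R]_(a, b) 'M[R]_(c, d) R leb _ (mf measurableT) (f_ge0 _).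
apply: eq_measurable_fun mG => u _; rewrite /fubini_G int_f/= hintE.
by rewrite indicE in_setT mule1.
Qed.

Lemma tonelli_hint L : measurable L ->
  (\int[leb]_(u in L) (hint u)%:E = \int[leb]_(y in D) \int[leb]_(u in L) (F y u)%:E)%E.
Proof.
move=> mL; have E := @fubini_tonelli _ _ 'M[R]_(a, b) 'M[R]_(c, d) R leb leb _ (mf mL) (f_ge0 _).
transitivity (\int[leb]_u \int[leb]_y f L (y, u))%E.
  rewrite integral_mkcond; apply: eq_integral => u _; rewrite int_f -hintE patchE.
  by case: ifPn => [uL|/negbTE uL]; rewrite indicE uL ?mule1 ?mule0.
rewrite -E [RHS]integral_mkcond; apply: eq_integral => y _; rewrite patchE.
case: ifPn => yD.
  rewrite [RHS]integral_mkcond; apply: eq_integral => u _; rewrite patchE /f/= !indicE yD mul1r.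
  by case: ifPn => uL; rewrite ?mulr1 ?mulr0.
by rewrite integral0_eq// => u _; rewrite /f/= indicE (negbTE yD) mul0r mulr0.
Qed.

(** By homogeneity the sublevel set at t is the dilate by t^(1 / p) of the one at 1. *)
Lemma leb_hint_sublevel t : 0 < t ->
  (leb [set u | (hint u <= t)%R] = (t `^ ((c * d)%:R / p))%:E * leb [set u | (hint u <= 1)%R])%E.
Proof.
move=> t0; have mle s : measurable [set u | hint u <= s].
  by apply: measurable_le_set => //; exact: measurable_hint.
have s0 : 0 < t `^ p^-1 by rewrite powR_gt0.
rewrite (leb_scale s0)// -powR_mulrn ?powR_ge0// -powRrM [p^-1 * _]mulrC.
congr (_ * leb _)%E; apply/funext => u /=.
rewrite hintZ// -powRrM mulVf ?gt_eqF// powRr1 ?(ltW t0)//.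
by rewrite -[X in _ <= X]mulr1 ler_pM2l.
Qed.

End homogeneous_integral.

Lemma integral_scale {R : realType} n m (k : R) (D : set 'M[R]_(n, m)) (g : 'M[R]_(n, m) -> R) :
  0 < k -> measurable D -> measurable_fun setT g -> (forall x, 0 <= g x) ->
  (\int[leb]_(x in D) (g x)%:E =
   (k ^+ (n * m))%:E * \int[leb]_(x in [set x : 'M[R]_(n, m) | D (k *: x)%R]) (g (k *: x)%R)%:E)%E.
Proof.
move=> k0 mD mg g0.
have mf : measurable_fun setT (fun x : 'M[R]_(n, m) => k *: x).
  by apply: cts_measurable_mx; apply: cts_mxZ; [exact: cst_continuous|exact: cts_id].
have kn0 : 0 <= k ^+ (n * m) by rewrite exprn_ge0// ltW.
pose mu : {measure set 'M[R]_(n, m) -> \bar R} := pushforward leb (fun x => k *: x).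
pose nu : {measure set 'M[R]_(n, m) -> \bar R} := mscale (NngNum kn0) (mu mf).
have mgE : measurable_fun D (fun x => (g x)%:E).
  by apply: (measurable_funS measurableT) => //; apply/measurable_EFinP.
rewrite (@eq_measure_integral _ _ _ _ nu); last by move=> A mA _; exact: leb_scale.
rewrite ge0_integral_mscale//; last by move=> x _; rewrite lee_fin.
congr (_ * _)%E; rewrite ge0_integral_pushforward//.
by move=> x _; rewrite lee_fin.
Qed.

Lemma Cc_grad_support {R : realType} k (f : 'cV[R]_(1 + k) -> R) : Cc_infty f ->
  exists2 rho : R, 0 < rho & forall x, ~ eball rho x -> grad f x = 0.
Proof.
move=> fC; have [C C0 hC] := compact_cts_bounded fC.2 (cts_frob (@cts_id _)).
exists (C + 1); first by rewrite ltr_wpDl// ltW.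
move=> x xC; apply/colP => i; rewrite !mxE.
apply: (@derive_support _ _ f (closure [set x | f x != 0])); first exact: closed_closure.
  by move=> y yK; apply/eqP/negPn/negP => h; apply: yK; exact: subset_closure.
move=> /hC; rewrite ger0_norm ?frob_ge0// => h; apply: xC.
by apply: le_lt_trans h _; rewrite ltrDl.
Qed.

Section mixed_kernel.
Context {R : realType} {n m : nat} (H : 'rV[R]_m -> R) (p M : R).
Hypothesis p_gt0 : 0 < p.
Hypothesis M_ge0 : 0 <= M.
Hypothesis H_le : forall w, H w <= M * frob w `^ p.
Hypothesis H_hom : forall s w, 0 < s -> H (s *: w) = s `^ p * H w.
Hypothesis H_cts : continuous H.

Lemma kernel_le (w : 'cV[R]_n) (u : 'M[R]_(n, m)) : H (w^T *m u) <= M * (frob w * frob u) `^ p.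
Proof.
apply: le_trans (H_le _) _; rewrite ler_wpM2l//.
apply: ge0_ler_powR; rewrite ?nnegrE ?mulr_ge0 ?frob_ge0 ?(ltW p_gt0)//.
by rewrite -(frob_trmx w) frob_mulmx.
Qed.

Lemma kernel_homl (w : 'cV[R]_n) (u : 'M[R]_(n, m)) s : 0 < s ->
  H ((s *: w)^T *m u) = s `^ p * H (w^T *m u).
Proof. by move=> s0; rewrite linearZ -scalemxAl H_hom. Qed.

Lemma kernel_homr (w : 'cV[R]_n) (u : 'M[R]_(n, m)) s : 0 < s ->
  H (w^T *m (s *: u)) = s `^ p * H (w^T *m u).
Proof. by move=> s0; rewrite -scalemxAr H_hom. Qed.

Lemma measurable_kernel d (T : measurableType d) (g : T -> 'cV[R]_n) (h : T -> 'M[R]_(n, m)) :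
  measurable_fun setT g -> measurable_fun setT h ->
  measurable_fun setT (fun t => H ((g t)^T *m h t)).
Proof.
move=> mg mh; apply: (measurableT_comp (f := H)); first exact: continuous_measurable_mx.
apply: measurable_mx => i j.
rewrite (_ : (fun t => _) = (fun t => \sum_l g t l i * h t l j)); last first.
  by apply/funext => t; rewrite !mxE; apply: eq_bigr => l _; rewrite !mxE.
apply: measurable_sum => l; apply: measurable_funM.
  exact: (measurableT_comp (measurable_coord l i) mg).
exact: (measurableT_comp (measurable_coord l j) mh).
Qed.

End mixed_kernel.

(** * The function Psi and the body polar to its sublevel set *)

Section centroid_weight.
Context {R : realType} {k m : nat} (H : 'rV[R]_(1 + m) -> R) (p M Rr eta : R).
Notation V := 'cV[R]_(1 + k).
Notation U := 'M[R]_(1 + k, 1 + m).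
Variable L : set U.
Hypothesis p_gt1 : 1 < p.
Hypothesis M_ge0 : 0 <= M.
Hypothesis H_ge0 : forall w, 0 <= H w.
Hypothesis H_le : forall w, H w <= M * frob w `^ p.
Hypothesis H_hom : forall s w, 0 < s -> H (s *: w) = s `^ p * H w.
Hypothesis H_cts : continuous H.
Hypothesis H_sub : forall w0, exists y c, minorant H y c /\ inner w0 y - c = H w0.
Hypothesis Rr_gt0 : 0 < Rr.
Hypothesis eta_gt0 : 0 < eta.
Hypothesis mL : measurable L.
Hypothesis L_sub : L `<=` eball Rr.

Let p_gt0 : 0 < p. Proof. exact: lt_trans p_gt1. Qed.

Let ker (u : U) (w : V) := H (w^T *m u).

Definition centroid_weight (w : V) : R := hint L ker w + eta * frob w `^ p.
Local Notation Psi := centroid_weight.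

Let L_lty : (leb L < +oo)%E.
Proof.
apply: le_lt_trans (leb_eball_lty (1 + k) (1 + m) Rr).
by apply: le_measure; rewrite ?inE//; exact: measurable_eball.
Qed.

Let mker : measurable_fun setT (fun yu : U * V => ker yu.1 yu.2).
Proof. exact: (measurable_kernel H_cts measurable_snd measurable_fst). Qed.

Let ker_ge0 u w : 0 <= ker u w. Proof. exact: H_ge0. Qed.

Let ker_le u w : L u -> ker u w <= M * Rr `^ p * frob w `^ p.
Proof.
move=> /L_sub; rewrite /eball/= => uR; apply: le_trans (kernel_le p_gt0 M_ge0 H_le w u) _.
rewrite [frob w * _]mulrC powRM ?frob_ge0// -mulrA ler_wpM2l//.
by rewrite ler_wpM2r ?powR_ge0// ge0_ler_powR ?nnegrE ?frob_ge0 ?(ltW uR) ?(ltW p_gt0) ?(ltW Rr_gt0).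
Qed.

Let ker_hom u w s : 0 < s -> ker u (s *: w) = s `^ p * ker u w.
Proof. exact: kernel_homl. Qed.

Let c0 := M * Rr `^ p * fine (leb L) + eta.
Let c0_gt0 : 0 < c0.
Proof. by rewrite ltr_wpDl// mulr_ge0// ?fine_ge0// mulr_ge0// powR_ge0. Qed.

Lemma centroid_hintE w : (hint L ker w)%:E = (\int[leb]_(u in L) (H (w^T *m u))%:E)%E.
Proof. exact: (hintE mL L_lty ker_ge0 ker_le). Qed.

Lemma measurable_centroid_hint : measurable_fun setT (hint L ker).
Proof. exact: (measurable_hint mL L_lty mker ker_ge0 ker_le). Qed.

Lemma centroid_weight_ge0 w : 0 <= Psi w.
Proof. by rewrite addr_ge0 ?hint_ge0// mulr_ge0 ?powR_ge0// ltW. Qed.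

Let Psi_le w : Psi w <= c0 * frob w `^ p.
Proof.
rewrite mulrDl lerD2r; exact: (hint_le mL L_lty ker_ge0 ker_le).
Qed.

Let Psi_lower w : eta * frob w `^ p <= Psi w.
Proof. by rewrite lerDr hint_ge0. Qed.

Let Psi_hom s w : 0 < s -> Psi (s *: w) = s `^ p * Psi w.
Proof.
move=> s0; rewrite /Psi (hintZ mL L_lty mker ker_ge0 ker_le ker_hom)// frobZ gtr0_norm//.
by rewrite powRM ?frob_ge0 ?(ltW s0)// mulrCA -mulrDr.
Qed.

Lemma measurable_centroid_weight : measurable_fun setT Psi.
Proof.
apply: measurable_funD; first exact: measurable_centroid_hint.
apply: measurable_funM => //; apply: (measurableT_comp (measurable_powR p)).
by apply: continuous_measurable_mx; apply: cts_frob; exact: cts_id.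
Qed.

Let W : set V := [set w | Psi w <= 1].
(** Psi lies between eta |w|^p and c0 |w|^p, which gives the inner and outer radii of [W]; the added
    1 makes the outer inclusion strict. *)
Let del := c0 `^ (- p^-1).
Let rho := eta `^ (- p^-1) + 1.

Let del_gt0 : 0 < del. Proof. exact: powR_gt0. Qed.

Let W_del : eball del `<=` W.
Proof.
move=> w; rewrite /eball/W/= => wd; apply: le_trans (Psi_le w) _.
apply: (@le_trans _ _ (c0 * del `^ p)).
  by rewrite ler_pM2l// ge0_ler_powR ?nnegrE ?frob_ge0 ?(ltW wd) ?(ltW p_gt0) ?(ltW del_gt0).
by rewrite /del -powRrM mulNr mulVf ?gt_eqF// powR_inv1 ?(ltW c0_gt0)// mulfV// gt_eqF.
Qed.

Let W_rho : W `<=` eball rho.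
Proof.
move=> w; rewrite /eball/W/= => wW; apply: (@le_lt_trans _ _ (eta `^ (- p^-1))); last by rewrite ltrDl.
rewrite powRN; have := le_trans (Psi_lower w) wW.
rewrite -ler_pdivlMl// mulr1 => h.
have : (frob w `^ p) `^ p^-1 <= (eta^-1) `^ p^-1.
  by apply: ge0_ler_powR; rewrite ?nnegrE ?powR_ge0 ?invr_ge0 ?(ltW eta_gt0) ?(ltW p_gt0).
rewrite -powRrM mulfV ?gt_eqF// powRr1 ?frob_ge0// => /le_trans; apply.
by rewrite -powR_inv1 ?(ltW eta_gt0)// -powRrM mulN1r powRN.
Qed.

Lemma exists_wulff_radius : exists2 r : R, 0 < r & leb (gauge_ball W) = leb (@eball R (1 + k) 1 r).
Proof.
have rho0 : 0 < rho by rewrite ltr_wpDl// powR_ge0.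
have mG : measurable (gauge_ball W).
  by apply: open_measurable_mx; exact: (open_gauge_ball del_gt0 W_del W_rho).
have Goo : (leb (gauge_ball W) < +oo)%E.
  exact: (leb_sub_lty (gauge_ball_sub del_gt0 W_del W_rho)).
have G0 : (0 < leb (gauge_ball W))%E.
  apply: (@lt_le_trans _ _ (leb (@eball R (1 + k) 1 rho^-1))); first by apply: leb_eball_gt0; rewrite invr_gt0.
  apply: le_measure; rewrite ?inE//; first exact: measurable_eball.
  move=> x; rewrite /eball /gauge_ball/= => xr.
  apply: le_lt_trans (gauge_le_frob del_gt0 W_del W_rho x) _.
  by rewrite mulrC -ltr_pdivlMr// div1r.
have Gf : leb (gauge_ball W) \is a fin_num by rewrite ge0_fin_numE.
have [r r0 rE] := @exists_radius R k (fine (leb (gauge_ball W))) (fine_gt0 (introT andP (conj G0 Goo))).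
by exists r => //; rewrite rE fineK.
Qed.

Variable r : R.
Hypothesis r_gt0 : 0 < r.
Hypothesis G_ball : leb (gauge_ball W) = leb (@eball R (1 + k) 1 r).

Lemma centroid_weight_bathtub (l : R) : 0 <= l ->
  (\int[leb]_(u in eball Rr)
      mine (\int[leb]_(y in @eball R (1 + k) 1 r) (H (r^-1 *: ((unitv y)^T *m u)))%:E) l%:E <=
   leb (@eball R (1 + k) 1 r) + l%:E * leb (eball Rr `\` L))%E.
Proof.
move=> l0; rewrite -G_ball.
apply: (centroid_bathtub p_gt1 M_ge0 H_ge0 H_le H_hom H_cts H_sub r_gt0 del_gt0 W_del W_rho) => //.
move=> xi Wxi; rewrite -centroid_hintE lee_fin.
by apply: le_trans Wxi; rewrite lerDl mulr_ge0 ?powR_ge0// ltW.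
Qed.

Local Notation n := ((1 + k)%:R : R).
Local Notation om := (fine (leb (@eball R (1 + k) 1 1))).

(** The function h = Psi^(1 / p) dominates the support function of the gauge ball, because w / h(w)
    lies in [W]; this is the link between h and [G] that [isocapacitary] asks for. *)
Lemma centroid_weight_isocapacitary (f : V -> R) : Cc_infty f -> p < n ->
  0 < fine (leb [set x | 1 <= f x]) ->
  ((n * r `^ p * om `^ (p / n) * ((n - p) / (p - 1)) `^ (p - 1) *
    fine (leb [set x | (1 <= f x)%R]) `^ ((n - p) / n))%:E <= \int[leb]_x (Psi (grad f x))%:E)%E.
Proof.
move=> fC pn v0; pose h w := Psi w `^ p^-1.
have mh : measurable_fun setT h.
  exact: (measurableT_comp (measurable_powR p^-1) measurable_centroid_weight).
have h_ge0 w : 0 <= h w by exact: powR_ge0.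
have hpE w : h w `^ p = Psi w by rewrite /h -powRrM mulVf ?gt_eqF// powRr1 ?centroid_weight_ge0.
have h_le w : h w <= c0 `^ p^-1 * frob w.
  have pn0 : p != 0 by rewrite gt_eqF.
  have <- : (c0 * frob w `^ p) `^ p^-1 = c0 `^ p^-1 * frob w.
    by rewrite powRM ?powR_ge0 ?(ltW c0_gt0)// -powRrM mulfV// powRr1 ?frob_ge0.
  apply: ge0_ler_powR; last exact: Psi_le.
  - by rewrite invr_ge0 ltW.
  - by rewrite nnegrE centroid_weight_ge0.
  - by rewrite nnegrE mulr_ge0 ?powR_ge0// ltW.
have G_h w y : gauge_ball W y -> inner w y <= h w.
  rewrite /gauge_ball/= => yG; have [->|w0] := eqVneq w 0; first by rewrite inner0l.
  have hw : 0 < h w.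
    rewrite powR_gt0//; apply: lt_le_trans (Psi_lower w).
    by rewrite mulr_gt0// powR_gt0// frob_gt0.
  have Ww : W ((h w)^-1 *: w).
    rewrite /W/= Psi_hom ?invr_gt0// -[Psi w]hpE -powRM ?invr_ge0// mulVf ?gt_eqF// powR1//.
  have := le_lt_trans (gauge_ge del_gt0 W_del W_rho y Ww) yG.
  by rewrite innerZl mulrC ltr_pdivrMr// mul1r => /ltW.
have := isocapacitary fC mh h_ge0 h_le (powR_ge0 _ _) G_h (open_gauge_ball del_gt0 W_del W_rho)
  (gauge_ball_sub del_gt0 W_del W_rho) r_gt0 G_ball p_gt1 pn v0.
by under eq_integral do rewrite hpE.
Qed.

End centroid_weight.

(** [q] stands for r^p. Combining the two bounds eliminates q up to an error eta E om / w, which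
    vanishes with eta. *)
Lemma le_of_perturbed {R : realType} (I x om E w : R) : 0 <= x -> 0 <= om -> 0 <= E -> 0 < w ->
  (forall eta, 0 < eta -> exists q, [/\ 0 < q, I * q <= w + eta * E & x * w <= om * q]) ->
  I * x <= om.
Proof.
move=> x0 om0 E0 w0 h; pose K := E * om / w.
have K0 : 0 <= K by apply: divr_ge0; [exact: mulr_ge0|exact: ltW].
apply/ler_addgt0Pr => e e0; pose eta := e / (K + 1).
have K1 : 0 < K + 1 by rewrite ltr_wpDl.
have eta0 : 0 < eta by rewrite divr_gt0.
have [q [q0 A B]] := h eta eta0.
have eK : eta * K <= e by rewrite /eta mulrAC ler_pdivrMr// ler_pM2l// lerDl.
have xq : x <= om * q / w by rewrite ler_pdivlMr.
rewrite -(ler_pM2r q0).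
have A1 : I * q * x <= (w + eta * E) * x by rewrite ler_wpM2r.
have A2 : eta * E * x <= eta * E * (om * q / w) by rewrite ler_wpM2l// mulr_ge0// ltW.
have A3 : eta * E * (om * q / w) = eta * K * q by rewrite /K; ring.
have A4 : eta * K * q <= e * q by rewrite ler_pM2r.
lra.
Qed.

Section energies.
Context {R : realType} {k m : nat} (H : 'rV[R]_(1 + m) -> R) (p M : R).
Notation V := 'cV[R]_(1 + k).
Notation U := 'M[R]_(1 + k, 1 + m).
Hypothesis p_gt1 : 1 < p.
Hypothesis M_ge0 : 0 <= M.
Hypothesis H_ge0 : forall w, 0 <= H w.
Hypothesis H_le : forall w, H w <= M * frob w `^ p.
Hypothesis H_hom : forall s w, 0 < s -> H (s *: w) = s `^ p * H w.
Hypothesis H_cts : continuous H.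

Let p_gt0 : 0 < p. Proof. exact: lt_trans p_gt1. Qed.

Lemma kernel_bound (g : V -> V) C (D : set V) : 0 <= C -> (forall y, D y -> frob (g y) <= C) ->
  forall (y : V) (u : U), D y -> H ((g y)^T *m u) <= M * C `^ p * frob u `^ p.
Proof.
move=> C0 hg y u Dy; apply: le_trans (kernel_le p_gt0 M_ge0 H_le _ _) _.
rewrite powRM ?frob_ge0// -mulrA ler_wpM2l// ler_wpM2r ?powR_ge0//.
by rewrite ge0_ler_powR ?nnegrE ?frob_ge0 ?(ltW p_gt0)// hg.
Qed.

(* The two functionals compared by the theorem: the p-energy of the directional
   gradients of f, and the same average for the radial field of the unit ball. *)
Definition directional_energy (rho : R) (f : V -> R) : U -> R :=
  hint (eball rho) (fun x u => H ((grad f x)^T *m u)).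

Definition radial_energy : U -> R := hint (eball 1) (fun (y : V) u => H ((unitv y)^T *m u)).

Let mrad : measurable_fun setT (fun yu : V * U => H ((unitv yu.1)^T *m yu.2)).
Proof.
apply: (measurable_kernel H_cts _ measurable_snd).
exact: (measurableT_comp (@measurable_unitv R (1 + k) 1) measurable_fst).
Qed.

Let unitv_bound := @kernel_bound (@unitv R (1 + k) 1) 1 (eball 1) ler01 (fun y _ => frob_unitv_le1 y).
Let mB := @measurable_eball R (1 + k) 1 1.
Let B_lty := leb_eball_lty (R := R) (1 + k) 1 1.

Lemma measurable_radial_energy : measurable_fun setT radial_energy.
Proof. exact: (measurable_hint mB B_lty mrad (fun _ _ => H_ge0 _) unitv_bound). Qed.

Lemma radial_energy_ge0 u : 0 <= radial_energy u.
Proof. by apply: hint_ge0 => y v; exact: H_ge0. Qed.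

Lemma radial_energyE u :
  (radial_energy u)%:E = (\int[leb]_(y in @eball R (1 + k) 1 1) (H ((unitv y)^T *m u))%:E)%E.
Proof. exact: (hintE mB B_lty (fun _ _ => H_ge0 _) unitv_bound). Qed.

Lemma radial_energyZ s u : 0 < s -> radial_energy (s *: u) = s `^ p * radial_energy u.
Proof.
exact: (hintZ mB B_lty mrad (fun _ _ => H_ge0 _) unitv_bound (fun y v s s0 => kernel_homr H_hom (unitv y) v s0)).
Qed.

Lemma radial_energy_le u : radial_energy u <= M * fine (leb (@eball R (1 + k) 1 1)) * frob u `^ p.
Proof.
have := hint_le mB B_lty (fun _ _ => H_ge0 _) unitv_bound u.
by rewrite powR1 mulr1.
Qed.

Lemma leb_radial_sublevel t : 0 < t -> (leb [set u | (radial_energy u <= t)%R] =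
  (t `^ (((1 + k) * (1 + m))%:R / p))%:E * leb [set u | (radial_energy u <= 1)%R])%E.
Proof.
exact: (leb_hint_sublevel p_gt0 mB B_lty mrad (fun _ _ => H_ge0 _) unitv_bound
  (fun y v s s0 => kernel_homr H_hom (unitv y) v s0)).
Qed.

Lemma leb_radial_sublevel_gt0 : (0 < leb [set u : U | (radial_energy u <= 1)%R])%E.
Proof.
pose om := fine (leb (@eball R (1 + k) 1 1)); pose c := M * om + 1.
have c0 : 0 < c by rewrite ltr_wpDl// mulr_ge0// fine_ge0.
pose d := c `^ (- p^-1).
have d0 : 0 < d by rewrite powR_gt0.
apply: (@lt_le_trans _ _ (leb (@eball R (1 + k) (1 + m) d))); first exact: leb_eball_gt0.
apply: le_measure; rewrite ?inE//; first exact: measurable_eball.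
  by apply: measurable_le_set => //; exact: measurable_radial_energy.
move=> u; rewrite /eball/= => ud; apply: le_trans (radial_energy_le u) _.
apply: (@le_trans _ _ (c * d `^ p)).
  apply: ler_pM; rewrite ?powR_ge0 ?mulr_ge0 ?fine_ge0 ?lerDl//.
  by rewrite ge0_ler_powR ?nnegrE ?frob_ge0 ?(ltW ud) ?(ltW p_gt0) ?(ltW d0).
by rewrite /d -powRrM mulNr mulVf ?gt_eqF// powR_inv1 ?(ltW c0)// mulfV// gt_eqF.
Qed.

(** The substitution of r y for y gives r^n, and the homogeneity of [H] gives r^(- p). *)
Lemma radial_energy_scale r (u : U) : 0 < r ->
  (\int[leb]_(y in @eball R (1 + k) 1 r) (H (r^-1 *: ((unitv y)^T *m u)))%:E)%E =
  (r `^ ((1 + k)%:R - p) * radial_energy u)%:E.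
Proof.
move=> r0; have ri : 0 < r^-1 by rewrite invr_gt0.
rewrite (@integral_scale _ _ _ r)//; last 2 first.
- exact: measurable_eball.
- rewrite (_ : (fun y => _) = (fun y : V => H ((unitv y)^T *m (r^-1 *: u)))).
    exact: (measurable_kernel H_cts (@measurable_unitv R (1 + k) 1) (measurable_cst _)).
  by apply/funext => y; rewrite scalemxAr.
rewrite (_ : mkset _ = @eball R (1 + k) 1 1); last first.
  by apply/funext => y; rewrite /eball/= frobZ gtr0_norm// -[X in _ < X]mulr1 ltr_pM2l.
transitivity ((r ^+ ((1 + k) * 1))%:E * (radial_energy (r^-1 *: u))%:E)%E.
  congr (_ * _)%E; rewrite radial_energyE; apply: eq_integral => y _; congr (_%:E).
  by rewrite /unitv frobZ gtr0_norm// scalerA invfM mulrAC mulVf ?gt_eqF// mul1r -scalemxAr.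
rewrite radial_energyZ// -EFinM mulrA muln1 -powR_mulrn ?(ltW r0)//.
by rewrite -[r^-1]powR_inv1 ?(ltW r0)// -powRrM mulN1r -powRDp.
Qed.

Variables (f : V -> R) (rho C : R).
Hypothesis fC : Cc_infty f.
Hypothesis grad_out : forall x, ~ eball rho x -> grad f x = 0.
Hypothesis C_gt0 : 0 < C.
Hypothesis grad_le : forall x, frob (grad f x) <= C.

Let mdir : measurable_fun setT (fun xu : V * U => H ((grad f xu.1)^T *m xu.2)).
Proof.
apply: (measurable_kernel H_cts _ measurable_snd).
exact: (measurableT_comp (cts_measurable_mx (Cc_grad_continuous fC)) measurable_fst).
Qed.

Let grad_bound := @kernel_bound (grad f) C (eball rho) (ltW C_gt0) (fun x _ => grad_le x).
Let mD := @measurable_eball R (1 + k) 1 rho.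
Let D_lty := leb_eball_lty (R := R) (1 + k) 1 rho.
Local Notation P := (directional_energy rho f).

Lemma measurable_directional_energy : measurable_fun setT P.
Proof. exact: (measurable_hint mD D_lty mdir (fun _ _ => H_ge0 _) grad_bound). Qed.

Lemma directional_energy_ge0 u : 0 <= P u.
Proof. by apply: hint_ge0 => y v; exact: H_ge0. Qed.

Lemma directional_energyE u :
  (P u)%:E = (\int[leb]_(x in eball rho) (H ((grad f x)^T *m u))%:E)%E.
Proof. exact: (hintE mD D_lty (fun _ _ => H_ge0 _) grad_bound). Qed.

Lemma directional_energyZ s u : 0 < s -> P (s *: u) = s `^ p * P u.
Proof.
exact: (hintZ mD D_lty mdir (fun _ _ => H_ge0 _) grad_bound (fun x v s s0 => kernel_homr H_hom (grad f x) v s0)).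
Qed.

Lemma tonelli_directional_energy L : measurable L ->
  (\int[leb]_(u in L) (P u)%:E =
   \int[leb]_(x in eball rho) \int[leb]_(u in L) (H ((grad f x)^T *m u))%:E)%E.
Proof. exact: (tonelli_hint mD D_lty mdir (fun _ _ => H_ge0 _) grad_bound). Qed.

Variable Rr : R.
Hypothesis Rr_gt0 : 0 < Rr.
Hypothesis H_sub : forall w0, exists y c, minorant H y c /\ inner w0 y - c = H w0.
Local Notation n := ((1 + k)%:R : R).
Local Notation a := (((1 + k) * (1 + m))%:R / p).
Local Notation om := (fine (leb (@eball R (1 + k) 1 1))).
Hypothesis p_lt : p < n.
Hypothesis vol_gt0 : 0 < fine (leb [set x | 1 <= f x]).
Local Notation iso := (n * om `^ (p / n) * ((n - p) / (p - 1)) `^ (p - 1) *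
  fine (leb [set x | 1 <= f x]) `^ ((n - p) / n)).

Let a_ge1 : 1 <= a.
Proof.
rewrite ler_pdivlMr// mul1r; apply: le_trans (ltW p_lt) _.
by rewrite ler_nat leq_pmulr.
Qed.

Let L : set U := eball Rr `&` [set u | P u < 1].
Let v := fine (leb L).
Let VB := fine (leb [set u : U | radial_energy u <= 1]).
Let j := powR_mean a.

Let mBR : measurable (eball Rr : set U). Proof. exact: measurable_eball. Qed.

Let mL : measurable L.
Proof.
by apply: measurableI => //; apply: measurable_lt_set => //; exact: measurable_directional_energy.
Qed.

Let L_fin : leb L \is a fin_num.
Proof.
rewrite ge0_fin_numE//; apply: le_lt_trans (leb_eball_lty (1 + k) (1 + m) Rr).
by apply: le_measure; rewrite ?inE//; move=> u [].
Qed.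

Let vE : leb L = v%:E. Proof. by rewrite /v fineK. Qed.
Let v_ge0 : 0 <= v. Proof. exact: fine_ge0. Qed.

(** [L] contains its dilates by z^(1 / p), so at least the fraction z^a of its volume lies in {P <=
    z}, where a = N / p; integrating over z leaves 1 minus the mean of z^a. *)
Lemma integral_directional_le : (\int[leb]_(u in L) (P u)%:E <= (v * (1 - j))%:E)%E.
Proof.
have -> : (\int[leb]_(u in L) (P u)%:E = \int[leb]_(u in L) (Num.min (P u) 1)%:E)%E.
  by apply: eq_integral => u /[!inE] -[_ /ltW Pu]; rewrite min_l.
have L_lty : (leb L < +oo)%E by rewrite vE ltry.
have := @integral_min1_le _ _ a_ge1 _ _ L P v mL L_lty measurable_directional_energy
  directional_energy_ge0 v_ge0.
rewrite vE => h; rewrite mulrBr mulr1 EFinB leeBrDr//; apply: h => z /andP[z0 z1].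
have s0 : 0 < z `^ p^-1 by rewrite powR_gt0.
have s1 : z `^ p^-1 <= 1.
  suff : z `^ p^-1 <= 1 `^ p^-1 by rewrite powR1.
  by apply: ge0_ler_powR; rewrite ?nnegrE ?invr_ge0 ?(ltW p_gt0) ?(ltW z0) ?(ltW z1).
have mLz : measurable [set u | L u /\ P u <= z].
  by apply: measurableI => //; apply: measurable_le_set => //; exact: measurable_directional_energy.
rewrite (leb_scale s0 mLz) -powR_mulrn ?powR_ge0// -powRrM [p^-1 * _]mulrC mulrC EFinM -vE.
rewrite muleC; apply: lee_wpmul2l; first by rewrite lee_fin powR_ge0.
apply: le_measure; rewrite ?inE//.
  apply: (measurable_preimage_mx (f := fun u : U => z `^ p^-1 *: u)) => //.
  by apply: cts_measurable_mx; apply: cts_mxZ; [exact: cst_continuous|exact: cts_id].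
move=> u [uR Pu]; have Pz : P (z `^ p^-1 *: u) <= z.
  rewrite directional_energyZ// -powRrM mulVf ?gt_eqF// powRr1 ?(ltW z0)//.
  by rewrite -[X in _ <= X]mulr1 ler_pM2l// ltW.
split=> //; split; last by apply: le_lt_trans Pz z1.
rewrite /eball/= frobZ gtr0_norm//; apply: le_lt_trans uR.
by rewrite -[X in _ <= X]mul1r ler_wpM2r ?frob_ge0.
Qed.

Hypothesis VB_lty : (leb [set u : U | (radial_energy u <= 1)%R] < +oo)%E.

Let VBE : leb [set u : U | (radial_energy u <= 1)%R] = VB%:E.
Proof. by rewrite /VB fineK// ge0_fin_numE. Qed.

Let VB_gt0 : 0 < VB. Proof. by rewrite -lte_fin -VBE leb_radial_sublevel_gt0. Qed.

(** Chosen so that {P_B <= x} has the same volume as [L], by homogeneity of P_B. *)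
Let x := (v / VB) `^ a^-1.

Let a_gt0 : 0 < a. Proof. exact: lt_le_trans a_ge1. Qed.

Let xaVB : x `^ a * VB = v.
Proof.
by rewrite /x -powRrM mulVf ?gt_eqF// powRr1 ?divr_ge0 ?(ltW VB_gt0)// divfK// gt_eqF.
Qed.

(** Bounds the integral of |grad f|^p, the coefficient of [eta]. *)
Let ED := C `^ p * fine (leb (@eball R (1 + k) 1 rho)).

Section weighted.
Variable eta : R.
Hypothesis eta_gt0 : 0 < eta.
Variable r : R.
Hypothesis r_gt0 : 0 < r.
Hypothesis G_ball : leb (gauge_ball [set w : V | centroid_weight H p eta L w <= 1]) = leb (@eball R (1 + k) 1 r).

Let L_sub : L `<=` eball Rr. Proof. by move=> u []. Qed.

Let H0 : H 0 = 0.
Proof. by apply/eqP; rewrite eq_le H_ge0 andbT; apply: le_trans (H_le 0) _; rewrite frob0 powR0 ?mulr0 ?gt_eqF. Qed.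

Let Psi0 : centroid_weight H p eta L 0 = 0.
Proof.
rewrite /centroid_weight frob0 powR0 ?gt_eqF// mulr0 addr0 /hint.
by under eq_integral do rewrite trmx0 mul0mx H0; rewrite integral0.
Qed.

Lemma isocapacitary_bound : iso * r `^ p <= v * (1 - j) + eta * ED.
Proof.
have := centroid_weight_isocapacitary p_gt1 M_ge0 H_ge0 H_le H_hom H_cts Rr_gt0 eta_gt0 mL L_sub r_gt0 G_ball fC p_lt vol_gt0.
set lhs := (X in (X%:E <= _)%E -> _) => h.
rewrite (_ : iso * r `^ p = lhs); last by rewrite /lhs; ring.
rewrite -lee_fin; apply: le_trans h _; rewrite EFinD.
have mh : measurable_fun setT (fun x : V => hint L (fun (u : U) w => H (w^T *m u)) (grad f x)).
  apply: (measurableT_comp (measurable_centroid_hint p_gt1 M_ge0 H_ge0 H_le H_cts Rr_gt0 mL L_sub)).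
  exact: (cts_measurable_mx (Cc_grad_continuous fC)).
have DfE : leb (@eball R (1 + k) 1 rho) = (fine (leb (@eball R (1 + k) 1 rho)))%:E.
  by rewrite fineK// ge0_fin_numE.
apply: (@le_trans _ _ (\int[leb]_(x in @eball R (1 + k) 1 rho)
    ((hint L (fun (u : U) w => H (w^T *m u)) (grad f x))%:E + (eta * C `^ p)%:E))%E).
  rewrite [leRHS]integral_mkcond; apply: ge0_le_integral_gen => y _.
    by rewrite lee_fin centroid_weight_ge0.
  rewrite patchE; case: ifPn; rewrite ?inE ?notin_setE => yr; last by rewrite grad_out// Psi0.
  rewrite -EFinD lee_fin lerD2l ler_pM2l// ge0_ler_powR ?nnegrE ?frob_ge0 ?(ltW C_gt0) ?(ltW p_gt0)//.
rewrite ge0_integralD//; last 3 first.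
- by move=> y _; rewrite lee_fin hint_ge0.
- by apply: (measurable_funS measurableT) => //; apply/measurable_EFinP.
- by move=> y _; rewrite lee_fin mulr_ge0 ?powR_ge0// ltW.
rewrite integral_cst// [X in (_ + _ * X)%E]DfE -EFinM /ED mulrA leeD2r//.
apply: le_trans integral_directional_le; rewrite tonelli_directional_energy//.
rewrite le_eqVlt; apply/orP; left; apply/eqP; apply: eq_integral => y _.
exact: (centroid_hintE p_gt1 M_ge0 H_ge0 H_le Rr_gt0 mL L_sub).
Qed.

(** The truncation level [l] is the value of the ball integral where P_B = x, by
    [radial_energy_scale]. The truncated integral over the large ball then loses at most v times the
    mean of z^a, the same mean as in [integral_directional_le], so that v (1 - j) appears in both
    bounds. *)
Lemma bathtub_bound : 0 < v -> x * (v * (1 - j)) <= om * r `^ p.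
Proof.
move=> v0; have x0 : 0 < x by rewrite powR_gt0// divr_gt0.
have rn0 : 0 < r `^ (n - p) by rewrite powR_gt0.
pose l := x * r `^ (n - p); have l0 : 0 < l by rewrite mulr_gt0.
have := centroid_weight_bathtub p_gt1 M_ge0 H_ge0 H_le H_hom H_cts H_sub Rr_gt0 eta_gt0 mL L_sub r_gt0 G_ball (ltW l0).
pose I := (\int[leb]_(u in (eball Rr : set U)) (Num.min (radial_energy u / x) 1)%:E)%E.
have mRE : measurable_fun setT (fun u : U => radial_energy u / x).
  by apply: measurable_funM => //; exact: measurable_radial_energy.
have RE0 u : 0 <= radial_energy u / x by rewrite divr_ge0 ?radial_energy_ge0// ltW.
have -> : (\int[leb]_(u in (eball Rr : set U))
    mine (\int[leb]_(y in @eball R (1 + k) 1 r) (H (r^-1 *: ((unitv y)^T *m u)))%:E) l%:E = l%:E * I)%E.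
  rewrite -ge0_integralZl_EFin//; last 3 first.
  - by move=> u _; rewrite lee_fin le_min RE0/=.
  - apply: (measurable_funS measurableT) => //; apply/measurable_EFinP.
    exact: measurable_minr.
  - exact: ltW.
  apply: eq_integral => u _; rewrite radial_energy_scale// -EFin_min -EFinM; congr _%:E.
  rewrite minr_pMr ?(ltW l0)// mulr1 /l; congr Num.min.
  by rewrite mulrAC -mulrA mulrCA mulrA divfK ?gt_eqF// mulrC.
have b_fin : leb (eball Rr : set U) \is a fin_num by rewrite ge0_fin_numE// leb_eball_lty.
have I_le : (I <= leb (eball Rr : set U))%E.
  rewrite -[leRHS]mul1e -integral_cst//; apply: ge0_le_integral_gen => u _.
    by rewrite lee_fin le_min RE0/=.
  by rewrite lee_fin ge_min lexx orbT.
have I_ge0 : (0 <= I)%E by apply: integral_ge0 => u _; rewrite lee_fin le_min RE0/=.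
have I_fin : I \is a fin_num.
  by rewrite ge0_fin_numE//; apply: le_lt_trans I_le _; rewrite -ge0_fin_numE.
have low := @integral_min1_ge _ _ a_ge1 _ _ (eball Rr : set U) _ v mBR (leb_eball_lty _ _ _) mRE RE0 v_ge0.
have {low} low : (leb (eball Rr : set U) <= I + (v * j)%:E)%E.
  apply: low => z /andP[z0 z1]; have zx : 0 < z * x by rewrite mulr_gt0.
  apply: (@le_trans _ _ (leb [set u : U | radial_energy u <= z * x])).
    apply: le_measure; rewrite ?inE.
    - by apply: measurableI => //; apply: measurable_le_set.
    - by apply: measurable_le_set => //; exact: measurable_radial_energy.
    - by move=> u [_]; rewrite /= ler_pdivrMr.
  rewrite leb_radial_sublevel// VBE -EFinM lee_fin powRM ?(ltW z0) ?(ltW x0)//.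
  by rewrite -mulrA xaVB mulrC.
have -> : leb (@eball R (1 + k) 1 r) = (r `^ n * om)%:E.
  rewrite leb_eball// muln1 -powR_mulrn ?(ltW r_gt0)// EFinM fineK//.
  by rewrite ge0_fin_numE// leb_eball_lty.
have -> : leb (eball Rr `\` L) = (leb (eball Rr : set U) - leb L)%E.
  have := measureD mBR mL (leb_eball_lty _ _ _); rewrite setIidr//; exact.
move: low I_le; rewrite -(fineK b_fin) -(fineK I_fin) vE -EFinB -!EFinM -!EFinD !lee_fin.
set b := fine _; set i := fine _ => low _ h.
have h2 : x * (v * (1 - j)) * r `^ (n - p) <= om * r `^ p * r `^ (n - p).
  have -> : om * r `^ p * r `^ (n - p) = om * r `^ n by rewrite -mulrA -powRDp// (addrC p) subrK.
  have : l * (b - i) <= l * (v * j) by rewrite ler_pM2l// lerBlDl.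
  rewrite /l in h *; lra.
by rewrite ler_pM2r in h2.
Qed.

End weighted.

(** The bounds [isocapacitary_bound] and [bathtub_bound] share r^p and v (1 - j); [le_of_perturbed]
    removes both and sends eta to 0. *)
Lemma capacity_volume_le : iso * x <= om.
Proof.
have om0 : 0 <= om by exact: fine_ge0.
have iso0 : 0 <= iso by rewrite !mulr_ge0 ?powR_ge0.
have [v0|v0] := leP v 0.
  have vz : v = 0 by apply/eqP; rewrite eq_le v0 v_ge0.
  by rewrite /x vz mul0r powR0 ?mulr0// gt_eqF// invr_gt0.
have x0 : 0 <= x by exact: powR_ge0.
have vj : 0 < v * (1 - j) by rewrite mulr_gt0// subr_gt0 powR_mean_lt1.
have ED0 : 0 <= ED by rewrite mulr_ge0 ?powR_ge0// fine_ge0.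
apply: (le_of_perturbed x0 om0 ED0 vj) => eta eta0.
have L_sub : L `<=` eball Rr by move=> u [].
have [r r0 rE] := exists_wulff_radius p_gt1 M_ge0 H_ge0 H_le Rr_gt0 eta0 mL L_sub.
exists (r `^ p); split; first exact: powR_gt0.
  exact: (isocapacitary_bound eta0 r0 rE).
exact: (bathtub_bound eta0 r0 rE v0).
Qed.

End energies.

(** * Support functions and the affine capacity *)

Section support_function.
Context {R : realType} {m : nat}.
Notation Y := 'rV[R]_m.
Variable Q : set Y.
Hypothesis Q_compact : compact Q.
Hypothesis Q_0 : Q 0.
Local Notation hQ := (support_fun Q).

Let image_compact (g : Y -> R) : continuous g -> compact [set g y | y in Q].
Proof. by move=> cg; apply: continuous_compact => //; exact: continuous_subspaceT. Qed.

Let cts_inner_l (x : Y) : continuous (inner x).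
Proof. by apply: cts_inner; [exact: cst_continuous|exact: cts_id]. Qed.

Lemma support_fun_ge x q : Q q -> inner x q <= hQ x.
Proof.
move=> Qq; apply: sup_upper_bound; last by exists q.
by apply: compact_has_sup; [exists (inner x 0); exists 0|apply: image_compact; exact: cts_inner_l].
Qed.

Lemma support_fun_ge0 x : 0 <= hQ x.
Proof. by rewrite -(inner0r x); exact: support_fun_ge. Qed.

Lemma support_fun_le x c : (forall q, Q q -> inner x q <= c) -> hQ x <= c.
Proof.
move=> h; apply: ge_sup; first by exists (inner x 0); exists 0.
by move=> _ [q Qq <-]; exact: h.
Qed.

Lemma support_fun_attained x : exists2 q, Q q & inner x q = hQ x.
Proof.
have cI := image_compact (@cts_inner_l x).
have : closure [set inner x y | y in Q] (hQ x).
  apply: closure_sup; first by exists (inner x 0); exists 0.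
  by case: (compact_has_sup _ cI) => //; exists (inner x 0); exists 0.
have /closure_id <- : closed [set inner x y | y in Q].
  by apply: compact_closed => //; exact: Rhausdorff.
by move=> [q Qq qE]; exists q.
Qed.

Lemma support_fun_bounded : exists2 B : R, 0 <= B & forall q, Q q -> frob q <= B.
Proof.
have cF := image_compact (cts_frob (@cts_id _)).
exists (sup [set frob q | q in Q]).
  rewrite -(@frob0 R 1 m); apply: sup_upper_bound; last by exists 0.
  by apply: compact_has_sup => //; exists (frob (0 : Y)); exists 0.
move=> q Qq; apply: sup_upper_bound; last by exists q.
by apply: compact_has_sup => //; exists (frob (0 : Y)); exists 0.
Qed.

Lemma support_funZ s x : 0 < s -> hQ (s *: x) = s * hQ x.
Proof.
move=> s0; apply/eqP; rewrite eq_le; apply/andP; split.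
  by apply: support_fun_le => q Qq; rewrite innerZl ler_pM2l// support_fun_ge.
rewrite -ler_pdivlMl//; apply: support_fun_le => q Qq.
by rewrite ler_pdivlMl// -innerZl support_fun_ge.
Qed.

Variables (B p : R).
Hypothesis B_ge0 : 0 <= B.
Hypothesis Q_B : forall q, Q q -> frob q <= B.
Hypothesis p_gt1 : 1 < p.

Let p_gt0 : 0 < p. Proof. exact: lt_trans p_gt1. Qed.

Lemma support_fun_le_frob x : hQ x <= B * frob x.
Proof.
apply: support_fun_le => q Qq; apply: le_trans (inner_le_frob _ _) _.
by rewrite mulrC ler_wpM2r ?frob_ge0// Q_B.
Qed.

Lemma support_fun_lipschitz x y : hQ x - hQ y <= B * frob (x - y).
Proof.
rewrite lerBlDr; apply: support_fun_le => q Qq.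
rewrite -[x in inner x q](subrK y) innerDl lerD ?support_fun_ge//.
by apply: le_trans (support_fun_ge _ Qq) (support_fun_le_frob _).
Qed.

Definition support_pow x : R := hQ x `^ p.

Lemma support_pow_ge0 x : 0 <= support_pow x. Proof. exact: powR_ge0. Qed.

Lemma support_pow_le x : support_pow x <= B `^ p * frob x `^ p.
Proof.
rewrite -powRM ?frob_ge0//; apply: ge0_ler_powR; rewrite ?nnegrE ?(ltW p_gt0) ?support_fun_ge0//.
  by rewrite mulr_ge0// frob_ge0.
exact: support_fun_le_frob.
Qed.

Lemma support_pow_hom s x : 0 < s -> support_pow (s *: x) = s `^ p * support_pow x.
Proof. by move=> s0; rewrite /support_pow support_funZ// powRM ?support_fun_ge0// ltW. Qed.

(* The tangent of t^p at the value t = h_Q(w0), composed with a maximizer. *)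
Lemma support_pow_minorant w0 : exists y c, minorant support_pow y c /\ inner w0 y - c = support_pow w0.
Proof.
have [q Qq qE] := support_fun_attained w0; set t := hQ w0 in qE.
have t0 : 0 <= t by exact: support_fun_ge0.
exists ((p * t `^ (p - 1)) *: q), ((p - 1) * t `^ p); split; last first.
  by rewrite innerZr qE -mulrA -[_ * t]mulrC mulr_powRB1// /support_pow -/t; ring.
move=> w; rewrite innerZr lerBlDr; apply: le_trans (young_tangent p_gt1 (support_fun_ge0 w) t0).
by rewrite ler_wpM2l ?mulr_ge0 ?powR_ge0 ?(ltW p_gt0)// support_fun_ge.
Qed.

Lemma powR_lipschitz (A a b : R) : 0 <= a <= A -> 0 <= b <= A -> a `^ p - b `^ p <= p * A `^ (p - 1) * `|a - b|.
Proof.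
move=> /andP[a0 aA] /andP[b0 bA].
have := young_tangent p_gt1 b0 a0; rewrite -[a `^ p in leRHS]mulr_powRB1// => h.
apply: (@le_trans _ _ (p * a `^ (p - 1) * (a - b))).
  rewrite -[a `^ p in leLHS]mulr_powRB1//; move: h; lra.
apply: (@le_trans _ _ (p * a `^ (p - 1) * `|a - b|)).
  by rewrite ler_wpM2l ?mulr_ge0 ?powR_ge0 ?(ltW p_gt0)// ler_norm.
rewrite ler_wpM2r// ler_wpM2l ?(ltW p_gt0)// ge0_ler_powR ?nnegrE ?subr_ge0 ?(ltW p_gt1)//.
exact: le_trans aA.
Qed.

Lemma support_pow_cts : continuous support_pow.
Proof.
move=> x U /nbhs_ballP[e /= e0 eU].
(* [A] bounds the support function on the unit neighbourhood of x. *)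
pose A := hQ x + B; have A0 : 0 <= A by rewrite addr_ge0 ?support_fun_ge0.
pose c := p * A `^ (p - 1) * B; have c0 : 0 <= c by rewrite !mulr_ge0 ?powR_ge0// ltW.
have op : open [set y : Y | frob (x - y) < Num.min 1 (e / (c + 1))].
  apply: open_lt; last exact: cst_continuous.
  by apply: cts_frob; apply: cts_mxD; [exact: cst_continuous|apply: cts_mxN; exact: cts_id].
have c1 : 0 < c + 1 by rewrite ltr_wpDl.
have inx : [set y : Y | frob (x - y) < Num.min 1 (e / (c + 1))] x.
  by rewrite /= subrr frob0 lt_min ltr01 divr_gt0.
apply: filterS (open_nbhs_nbhs (conj op inx)) => y /=; rewrite lt_min => /andP[d1 d2].
have dyx : frob (y - x) = frob (x - y) by rewrite -frobN opprB.
have xA : 0 <= hQ x <= A by rewrite support_fun_ge0 lerDl.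
have yA : 0 <= hQ y <= A.
  rewrite support_fun_ge0 /A -lerBlDl; apply: le_trans (support_fun_lipschitz _ _) _.
  by rewrite dyx -[leRHS]mulr1 ler_wpM2l// ltW.
have dist : `|hQ x - hQ y| <= B * frob (x - y).
  by rewrite ler_norml lerNl opprB -[in X in X && _]dyx !support_fun_lipschitz.
have key : p * A `^ (p - 1) * `|hQ x - hQ y| < e.
  apply: (@le_lt_trans _ _ (c * frob (x - y))).
    by rewrite /c -[leRHS]mulrA ler_wpM2l// mulr_ge0 ?powR_ge0// ltW.
  apply: (@le_lt_trans _ _ ((c + 1) * frob (x - y))); first by rewrite ler_wpM2r ?frob_ge0// lerDl.
  by rewrite mulrC -ltr_pdivlMr.
apply: eU; rewrite /ball/= ltr_norml ltrNl opprB; apply/andP; split; apply: le_lt_trans key.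
  by rewrite distrC; exact: powR_lipschitz.
exact: powR_lipschitz.
Qed.

End support_function.

(** * Extended powers, the completed measure and exhaustion by balls *)

Section conversions.
Context {R : realType}.
Local Open Scope ereal_scope.

Lemma inv_poweR_ge0 (x : \bar R) a : 0 <= inv_poweR x a.
Proof. by case: x => [r| |] //=; case: ifP => //; rewrite lee_fin powR_ge0. Qed.

Lemma le_inv_poweR (x y : \bar R) a : (0 < a)%R -> 0 <= x -> x <= y -> inv_poweR y a <= inv_poweR x a.
Proof.
move=> a0 x0 xy; have y0 := le_trans x0 xy.
case: y xy y0 => [s| |]; case: x x0 => [r| |] //=; rewrite ?lee_fin => r0 rs s0; last first.
  by case: ifP => //; rewrite lee_fin powR_ge0.
have [_|rn0] := eqVneq r 0%R; first by rewrite leey.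
have rp : (0 < r)%R by rewrite lt_neqAle eq_sym rn0.
have sp : (0 < s)%R by apply: lt_le_trans rs.
rewrite (gt_eqF sp) lee_fin !powRN lef_pV2 ?posrE ?powR_gt0//.
by apply: ge0_ler_powR; rewrite ?nnegrE ?(ltW a0).
Qed.

Lemma le_of_powR_inv_le (I om b v a : R) : (0 < I)%R -> (0 < b)%R -> (0 < a)%R -> (0 <= om)%R -> (0 <= v)%R ->
  (I * (v / b) `^ a^-1 <= om)%R -> (v <= b * (om / I) `^ a)%R.
Proof.
move=> I0 b0 a0 om0 v0; rewrite mulrC -ler_pdivlMr// => h.
rewrite mulrC -ler_pdivrMr//.
have q0 : (0 <= v / b)%R by rewrite divr_ge0// ltW.
have an0 : a != 0%R by rewrite gt_eqF.
rewrite -[leLHS](powRr1 q0) -(mulVf an0) powRrM.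
by apply: ge0_ler_powR; rewrite ?nnegrE ?powR_ge0 ?(ltW a0)// divr_ge0// ltW.
Qed.

Lemma le_inv_poweR_scale (N I om a : R) (v w : \bar R) :
  (0 < N)%R -> (0 < I)%R -> (0 < om)%R -> (0 < a)%R -> 0 <= v -> 0 < w -> w < +oo ->
  v <= (fine w * (om / I) `^ a)%:E ->
  (I / om)%:E * inv_poweR (N%:E * w) a^-1 <= inv_poweR (N%:E * v) a^-1.
Proof.
move=> N0 I0 om0 a0; case: w => [b| |]//; case: v => [v| |]//; rewrite ?lee_fin ?lte_fin/= => v0 b0 _ h.
have [_|vn0] := eqVneq (N * v)%R 0%R; first by rewrite leey.
have vp : (0 < v)%R.
  by rewrite lt_neqAle v0 andbT; apply: contraNneq vn0 => <-; rewrite mulr0.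
rewrite gt_eqF ?mulr_gt0// -EFinM lee_fin !powRM ?(ltW N0) ?(ltW b0)//.
rewrite mulrCA ler_pM2l ?powR_gt0// !powRN.
have : (v `^ a^-1 <= b `^ a^-1 * (om / I))%R.
  have e : (b `^ a^-1 * (om / I) = (b * (om / I) `^ a) `^ a^-1)%R.
    by rewrite powRM ?powR_ge0 ?(ltW b0)// -powRrM mulfV ?gt_eqF// powRr1// divr_ge0 ?ltW.
  by rewrite e; apply: ge0_ler_powR; rewrite ?nnegrE ?invr_ge0 ?(ltW a0)// mulr_ge0 ?powR_ge0// ltW.
have vq : (0 < v `^ a^-1)%R by rewrite powR_gt0.
have bq : (0 < b `^ a^-1)%R by rewrite powR_gt0.
rewrite mulrA ler_pdivlMr// => xy.
by rewrite ler_pdivrMr// [leRHS]mulrC ler_pdivlMr// mulrAC ler_pdivrMr// mulrC.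
Qed.

Lemma inv_poweR_mull (c a : R) (x : \bar R) : (0 < c)%R -> 0 <= x ->
  inv_poweR (c%:E * x) a = (c `^ (- a))%:E * inv_poweR x a.
Proof.
move=> c0; case: x => [r| |]// x0 /=; last by rewrite gt0_muley ?lte_fin// mule0.
rewrite mulf_eq0 (gt_eqF c0)/=; case: ifP => _; first by rewrite gt0_muley// lte_fin powR_gt0.
by rewrite powRM ?(ltW c0)// EFinM.
Qed.

(** The identity is measurable from the Caratheodory sets to the Borel sets and pushes the completed
    measure forward to [leb], so Borel functions have the same integral. *)
Lemma integral_volume_measure n m (g : 'M[R]_(n, m) -> \bar R) : measurable_fun setT g ->
  (forall x, 0 <= g x) -> \int[volume_measure]_x g x = \int[leb]_x g x.
Proof.
move=> mg g0; have mid := @measurable_caratheodory_id R n m.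
pose mu : {measure set 'M[R]_(n, m) -> \bar R} :=
  pushforward (@volume_measure R n m) (id : caratheodory_type (@volume R n m) -> 'M[R]_(n, m)).
rewrite [RHS](@eq_measure_integral _ _ _ _ (mu mid)); last by move=> A mA _.
by rewrite ge0_integral_pushforward// preimage_setT.
Qed.

Lemma leb_le_bigcup n m (A : set 'M[R]_(n, m)) (c : \bar R) : measurable A ->
  (forall r, (0 < r)%R -> leb (eball r `&` A) <= c) -> leb A <= c.
Proof.
move=> mA h; pose F (i : nat) : set 'M[R]_(n, m) := eball i.+1%:R `&` A.
have mF i : measurable (F i) by apply: measurableI => //; exact: measurable_eball.
have FA : \bigcup_i F i = A.
  apply/seteqP; split => [x [i _ []]//|x Ax].
  exists (Num.bound (frob x)) => //; split=> //; rewrite /eball/=.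
  by apply: lt_trans (archi_boundP (frob_ge0 x)) _; rewrite ltr_nat.
have ndF : nondecreasing_seq F.
  move=> i j ij; apply/subsetPset => x [xi Ax]; split => //.
  by apply: lt_le_trans xi _; rewrite ler_nat.
have cv := nondecreasing_cvg_mu (mu := leb) mF (bigcupT_measurable F mF) ndF.
rewrite FA in cv; rewrite -(cvg_lim _ cv)//; apply: lime_le; first by apply/cvg_ex; exists (leb A).
by apply: nearW => i; exact: h.
Qed.

End conversions.

(** * Volumes of sublevel sets against the affine energy and the polar body *)

Section affine_comparison.
Context {R : realType} {k m : nat}.
Notation V := 'cV[R]_(1 + k).
Notation U := 'M[R]_(1 + k, 1 + m).
Variables (Q : set 'rV[R]_(1 + m)) (p B : R).
Hypothesis Q_compact : compact Q.
Hypothesis Q_0 : Q 0.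
Hypothesis B_ge0 : 0 <= B.
Hypothesis Q_B : forall q, Q q -> frob q <= B.
Hypothesis p_gt1 : 1 < p.
Hypothesis k_gt0 : (0 < k)%N.

Local Notation H := (support_pow Q p).
Local Notation Nn := ((1 + k) * (1 + m))%N.
Local Notation n := ((1 + k)%:R : R).
Local Notation a := (Nn%:R / p).

Let p_gt0 : 0 < p. Proof. exact: lt_trans p_gt1. Qed.
Let pn0 : p != 0. Proof. by rewrite gt_eqF. Qed.
Let H_ge0 := @support_pow_ge0 R (1 + m) Q p.
Let H_le := support_pow_le Q_compact Q_0 B_ge0 Q_B p_gt1.
Let H_hom := support_pow_hom Q_compact Q_0 p.
Let H_cts := support_pow_cts Q_compact Q_0 B_ge0 Q_B p_gt1.
Let M_ge0 : 0 <= B `^ p := powR_ge0 _ _.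

Let N0 : (0 : R) < Nn%:R. Proof. by rewrite ltr0n. Qed.

Local Notation RE := (radial_energy (k := k) H).

(** The sphere integral is at most n times the integral over the unit ball of the extension constant
    along rays, which is P_B(u). *)
Lemma h_Pi_le (u : U) : (h_Pi p Q u <= ((n * RE u) `^ p^-1)%:E)%E.
Proof.
have i0 : (0 <= \int[hausdorff_measure (1 + k).-1]_(v in (sphere : set V)) (H (v^T *m u))%:E)%E.
  by apply: integral_ge0 => v _; rewrite lee_fin.
rewrite /h_Pi -poweR_EFin; apply: gt0_ler_poweR.
- by rewrite invr_ge0 ltW.
- by rewrite in_itv/= i0 leey.
- by rewrite in_itv/= leey andbT lee_fin mulr_ge0 ?radial_energy_ge0.
have mH : measurable_fun setT (fun v : V => H (v^T *m u)).
  exact: (measurable_kernel H_cts (@measurable_id _ _ _) (measurable_cst u)).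
have := @integral_sphere_le R (1 + k) 1 _ (fun v : V => (H (v^T *m u))%:E); rewrite muln1.
rewrite -(radial_energyE p_gt1 M_ge0 H_ge0 H_le) -EFinM; apply => //.
- by move=> v; rewrite lee_fin.
- by move=> t _; under eq_set do rewrite lte_fin; apply: measurable_lt_set.
- apply/measurable_EFinP.
  exact: (measurable_kernel H_cts (@measurable_unitv R (1 + k) 1) (measurable_cst u)).
Qed.

(** A matrix u with n P_B(u) <= 1 has h_Pi(u) <= 1, so it pairs to at most 1 with every point of the
    body. The leading factor is the volume ratio of the sublevel sets at 1 / n and at 1. *)
Lemma volume_polar_Pi_body_ge :
  ((n^-1 `^ a)%:E * leb [set u : U | (RE u <= 1)%R] <= volume (polar (Pi_body p Q : set U)))%E.
Proof.
rewrite -(leb_radial_sublevel p_gt1 M_ge0 H_ge0 H_le H_hom H_cts) ?invr_gt0 ?ltr0n//.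
apply: le_outer_measure => u /= REu y /(_ u); rewrite innerC => yu.
rewrite -lee_fin; apply: le_trans yu _; apply: le_trans (h_Pi_le u) _.
rewrite lee_fin; apply: (@le_trans _ _ (1 `^ p^-1)); last by rewrite powR1.
apply: ge0_ler_powR; rewrite ?nnegrE ?invr_ge0 ?(ltW p_gt0) ?mulr_ge0 ?radial_energy_ge0//.
by rewrite -ler_pdivlMl// mulr1.
Qed.

Variables (f : V -> R) (rho C : R).
Hypothesis fC : Cc_infty f.
Hypothesis grad_out : forall x, ~ eball rho x -> grad f x = 0.
Hypothesis C_gt0 : 0 < C.
Hypothesis grad_le : forall x, frob (grad f x) <= C.

Local Notation P := (directional_energy H rho f : U -> R).

Let mP : measurable_fun setT P.
Proof. exact: (measurable_directional_energy p_gt1 M_ge0 H_ge0 H_le H_cts rho fC C_gt0 grad_le). Qed.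

Let P0 u : 0 <= P u. Proof. exact: directional_energy_ge0. Qed.

Lemma Lnorm_support_fun_grad u :
  ('N[volume_measure]_(p%:E)[EFin \o support_fun Q \o grad_dir f u] = ((P u) `^ p^-1)%:E)%E.
Proof.
rewrite unlock -poweR_EFin; congr (_ `^ _)%E.
rewrite (directional_energyE p_gt1 M_ge0 H_ge0 H_le rho C_gt0 grad_le).
have mH : measurable_fun setT (fun x : V => H ((grad f x)^T *m u)).
  exact: (measurable_kernel H_cts (cts_measurable_mx (Cc_grad_continuous fC)) (measurable_cst u)).
transitivity (\int[volume_measure]_x (H ((grad f x)^T *m u))%:E)%E.
  apply: eq_integral => x _ /=.
  by rewrite ger0_norm ?support_fun_ge0// poweR_EFin.
rewrite integral_volume_measure//; first last.
- by move=> x; rewrite lee_fin.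
- exact/measurable_EFinP.
rewrite [RHS]integral_mkcond; apply: eq_integral => x _; rewrite patchE; case: ifPn => //.
rewrite notin_setE => /grad_out ->; rewrite trmx0 mul0mx; congr _%:E.
apply/eqP; rewrite eq_le H_ge0 andbT; apply: le_trans (H_le 0) _.
by rewrite frob0 powR0// mulr0.
Qed.

Let g (u : U) := inv_poweR ((P u) `^ p^-1)%:E Nn%:R.

Let gE t (u : U) : (t%:E < g u)%E = (P u <= 0) || (t < P u `^ p^-1 `^ (- Nn%:R)).
Proof.
rewrite /g /=; have [Pu|Pu] := leP (P u) 0.
  have -> : P u = 0 by apply/eqP; rewrite eq_le Pu P0.
  by rewrite powR0 ?invr_eq0// eqxx ltry.
by rewrite gt_eqF ?powR_gt0// lte_fin.
Qed.

Let mPpow (h : U -> U) : measurable_fun setT h ->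
  measurable_fun setT (fun u : U => P (h u) `^ p^-1 `^ (- Nn%:R)).
Proof.
move=> mh; apply: (measurableT_comp (measurable_powR _)).
by apply: (measurableT_comp (measurable_powR _)); exact: (measurableT_comp mP mh).
Qed.

Let mg (h : U -> U) (t : U -> R) : measurable_fun setT h -> measurable_fun setT t ->
  measurable [set u | ((t u)%:E < g (h u))%E].
Proof.
move=> mh mt.
rewrite (_ : mkset _ = [set u | P (h u) <= 0] `|` [set u | t u < P (h u) `^ p^-1 `^ (- Nn%:R)]).
  have mPh : measurable_fun setT (fun u => P (h u)) by exact: (measurableT_comp mP mh).
  have m1 := measurable_le_set mPh (measurable_cst (0 : R)).
  have m2 := measurable_lt_set mt (mPpow mh).
  exact: measurableU m1 m2.
by apply/seteqP; split => u /=; rewrite gE => /orP.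
Qed.

(** By homogeneity |u|^N < P(unitv u)^(- N / p) forces P(u) < 1, so the volume in
    [integral_sphere_le_leb] is bounded by that of a sublevel set. Where P vanishes on a ray, the
    integrand is infinite and the whole ray lies in {P < 1}. *)
Lemma integral_inv_energy_le :
  (\int[hausdorff_measure Nn.-1]_(u in (sphere : set U))
     inv_poweR 'N[volume_measure]_(p%:E)[EFin \o support_fun Q \o grad_dir f u] Nn%:R <=
   Nn%:R%:E * leb [set u : U | (P u < 1)%R])%E.
Proof.
under eq_integral do rewrite Lnorm_support_fun_grad.
have mfrob : measurable_fun setT (fun u : U => frob u ^+ Nn).
  by apply: measurable_funX; apply: continuous_measurable_mx; apply: cts_frob; exact: cts_id.
have Nn1 : (1 < Nn)%N.
  by rewrite mulnC; apply: leq_trans (leq_pmull _ _).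
apply: le_trans (integral_sphere_le_leb Nn1 (g := g) _ _ _) _.
- by move=> u; exact: inv_poweR_ge0.
- by move=> t _; exact: (mg (@measurable_id _ _ _) (measurable_cst t)).
- exact: (mg (@measurable_unitv R _ _) mfrob).
apply: lee_wpmul2l => //; apply: le_measure; rewrite ?inE.
- exact: (mg (@measurable_unitv R _ _) mfrob).
- exact: measurable_lt_set.
move=> u; rewrite /= gE => h.
have Pz s (w : U) : 0 < s -> P (s *: w) = s `^ p * P w.
  exact: (directional_energyZ p_gt1 M_ge0 H_ge0 H_le H_hom H_cts rho fC C_gt0 grad_le).
have [->|u0] := eqVneq u 0.
  have := directional_energyE p_gt1 M_ge0 H_ge0 H_le rho C_gt0 grad_le (0 : U).
  rewrite (eq_integral (fun=> 0%E)) ?integral0.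
    by case => ->.
  move=> x _; rewrite mulmx0; congr _%:E.
  apply/eqP; rewrite eq_le H_ge0 andbT; apply: le_trans (H_le 0) _.
  by rewrite frob0 powR0// mulr0.
have fu := frob_gt0 u0.
have -> : u = frob u *: unitv u by rewrite /unitv scalerA mulfV ?scale1r// gt_eqF.
rewrite Pz//; have [Pu|Pu] := leP (P (unitv u)) 0.
  by rewrite (_ : P (unitv u) = 0) ?mulr0//; apply/eqP; rewrite eq_le Pu P0.
move: h; rewrite leNgt Pu/= => h.
have q0 : 0 < P (unitv u) `^ p^-1 by rewrite powR_gt0.
have : frob u * P (unitv u) `^ p^-1 < 1.
  rewrite -(@ltr_pXn2r _ Nn)// ?nnegrE ?mulr_ge0 ?frob_ge0 ?(ltW q0)// expr1n exprMn.
  by move: h; rewrite powRN powR_mulrn ?(ltW q0)// -ltr_pdivlMr ?exprn_gt0// div1r.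
move=> fP; have e : frob u `^ p * P (unitv u) = (frob u * P (unitv u) `^ p^-1) `^ p.
  by rewrite powRM ?frob_ge0 ?powR_ge0// -powRrM mulVf// powRr1// ltW.
rewrite e; apply: (@lt_le_trans _ _ (1 `^ p)); last by rewrite powR1.
apply: gt0_ltr_powR => //; rewrite ?nnegrE//.
by rewrite mulr_ge0 ?frob_ge0 ?powR_ge0.
Qed.

Local Notation om := (fine (leb (@eball R (1 + k) 1 1))).
Local Notation VB := (fine (leb [set u : U | RE u <= 1])).
Hypothesis p_lt : p < n.
Hypothesis vol_gt0 : 0 < fine (leb [set x | 1 <= f x]).
Hypothesis VB_lty : (leb [set u : U | (RE u <= 1)%R] < +oo)%E.
Local Notation iso := (n * om `^ (p / n) * ((n - p) / (p - 1)) `^ (p - 1) *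
  fine (leb [set x | 1 <= f x]) `^ ((n - p) / n)).

Let a_gt0 : 0 < a. Proof. by rewrite divr_gt0. Qed.

Let VB_gt0 : 0 < VB.
Proof.
by rewrite fine_gt0// VB_lty (leb_radial_sublevel_gt0 p_gt1 M_ge0 H_ge0 H_le H_cts).
Qed.

Let om_gt0 : 0 < om.
Proof. by rewrite fine_gt0// leb_eball_gt0//= leb_eball_lty. Qed.

Let iso_gt0 : 0 < iso.
Proof. by rewrite !mulr_gt0 ?powR_gt0 ?divr_gt0 ?subr_gt0 ?ltr0n. Qed.

(** [capacity_volume_le] holds with the same constants for every radius of the large ball, so the
    volumes of the exhausting sets are bounded uniformly. *)
Lemma leb_directional_sublevel_le :
  (leb [set u : U | (P u < 1)%R] <= (VB * (om / iso) `^ a)%:E)%E.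
Proof.
have mS : measurable [set u : U | P u < 1].
  exact: (measurable_lt_set mP (measurable_cst (1 : R))).
apply: leb_le_bigcup => // r r0.
have v_fin : leb (eball r `&` [set u : U | P u < 1]) \is a fin_num.
  rewrite ge0_fin_numE//; apply: le_lt_trans (leb_eball_lty (1 + k) (1 + m) r).
  apply: le_measure; rewrite ?inE; [|exact: measurable_eball|by move=> u []].
  by apply: measurableI => //; exact: measurable_eball.
rewrite -(fineK v_fin) lee_fin; apply: le_of_powR_inv_le => //; first exact: ltW.
  exact: fine_ge0.
exact: (capacity_volume_le p_gt1 M_ge0 H_ge0 H_le H_hom H_cts fC grad_out C_gt0 grad_le r0
  (support_pow_minorant Q_compact Q_0 p_gt1) p_lt vol_gt0 VB_lty).
Qed.

Lemma inv_volume_le :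
  ((iso / om)%:E * inv_poweR (Nn%:R%:E * leb [set u : U | (RE u <= 1)%R]) a^-1 <=
   inv_poweR (Nn%:R%:E * leb [set u : U | (P u < 1)%R]) a^-1)%E.
Proof.
have RE0 := leb_radial_sublevel_gt0 (k := k) p_gt1 M_ge0 H_ge0 H_le H_cts.
exact: (le_inv_poweR_scale N0 iso_gt0 om_gt0 a_gt0 (measure_ge0 _ _) RE0 VB_lty leb_directional_sublevel_le).
Qed.

End affine_comparison.

Lemma lee_combine {R : realType} (A Bi n c w I om : R) (J X Y : \bar R) :
  0 <= A -> 0 <= Bi -> 0 <= c -> 0 <= w -> (0 <= X)%E -> (J <= n%:E * X)%E ->
  A * Bi * n * c * w <= I / om -> ((I / om)%:E * X <= Y)%E ->
  (A%:E * (Bi%:E * J) * c%:E * w%:E <= Y)%E.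
Proof.
move=> A0 B0 c0 w0 X0 JX h; apply: le_trans.
apply: (@le_trans _ _ (A%:E * (Bi%:E * (n%:E * X)) * c%:E * w%:E)%E).
  by rewrite lee_wpmul2r ?lee_fin// lee_wpmul2r ?lee_fin// lee_wpmul2l ?lee_fin// lee_wpmul2l ?lee_fin.
rewrite !muleA (muleAC _ X c%:E) (muleAC _ X w%:E) -!EFinM.
by rewrite lee_wpmul2r// lee_fin.
Qed.

Lemma powR_div_swap {R : realType} (x y s : R) : 0 < x -> 0 < y -> (x / y) `^ (- s) = (y / x) `^ s.
Proof.
move=> x0 y0; have q0 : 0 <= x / y by rewrite divr_ge0 ?ltW.
by rewrite -mulN1r powRrM powR_inv1// invf_div.
Qed.

Lemma iso_constant_le {R : realType} (n om b c w w' : R) : 0 < n -> 0 < om -> 0 <= b -> 0 <= c ->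
  w <= w' -> n * b / (n * om) * n * c * w <= n * b * c * w' / om.
Proof.
move=> n0 om0 b0 c0 ww.
have -> : n * b / (n * om) * n * c * w = n * b * c * w / om.
  by field; rewrite !gt_eqF.
by rewrite ler_pM2r ?invr_gt0// ler_wpM2l// !mulr_ge0// ltW.
Qed.
Theorem theorem4p1 (R : realType) (n m : nat) (hn : (2 <= n)%N) (hm : (1 <= m)%N)
    (p : R) (hp1 : 1 < p) (hpn : p < n%:R)
    (Q : set 'rV[R]_m) (Q_compact : compact Q) (Q_convex : convex_set Q)
    (Q_interior : Q° !=set0) (Q_0 : Q 0)
    (K : set 'cV[R]_n) (K_compact : compact K) :
  ((n%:R * omega n `^ (p / n%:R))%:E * d_const n p Q *
     (((p - 1) / (n%:R - p)) `^ (1 - p))%:E *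
     volume K `^ ((n%:R - p) / n%:R)
   <= affine_capacity p Q K)%E.

Proof.
move: hpn K K_compact; case: n hn => [//|k] hn hpn K _.
move: Q Q_compact Q_convex Q_interior Q_0; case: m hm => [//|l] hm Q Q_compact _ _ Q_0.
have p0 : 0 < p by apply: lt_trans hp1.
have np : 0 < k.+1%:R - p by rewrite subr_gt0.
have e0 : (k.+1%:R - p) / k.+1%:R != 0 by rewrite gt_eqF// divr_gt0.
apply: le_ereal_inf_tmp => _ [f [fC fK] <-].
(* For a null set the left side vanishes, since the exponent (n - p) / n is nonzero and 0^0 = 1 is
   avoided. *)
have [K0|K0] := eqVneq (volume K) 0%E.
  by rewrite K0 poweR0r// mule0; exact: inv_poweR_ge0.
have [B B0 QB] := support_fun_bounded Q_compact Q_0.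
have [rho rho0 gout] := Cc_grad_support fC.
have [C C0 gle] := Cc_grad_bounded fC.
have Kf : (volume K <= leb [set x | (1 <= f x)%R])%E by exact: le_outer_measure.
have f_lty : (leb [set x | (1 <= f x)%R] < +oo)%E.
  have [rf _ fr] := Cc_support fC; apply: (@leb_sub_lty _ _ _ rf); last exact: measurable_ge.
  by move=> x /= f1; apply: fr; rewrite gt_eqF// (lt_le_trans ltr01).
have vol0 : 0 < fine (leb [set x | 1 <= f x]).
  by rewrite fine_gt0// f_lty andbT (lt_le_trans _ Kf)// lt_neqAle eq_sym K0 outer_measure_ge0.
have K_fin : volume K \is a fin_num.
  by rewrite ge0_fin_numE ?outer_measure_ge0//; apply: le_lt_trans Kf f_lty.
have a0 : 0 < p / (k.+1 * l.+1)%:R by rewrite divr_gt0// ltr0n muln_gt0.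
(* The energy of f is bounded below through the volume of {P_f < 1}. *)
apply: le_trans (le_inv_poweR a0 (integral_ge0 _ (fun u _ => inv_poweR_ge0 _ _))
  (integral_inv_energy_le Q_compact Q_0 B0 QB hp1 hn fC gout C0 gle)).
have aE : p / (k.+1 * l.+1)%:R = ((k.+1 * l.+1)%:R / p)^-1 by rewrite invf_div.
pose V := leb [set u : 'M[R]_(1 + k, 1 + l) | (radial_energy (support_pow Q p) u <= 1)%R].
pose X := inv_poweR ((k.+1 * l.+1)%:R%:E * V)%E (p / (k.+1 * l.+1)%:R).
have V0 : (0 <= V)%E by exact: measure_ge0.
(* The lower bound for the polar volume carries the factor n^(- N / p), N = n m, which the power - p
   / N turns into n. *)
have D : (inv_poweR ((k.+1 * l.+1)%:R%:E * volume (polar (Pi_body p Q : set 'M[R]_(k.+1, l.+1))))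
    (p / (k.+1 * l.+1)%:R) <= k.+1%:R%:E * X)%E.
  have N0 : (0 <= (k.+1 * l.+1)%:R%:E :> \bar R)%E by rewrite lee_fin.
  have c0 : 0 < (k.+1%:R^-1 : R) `^ ((k.+1 * l.+1)%:R / p) by rewrite powR_gt0// invr_gt0.
  have := lee_wpmul2l N0 (volume_polar_Pi_body_ge (k := k) Q_compact Q_0 B0 QB hp1 hn).
  rewrite -/V muleCA => /(le_inv_poweR a0) h.
  apply: le_trans (h _) _; first by rewrite !mule_ge0// lee_fin ltW.
  have r0 : 0 < (k.+1 * l.+1)%:R / p by rewrite divr_gt0// ltr0n muln_gt0.
  rewrite inv_poweR_mull ?mule_ge0// -/X [X in (X%:E * _)%E](_ : _ = k.+1%:R)//.
  by rewrite -powRrM aE mulrN mulfV ?gt_eqF// powR_inv1 ?invrK// invr_ge0.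
have om0 : 0 < fine (leb (@eball R (1 + k) 1 1)) by rewrite fine_gt0// leb_eball_gt0//= leb_eball_lty.
set om := fine (leb (@eball R (1 + k) 1 1)) in om0.
pose I := k.+1%:R * om `^ (p / k.+1%:R) * ((k.+1%:R - p) / (p - 1)) `^ (p - 1) *
  fine (leb [set x | 1 <= f x]) `^ ((k.+1%:R - p) / k.+1%:R).
rewrite /d_const omegaE -(fineK K_fin) poweR_EFin -/om.
apply: (lee_combine (I := I) (om := om) _ _ _ _ _ D).
- by rewrite mulr_ge0// powR_ge0.
- by rewrite invr_ge0 mulr_ge0// ltW.
- exact: powR_ge0.
- exact: powR_ge0.
- exact: inv_poweR_ge0.
(* The one inequality between the constants is |K| <= |{f >= 1}|; the other factors agree. *)
- rewrite -(opprB p 1) powR_div_swap ?subr_gt0//.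
  apply: iso_constant_le; rewrite ?powR_ge0//.
  apply: ge0_ler_powR; rewrite ?nnegrE ?divr_ge0 ?(ltW np) ?fine_ge0 ?outer_measure_ge0//.
  by apply: fine_le => //; rewrite ge0_fin_numE.
(* If [V] is infinite then [X] = 0 and the bound is trivial. *)
- have [V_lty|] := ltP V +oo%E.
    rewrite /X aE.
    exact: (inv_volume_le Q_compact Q_0 B0 QB hp1 fC gout C0 gle hpn vol0 V_lty).
  rewrite leye_eq => /eqP Voo; rewrite /X Voo gt0_muley ?lte_fin ?ltr0n ?muln_gt0// mule0.
  exact: inv_poweR_ge0.
Qed.
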